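(* Fix $m\in\mathbb Z$. For $N\ge1$ let $N_2\in\{0,1\}$ be the residue of $N$ mod $2$. There are complex numbers $d_{m,j}(a)$ ($j\ge0$, $a\in\{0,1\}$), depending only on $m,j,a$, with $$d_{m,0}(a)=-\frac{\sqrt2}{\pi i}\Big(\frac{-2}{z_0}\Big)^{m}e^{-z_0/2}\big(1+(-1)^{a}e^{z_0/2}\big)^{1/2}$$ (principal square root), such that for every integer $r\ge1$ and all integers $N\ge1$, $$A_m(-1,N)=\mathrm{Re}\Big[\frac{w_0^{-N/2}}{N^{1-m}}\Big(d_{m,0}(N_2)+\frac{d_{m,1}(N_2)}{N}+\dots+\frac{d_{m,r-1}(N_2)}{N^{r-1}}\Big)\Big]+O\Big(\frac{|w_0|^{-N/2}}{N^{r+1-m}}\Big),$$ with implied constant depending only on $m$ and $r$.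
   Context: $(q)_N:=(1-q)(1-q^2)\cdots(1-q^N)$. For a primitive $k$th root of unity $\xi$, the numbers $A_m(\xi,N)$ are the coefficients of the Laurent expansion $1/(q)_N=\sum_{m\ge -\lfloor N/k\rfloor}A_m(\xi,N)(q-\xi)^m$ about $q=\xi$. $\mathrm{Li}_2$ denotes the dilogarithm ($\mathrm{Li}_2(w)=\sum_{n\ge1}w^n/n^2$ for $|w|\le1$, continued analytically to $\mathbb C\setminus[1,\infty)$). $w_0$ is the solution of $\mathrm{Li}_2(w)-2\pi i\log w=0$ (principal branches), numerically $w_0\approx 0.91619782-0.18245890i$, and $z_0:=2\pi i+\log(1-w_0)\approx -1.6055276+7.4234262i$ (principal logarithm). Complex powers $w^{\tau}$ mean $e^{\tau\log w}$ with the principal logarithm. *)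

(* Defs.v *)
From Stdlib Require Import Reals Lra ZArith List.
Open Scope R_scope.

Record Cplx := mkC { Cre : R; Cim : R }.

Definition RtoC (x : R) : Cplx := mkC x 0.
Definition C0 : Cplx := RtoC 0.
Definition C1 : Cplx := RtoC 1.
Definition Ci : Cplx := mkC 0 1.
Definition Cadd (z w : Cplx) : Cplx := mkC (Cre z + Cre w) (Cim z + Cim w).
Definition Copp (z : Cplx) : Cplx := mkC (- Cre z) (- Cim z).
Definition Csub (z w : Cplx) : Cplx := Cadd z (Copp w).
Definition Cmul (z w : Cplx) : Cplx :=
  mkC (Cre z * Cre w - Cim z * Cim w) (Cre z * Cim w + Cim z * Cre w).
Definition Cnorm2 (z : Cplx) : R := Cre z * Cre z + Cim z * Cim z.
Definition Cnorm (z : Cplx) : R := sqrt (Cnorm2 z).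
Definition Cinv (z : Cplx) : Cplx := mkC (Cre z / Cnorm2 z) (- Cim z / Cnorm2 z).
Definition Cdiv (z w : Cplx) : Cplx := Cmul z (Cinv w).

Fixpoint Cpown (z : Cplx) (n : nat) : Cplx :=
  match n with O => C1 | S n' => Cmul z (Cpown z n') end.

Definition Cpowz (z : Cplx) (m : Z) : Cplx :=
  match m with
  | Z0 => C1
  | Zpos p => Cpown z (Pos.to_nat p)
  | Zneg p => Cinv (Cpown z (Pos.to_nat p))
  end.

Fixpoint Csum (r : nat) (f : nat -> Cplx) : Cplx :=
  match r with O => C0 | S r' => Cadd (Csum r' f) (f r') end.

Definition Cexp (z : Cplx) : Cplx :=
  mkC (exp (Cre z) * cos (Cim z)) (exp (Cre z) * sin (Cim z)).

(** principal argument, in (-PI, PI] *)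
Definition Carg (z : Cplx) : R :=
  let x := Cre z in let y := Cim z in
  if Rlt_dec 0 x then atan (y / x)
  else if Rlt_dec x 0 then
         (if Rle_dec 0 y then atan (y / x) + PI else atan (y / x) - PI)
  else if Rlt_dec 0 y then PI / 2
  else if Rlt_dec y 0 then - (PI / 2)
  else 0.

Definition Clog (z : Cplx) : Cplx := mkC (ln (Cnorm z)) (Carg z).

Definition Cpow (w tau : Cplx) : Cplx :=
  if Req_EM_T (Cnorm2 w) 0 then C0 else Cexp (Cmul tau (Clog w)).

(** * Dilogarithm: partial sums sum_{n=1}^M w^n/n^2 and the statement
      "Li2(w) = L" via convergence of the defining series (valid for |w| <= 1,
      where the series converges and agrees with the analytic continuation). *)
Fixpoint Li2_partial (w : Cplx) (M : nat) : Cplx :=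
  match M with
  | O => C0
  | S M' => Cadd (Li2_partial w M') (Cdiv (Cpown w (S M')) (RtoC (INR (S M') ^ 2)))
  end.

Definition is_Li2 (w L : Cplx) : Prop :=
  Un_cv (fun M => Cre (Li2_partial w M)) (Cre L) /\
  Un_cv (fun M => Cim (Li2_partial w M)) (Cim L).

Definition w0_approx : Cplx := mkC 0.91619782 (-0.18245890).

Definition z0_of (w0 : Cplx) : Cplx := Cadd (mkC 0 (2 * PI)) (Clog (Csub C1 w0)).

Definition d0_formula (w0 : Cplx) (m : Z) (a : nat) : Cplx :=
  let z0 := z0_of w0 in
  Cmul (Cdiv (RtoC (- sqrt 2)) (mkC 0 PI))
   (Cmul (Cpowz (Cdiv (RtoC (-2)) z0) m)
    (Cmul (Cexp (Cmul (RtoC (- (1/2))) z0))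
       (Cpow (Cadd C1 (Cmul (RtoC ((-1) ^ a)) (Cexp (Cmul (RtoC (1/2)) z0))))
             (RtoC (1/2))))).

(** * Laurent coefficients A_m(-1,N) of 1/(q)_N about q = -1.
    We substitute q = t - 1 and work with power series in t.
    Coefficient of t^n in the polynomial 1 - (t-1)^j: *)
Definition qfactor (j n : nat) : R :=
  (if Nat.eqb n 0 then 1 else 0)
  - (if Nat.leb n j then Binomial.C j n * (-1) ^ (j - n) else 0).

Definition conv (f g : nat -> R) (n : nat) : R :=
  sum_f_R0 (fun i => f i * g (n - i)%nat) n.

(** coefficients (in t = q + 1) of (q)_N = prod_{j=1}^N (1 - q^j) *)
Fixpoint qpoch_coef (N : nat) : nat -> R :=
  match N with
  | O => fun n => if Nat.eqb n 0 then 1 else 0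
  | S N' => conv (qpoch_coef N') (qfactor N)
  end.

Fixpoint inv_series_list (c : nat -> R) (n : nat) : list R :=
  match n with
  | O => (/ c 0%nat) :: nil
  | S n' =>
      let l := inv_series_list c n' in
      l ++ ((- / c 0%nat) * sum_f_R0 (fun i => c (S i) * nth (n' - i) l 0) n') :: nil
  end.

Definition inv_series (c : nat -> R) (n : nat) : R := nth n (inv_series_list c n) 0.

(** (q)_N vanishes to order exactly floor(N/2) at q = -1 (cf. the context:
    the Laurent expansion starts at m = -floor(N/2)).  Writing
    (q)_N = t^k g(t), k = N/2, the Laurent coefficients of 1/(q)_N are the
    coefficients of the power series 1/g(t), shifted by k. *)
Definition A_coef (m : Z) (N : nat) : R :=
  let k := (N / 2)%nat in
  let e := (m + Z.of_nat k)%Z in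
  if Z.ltb e 0 then 0
  else inv_series (fun n => qpoch_coef N (k + n)%nat) (Z.to_nat e).

(* Main.v *)
(** Cauchy's formula writes [A_m(-1,N)] as the imaginary part of a contour
    integral over an upper half circle around [q = -1].  Put [q = -e^s] with
    [s = z/(2N)]: the product [(q)_N] then varies on the scale [z = O(1)], its zeros lie on
    the imaginary axis outside [|Im z| < 2 pi], and the contour may be pushed
    onto the ray [z = rho z0], where the saddle sits at [rho = 1].

    On the ray the zeros of the even factors at [z = 0] are split off, the remaining
    factors are smooth functions of [j rho/N], and an Euler-Maclaurin
    expansion together with Stirling's series gives
    [1/(q)_N = (1/(N Gam_N)) e^{N P(rho)} H_N(rho)], where [H_N] expands in powers of
    [1/N], [Gam_N] is a Gaussian integral, and
    [2 z0 rho P(rho) = Li2(e^{rho z0}) - Li2(1)].  The reflection formula for [Li2]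
    and the equation defining [w0] give [P(1) = -(log w0)/2] and [P'(1) = 0], so Laplace's
    method yields the expansion; [Gam_N] cancels.

    Everything else is exponentially smaller.  On the ray,
    [(rho^2 P')' = rho z0 / (2 (e^{-rho z0} - 1))] controls the sign of [Re P'] near [rho = 1] and
    crude bounds for [Li2] suffice elsewhere.  The ray is reached from the
    positive reals along [Im z = 3 pi/2]; there [(q)_N] is bounded below through
    its values at [Re z = 0], which are products of sines. *)

From Stdlib Require Import Reals Lra Lia ZArith List ClassicalEpsilon Machin.
From Coquelicot Require Import Rcomplements Hierarchy Continuity Derive RInt RInt_analysis AutoDerive.
From Coquelicot Require ElemFct.
Require Import Defs.
Open Scope R_scope.

(** Path independence comes from primitives of the form z times the integral of f(tz) over 0 <= t <=
    1, on star-shaped domains, and holomorphy is only ever tested along real curves. Half of the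
    circle suffices because the Laurent coefficients are real: at real endpoints the primitives of
    the polar and regular parts are real and drop out of the imaginary part.

    The quantitative obstacle is a weak saddle. Since |w0| is close to 1, Re P(1) is only about
    0.034, and the certified lower bound is 0.0335. Every other piece must grow at a smaller
    exponential rate: the vertical sides reach 0.03, the horizontal side 0.0325, the ray outside a
    middle range 0.033. These margins fix most numerical constants and force the refined product
    estimate on the horizontal side.

    Stirling's series is derived from the same Laplace lemma as the saddle contribution. The parity
    of N shifts the end nodes of the Euler-Maclaurin sums and the number of split-off zeros, so
    expansions are taken along each parity class separately and joined at the end. *)

Notation RV := R_CompleteNormedModule (only parsing).
Notation mul_le_l := Rmult_le_compat_l (only parsing).
Notation mul_le_r := Rmult_le_compat_r (only parsing).
Notation mul_pos := Rmult_le_pos (only parsing).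
Notation mul_lt_pos := Rmult_lt_0_compat (only parsing).
Notation inv_pos := Rinv_0_lt_compat (only parsing).
Notation inv_le := Rinv_le_contravar (only parsing).
Tactic Notation "le_via" uconstr(t) := eapply Rle_trans; [apply t|].
Tactic Notation "le_to" uconstr(t) := eapply Rle_trans; [|apply t].
Ltac minmax H := rewrite Rmin_left, Rmax_right in H by lra.

(* Complex arithmetic, exponential and principal logarithm *)
Declare Scope cx_scope.
Delimit Scope cx_scope with cx.
Notation "x + y" := (Cadd x y) : cx_scope.
Notation "x - y" := (Csub x y) : cx_scope.
Notation "x * y" := (Cmul x y) : cx_scope.
Notation "x / y" := (Cdiv x y) : cx_scope.
Notation "- x" := (Copp x) : cx_scope.
Notation "/ x" := (Cinv x) : cx_scope.

Bind Scope cx_scope with Cplx.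
Arguments Cnorm z%_cx.
Arguments Cnorm2 z%_cx.
Arguments Cexp z%_cx.
Arguments Clog z%_cx.
Arguments Cpown z%_cx n%_nat.

Lemma cx_eq (z w : Cplx) : Cre z = Cre w -> Cim z = Cim w -> z = w.
Proof. destruct z, w; simpl; congruence. Qed.

Lemma Cnorm2_pos (z : Cplx) : z <> C0 -> 0 < Cnorm2 z.
Proof.
  intros H; destruct z as [x y]; unfold Cnorm2; simpl.
  destruct (Req_dec x 0) as [->|Hx].
  - destruct (Req_dec y 0) as [->|Hy]; [now elim H|].
    generalize (Rsqr_pos_lt y Hy); unfold Rsqr; lra.
  - generalize (Rsqr_pos_lt x Hx) (Rle_0_sqr y); unfold Rsqr; lra.
Qed.

Lemma Cnorm2_nonneg (z : Cplx) : 0 <= Cnorm2 z.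
Proof. unfold Cnorm2; nra. Qed.

Lemma Cplx_field : field_theory C0 C1 Cadd Cmul Csub Copp Cdiv Cinv eq.
Proof.
  constructor.
  - constructor; intros; apply cx_eq; simpl; ring.
  - intros H; apply (f_equal Cre) in H; simpl in H; lra.
  - reflexivity.
  - intros p Hp; apply Cnorm2_pos in Hp; apply cx_eq; simpl;
      unfold Cnorm2 in *; field; lra.
Qed.
Add Field Cplx_field_inst : Cplx_field.

Lemma RtoC_add a b : RtoC (a + b) = (RtoC a + RtoC b)%cx.
Proof. apply cx_eq; simpl; ring. Qed.
Lemma RtoC_sub a b : RtoC (a - b) = (RtoC a - RtoC b)%cx.
Proof. apply cx_eq; simpl; ring. Qed.
Lemma RtoC_mul a b : RtoC (a * b) = (RtoC a * RtoC b)%cx.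
Proof. apply cx_eq; simpl; ring. Qed.
Lemma RtoC_opp a : RtoC (- a) = (- RtoC a)%cx.
Proof. apply cx_eq; simpl; ring. Qed.
Lemma RtoC_inj a b : RtoC a = RtoC b -> a = b.
Proof. intros H; apply (f_equal Cre) in H; exact H. Qed.
Lemma RtoC_neq0 a : a <> 0 -> RtoC a <> C0.
Proof. intros H E; apply H, RtoC_inj, E. Qed.
Lemma RtoC_inv a : a <> 0 -> RtoC (/ a) = (/ RtoC a)%cx.
Proof. intros H; apply cx_eq; simpl; unfold Cnorm2; simpl; field; lra. Qed.
Lemma RtoC_div a b : b <> 0 -> RtoC (a / b) = (RtoC a / RtoC b)%cx.
Proof. intros H; unfold Rdiv, Cdiv; rewrite RtoC_mul, RtoC_inv; auto. Qed.

Lemma Cmul_neq0 z w : z <> C0 -> w <> C0 -> (z * w)%cx <> C0.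
Proof.
  intros Hz Hw E. apply Hw.
  replace w with (/ z * (z * w))%cx by (field; auto). rewrite E. ring.
Qed.
Lemma Cre_neq0 z : Cre z <> 0 -> z <> C0.
Proof. intros H E; apply H; rewrite E; reflexivity. Qed.
Lemma Cim_neq0 z : Cim z <> 0 -> z <> C0.
Proof. intros H E; apply H; rewrite E; reflexivity. Qed.

Lemma Cnorm2_mul z w : Cnorm2 (z * w)%cx = Cnorm2 z * Cnorm2 w.
Proof. unfold Cnorm2; simpl; ring. Qed.
Lemma Cnorm_nonneg z : 0 <= Cnorm z.
Proof. apply sqrt_pos. Qed.
Lemma Cnorm_sqr z : Cnorm z * Cnorm z = Cnorm2 z.
Proof. apply sqrt_sqrt, Cnorm2_nonneg. Qed.
Lemma Cnorm_mul z w : Cnorm (z * w)%cx = Cnorm z * Cnorm w.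
Proof. unfold Cnorm; rewrite Cnorm2_mul; apply sqrt_mult; apply Cnorm2_nonneg. Qed.
Lemma Cnorm_pos z : z <> C0 -> 0 < Cnorm z.
Proof. intros H; apply sqrt_lt_R0, Cnorm2_pos, H. Qed.
Lemma Cnorm_RtoC a : Cnorm (RtoC a) = Rabs a.
Proof.
  unfold Cnorm, Cnorm2; simpl. replace (a * a + 0 * 0) with (Rsqr a) by (unfold Rsqr; ring).
  apply sqrt_Rsqr_abs.
Qed.
Lemma Cnorm_opp z : Cnorm (- z)%cx = Cnorm z.
Proof. unfold Cnorm, Cnorm2; simpl; f_equal; ring. Qed.
Lemma Cnorm_0 : Cnorm C0 = 0.
Proof. unfold C0; rewrite Cnorm_RtoC; apply Rabs_R0. Qed.
Lemma Cnorm_1 : Cnorm C1 = 1.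
Proof. unfold C1; rewrite Cnorm_RtoC; apply Rabs_R1. Qed.
Lemma Cnorm_inv z : z <> C0 -> Cnorm (/ z)%cx = / Cnorm z.
Proof.
  intros H. assert (H1 := Cnorm_pos z H).
  apply (Rmult_eq_reg_l (Cnorm z)); [|lra].
  rewrite <- Cnorm_mul. replace (z * / z)%cx with C1 by (field; auto).
  rewrite Cnorm_1; field; lra.
Qed.
Lemma Cnorm_div z w : w <> C0 -> Cnorm (z / w)%cx = Cnorm z / Cnorm w.
Proof. intros H; unfold Cdiv, Rdiv; now rewrite Cnorm_mul, Cnorm_inv. Qed.
Lemma Cre_le_norm z : Rabs (Cre z) <= Cnorm z.
Proof.
  rewrite <- sqrt_Rsqr_abs. apply sqrt_le_1_alt. unfold Rsqr, Cnorm2.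
  generalize (Rle_0_sqr (Cim z)); unfold Rsqr; lra.
Qed.
Lemma Cim_le_norm z : Rabs (Cim z) <= Cnorm z.
Proof.
  rewrite <- sqrt_Rsqr_abs. apply sqrt_le_1_alt. unfold Rsqr, Cnorm2.
  generalize (Rle_0_sqr (Cre z)); unfold Rsqr; lra.
Qed.
Lemma Cnorm_le_sum z : Cnorm z <= Rabs (Cre z) + Rabs (Cim z).
Proof.
  generalize (Rabs_pos (Cre z)) (Rabs_pos (Cim z)); intros H1 H2.
  rewrite <- (sqrt_Rsqr (Rabs (Cre z) + Rabs (Cim z))) by lra.
  apply sqrt_le_1_alt. unfold Cnorm2, Rsqr.
  rewrite <- (Rabs_right (Cre z * Cre z)), <- (Rabs_right (Cim z * Cim z)) by nra.
  rewrite !Rabs_mult. nra.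
Qed.
Lemma Cnorm_triang z w : Cnorm (z + w)%cx <= Cnorm z + Cnorm w.
Proof.
  generalize (Cnorm_nonneg z) (Cnorm_nonneg w); intros H1 H2.
  apply Rsqr_incr_0_var; [|lra]. unfold Rsqr.
  assert (H3 : Cre z * Cre w + Cim z * Cim w <= Cnorm z * Cnorm w).
  { rewrite <- Cnorm_mul.
    replace (Cnorm (z * w)%cx) with (Cnorm (z * mkC (Cre w) (- Cim w))%cx)
      by (unfold Cnorm, Cnorm2; simpl; f_equal; ring).
    le_via Rle_abs. le_to Cre_le_norm.
    right; f_equal; simpl; ring. }
  replace ((Cnorm z + Cnorm w) * (Cnorm z + Cnorm w))
    with (Cnorm z * Cnorm z + Cnorm w * Cnorm w + 2 * (Cnorm z * Cnorm w)) by ring.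
  rewrite !Cnorm_sqr. unfold Cnorm2; simpl. lra.
Qed.
Lemma Cnorm_sub_le z w : Cnorm (z - w)%cx <= Cnorm z + Cnorm w.
Proof. unfold Csub; rewrite <- (Cnorm_opp w); apply Cnorm_triang. Qed.
Lemma Cnorm_sub_ge z w : Cnorm z - Cnorm w <= Cnorm (z - w)%cx.
Proof.
  generalize (Cnorm_triang (z - w) w).
  replace (z - w + w)%cx with z by ring. lra.
Qed.
Lemma Cnorm_sub_sym z w : Cnorm (z - w)%cx = Cnorm (w - z)%cx.
Proof. rewrite <- Cnorm_opp; f_equal; ring. Qed.
Lemma Cnorm_eq0 z : Cnorm z = 0 -> z = C0.
Proof.
  intros H. generalize (Cre_le_norm z) (Cim_le_norm z); rewrite H.
  intros H1 H2. apply cx_eq; simpl; [revert H1|revert H2]; unfold Rabs;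
  destruct (Rcase_abs _); lra.
Qed.
Lemma Cnorm_pown z n : Cnorm (Cpown z n) = Cnorm z ^ n.
Proof. induction n; simpl; [apply Cnorm_1|]. now rewrite Cnorm_mul, IHn. Qed.

Lemma Cexp_add z w : Cexp (z + w)%cx = (Cexp z * Cexp w)%cx.
Proof. apply cx_eq; simpl; rewrite exp_plus, ?cos_plus, ?sin_plus; ring. Qed.
Lemma Cexp_0 : Cexp C0 = C1.
Proof. apply cx_eq; simpl; rewrite exp_0, ?cos_0, ?sin_0; ring. Qed.
Lemma Cnorm_exp z : Cnorm (Cexp z) = exp (Cre z).
Proof.
  unfold Cnorm, Cnorm2; simpl.
  replace (_ + _) with (Rsqr (exp (Cre z)) * (Rsqr (sin (Cim z)) + Rsqr (cos (Cim z))))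
    by (unfold Rsqr; ring).
  rewrite sin2_cos2, Rmult_1_r. apply sqrt_Rsqr. left; apply exp_pos.
Qed.
Lemma Cexp_neq0 z : Cexp z <> C0.
Proof.
  intros E. generalize (Cnorm_exp z) (exp_pos (Cre z)); rewrite E, Cnorm_0. lra.
Qed.
Lemma Cexp_opp z : Cexp (- z)%cx = (/ Cexp z)%cx.
Proof.
  assert (H : (Cexp (- z) * Cexp z)%cx = C1)
    by (rewrite <- Cexp_add, <- Cexp_0; f_equal; ring).
  assert (Hz := Cexp_neq0 z).
  replace (Cexp (- z)) with (Cexp (- z) * Cexp z / Cexp z)%cx by (field; auto).
  rewrite H. field; auto.
Qed.
Lemma Cexp_sub z w : Cexp (z - w)%cx = (Cexp z / Cexp w)%cx.
Proof. unfold Csub. now rewrite Cexp_add, Cexp_opp. Qed.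
Lemma Cexp_RtoC a : Cexp (RtoC a) = RtoC (exp a).
Proof. apply cx_eq; simpl; rewrite ?cos_0, ?sin_0; ring. Qed.
Lemma Cexp_nat z n : Cexp (RtoC (INR n) * z)%cx = Cpown (Cexp z) n.
Proof.
  induction n.
  - simpl Cpown. rewrite <- Cexp_0. f_equal. simpl INR. change (RtoC 0) with C0. ring.
  - simpl Cpown. rewrite <- IHn, <- Cexp_add. f_equal.
    rewrite S_INR, RtoC_add. change (RtoC 1) with C1. ring.
Qed.

Lemma Clog_rp z : 0 < Cre z -> Clog z = mkC (ln (Cnorm z)) (atan (Cim z / Cre z)).
Proof. intros H; unfold Clog, Carg. destruct (Rlt_dec 0 (Cre z)); [reflexivity|lra]. Qed.

Lemma Clog_im_bound z : 0 < Cre z -> - (PI / 2) < Cim (Clog z) < PI / 2.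
Proof. intros H; rewrite Clog_rp by auto; simpl. generalize (atan_bound (Cim z / Cre z)); lra. Qed.

Lemma Cexp_Clog z : 0 < Cre z -> Cexp (Clog z) = z.
Proof.
  intros H. rewrite Clog_rp by auto.
  assert (Hn : 0 < Cnorm z) by (apply Cnorm_pos, Cre_neq0; lra).
  assert (E : Cnorm z = Cre z * sqrt (1 + Rsqr (Cim z / Cre z))).
  { rewrite <- (sqrt_Rsqr (Cre z)) at 1 by lra.
    rewrite <- sqrt_mult; [|apply Rle_0_sqr|generalize (Rle_0_sqr (Cim z / Cre z)); lra].
    unfold Cnorm, Cnorm2; f_equal; unfold Rsqr; field; lra. }
  apply cx_eq; simpl; rewrite exp_ln by auto.
  - rewrite cos_atan, E. field. repeat split; try lra; intros Hs; apply sqrt_eq_0 in Hs;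
    generalize (Rle_0_sqr (Cim z / Cre z)); lra.
  - rewrite sin_atan, E. field. repeat split; try lra; intros Hs; apply sqrt_eq_0 in Hs;
    generalize (Rle_0_sqr (Cim z / Cre z)); lra.
Qed.

Lemma Cexp_inj_im z w : Cexp z = Cexp w -> Rabs (Cim z - Cim w) < 2 * PI -> z = w.
Proof.
  intros E H.
  assert (Hr : Cre z = Cre w).
  { apply exp_inv. rewrite <- !Cnorm_exp. now rewrite E. }
  apply cx_eq; auto.
  assert (Hp := exp_pos (Cre w)).
  assert (E1 := f_equal Cre E). assert (E2 := f_equal Cim E). simpl in E1, E2.
  rewrite Hr in E1, E2.
  apply Rmult_eq_reg_l in E1; [|lra]. apply Rmult_eq_reg_l in E2; [|lra].
  set (d := Cim z - Cim w) in *.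
  assert (Hc : cos d = 1).
  { unfold d; rewrite cos_minus, E1, E2. generalize (sin2_cos2 (Cim w)); unfold Rsqr; lra. }
  assert (Hs : sin (d / 2) = 0).
  { replace d with (2 * (d / 2)) in Hc by field. rewrite cos_2a_sin in Hc.
    assert (sin (d/2) * sin (d/2) = 0) by lra. apply Rmult_integral in H0; lra. }
  assert (Hd : - PI < d / 2 < PI) by (apply Rabs_def2 in H; lra).
  destruct (Rtotal_order (d/2) 0) as [Hl|[Hl|Hl]].
  - assert (0 < sin (- (d/2))) by (apply sin_gt_0; lra). rewrite sin_neg in H0; lra.
  - unfold d in Hl; lra.
  - assert (0 < sin (d/2)) by (apply sin_gt_0; lra). lra.
Qed.

Lemma Clog_mul z w : 0 < Cre z -> 0 < Cre w -> 0 < Cre (z * w)%cx ->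
  Clog (z * w)%cx = (Clog z + Clog w)%cx.
Proof.
  intros Hz Hw Hzw. apply Cexp_inj_im.
  - rewrite Cexp_add, !Cexp_Clog; auto.
  - generalize (Clog_im_bound _ Hz) (Clog_im_bound _ Hw) (Clog_im_bound _ Hzw) PI_RGT_0.
    simpl. intros. apply Rabs_def1; lra.
Qed.

Lemma Clog_RtoC a : 0 < a -> Clog (RtoC a) = RtoC (ln a).
Proof.
  intros H. rewrite Clog_rp by (simpl; auto). rewrite Cnorm_RtoC, Rabs_right by lra.
  simpl. unfold Rdiv; rewrite Rmult_0_l, atan_0. reflexivity.
Qed.

Lemma Clog_mul_RtoC a z : 0 < a -> 0 < Cre z -> Clog (RtoC a * z)%cx = (RtoC (ln a) + Clog z)%cx.
Proof.
  intros Ha Hz. rewrite Clog_mul, Clog_RtoC; auto; simpl; nra.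
Qed.

(** * Derivatives and integrals of complex functions of a real variable *)

Lemma is_derive_val (f : R -> R) (x l : R) l' : is_derive f x l -> l = l' -> is_derive f x l'.
Proof. intros H <-; exact H. Qed.

Lemma dconst (a x : R) : is_derive (fun _ : R => a) x 0.
Proof. apply (is_derive_const (V := R_NormedModule)). Qed.
Lemma did (x : R) : is_derive (fun t : R => t) x 1.
Proof. apply (is_derive_id (K := R_AbsRing)). Qed.

Definition cder (f : R -> Cplx) (x : R) (l : Cplx) : Prop :=
  is_derive (fun t => Cre (f t)) x (Cre l) /\ is_derive (fun t => Cim (f t)) x (Cim l).

Lemma cder_val (f : R -> Cplx) (x : R) l l' : cder f x l -> l = l' -> cder f x l'.
Proof. intros H <-; exact H. Qed.

Lemma cder_ext (f g : R -> Cplx) (x : R) l : (forall t, f t = g t) -> cder f x l -> cder g x l.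
Proof.
  intros E [H1 H2]; split; [eapply is_derive_ext; [|exact H1]|eapply is_derive_ext; [|exact H2]];
  intros t; simpl; now rewrite E.
Qed.

Lemma cder_ext_loc (f g : R -> Cplx) (x : R) l : locally x (fun t => f t = g t) -> cder f x l -> cder g x l.
Proof.
  intros E [H1 H2]; split;
  [eapply is_derive_ext_loc; [|exact H1]|eapply is_derive_ext_loc; [|exact H2]];
  revert E; apply filter_imp; intros t E; now rewrite E.
Qed.

Lemma cder_const (k : Cplx) x : cder (fun _ => k) x C0.
Proof. split; [exact (dconst (Cre k) x)|exact (dconst (Cim k) x)]. Qed.

Lemma cder_RtoC (f : R -> R) (x l : R) : is_derive f x l -> cder (fun t => RtoC (f t)) x (RtoC l).
Proof. intros H; split; [exact H|exact (dconst 0 x)]. Qed.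

Lemma cder_id x : cder RtoC x C1.
Proof. apply cder_RtoC, did. Qed.

Lemma dmult (f g : R -> R) (x l m : R) : is_derive f x l -> is_derive g x m ->
  is_derive (fun t => f t * g t) x (l * g x + f x * m).
Proof. intros H1 H2. apply (is_derive_mult f g x l m H1 H2). Qed.
Lemma dplus (f g : R -> R) (x l m : R) : is_derive f x l -> is_derive g x m ->
  is_derive (fun t => f t + g t) x (l + m).
Proof. intros H1 H2. apply (is_derive_plus (V := R_NormedModule) f g x l m H1 H2). Qed.
Lemma dopp (f : R -> R) (x l : R) : is_derive f x l -> is_derive (fun t => - f t) x (- l).
Proof. intros H1. apply (is_derive_opp (V := R_NormedModule) f x l H1). Qed.
Lemma dminus (f g : R -> R) (x l m : R) : is_derive f x l -> is_derive g x m ->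
  is_derive (fun t => f t - g t) x (l - m).
Proof. intros H1 H2. apply (is_derive_minus (V := R_NormedModule) f g x l m H1 H2). Qed.
Lemma dcomp (f g : R -> R) (x l m : R) : is_derive f (g x) l -> is_derive g x m ->
  is_derive (fun t => f (g t)) x (l * m).
Proof.
  intros H1 H2. rewrite Rmult_comm.
  apply (is_derive_comp (V := R_NormedModule) f g x l m H1 H2).
Qed.
Lemma dinv (f : R -> R) (x l : R) : is_derive f x l -> f x <> 0 ->
  is_derive (fun t => / f t) x (- l / (f x * f x)).
Proof.
  intros H1 H2. eapply is_derive_val; [apply (is_derive_inv f x l H1 H2)|]; cbv beta; field; auto.
Qed.

Lemma cder_add (f g : R -> Cplx) (x : R) l m : cder f x l -> cder g x m -> cder (fun t => f t + g t)%cx x (l + m)%cx.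
Proof. intros [H1 H2] [H3 H4]; split; apply dplus; auto. Qed.
Lemma cder_opp (f : R -> Cplx) (x : R) l : cder f x l -> cder (fun t => - f t)%cx x (- l)%cx.
Proof. intros [H1 H2]; split; apply dopp; auto. Qed.
Lemma cder_sub (f g : R -> Cplx) (x : R) l m : cder f x l -> cder g x m -> cder (fun t => f t - g t)%cx x (l - m)%cx.
Proof. intros [H1 H2] [H3 H4]; split; apply dplus; auto; apply dopp; auto. Qed.
Lemma cder_mul (f g : R -> Cplx) (x : R) l m : cder f x l -> cder g x m ->
  cder (fun t => f t * g t)%cx x (l * g x + f x * m)%cx.
Proof.
  intros [H1 H2] [H3 H4]; split; simpl.
  - eapply is_derive_val; [apply dminus; apply dmult; eassumption|]; cbv beta; ring.
  - eapply is_derive_val; [apply dplus; apply dmult; eassumption|]; cbv beta; ring.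
Qed.
Lemma cder_scal k g x m : cder g x m -> cder (fun t => k * g t)%cx x (k * m)%cx.
Proof.
  intros H. eapply cder_val; [apply cder_mul; [apply cder_const|exact H]|]; cbv beta; ring.
Qed.
Lemma cder_norm2 (f : R -> Cplx) (x : R) l : cder f x l ->
  is_derive (fun t => Cnorm2 (f t)) x (2 * (Cre (f x) * Cre l + Cim (f x) * Cim l)).
Proof.
  intros [H1 H2]. eapply is_derive_val; [apply dplus; apply dmult; eassumption|]; cbv beta; ring.
Qed.
Lemma cder_inv (f : R -> Cplx) (x : R) l : cder f x l -> f x <> C0 ->
  cder (fun t => / f t)%cx x (- l / (f x * f x))%cx.
Proof.
  intros H Hx. assert (Hn := Cnorm2_pos _ Hx).
  assert (Hd := cder_norm2 _ _ _ H). destruct H as [H1 H2].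
  split; simpl.
  - eapply is_derive_val; [apply dmult; [exact H1|apply dinv; [exact Hd|lra]]|].
    cbv beta; rewrite Cnorm2_mul. unfold Cnorm2 in *. field; lra.
  - eapply is_derive_val; [apply dmult; [apply dopp, H2|apply dinv; [exact Hd|lra]]|].
    cbv beta; rewrite Cnorm2_mul. unfold Cnorm2 in *. field; lra.
Qed.
Lemma dexp (x : R) : is_derive exp x (exp x).
Proof. apply is_derive_Reals, derivable_pt_lim_exp. Qed.
Lemma cder_exp (f : R -> Cplx) (x : R) l : cder f x l -> cder (fun t => Cexp (f t)) x (Cexp (f x) * l)%cx.
Proof.
  intros [H1 H2]; split; simpl.
  - eapply is_derive_val.
    + apply dmult; [apply dcomp; [apply dexp|exact H1]|
      apply (dcomp cos); [apply is_derive_Reals, derivable_pt_lim_cos|exact H2]].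
    + cbv beta; ring.
  - eapply is_derive_val.
    + apply dmult; [apply dcomp; [apply dexp|exact H1]|
      apply (dcomp sin); [apply is_derive_Reals, derivable_pt_lim_sin|exact H2]].
    + cbv beta; ring.
Qed.

Lemma dln (x : R) : 0 < x -> is_derive ln x (/ x).
Proof. intros H; apply is_derive_Reals, derivable_pt_lim_ln, H. Qed.

Lemma locally_Rgt0 (f : R -> R) (x l : R) : is_derive f x l -> 0 < f x -> locally x (fun t => 0 < f t).
Proof.
  intros Hd H.
  assert (Hc : continuous f x).
  { apply (ex_derive_continuous (K := R_AbsRing) (V := R_NormedModule)). exists l; exact Hd. }
  apply Hc. apply (open_gt 0 (f x)); auto.
Qed.

Lemma Clog_re z : Cre (Clog z) = / 2 * ln (Cnorm2 z) \/ Cnorm2 z = 0.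
Proof.
  destruct (Cnorm2_nonneg z) as [H|H]; [left|right; auto].
  simpl. unfold Cnorm. rewrite <- (sqrt_sqrt (Cnorm2 z)) at 2 by lra.
  rewrite ln_mult by (apply sqrt_lt_R0; auto). field.
Qed.

Lemma cder_log (f : R -> Cplx) (x : R) l : cder f x l -> 0 < Cre (f x) -> cder (fun t => Clog (f t)) x (l / f x)%cx.
Proof.
  intros H Hp.
  assert (Hn : 0 < Cnorm2 (f x)) by (apply Cnorm2_pos, Cre_neq0; lra).
  assert (Hd := cder_norm2 _ _ _ H). destruct H as [H1 H2].
  assert (L := locally_Rgt0 _ _ _ H1 Hp).
  split.
  - eapply is_derive_ext_loc with (f := fun t => / 2 * ln (Cnorm2 (f t))).
    + revert L; apply filter_imp; intros t Ht. simpl.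
      destruct (Clog_re (f t)) as [E|E]; [symmetry; exact E|].
      exfalso. unfold Cnorm2 in E. nra.
    + eapply is_derive_val; [apply dmult; [apply dconst|apply dcomp; [apply dln; auto|exact Hd]]|].
      simpl. field. lra.
  - eapply is_derive_ext_loc with (f := fun t => atan (Cim (f t) / Cre (f t))).
    + revert L; apply filter_imp; intros t Ht. rewrite (Clog_rp (f t) Ht). reflexivity.
    + eapply is_derive_val.
      * apply (dcomp atan).
        { apply is_derive_Reals, derivable_pt_lim_atan. }
        { apply dmult; [exact H2|apply dinv; [exact H1|lra]]. }
      * simpl. unfold Cnorm2, Rsqr in *. field. repeat split; nra.
Qed.

Definition ccont (f : R -> Cplx) (x : R) : Prop :=
  continuous (fun t => Cre (f t)) x /\ continuous (fun t => Cim (f t)) x.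

Lemma dcont (f : R -> R) (x l : R) : is_derive f x l -> continuous f x.
Proof.
  intros H. apply (ex_derive_continuous (K := R_AbsRing) (V := R_NormedModule)). exists l; exact H.
Qed.
Lemma cder_ccont f x l : cder f x l -> ccont f x.
Proof. intros [H1 H2]; split; eapply dcont; eassumption. Qed.
Lemma ccont_const k x : ccont (fun _ => k) x.
Proof. split; apply continuous_const. Qed.
Lemma ccont_add f g x : ccont f x -> ccont g x -> ccont (fun t => f t + g t)%cx x.
Proof.
  intros [H1 H2] [H3 H4]; split; apply (continuous_plus (V := R_NormedModule)); auto.
Qed.
Lemma ccont_opp f x : ccont f x -> ccont (fun t => - f t)%cx x.
Proof. intros [H1 H2]; split; apply (continuous_opp (V := R_NormedModule)); auto. Qed.
Lemma ccont_sub f g x : ccont f x -> ccont g x -> ccont (fun t => f t - g t)%cx x.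
Proof. intros; apply ccont_add; auto; now apply ccont_opp. Qed.
Lemma ccont_mul f g x : ccont f x -> ccont g x -> ccont (fun t => f t * g t)%cx x.
Proof.
  intros [H1 H2] [H3 H4]; split; simpl.
  - apply (continuous_minus (V := R_NormedModule)); apply (continuous_mult (K := R_AbsRing)); auto.
  - apply (continuous_plus (V := R_NormedModule)); apply (continuous_mult (K := R_AbsRing)); auto.
Qed.

Definition CInt (f : R -> Cplx) (a b : R) : Cplx :=
  mkC (RInt (fun t => Cre (f t)) a b) (RInt (fun t => Cim (f t)) a b).
Definition ex_CInt (f : R -> Cplx) (a b : R) : Prop :=
  ex_RInt (fun t => Cre (f t)) a b /\ ex_RInt (fun t => Cim (f t)) a b.

Lemma ex_CInt_cont f a b : (forall x, Rmin a b <= x <= Rmax a b -> ccont f x) -> ex_CInt f a b.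
Proof.
  intros H; split; apply (ex_RInt_continuous (V := RV)); intros z Hz; apply H, Hz.
Qed.

Lemma CInt_ext f g a b : (forall x, Rmin a b < x < Rmax a b -> f x = g x) -> CInt f a b = CInt g a b.
Proof.
  intros H; apply cx_eq; simpl; apply RInt_ext; intros x Hx; now rewrite H.
Qed.

Lemma CInt_add f g a b : ex_CInt f a b -> ex_CInt g a b ->
  CInt (fun t => f t + g t)%cx a b = (CInt f a b + CInt g a b)%cx.
Proof.
  intros [H1 H2] [H3 H4]; apply cx_eq; simpl;
  apply (RInt_plus (V := RV)); auto.
Qed.
Lemma ex_CInt_scal k f a b : ex_CInt f a b -> ex_CInt (fun t => k * f t)%cx a b.
Proof.
  intros [H1 H2]; split; simpl.
  - apply (ex_RInt_minus (V := R_NormedModule)); apply (ex_RInt_scal (V := R_NormedModule)); auto.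
  - apply (ex_RInt_plus (V := R_NormedModule)); apply (ex_RInt_scal (V := R_NormedModule)); auto.
Qed.
Lemma CInt_scal k f a b : ex_CInt f a b -> CInt (fun t => k * f t)%cx a b = (k * CInt f a b)%cx.
Proof.
  intros [H1 H2]; apply cx_eq; simpl.
  - rewrite (RInt_minus (V := RV) (fun t => Cre k * Cre (f t)) (fun t => Cim k * Cim (f t)));
    try (apply (ex_RInt_scal (V := R_NormedModule)); auto).
    rewrite !(RInt_scal (V := RV)); auto.
  - rewrite (RInt_plus (V := RV) (fun t => Cre k * Cim (f t)) (fun t => Cim k * Cre (f t)));
    try (apply (ex_RInt_scal (V := R_NormedModule)); auto).
    rewrite !(RInt_scal (V := RV)); auto.
Qed.
Lemma CInt_Chasles f a b c : ex_CInt f a b -> ex_CInt f b c ->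
  (CInt f a b + CInt f b c)%cx = CInt f a c.
Proof.
  intros [H1 H2] [H3 H4]; apply cx_eq; simpl;
  apply (RInt_Chasles (V := RV)); auto.
Qed.

Lemma CInt_derive F f a b : (forall x, Rmin a b <= x <= Rmax a b -> cder F x (f x)) ->
  (forall x, Rmin a b <= x <= Rmax a b -> ccont f x) -> CInt f a b = (F b - F a)%cx.
Proof.
  intros Hd Hc. apply cx_eq; simpl; apply is_RInt_unique.
  - apply (is_RInt_derive (V := RV) (fun t => Cre (F t)));
    intros x Hx; [apply Hd|apply Hc]; auto.
  - apply (is_RInt_derive (V := RV) (fun t => Cim (F t)));
    intros x Hx; [apply Hd|apply Hc]; auto.
Qed.

(** The factor 2 comes from estimating real and imaginary parts separately; the same holds for
    [cder_MVT]. It is harmless, as only orders of magnitude matter in the applications. *)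
Lemma CInt_bound f a b M : a <= b -> ex_CInt f a b ->
  (forall x, a <= x <= b -> Cnorm (f x) <= M) -> Cnorm (CInt f a b) <= 2 * M * (b - a).
Proof.
  intros Hab [H1 H2] HM. le_via Cnorm_le_sum. simpl.
  assert (Rabs (RInt (fun t => Cre (f t)) a b) <= (b - a) * M).
  { apply abs_RInt_le_const; auto. intros t Ht. eapply Rle_trans; [apply Cre_le_norm|auto]. }
  assert (Rabs (RInt (fun t => Cim (f t)) a b) <= (b - a) * M).
  { apply abs_RInt_le_const; auto. intros t Ht. eapply Rle_trans; [apply Cim_le_norm|auto]. }
  lra.
Qed.

Lemma cder_MVT F f a b M : a <= b -> (forall x, a <= x <= b -> cder F x (f x)) ->
  (forall x, a <= x <= b -> Cnorm (f x) <= M) -> Cnorm (F b - F a)%cx <= 2 * M * (b - a).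
Proof.
  intros Hab Hd HM. le_via Cnorm_le_sum. simpl.
  assert (G : forall (g dg : R -> R), (forall x, a <= x <= b -> is_derive g x (dg x)) ->
    (forall x, a <= x <= b -> Rabs (dg x) <= M) -> Rabs (g b - g a) <= M * (b - a)).
  { intros g dg Hg Hb. destruct (MVT_gen g a b dg) as [c [Hc E]].
    - intros x. rewrite Rmin_left, Rmax_right by lra. intros; apply Hg; lra.
    - intros x. rewrite Rmin_left, Rmax_right by lra. intros Hx.
      apply continuity_pt_filterlim. apply (dcont _ _ _ (Hg x Hx)).
    - minmax Hc.
      rewrite E, Rabs_mult, (Rabs_right (b - a)) by lra.
      apply mul_le_r; [lra|auto]. }
  assert (H1 := G (fun t => Cre (F t)) (fun t => Cre (f t)) (fun x Hx => proj1 (Hd x Hx))).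
  assert (H2 := G (fun t => Cim (F t)) (fun t => Cim (f t)) (fun x Hx => proj2 (Hd x Hx))).
  assert (Rabs (Cre (F b) + - Cre (F a)) <= M * (b + - a)).
  { apply H1. intros x Hx. eapply Rle_trans; [apply Cre_le_norm|auto]. }
  assert (Rabs (Cim (F b) + - Cim (F a)) <= M * (b + - a)).
  { apply H2. intros x Hx. eapply Rle_trans; [apply Cim_le_norm|auto]. }
  lra.
Qed.

Lemma cder_zero_const F a b : a <= b -> (forall x, a <= x <= b -> cder F x C0) -> F b = F a.
Proof.
  intros Hab H.
  assert (Cnorm (F b - F a)%cx <= 2 * 0 * (b - a)).
  { apply (cder_MVT F (fun _ => C0)); auto. intros; rewrite Cnorm_0; lra. }
  assert (E : Cnorm (F b - F a)%cx = 0) by (generalize (Cnorm_nonneg (F b - F a)%cx); lra).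
  apply Cnorm_eq0 in E.
  replace (F b) with (F b - F a + F a)%cx by ring. rewrite E; ring.
Qed.

(** * Holomorphic functions *)

Definition c2 (f : R -> R -> Cplx) (x y : R) : Prop :=
  continuity_2d_pt (fun u v => Cre (f u v)) x y /\ continuity_2d_pt (fun u v => Cim (f u v)) x y.

Lemma c2_const k x y : c2 (fun _ _ => k) x y.
Proof. split; apply continuity_2d_pt_const. Qed.
Lemma c2_add f g x y : c2 f x y -> c2 g x y -> c2 (fun u v => f u v + g u v)%cx x y.
Proof. intros [H1 H2] [H3 H4]; split; apply continuity_2d_pt_plus; auto. Qed.
Lemma c2_opp f x y : c2 f x y -> c2 (fun u v => - f u v)%cx x y.
Proof. intros [H1 H2]; split; apply continuity_2d_pt_opp; auto. Qed.
Lemma c2_mul f g x y : c2 f x y -> c2 g x y -> c2 (fun u v => f u v * g u v)%cx x y.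
Proof.
  intros [H1 H2] [H3 H4]; split; simpl.
  - apply continuity_2d_pt_minus; apply continuity_2d_pt_mult; auto.
  - apply continuity_2d_pt_plus; apply continuity_2d_pt_mult; auto.
Qed.
Lemma c2_inv f x y : c2 f x y -> f x y <> C0 -> c2 (fun u v => / f u v)%cx x y.
Proof.
  intros [H1 H2] Hn.
  assert (Hd : continuity_2d_pt (fun u v => / Cnorm2 (f u v)) x y).
  { apply (continuity_2d_pt_inv (fun u v => Cnorm2 (f u v))).
    - unfold Cnorm2; apply continuity_2d_pt_plus; apply continuity_2d_pt_mult; auto.
    - apply Cnorm2_pos in Hn; lra. }
  split; simpl; unfold Rdiv; apply continuity_2d_pt_mult; auto.
  now apply continuity_2d_pt_opp.
Qed.
Lemma c2_exp f x y : c2 f x y -> c2 (fun u v => Cexp (f u v)) x y.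
Proof.
  intros [H1 H2].
  assert (He : continuity_2d_pt (fun u v => exp (Cre (f u v))) x y)
    by (apply continuity_1d_2d_pt_comp; auto;
        apply derivable_continuous_pt, derivable_pt_exp).
  split; simpl; apply continuity_2d_pt_mult; auto.
  - apply continuity_1d_2d_pt_comp; auto; apply derivable_continuous_pt, derivable_pt_cos.
  - apply continuity_1d_2d_pt_comp; auto; apply derivable_continuous_pt, derivable_pt_sin.
Qed.

(** Holomorphy encoded by its use: the chain rule along real curves, and continuity of f and f'
    along two-parameter families. The latter is the form required for differentiating under an
    integral sign. *)
Record Hol (D : Cplx -> Prop) (f f' : Cplx -> Cplx) : Prop := {
  hol_der : forall g g' x, cder g x g' -> D (g x) -> cder (fun t => f (g t)) x (f' (g x) * g')%cx;
  hol_cont : forall g x y, c2 g x y -> D (g x y) -> c2 (fun u v => f (g u v)) x y;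
  hol_cont' : forall g x y, c2 g x y -> D (g x y) -> c2 (fun u v => f' (g u v)) x y }.

Lemma Hol_const D k : Hol D (fun _ => k) (fun _ => C0).
Proof.
  split; intros.
  - eapply cder_val; [apply cder_const|cbv beta; ring].
  - apply c2_const.
  - apply c2_const.
Qed.
Lemma Hol_id D : Hol D (fun z => z) (fun _ => C1).
Proof.
  split; intros; auto.
  - eapply cder_val; [eassumption|cbv beta; ring].
  - apply c2_const.
Qed.
Lemma Hol_add D f f' g g' : Hol D f f' -> Hol D g g' ->
  Hol D (fun z => f z + g z)%cx (fun z => f' z + g' z)%cx.
Proof.
  intros [a1 a2 a3] [b1 b2 b3]; split; intros.
  - eapply cder_val; [apply cder_add; [apply a1|apply b1]; eassumption|cbv beta; ring].
  - apply c2_add; auto.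
  - apply c2_add; auto.
Qed.
Lemma Hol_mul D f f' g g' : Hol D f f' -> Hol D g g' ->
  Hol D (fun z => f z * g z)%cx (fun z => f' z * g z + f z * g' z)%cx.
Proof.
  intros [a1 a2 a3] [b1 b2 b3]; split; intros.
  - eapply cder_val; [apply cder_mul; [apply a1|apply b1]; eassumption|cbv beta; ring].
  - apply c2_mul; auto.
  - apply c2_add; apply c2_mul; auto.
Qed.
Lemma Hol_opp D f f' : Hol D f f' -> Hol D (fun z => - f z)%cx (fun z => - f' z)%cx.
Proof.
  intros [a1 a2 a3]; split; intros.
  - eapply cder_val; [apply cder_opp, a1; eassumption|cbv beta; ring].
  - apply c2_opp; auto.
  - apply c2_opp; auto.
Qed.
Lemma Hol_exp D f f' : Hol D f f' -> Hol D (fun z => Cexp (f z)) (fun z => Cexp (f z) * f' z)%cx.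
Proof.
  intros [a1 a2 a3]; split; intros.
  - eapply cder_val; [apply cder_exp, a1; eassumption|cbv beta; ring].
  - apply c2_exp; auto.
  - apply c2_mul; auto. apply c2_exp; auto.
Qed.
Lemma Hol_inv D f f' : Hol D f f' -> (forall z, D z -> f z <> C0) ->
  Hol D (fun z => / f z)%cx (fun z => - f' z / (f z * f z))%cx.
Proof.
  intros [a1 a2 a3] Hn; split; intros.
  - eapply cder_val; [apply cder_inv; [apply a1; eassumption|auto]|]. cbv beta; field; auto.
  - apply c2_inv; auto.
  - apply c2_mul; [apply c2_opp; auto|].
    apply (c2_inv (fun u v => f (g u v) * f (g u v))%cx); [apply c2_mul; auto|].
    apply Cmul_neq0; auto.
Qed.
Lemma Hol_val D f f1' f2' : Hol D f f1' -> (forall z, f1' z = f2' z) -> Hol D f f2'.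
Proof.
  intros [a1 a2 a3] E; split; intros; auto.
  - eapply cder_val; [apply a1; eassumption|now rewrite E].
  - destruct (a3 g x y H H0) as [h1 h2]; split;
    [eapply continuity_2d_pt_ext; [|exact h1]|eapply continuity_2d_pt_ext; [|exact h2]];
    intros; simpl; now rewrite E.
Qed.
Lemma Hol_pown D f f' n : Hol D f f' -> exists h', Hol D (fun z => Cpown (f z) n) h'.
Proof.
  intros H; induction n as [|n [h' IH]]; simpl.
  - eexists; apply Hol_const.
  - eexists; apply Hol_mul; eassumption.
Qed.

(** * Primitives on star-shaped domains *)

Definition star_open (D : Cplx -> Prop) : Prop :=
  (forall z t, D z -> 0 <= t <= 1 -> D (RtoC t * z)%cx) /\
  (forall g x y, c2 g x y -> D (g x y) -> locally_2d (fun u v => D (g u v)) x y).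

Definition star_prim (f : Cplx -> Cplx) (z : Cplx) : Cplx :=
  (z * CInt (fun t => f (RtoC t * z)%cx) 0 1)%cx.

Definition lin (a d : Cplx) (u : R) : Cplx := (a + RtoC u * d)%cx.
Lemma cder_lin a d x : cder (lin a d) x d.
Proof.
  eapply cder_val.
  - apply cder_add; [apply cder_const|apply cder_mul; [apply cder_id|apply cder_const]].
  - cbv beta. ring.
Qed.
Lemma c2_snd x y : c2 (fun u v => RtoC v) x y.
Proof. split; [apply continuity_2d_pt_id2|exact (continuity_2d_pt_const x y 0)]. Qed.
Lemma c2_of_ccont g x y : ccont g x -> c2 (fun u _ => g u) x y.
Proof.
  intros [H1 H2]; split.
  - apply (continuity_1d_2d_pt_comp (fun t => Cre (g t)) (fun u _ => u));
    [apply continuity_pt_filterlim; exact H1|apply continuity_2d_pt_id1].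
  - apply (continuity_1d_2d_pt_comp (fun t => Cim (g t)) (fun u _ => u));
    [apply continuity_pt_filterlim; exact H2|apply continuity_2d_pt_id1].
Qed.

Lemma locally_2d_fst (P : R -> Prop) x y : locally_2d (fun u _ => P u) x y -> locally x P.
Proof.
  intros [e He]. exists e. intros u Hu. apply (He u y); [exact Hu|].
  rewrite Rminus_diag, Rabs_R0. apply cond_pos.
Qed.

Section StarPrimitive.
Variables (D : Cplx -> Prop) (f f' : Cplx -> Cplx).
Hypothesis HD : star_open D.
Hypothesis Hf : Hol D f f'.
Variables (E : R -> Prop) (z dz : R -> Cplx).
Hypothesis HE : open E.
Hypothesis Hz : forall u, E u -> cder z u (dz u).
Hypothesis Hdz : forall u, E u -> ccont dz u.

Lemma c2_ray u t : E u -> c2 (fun u v => RtoC v * z u)%cx u t.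
Proof.
  intros Hu. apply c2_mul; [apply c2_snd|]. apply c2_of_ccont. eapply cder_ccont, Hz, Hu.
Qed.

Lemma ray_der_u t u : E u -> D (RtoC t * z u)%cx ->
  cder (fun u => f (RtoC t * z u)%cx) u (f' (RtoC t * z u) * (RtoC t * dz u))%cx.
Proof.
  intros Hu H. apply (hol_der D f f' Hf); auto.
  eapply cder_val; [apply cder_mul; [apply cder_const|apply Hz, Hu]|cbv beta; ring].
Qed.

Lemma ray_der_t t u : D (RtoC t * z u)%cx ->
  cder (fun t => f (RtoC t * z u)%cx) t (f' (RtoC t * z u) * z u)%cx.
Proof.
  intros H. apply (hol_der D f f' Hf); auto.
  eapply cder_val; [apply cder_mul; [apply cder_id|apply cder_const]|cbv beta; ring].
Qed.

Lemma star_locally x : E x -> D (z x) ->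
  locally x (fun u => E u /\ forall t, 0 <= t <= 1 -> D (RtoC t * z u)%cx).
Proof.
  intros HEx Hx. destruct HD as [Hs Ho].
  assert (L : locally_2d (fun u _ => D (z u)) x 0).
  { apply (Ho (fun u _ => z u) x 0); [|exact Hx]. apply c2_of_ccont. eapply cder_ccont; apply Hz; exact HEx. }
  apply locally_2d_fst in L. generalize (filter_and _ _ (HE x HEx) L).
  apply filter_imp; intros u [Hu1 Hu]; split; auto.
Qed.

Lemma ray_ex_CInt u : (forall t, 0 <= t <= 1 -> D (RtoC t * z u)%cx) ->
  ex_CInt (fun t => f (RtoC t * z u)%cx) 0 1.
Proof.
  intros H. apply ex_CInt_cont. intros t Ht. minmax Ht.
  eapply cder_ccont, ray_der_t; auto.
Qed.

Lemma ray_CInt_der x : E x -> D (z x) ->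
  cder (fun u => CInt (fun t => f (RtoC t * z u)%cx) 0 1) x
    (CInt (fun t => f' (RtoC t * z x) * (RtoC t * dz x))%cx 0 1).
Proof.
  intros HEx Hx. assert (L := star_locally x HEx Hx).
  assert (Hx1 : forall t, 0 <= t <= 1 -> D (RtoC t * z x)%cx) by (intros; now apply HD).
  assert (L2 : forall t, 0 <= t <= 1 -> locally_2d (fun u v => E u /\ D (RtoC v * z u)%cx) x t).
  { intros t Ht. apply locally_2d_and.
    - destruct (HE x HEx) as [e He]. exists e. intros u v Hu _. apply He, Hu.
    - apply HD; [apply c2_ray; auto|auto]. }
  assert (Hc : forall t, 0 <= t <= 1 -> c2 (fun u v => f' (RtoC v * z u) * (RtoC v * dz u))%cx x t).
  { intros t Ht. apply c2_mul.
    - apply (hol_cont' D f f' Hf (fun u v => RtoC v * z u)%cx); [apply c2_ray; auto|auto].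
    - apply c2_mul; [apply c2_snd|apply c2_of_ccont; auto]. }
  split; simpl.
  - eapply is_derive_val.
    + apply (is_derive_RInt_param (fun u t => Cre (f (RtoC t * z u)%cx))).
      * revert L; apply filter_imp; intros u [HEu Hu] t Ht. minmax Ht.
        eexists. exact (proj1 (ray_der_u t u HEu (Hu t Ht))).
      * intros t Ht. minmax Ht.
        eapply continuity_2d_pt_ext_loc; [|exact (proj1 (Hc t Ht))].
        generalize (L2 t Ht). apply locally_2d_impl, locally_2d_forall.
        intros u v [HEu H]. symmetry. exact (is_derive_unique _ _ _ (proj1 (ray_der_u v u HEu H))).
      * revert L; apply filter_imp; intros u [_ Hu]. exact (proj1 (ray_ex_CInt u Hu)).
    + apply RInt_ext. intros t Ht. minmax Ht.
      assert (Ht' : 0 <= t <= 1) by lra.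
      exact (is_derive_unique _ _ _ (proj1 (ray_der_u t x HEx (Hx1 t Ht')))).
  - eapply is_derive_val.
    + apply (is_derive_RInt_param (fun u t => Cim (f (RtoC t * z u)%cx))).
      * revert L; apply filter_imp; intros u [HEu Hu] t Ht. minmax Ht.
        eexists. exact (proj2 (ray_der_u t u HEu (Hu t Ht))).
      * intros t Ht. minmax Ht.
        eapply continuity_2d_pt_ext_loc; [|exact (proj2 (Hc t Ht))].
        generalize (L2 t Ht). apply locally_2d_impl, locally_2d_forall.
        intros u v [HEu H]. symmetry. exact (is_derive_unique _ _ _ (proj2 (ray_der_u v u HEu H))).
      * revert L; apply filter_imp; intros u [_ Hu]. exact (proj2 (ray_ex_CInt u Hu)).
    + apply RInt_ext. intros t Ht. minmax Ht.
      assert (Ht' : 0 <= t <= 1) by lra.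
      exact (is_derive_unique _ _ _ (proj2 (ray_der_u t x HEx (Hx1 t Ht')))).
Qed.

Lemma ccont_snd_of_c2 (h : R -> R -> Cplx) x t : c2 h x t -> ccont (fun v => h x v) t.
Proof.
  assert (G : forall k : R -> R -> R, continuity_2d_pt k x t -> continuous (fun v => k x v) t).
  { intros k Hk. apply continuity_pt_filterlim. apply continuity_pt_locally.
    intros eps. destruct (Hk eps) as [e He]. exists e. intros v Hv.
    apply (He x v); [rewrite Rminus_diag, Rabs_R0; apply cond_pos|exact Hv]. }
  intros [H1 H2]; split; [apply (G (fun u v => Cre (h u v)))|apply (G (fun u v => Cim (h u v)))]; auto.
Qed.

(** Differentiating z times the integral of f(tz) under the integral sign gives dz times the
    integral of f(tz) + t z f'(tz). That integrand is the t-derivative of t f(tz), so the integral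
    is f(z). *)
Lemma star_prim_der x : E x -> D (z x) -> cder (fun u => star_prim f (z u)) x (f (z x) * dz x)%cx.
Proof.
  intros HEx Hx.
  assert (Hx1 : forall t, 0 <= t <= 1 -> D (RtoC t * z x)%cx) by (intros; now apply HD).
  assert (Hc : forall t, 0 <= t <= 1 -> ccont (fun t => f' (RtoC t * z x) * (RtoC t * dz x))%cx t).
  { intros t Ht. apply (ccont_snd_of_c2 (fun u v => f' (RtoC v * z u) * (RtoC v * dz u))%cx).
    apply c2_mul.
    - apply (hol_cont' D f f' Hf (fun u v => RtoC v * z u)%cx); [apply c2_ray; auto|auto].
    - apply c2_mul; [apply c2_snd|apply c2_of_ccont; auto]. }
  eapply cder_val; [apply cder_mul; [apply Hz, HEx|apply ray_CInt_der; auto]|].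
  cbv beta.
  assert (F1 := ray_ex_CInt x Hx1).
  assert (F2 : ex_CInt (fun t => f' (RtoC t * z x) * (RtoC t * dz x))%cx 0 1).
  { apply ex_CInt_cont. intros t Ht. minmax Ht. auto. }
  rewrite <- (CInt_scal (dz x) _ _ _ F1), <- (CInt_scal (z x) _ _ _ F2).
  rewrite <- CInt_add by (apply ex_CInt_scal; assumption).
  rewrite (CInt_derive (fun t => dz x * (RtoC t * f (RtoC t * z x)))%cx).
  - change (RtoC 1) with C1. change (RtoC 0) with C0.
    replace (C1 * z x)%cx with (z x) by ring. ring.
  - intros t Ht. minmax Ht.
    eapply cder_val.
    + apply cder_scal, cder_mul; [apply cder_id|apply ray_der_t; auto].
    + cbv beta. ring.
  - intros t Ht. minmax Ht.
    apply ccont_add; apply ccont_mul; auto using ccont_const.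
    eapply cder_ccont, ray_der_t; auto.
Qed.

End StarPrimitive.

(** Cauchy's theorem in the form used here: the integral along a curve depends only on its
    endpoints. *)
Lemma star_curve_CInt D f f' (E : R -> Prop) z dz a b : star_open D -> Hol D f f' -> open E ->
  (forall u, E u -> cder z u (dz u)) -> (forall u, E u -> ccont dz u) -> a <= b ->
  (forall u, a <= u <= b -> E u /\ D (z u)) ->
  CInt (fun u => f (z u) * dz u)%cx a b = (star_prim f (z b) - star_prim f (z a))%cx.
Proof.
  intros HD Hf HE Hz Hdz Hab H.
  apply (CInt_derive (fun u => star_prim f (z u))).
  - intros u Hu. minmax Hu.
    apply (star_prim_der D f f' HD Hf E); auto; apply H; auto.
  - intros u Hu. minmax Hu. destruct (H u Hu).
    apply ccont_mul; auto. eapply cder_ccont, (hol_der D f f' Hf); [apply Hz|]; auto.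
Qed.

Lemma star_seg_CInt D f f' a d : star_open D -> Hol D f f' ->
  (forall u, 0 <= u <= 1 -> D (lin a d u)) ->
  CInt (fun u => f (lin a d u) * d)%cx 0 1 = (star_prim f (a + d) - star_prim f a)%cx.
Proof.
  intros HD Hf H.
  rewrite (star_curve_CInt D f f' (fun _ => True) (lin a d) (fun _ => d)); auto using open_true, cder_lin, ccont_const; try lra.
  unfold lin. f_equal; [|f_equal]; f_equal; [change (RtoC 1) with C1|change (RtoC 0) with C0]; ring.
Qed.

(** * Smooth functions on an open set *)

Fixpoint sm (n : nat) (D : R -> Prop) (f : R -> R) : Prop :=
  match n with
  | O => True
  | S n' => (forall x, D x -> ex_derive f x) /\ sm n' D (Derive f)
  end.
Definition smooth (D : R -> Prop) (f : R -> R) : Prop := forall n, sm n D f.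

Section Smooth.
Variable D : R -> Prop.
Hypothesis HO : open D.

Lemma sm_ext n : forall f g, (forall x, D x -> f x = g x) -> sm n D f -> sm n D g.
Proof.
  induction n as [|n IH]; intros f g E; simpl; auto.
  intros [H1 H2]. split.
  - intros x Hx. apply ex_derive_ext_loc with f; auto.
    apply (filter_imp D); [exact E|apply HO, Hx].
  - apply (IH (Derive f)); auto. intros x Hx. apply Derive_ext_loc.
    apply (filter_imp D); [exact E|apply HO, Hx].
Qed.
Lemma sm_down n : forall f, sm (S n) D f -> sm n D f.
Proof.
  induction n as [|n IH]; intros f H; [exact I|].
  destruct H as [H1 H2]. split; auto.
Qed.
Lemma sm_intro n f f' : (forall x, D x -> is_derive f x (f' x)) -> sm n D f' -> sm (S n) D f.
Proof.
  intros H1 H2; split.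
  - intros x Hx. exists (f' x); auto.
  - apply (sm_ext n f'); auto. intros x Hx. symmetry. now apply is_derive_unique, H1.
Qed.
Lemma smooth_ext f g : (forall x, D x -> f x = g x) -> smooth D f -> smooth D g.
Proof. intros E H n. apply (sm_ext n f g E), H. Qed.
Lemma smooth_is_derive f x : smooth D f -> D x -> is_derive f x (Derive f x).
Proof. intros H Hx. apply Derive_correct. destruct (H 1%nat) as [H1 _]. auto. Qed.
Lemma smooth_cont f x : smooth D f -> D x -> continuous f x.
Proof. intros H Hx. eapply dcont, smooth_is_derive; auto. Qed.
Lemma smooth_Derive f : smooth D f -> smooth D (Derive f).
Proof. intros H n. destruct (H (S n)); auto. Qed.
Lemma smooth_Derive_n f k : smooth D f -> smooth D (Derive_n f k).
Proof. intros H; induction k; simpl; auto. now apply smooth_Derive. Qed.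

Lemma sm_const n (a : R) : sm n D (fun _ => a).
Proof.
  revert a; induction n; intros a; [exact I|].
  apply sm_intro with (fun _ => 0); auto. intros; apply dconst.
Qed.
Lemma smooth_const (a : R) : smooth D (fun _ => a).
Proof. intros n; apply sm_const. Qed.
Lemma smooth_id : smooth D (fun x => x).
Proof.
  intros [|n]; [exact I|]. apply sm_intro with (fun _ => 1); [intros; apply did|apply sm_const].
Qed.
Lemma sm_plus n : forall f g, sm n D f -> sm n D g -> sm n D (fun x => f x + g x).
Proof.
  induction n; intros f g Hf Hg; [exact I|]. destruct Hf as [f1 f2], Hg as [g1 g2].
  apply sm_intro with (fun x => Derive f x + Derive g x); auto.
  intros x Hx; apply dplus; apply Derive_correct; auto.
Qed.
Lemma sm_mult n : forall f g, sm n D f -> sm n D g -> sm n D (fun x => f x * g x).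
Proof.
  induction n; intros f g Hf Hg; [exact I|].
  assert (Hf' := sm_down _ _ Hf). assert (Hg' := sm_down _ _ Hg).
  destruct Hf as [f1 f2], Hg as [g1 g2].
  apply sm_intro with (fun x => Derive f x * g x + f x * Derive g x).
  - intros x Hx; apply dmult; apply Derive_correct; auto.
  - apply sm_plus; auto.
Qed.
Lemma smooth_plus f g : smooth D f -> smooth D g -> smooth D (fun x => f x + g x).
Proof. intros H1 H2 n; apply sm_plus; auto. Qed.
Lemma smooth_mult f g : smooth D f -> smooth D g -> smooth D (fun x => f x * g x).
Proof. intros H1 H2 n; apply sm_mult; auto. Qed.
Lemma smooth_opp f : smooth D f -> smooth D (fun x => - f x).
Proof.
  intros H; apply (smooth_ext (fun x => -1 * f x)); [intros; ring|].
  apply smooth_mult; auto using smooth_const.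
Qed.
Lemma smooth_minus f g : smooth D f -> smooth D g -> smooth D (fun x => f x - g x).
Proof. intros; apply smooth_plus; auto using smooth_opp. Qed.
Lemma smooth_pow f k : smooth D f -> smooth D (fun x => f x ^ k).
Proof.
  intros H; induction k; simpl; [apply smooth_const|now apply smooth_mult].
Qed.
Lemma smooth_inv f : smooth D f -> (forall x, D x -> f x <> 0) -> smooth D (fun x => / f x).
Proof.
  intros H Hn n; induction n; [exact I|].
  apply sm_intro with (fun x => - Derive f x * (/ f x * / f x)).
  - intros x Hx. eapply is_derive_val.
    + apply dinv; [apply smooth_is_derive; auto|auto].
    + field; auto.
  - apply sm_mult; [apply smooth_opp, smooth_Derive, H|]. now apply sm_mult.
Qed.

End Smooth.

Lemma sm_subset n (D D' : R -> Prop) : (forall x, D' x -> D x) -> forall f, sm n D f -> sm n D' f.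
Proof. intros H; induction n; simpl; auto. intros f [H1 H2]; split; auto. Qed.
Lemma smooth_subset (D D' : R -> Prop) f : (forall x, D' x -> D x) -> smooth D f -> smooth D' f.
Proof. intros H Hf n; eapply sm_subset; eauto. Qed.

Lemma smooth_comp (D E : R -> Prop) f g : open D -> open E -> smooth E f -> smooth D g ->
  (forall x, D x -> E (g x)) -> smooth D (fun x => f (g x)).
Proof.
  intros HD HE Hf Hg HDE n. revert f Hf. induction n; intros f Hf; [exact I|].
  apply (sm_intro D HD) with (fun x => Derive f (g x) * Derive g x).
  - intros x Hx. apply dcomp; eapply smooth_is_derive; eauto.
  - apply sm_mult; auto; [apply IHn; now apply smooth_Derive|]. apply smooth_Derive; auto.
Qed.

Lemma smooth_exp : smooth (fun _ => True) exp.
Proof.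
  intros n; induction n; [exact I|].
  apply (sm_intro _ open_true) with exp; auto. intros; apply dexp.
Qed.
Lemma smooth_sincos : smooth (fun _ => True) sin /\ smooth (fun _ => True) cos.
Proof.
  cut (forall n, sm n (fun _ => True) sin /\ sm n (fun _ => True) cos).
  { intros H; split; intros n; apply H. }
  intros n; induction n as [|n [IH1 IH2]]; [split; exact I|]. split.
  - apply (sm_intro _ open_true) with cos; auto.
    intros; apply is_derive_Reals, derivable_pt_lim_sin.
  - apply (sm_intro _ open_true) with (fun x => -1 * sin x); auto.
    + intros; apply is_derive_Reals. replace (-1 * sin x) with (- sin x) by ring.
      apply derivable_pt_lim_cos.
    + apply sm_mult; auto using sm_const, open_true.
Qed.
Lemma smooth_ln : smooth (fun x => 0 < x) ln.
Proof.
  intros [|n]; [exact I|].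
  apply (sm_intro _ (open_gt 0)) with Rinv; [intros; now apply dln|].
  apply (smooth_inv _ (open_gt 0) (fun x => x)); [apply smooth_id, open_gt|intros; lra].
Qed.
Lemma smooth_atan : smooth (fun _ => True) atan.
Proof.
  intros [|n]; [exact I|].
  apply (sm_intro _ open_true) with (fun x => / (1 + x * x)).
  - intros x _. apply is_derive_Reals. replace (/ (1 + x * x)) with (/ (1 + x ^ 2)) by (f_equal; ring).
    apply derivable_pt_lim_atan.
  - apply (smooth_inv _ open_true).
    + apply smooth_plus; auto using smooth_const, open_true.
      apply smooth_mult; auto using smooth_id, open_true.
    + intros; nra.
Qed.

(** * Hadamard averages *)

(** The weight t^j makes this family closed under differentiation, since each derivative in x brings
    out one factor t. Smoothness of the averages follows by induction. *)
Definition hav (j : nat) (f : R -> R) (x : R) : R := RInt (fun t => t ^ j * f (t * x)) 0 1.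

Section Hadamard.
Variable D : R -> Prop.
Hypothesis HO : open D.
Hypothesis HS : forall x t, D x -> 0 <= t <= 1 -> D (t * x).

Lemma scale_open_2d x t : D (t * x) -> locally_2d (fun u v => D (v * u)) x t.
Proof.
  intros H. destruct (HO _ H) as [e He].
  assert (C : continuity_2d_pt (fun u v => v * u) x t)
    by (apply continuity_2d_pt_mult; [apply continuity_2d_pt_id2|apply continuity_2d_pt_id1]).
  generalize (C e). apply locally_2d_impl, locally_2d_forall. intros u v Huv. now apply He.
Qed.

Lemma scaled_der_x j f x t : smooth D f -> D (t * x) ->
  is_derive (fun u => t ^ j * f (t * u)) x (t ^ S j * Derive f (t * x)).
Proof.
  intros Hf Hx. eapply is_derive_val.
  - apply dmult; [apply dconst|apply (dcomp f (fun u => t * u))].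
    + eapply smooth_is_derive; eauto.
    + apply dmult; [apply dconst|apply did].
  - simpl; ring.
Qed.

Lemma pow_der j (t : R) : is_derive (fun u => u ^ j) t (INR j * t ^ pred j).
Proof. apply is_derive_Reals, derivable_pt_lim_pow. Qed.

Lemma scaled_cont_t j f x t : smooth D f -> D (t * x) -> continuous (fun t => t ^ j * f (t * x)) t.
Proof.
  intros Hf Hx. eapply dcont. apply dmult; [apply pow_der|apply (dcomp f (fun t => t * x))].
  - eapply smooth_is_derive; eauto.
  - apply dmult; [apply did|apply dconst].
Qed.

Lemma hav_ex j f x : smooth D f -> D x -> ex_RInt (fun t => t ^ j * f (t * x)) 0 1.
Proof.
  intros Hf Hx. apply (ex_RInt_continuous (V := RV)).
  intros t Ht. minmax Ht. apply scaled_cont_t; auto.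
Qed.

Lemma hav_der j f x : smooth D f -> D x -> is_derive (hav j f) x (hav (S j) (Derive f) x).
Proof.
  intros Hf Hx.
  assert (L : locally x D) by (apply HO, Hx).
  eapply is_derive_val.
  - apply (is_derive_RInt_param (fun u t => t ^ j * f (t * u))).
    + revert L; apply filter_imp; intros u Hu t Ht. minmax Ht.
      eexists. apply scaled_der_x; auto.
    + intros t Ht. minmax Ht.
      apply continuity_2d_pt_ext_loc with (fun u v => v ^ S j * Derive f (v * u)).
      * generalize (scale_open_2d x t (HS _ _ Hx Ht)). apply locally_2d_impl, locally_2d_forall.
        intros u v H. symmetry. apply is_derive_unique. apply scaled_der_x; auto.
      * apply continuity_2d_pt_mult.
        -- apply (continuity_1d_2d_pt_comp (fun v => v ^ S j) (fun _ v => v)).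
           ++ apply derivable_continuous_pt, derivable_pt_pow.
           ++ apply continuity_2d_pt_id2.
        -- apply (continuity_1d_2d_pt_comp (Derive f) (fun u v => v * u)).
           ++ apply continuity_pt_filterlim, (smooth_cont D); auto. apply smooth_Derive; auto.
           ++ apply continuity_2d_pt_mult; [apply continuity_2d_pt_id2|apply continuity_2d_pt_id1].
    + revert L; apply filter_imp; intros u Hu. apply hav_ex; auto.
  - apply RInt_ext. intros t Ht. minmax Ht.
    apply is_derive_unique, scaled_der_x; auto. apply HS; auto; lra.
Qed.

Lemma smooth_hav j f : smooth D f -> smooth D (hav j f).
Proof.
  intros Hf n. revert j f Hf; induction n; intros j f Hf; [exact I|].
  apply (sm_intro D HO) with (hav (S j) (Derive f)).
  - intros; apply hav_der; auto.
  - apply IHn, smooth_Derive; auto.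
Qed.

(** Hadamard's lemma: a zero at 0 is divided out with a smooth quotient. It is used to remove the
    zeros of the even factors and to straighten the phase in Laplace's method. *)
Lemma hadamard f x : smooth D f -> D x -> f x = f 0 + x * hav 0 (Derive f) x.
Proof.
  intros Hf Hx.
  assert (H : RInt (fun t => x * (t ^ 0 * Derive f (t * x))) 0 1 = f x - f 0).
  { apply is_RInt_unique. replace (f x - f 0) with (f (1 * x) - f (0 * x)) by (rewrite Rmult_1_l, Rmult_0_l; auto).
    apply (is_RInt_derive (V := RV) (fun t => f (t * x))).
    - intros t Ht. minmax Ht.
      eapply is_derive_val.
      + apply (dcomp f (fun t => t * x)); [eapply smooth_is_derive; eauto|].
        apply dmult; [apply did|apply dconst].
      + cbv beta; simpl; ring.
    - intros t Ht. minmax Ht.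
      apply (continuous_mult (K := R_AbsRing) (fun _ => x)); [apply continuous_const|].
      apply scaled_cont_t; auto. apply smooth_Derive; auto. }
  unfold hav. rewrite (RInt_scal (V := RV)) in H.
  - unfold scal in H; simpl in H; unfold mult in H; simpl in H. simpl. lra.
  - apply (hav_ex 0); auto. apply smooth_Derive; auto.
Qed.

(** The primitive vanishing at 0, written with [hav] so that it inherits smoothness from the
    averages. *)
Definition prim (f : R -> R) (x : R) : R := x * hav 0 f x.

Lemma prim_der f x : smooth D f -> D x -> is_derive (prim f) x (f x).
Proof.
  intros Hf Hx. eapply is_derive_val.
  - apply dmult; [apply did|apply hav_der; auto].
  - unfold hav.
    assert (E1 := hav_ex 0 f x Hf Hx).
    assert (E2 := hav_ex 1 (Derive f) x (smooth_Derive D f Hf) Hx).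
    rewrite <- (RInt_scal (V := RV) _ _ _ 1), <- (RInt_scal (V := RV) _ _ _ x) by auto.
    rewrite <- (RInt_plus (V := RV)) by (apply (ex_RInt_scal (V := R_NormedModule)); auto).
    apply is_RInt_unique.
    replace (f x) with (1 * f (1 * x) - 0 * f (0 * x)) by (rewrite !Rmult_1_l; ring).
    apply (is_RInt_derive (V := RV) (fun t => t * f (t * x))).
    + intros t Ht. minmax Ht.
      eapply is_derive_val.
      * apply dmult; [apply did|apply (dcomp f (fun t => t * x)); [eapply smooth_is_derive; eauto|]].
        apply dmult; [apply did|apply dconst].
      * unfold plus, scal, mult; simpl. unfold mult; simpl. ring.
    + intros t Ht. minmax Ht.
      apply (continuous_plus (V := R_NormedModule));
      apply (continuous_mult (K := R_AbsRing) (fun _ => _)); try apply continuous_const;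
      apply scaled_cont_t; auto. apply smooth_Derive; auto.
Qed.

End Hadamard.

(** * Smooth complex functions of a real variable *)

Definition csm (D : R -> Prop) (f : R -> Cplx) : Prop :=
  smooth D (fun x => Cre (f x)) /\ smooth D (fun x => Cim (f x)).
Definition cD (f : R -> Cplx) (x : R) : Cplx :=
  mkC (Derive (fun t => Cre (f t)) x) (Derive (fun t => Cim (f t)) x).

Section CSmooth.
Variable D : R -> Prop.
Hypothesis HO : open D.

Lemma csm_cder f x : csm D f -> D x -> cder f x (cD f x).
Proof. intros [H1 H2] Hx; split; apply (smooth_is_derive D); auto. Qed.
Lemma csm_ccont f x : csm D f -> D x -> ccont f x.
Proof. intros; eapply cder_ccont, csm_cder; auto. Qed.
Lemma csm_cD f : csm D f -> csm D (cD f).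
Proof. intros [H1 H2]; split; apply smooth_Derive; auto. Qed.
Lemma cD_unique f x l : cder f x l -> cD f x = l.
Proof. intros [H1 H2]; apply cx_eq; simpl; now apply is_derive_unique. Qed.
Lemma csm_ext f g : (forall x, D x -> f x = g x) -> csm D f -> csm D g.
Proof.
  intros E [H1 H2]; split; [eapply smooth_ext; [exact HO| |exact H1]|eapply smooth_ext; [exact HO| |exact H2]];
  intros x Hx; simpl; now rewrite E.
Qed.
Lemma csm_const k : csm D (fun _ => k).
Proof. split; [exact (smooth_const D HO (Cre k))|exact (smooth_const D HO (Cim k))]. Qed.
Lemma csm_RtoC f : smooth D f -> csm D (fun x => RtoC (f x)).
Proof. intros H; split; [exact H|exact (smooth_const D HO 0)]. Qed.
Lemma csm_add f g : csm D f -> csm D g -> csm D (fun x => f x + g x)%cx.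
Proof. intros [H1 H2] [H3 H4]; split; apply smooth_plus; auto. Qed.
Lemma csm_opp f : csm D f -> csm D (fun x => - f x)%cx.
Proof. intros [H1 H2]; split; apply smooth_opp; auto. Qed.
Lemma csm_sub f g : csm D f -> csm D g -> csm D (fun x => f x - g x)%cx.
Proof. intros; apply csm_add; auto using csm_opp. Qed.
Lemma csm_mul f g : csm D f -> csm D g -> csm D (fun x => f x * g x)%cx.
Proof.
  intros [H1 H2] [H3 H4]; split.
  - apply smooth_minus; auto; apply smooth_mult; auto.
  - apply smooth_plus; auto; apply smooth_mult; auto.
Qed.
Lemma smooth_norm2 f : csm D f -> smooth D (fun x => Cnorm2 (f x)).
Proof. intros [H1 H2]. apply smooth_plus; auto; apply smooth_mult; auto. Qed.
Lemma csm_inv f : csm D f -> (forall x, D x -> f x <> C0) -> csm D (fun x => / f x)%cx.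
Proof.
  intros H Hn. assert (H3 := smooth_norm2 f H). destruct H as [H1 H2].
  assert (Hi : smooth D (fun x => / Cnorm2 (f x))).
  { apply smooth_inv; auto. intros x Hx. specialize (Cnorm2_pos _ (Hn x Hx)); lra. }
  split; apply smooth_mult; auto. apply smooth_opp; auto.
Qed.
Lemma csm_exp f : csm D f -> csm D (fun x => Cexp (f x)).
Proof.
  intros [H1 H2].
  assert (He : smooth D (fun x => exp (Cre (f x))))
    by (apply (smooth_comp D (fun _ => True)); auto using open_true, smooth_exp).
  split; apply smooth_mult; auto.
  - apply (smooth_comp D (fun _ => True) cos); auto using open_true; apply smooth_sincos.
  - apply (smooth_comp D (fun _ => True) sin); auto using open_true; apply smooth_sincos.
Qed.
Lemma csm_log f : csm D f -> (forall x, D x -> 0 < Cre (f x)) -> csm D (fun x => Clog (f x)).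
Proof.
  intros H Hp. assert (H3 := smooth_norm2 f H). destruct H as [H1 H2]. split.
  - apply (smooth_ext D HO (fun x => / 2 * ln (Cnorm2 (f x)))).
    + intros x Hx. destruct (Clog_re (f x)) as [E|E]; [symmetry; exact E|].
      exfalso. specialize (Hp x Hx). unfold Cnorm2 in E. nra.
    + apply smooth_mult; auto using smooth_const.
      apply (smooth_comp D (fun x => 0 < x) ln); auto using smooth_ln, open_gt.
      intros x Hx. apply Cnorm2_pos, Cre_neq0. specialize (Hp x Hx); lra.
  - apply (smooth_ext D HO (fun x => atan (Cim (f x) / Cre (f x)))).
    + intros x Hx. rewrite (Clog_rp (f x) (Hp x Hx)). reflexivity.
    + apply (smooth_comp D (fun _ => True) atan); auto using smooth_atan, open_true.
      apply smooth_mult; auto. apply smooth_inv; auto. intros x Hx. specialize (Hp x Hx); lra.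
Qed.

Section CHad.
Hypothesis HS : forall x t, D x -> 0 <= t <= 1 -> D (t * x).
Definition chav (f : R -> Cplx) (x : R) : Cplx :=
  mkC (hav 0 (fun t => Cre (f t)) x) (hav 0 (fun t => Cim (f t)) x).
Definition cprim (f : R -> Cplx) (x : R) : Cplx := (RtoC x * chav f x)%cx.
Lemma csm_chav f : csm D f -> csm D (chav f).
Proof. intros [H1 H2]; split; apply smooth_hav; auto. Qed.
Lemma chadamard f x : csm D f -> D x -> f x = (f 0 + RtoC x * chav (cD f) x)%cx.
Proof.
  intros [H1 H2] Hx; apply cx_eq; simpl.
  - assert (E := hadamard D HS _ x H1 Hx). rewrite E.
    change (hav 0 (fun t => Derive (fun t => Cre (f t)) t) x)
      with (hav 0 (Derive (fun t => Cre (f t))) x). ring.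
  - assert (E := hadamard D HS _ x H2 Hx). rewrite E.
    change (hav 0 (fun t => Derive (fun t => Cim (f t)) t) x)
      with (hav 0 (Derive (fun t => Cim (f t))) x). ring.
Qed.
Lemma cprim_re f x : Cre (cprim f x) = prim (fun t => Cre (f t)) x.
Proof. unfold cprim, prim; simpl; ring. Qed.
Lemma cprim_im f x : Cim (cprim f x) = prim (fun t => Cim (f t)) x.
Proof. unfold cprim, prim; simpl; ring. Qed.
Lemma csm_cprim f : csm D f -> csm D (cprim f).
Proof.
  intros H. apply csm_mul; [apply csm_RtoC, smooth_id, HO|now apply csm_chav].
Qed.
Lemma cprim_der f x : csm D f -> D x -> cder (cprim f) x (f x).
Proof.
  intros [H1 H2] Hx; split.
  - apply is_derive_ext with (prim (fun t => Cre (f t))); [intros; now rewrite cprim_re|].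
    apply (prim_der D); auto.
  - apply is_derive_ext with (prim (fun t => Cim (f t))); [intros; now rewrite cprim_im|].
    apply (prim_der D); auto.
Qed.
Lemma cprim_0 f : cprim f 0 = C0.
Proof. unfold cprim. change (RtoC 0) with C0. ring. Qed.
End CHad.
End CSmooth.

Lemma csm_subset (D D' : R -> Prop) f : (forall x, D' x -> D x) -> csm D f -> csm D' f.
Proof. intros H [H1 H2]; split; eapply smooth_subset; eauto. Qed.

(** * Asymptotic expansions in powers of 1/N *)

Definition eps (N : nat) : R := / INR N.
Lemma eps_pos N : (1 <= N)%nat -> 0 < eps N.
Proof. intros H; apply inv_pos, lt_0_INR; lia. Qed.
Lemma eps_le1 N : (1 <= N)%nat -> eps N <= 1.
Proof.
  intros H; unfold eps. rewrite <- Rinv_1. apply inv_le; [lra|].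
  change 1 with (INR 1); now apply le_INR.
Qed.
Lemma eps_INR N : (1 <= N)%nat -> INR N * eps N = 1.
Proof. intros H; unfold eps. apply Rinv_r, not_0_INR; lia. Qed.
Lemma eps_small (d : R) : 0 < d -> exists N0, (1 <= N0)%nat /\ forall N, (N0 <= N)%nat -> eps N < d.
Proof.
  intros Hd. destruct (archimed_cor1 d Hd) as [n [H1 H2]]. exists n. split; [lia|].
  intros N HN. eapply Rle_lt_trans; [|exact H1]. apply inv_le.
  - apply lt_0_INR; lia.
  - now apply le_INR.
Qed.

Section Expansions.
Variable Q : nat -> Prop.
Variable X : Type.
Variable dom : X -> Prop.
Variable Cf : (X -> Cplx) -> Prop.
Hypothesis Cf_const : forall k, Cf (fun _ => k).
Hypothesis Cf_add : forall f g, Cf f -> Cf g -> Cf (fun x => f x + g x)%cx.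
Hypothesis Cf_mul : forall f g, Cf f -> Cf g -> Cf (fun x => f x * g x)%cx.
Hypothesis Cf_exp : forall f, Cf f -> Cf (fun x => Cexp (f x)).
Hypothesis Cf_bdd : forall f, Cf f -> exists K, forall x, dom x -> Cnorm (f x) <= K.

(** Eventually along [Q], with a threshold that is uniform over [dom]. The space X and the class
    [Cf] are abstract because the calculus serves both functions on a window of the ray and, with a
    one-point X, plain sequences. *)
Definition evt (P : nat -> X -> Prop) : Prop :=
  exists N0, (1 <= N0)%nat /\ forall N, (N0 <= N)%nat -> Q N -> forall x, dom x -> P N x.

(* [Xp r H]: along [Q], and uniformly on [dom], [H N] expands in powers of [1/N] with
   coefficients in [Cf] and an error [O(N^-r)]; the coefficients are peeled off one by one. *)
Fixpoint Xp (r : nat) (H : nat -> X -> Cplx) : Prop :=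
  match r with
  | O => exists K, evt (fun N x => Cnorm (H N x) <= K)
  | S r' => exists h0 H1, Cf h0 /\ Xp r' H1 /\
      evt (fun N x => H N x = (h0 x + RtoC (eps N) * H1 N x)%cx)
  end.

Lemma evt_and P P' : evt P -> evt P' -> evt (fun N x => P N x /\ P' N x).
Proof.
  intros [n [Hn H]] [m [Hm H']]. exists (n + m)%nat. split; [lia|].
  intros; split; [apply H|apply H']; auto; lia.
Qed.
Lemma evt_imp (P P' : nat -> X -> Prop) :
  (forall N x, (1 <= N)%nat -> Q N -> dom x -> P N x -> P' N x) -> evt P -> evt P'.
Proof. intros E [n [Hn H]]. exists n; split; auto. intros; apply E; auto; lia. Qed.
Lemma evt_all (P : nat -> X -> Prop) : (forall N x, (1 <= N)%nat -> Q N -> dom x -> P N x) -> evt P.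
Proof. intros H; exists 1%nat; split; [lia|]. intros; apply H; auto. Qed.

Lemma Xp_ext r H H' : evt (fun N x => H N x = H' N x) -> Xp r H -> Xp r H'.
Proof.
  intros E; destruct r; simpl.
  - intros [K HK]; exists K. generalize (evt_and _ _ E HK).
    apply evt_imp; intros N x _ _ _ [E1 E2]. now rewrite <- E1.
  - intros (h0 & H1 & A & B & C); exists h0, H1; repeat split; auto.
    generalize (evt_and _ _ E C). apply evt_imp; intros N x _ _ _ [E1 E2]. now rewrite <- E1.
Qed.

Lemma Xp_bdd r : forall H, Xp r H -> exists K, evt (fun N x => Cnorm (H N x) <= K).
Proof.
  induction r; intros H HX; auto. destruct HX as (h0 & H1 & A & B & C).
  destruct (IHr _ B) as [K1 HK1]. destruct (Cf_bdd _ A) as [K0 HK0].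
  exists (K0 + K1). generalize (evt_and _ _ HK1 C). apply evt_imp. intros N x HN _ Hx [E1 E2].
  rewrite E2. le_via Cnorm_triang. rewrite Cnorm_mul, Cnorm_RtoC.
  generalize (HK0 x Hx) (eps_pos N HN) (eps_le1 N HN) (Cnorm_nonneg (H1 N x)). intros.
  rewrite Rabs_right by lra. nra.
Qed.

Lemma Xp_cf r h : Cf h -> Xp r (fun _ x => h x).
Proof.
  revert h; induction r; intros h Hh; simpl.
  - destruct (Cf_bdd _ Hh) as [K HK]; exists K. apply evt_all; auto.
  - exists h, (fun _ _ => C0). split; [|split]; auto.
    apply evt_all; intros; ring.
Qed.

Lemma Xp_add r : forall H G, Xp r H -> Xp r G -> Xp r (fun N x => H N x + G N x)%cx.
Proof.
  induction r; intros H G HH HG; simpl.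
  - destruct HH as [K1 H1], HG as [K2 H2]. exists (K1 + K2).
    generalize (evt_and _ _ H1 H2); apply evt_imp. intros N x _ _ _ [E1 E2].
    eapply Rle_trans; [apply Cnorm_triang|lra].
  - destruct HH as (h0 & H1 & A & B & C), HG as (g0 & G1 & A' & B' & C').
    exists (fun x => h0 x + g0 x)%cx, (fun N x => H1 N x + G1 N x)%cx. repeat split; auto.
    generalize (evt_and _ _ C C'); apply evt_imp. intros N x _ _ _ [E1 E2].
    rewrite E1, E2; ring.
Qed.

Lemma Xp_down r : forall H, Xp (S r) H -> Xp r H.
Proof.
  induction r; intros H HX.
  - apply (Xp_bdd 1); auto.
  - destruct HX as (h0 & H1 & A & B & C). exists h0, H1. repeat split; auto.
Qed.
Lemma Xp_le r r' H : (r' <= r)%nat -> Xp r H -> Xp r' H.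
Proof. induction 1; auto. intros; apply IHle, Xp_down; auto. Qed.

Lemma Xp_eps r H : Xp r H -> Xp (S r) (fun N x => RtoC (eps N) * H N x)%cx.
Proof.
  intros HX. exists (fun _ => C0), H. repeat split; auto. apply evt_all; intros; ring.
Qed.

Lemma Xp_mul r : forall H G, Xp r H -> Xp r G -> Xp r (fun N x => H N x * G N x)%cx.
Proof.
  induction r; intros H G HH HG.
  - destruct HH as [K1 H1], HG as [K2 H2]. exists (K1 * K2).
    generalize (evt_and _ _ H1 H2); apply evt_imp. intros N x _ _ _ [E1 E2].
    rewrite Cnorm_mul. apply Rmult_le_compat; auto using Cnorm_nonneg.
  - destruct HH as (h0 & H1 & A & B & C), HG as (g0 & G1 & A' & B' & C').
    exists (fun x => h0 x * g0 x)%cx,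
      (fun N x => (h0 x * G1 N x + H1 N x * g0 x) + RtoC (eps N) * (H1 N x * G1 N x))%cx.
    repeat split; auto.
    + apply Xp_add.
      * apply Xp_add; apply IHr; auto; apply Xp_cf; auto.
      * apply Xp_down, Xp_eps, IHr; auto.
    + generalize (evt_and _ _ C C'); apply evt_imp. intros N x _ _ _ [E1 E2].
      rewrite E1, E2; ring.
Qed.

Lemma Xp_scal r k H : Cf k -> Xp r H -> Xp r (fun N x => k x * H N x)%cx.
Proof. intros; apply Xp_mul; auto. apply Xp_cf; auto. Qed.
Lemma Xp_opp r H : Xp r H -> Xp r (fun N x => - H N x)%cx.
Proof.
  intros HX. apply (Xp_ext r (fun N x => - C1 * H N x)%cx).
  - apply evt_all; intros; ring.
  - apply (Xp_scal r (fun _ => - C1)%cx); auto.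
Qed.
Lemma Xp_sub r H G : Xp r H -> Xp r G -> Xp r (fun N x => H N x - G N x)%cx.
Proof. intros; apply Xp_add; auto using Xp_opp. Qed.

(** An error O(N^-r) is an expansion whose first r coefficients vanish: peeling off a zero
    coefficient multiplies the function by N. *)
Lemma Xp_err r : forall H K, evt (fun N x => Cnorm (H N x) <= K * eps N ^ r) -> Xp r H.
Proof.
  induction r; intros H K HK.
  - exists K. revert HK; apply evt_imp; intros; simpl in *; lra.
  - exists (fun _ => C0), (fun N x => RtoC (INR N) * H N x)%cx. repeat split; auto.
    + apply (IHr _ K). revert HK; apply evt_imp. intros N x HN _ _ HE.
      rewrite Cnorm_mul, Cnorm_RtoC, Rabs_right by (apply Rle_ge, pos_INR).
      assert (E := eps_INR N HN).
      replace (K * eps N ^ r) with (INR N * (K * (eps N * eps N ^ r)))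
        by (transitivity (K * eps N ^ r * (INR N * eps N)); [ring|rewrite E; ring]).
      apply mul_le_l; auto using pos_INR.
    + apply evt_all; intros N x HN _ _.
      replace (C0 + RtoC (eps N) * (RtoC (INR N) * H N x))%cx
        with (RtoC (INR N * eps N) * H N x)%cx by (rewrite RtoC_mul; ring).
      rewrite eps_INR by auto. change (RtoC 1) with C1. ring.
Qed.

Lemma Xp_epsk r k H : Xp r H -> Xp (r + k) (fun N x => RtoC (eps N ^ k) * H N x)%cx.
Proof.
  induction k; intros HX.
  - rewrite Nat.add_0_r. apply (Xp_ext r H); auto. apply evt_all; intros; simpl.
    change (RtoC 1) with C1; ring.
  - rewrite Nat.add_succ_r.
    apply (Xp_ext _ (fun N x => RtoC (eps N) * (RtoC (eps N ^ k) * H N x))%cx).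
    + apply evt_all; intros; simpl. rewrite RtoC_mul; ring.
    + apply Xp_eps; auto.
Qed.

Lemma Xp_sum r n : forall F : nat -> nat -> X -> Cplx, (forall k, (k < n)%nat -> Xp r (F k)) ->
  Xp r (fun N x => Csum n (fun k => F k N x)).
Proof.
  induction n; intros F HF; simpl.
  - apply (Xp_cf r (fun _ => C0)); auto.
  - apply Xp_add; auto.
Qed.

Lemma Xp_pown r n H : Xp r H -> Xp r (fun N x => Cpown (H N x) n).
Proof.
  intros HX; induction n; simpl; [apply (Xp_cf r (fun _ => C1)); auto|apply Xp_mul; auto].
Qed.

End Expansions.

(** Along t w, the remainder of order r+1 has derivative w times the remainder of order r and
    vanishes at t = 0. Each use of [cder_MVT] costs a factor 2, which explains 2^r. *)
Lemma Cexp_taylor r : forall w,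
  Cnorm (Cexp w - Csum r (fun k => RtoC (/ INR (fact k)) * Cpown w k))%cx
  <= 2 ^ r * Cnorm w ^ r * exp (Cnorm w).
Proof.
  induction r; intros w.
  - simpl. replace (Cexp w - C0)%cx with (Cexp w) by ring. rewrite Cnorm_exp.
    rewrite !Rmult_1_l. destruct (Rle_lt_or_eq_dec _ _ (Rle_trans _ _ _ (Rle_abs _) (Cre_le_norm w))) as [H|H].
    + left; now apply exp_increasing.
    + rewrite H; lra.
  - set (T := fun n v => Csum n (fun k => RtoC (/ INR (fact k)) * Cpown v k)%cx).
    assert (HT : forall n t, cder (fun t => T (S n) (RtoC t * w)%cx) t (w * T n (RtoC t * w))%cx).
    { assert (HP : forall k t, cder (fun t => RtoC (/ INR (fact (S k))) * Cpown (RtoC t * w) (S k))%cx t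
        (w * (RtoC (/ INR (fact k)) * Cpown (RtoC t * w) k))%cx).
      { intros k t.
        assert (HQ : forall k t, cder (fun t => Cpown (RtoC t * w) k) t
          (match k with O => C0 | S j => RtoC (INR k) * Cpown (RtoC t * w) j * w end)%cx).
        { clear k t. induction k; intros t; simpl Cpown.
          - apply cder_const.
          - eapply cder_val.
            + apply cder_mul; [|apply IHk].
              apply cder_mul; [apply cder_id|apply cder_const].
            + destruct k.
              * simpl. change (RtoC 1) with C1. ring.
              * rewrite (S_INR (S k)), RtoC_add. simpl Cpown. change (RtoC 1) with C1. ring. }
        eapply cder_val; [apply cder_scal, HQ|].
        replace (/ INR (fact k)) with (/ INR (fact (S k)) * INR (S k)).
        - rewrite RtoC_mul. ring.
        - rewrite fact_simpl, mult_INR. field. split; apply not_0_INR; [apply fact_neq_0|lia]. }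
      induction n; intros t; unfold T; simpl Csum.
      - eapply cder_val; [apply cder_add; [apply cder_const|apply cder_const]|]. ring.
      - eapply cder_val; [apply cder_add; [apply (IHn t)|apply HP]|]. unfold T. ring. }
    assert (HE : forall t, cder (fun t => Cexp (RtoC t * w) - T (S r) (RtoC t * w))%cx t
       (w * (Cexp (RtoC t * w) - T r (RtoC t * w)))%cx).
    { intros t. eapply cder_val.
      - apply cder_sub; [apply cder_exp, cder_mul; [apply cder_id|apply cder_const]|apply HT].
      - cbv beta. ring. }
    assert (B : Cnorm ((Cexp (RtoC 1 * w) - T (S r) (RtoC 1 * w)) -
       (Cexp (RtoC 0 * w) - T (S r) (RtoC 0 * w)))%cx
       <= 2 * (Cnorm w * (2 ^ r * Cnorm w ^ r * exp (Cnorm w))) * (1 - 0)).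
    { apply (cder_MVT (fun t => Cexp (RtoC t * w) - T (S r) (RtoC t * w))%cx
         (fun t => w * (Cexp (RtoC t * w) - T r (RtoC t * w)))%cx); [lra|auto|].
      intros t Ht. rewrite Cnorm_mul. apply mul_le_l; [apply Cnorm_nonneg|].
      le_via IHr.
      assert (Hw := Cnorm_nonneg w).
      assert (Hn : 0 <= Cnorm (RtoC t * w)%cx <= Cnorm w).
      { split; [apply Cnorm_nonneg|]. rewrite Cnorm_mul, Cnorm_RtoC, Rabs_right by lra. nra. }
      apply Rmult_le_compat.
      - apply mul_pos; [apply pow_le; lra|apply pow_le; lra].
      - left; apply exp_pos.
      - apply mul_le_l; [apply pow_le; lra|apply pow_incr; lra].
      - destruct (Req_dec (Cnorm (RtoC t * w)%cx) (Cnorm w)) as [->|Hne]; [lra|].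
        left; apply exp_increasing; lra. }
    assert (Z : (Cexp (RtoC 0 * w) - T (S r) (RtoC 0 * w))%cx = C0).
    { assert (ZT : forall n, T (S n) (RtoC 0 * w)%cx = C1).
      { induction n.
        - unfold T; simpl. replace (/ 1) with 1 by field. change (RtoC 1) with C1. ring.
        - unfold T in *. simpl Csum in *. rewrite IHn. change (RtoC 0) with C0. ring. }
      rewrite ZT. change (RtoC 0) with C0. replace (C0 * w)%cx with C0 by ring. rewrite Cexp_0; ring. }
    rewrite Z in B. change (RtoC 1) with C1 in B. replace (C1 * w)%cx with w in B by ring.
    replace (Cexp w - T (S r) w - C0)%cx with (Cexp w - T (S r) w)%cx in B by ring.
    le_via B. right. simpl. ring.
Qed.

Section ExpansionExp.
Variable Q : nat -> Prop.
Variable X : Type.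
Variable dom : X -> Prop.
Variable Cf : (X -> Cplx) -> Prop.
Hypothesis Cf_const : forall k, Cf (fun _ => k).
Hypothesis Cf_add : forall f g, Cf f -> Cf g -> Cf (fun x => f x + g x)%cx.
Hypothesis Cf_mul : forall f g, Cf f -> Cf g -> Cf (fun x => f x * g x)%cx.
Hypothesis Cf_exp : forall f, Cf f -> Cf (fun x => Cexp (f x)).
Hypothesis Cf_bdd : forall f, Cf f -> exists K, forall x, dom x -> Cnorm (f x) <= K.

(** With E = h0 + H1/N, exp E is exp h0 times the Taylor polynomial of exp at H1/N, plus a Taylor
    remainder of the required order. *)
Lemma Xp_exp r E : Xp Q X dom Cf r E -> Xp Q X dom Cf r (fun N x => Cexp (E N x)).
Proof.
  destruct r.
  - intros [K HK]. exists (exp K). revert HK; apply evt_imp. intros N x _ _ _ HE.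
    rewrite Cnorm_exp. assert (Cre (E N x) <= K).
    { le_via Rle_abs. eapply Rle_trans; [apply Cre_le_norm|auto]. }
    destruct H as [H|H]; [left; now apply exp_increasing|rewrite H; lra].
  - intros HX. destruct HX as (h0 & H1 & A & B & C).
    apply (Xp_ext _ _ _ _ _ (fun N x => Cexp (h0 x) *
      (Csum (S r) (fun k => RtoC (/ INR (fact k)) * (RtoC (eps N ^ k) * Cpown (H1 N x) k)) +
       (Cexp (RtoC (eps N) * H1 N x) -
        Csum (S r) (fun k => RtoC (/ INR (fact k)) * Cpown (RtoC (eps N) * H1 N x) k))))%cx).
    { revert C; apply evt_imp. intros N x _ _ _ HE. rewrite HE, Cexp_add. f_equal.
      assert (S1 : forall n, Csum n (fun k => RtoC (/ INR (fact k)) * (RtoC (eps N ^ k) * Cpown (H1 N x) k))%cx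
        = Csum n (fun k => RtoC (/ INR (fact k)) * Cpown (RtoC (eps N) * H1 N x) k)%cx).
      { induction n; cbn [Csum]; auto. rewrite IHn. f_equal. f_equal.
        clear. induction n; simpl Cpown; [simpl; change (RtoC 1) with C1; ring|].
        rewrite <- IHn. simpl pow. rewrite RtoC_mul; ring. }
      rewrite S1. ring. }
    apply Xp_scal; auto. apply Xp_add; auto.
    + apply (Xp_sum Q X dom Cf) with (F := fun k N x => (RtoC (/ INR (fact k)) * (RtoC (eps N ^ k) * Cpown (H1 N x) k))%cx); auto.
      intros k Hk. apply (Xp_scal Q X dom Cf) with (k := fun _ => RtoC (/ INR (fact k))); auto.
      destruct k.
      * apply (Xp_ext _ _ _ _ _ (fun _ _ => C1)); [|apply Xp_cf with (h := fun _ => C1); auto].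
        apply evt_all; intros; simpl. change (RtoC 1) with C1; ring.
      (* [H1] is known to one order less than [E]; for a positive power the factor N^-(k+1) makes up
         for the loss. *)
      * apply (Xp_le Q X dom Cf) with (r := (r + S k)%nat); auto; [lia|].
        apply (Xp_epsk Q X dom Cf) with (H := fun N x => Cpown (H1 N x) (S k)); auto.
        apply Xp_pown; auto.
    + destruct (Xp_bdd Q X dom Cf Cf_bdd r H1 B) as [K HK].
      apply (Xp_err Q X dom Cf) with (K := 2 ^ S r * Rabs K ^ S r * exp (Rabs K)); auto.
      revert HK; apply evt_imp. intros N x HN _ _ HE.
      assert (HKK : K <= Rabs K) by apply Rle_abs.
      le_via Cexp_taylor.
      generalize (eps_pos N HN) (eps_le1 N HN) (Cnorm_nonneg (H1 N x)); intros e1 e2 e3.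
      rewrite Cnorm_mul, Cnorm_RtoC, (Rabs_right (eps N)) by lra.
      rewrite Rpow_mult_distr.
      replace (2 ^ S r * Rabs K ^ S r * exp (Rabs K) * eps N ^ S r)
        with (2 ^ S r * (eps N ^ S r * Rabs K ^ S r) * exp (Rabs K)) by ring.
      assert (0 <= 2 ^ S r) by (apply pow_le; lra).
      assert (0 <= eps N ^ S r) by (apply pow_le; lra).
      apply Rmult_le_compat.
      * apply mul_pos; auto. apply mul_pos; auto. apply pow_le; auto.
      * left; apply exp_pos.
      * apply mul_le_l; auto. apply mul_le_l; auto. apply pow_incr; lra.
      * assert (eps N * Cnorm (H1 N x) <= Rabs K) by nra.
        destruct H2 as [H2|H2]; [left; now apply exp_increasing|rewrite H2; lra].
Qed.
End ExpansionExp.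

(** * Bounds, finite sums and Taylor expansions of smooth functions *)

Lemma smooth_bounded D f A B : smooth D f -> A <= B -> (forall x, A <= x <= B -> D x) ->
  exists K, 0 <= K /\ forall x, A <= x <= B -> Rabs (f x) <= K.
Proof.
  intros Hf HAB HD.
  assert (Hc : forall c, A <= c <= B -> continuity_pt (fun x => Rabs (f x)) c).
  { intros c Hc. apply (continuity_pt_comp f Rabs).
    - apply continuity_pt_filterlim, (smooth_cont D); auto.
    - apply Rcontinuity_abs. }
  destruct (continuity_ab_maj _ A B HAB Hc) as [m [H1 H2]].
  exists (Rabs (f m)). split; [apply Rabs_pos|auto].
Qed.

Lemma csm_bounded D f A B : csm D f -> A <= B -> (forall x, A <= x <= B -> D x) ->
  exists K, 0 <= K /\ forall x, A <= x <= B -> Cnorm (f x) <= K.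
Proof.
  intros [H1 H2] HAB HD.
  destruct (smooth_bounded D _ A B H1 HAB HD) as [K1 [a1 b1]].
  destruct (smooth_bounded D _ A B H2 HAB HD) as [K2 [a2 b2]].
  exists (K1 + K2). split; [lra|]. intros x Hx. le_via Cnorm_le_sum.
  specialize (b1 x Hx); specialize (b2 x Hx); lra.
Qed.

Lemma Csum_ext n F G : (forall k, (k < n)%nat -> F k = G k) -> Csum n F = Csum n G.
Proof. induction n; intros H; simpl; auto. rewrite IHn, H; auto. Qed.
Lemma Csum_add n F G : Csum n (fun k => F k + G k)%cx = (Csum n F + Csum n G)%cx.
Proof. induction n; simpl; [ring|]. rewrite IHn; ring. Qed.
Lemma Csum_scal n k F : Csum n (fun i => k * F i)%cx = (k * Csum n F)%cx.
Proof. induction n; simpl; [ring|]. rewrite IHn; ring. Qed.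
Lemma Csum_norm n F K : (forall k, (k < n)%nat -> Cnorm (F k) <= K) -> Cnorm (Csum n F) <= INR n * K.
Proof.
  induction n; intros H.
  - simpl. rewrite Cnorm_0; lra.
  - rewrite S_INR. simpl Csum. le_via Cnorm_triang.
    generalize (IHn (fun k Hk => H k (Nat.lt_lt_succ_r _ _ Hk))) (H n (Nat.lt_succ_diag_r n)). lra.
Qed.
Lemma Csum_swap n m (F : nat -> nat -> Cplx) :
  Csum n (fun i => Csum m (fun j => F i j)) = Csum m (fun j => Csum n (fun i => F i j)).
Proof.
  induction n; simpl.
  - symmetry. clear. induction m; simpl; auto. rewrite IHm; ring.
  - rewrite IHn, <- Csum_add. reflexivity.
Qed.
Lemma Csum_telescope n (F : nat -> Cplx) : Csum n (fun i => F (S i) - F i)%cx = (F n - F 0%nat)%cx.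
Proof. induction n; simpl; [ring|]. rewrite IHn; ring. Qed.
Lemma Csum_S_l n (F : nat -> Cplx) : Csum (S n) F = (F 0%nat + Csum n (fun i => F (S i)))%cx.
Proof. induction n; [simpl; ring|]. cbn [Csum] in *. rewrite IHn; ring. Qed.

Definition cDn (l : nat) (f : R -> Cplx) (x : R) : Cplx :=
  mkC (Derive_n (fun t => Cre (f t)) l x) (Derive_n (fun t => Cim (f t)) l x).

Section Taylor.
Variable D : R -> Prop.
Hypothesis HO : open D.
Hypothesis HP : forall x, 0 <= x -> D x.

Lemma csm_cDn l f : csm D f -> csm D (cDn l f).
Proof. intros [H1 H2]; split; apply smooth_Derive_n; auto. Qed.

Lemma smooth_ex_derive_n f k x : smooth D f -> D x -> ex_derive_n f k x.
Proof.
  intros H Hx. destruct k; simpl; auto.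
  destruct (smooth_Derive_n D f k H 1%nat) as [H1 _]. auto.
Qed.

Lemma rtaylor f n B : smooth D f -> 0 <= B -> exists K, 0 <= K /\ forall y d, 0 <= y -> 0 <= d -> y + d <= B ->
  Rabs (f (y + d) - sum_f_R0 (fun l => d ^ l / INR (fact l) * Derive_n f l y) n) <= K * d ^ S n.
Proof.
  intros Hf HB.
  destruct (smooth_bounded D (Derive_n f (S n)) 0 B) as [K [HK HB']]; auto.
  { apply smooth_Derive_n; auto. }
  { intros x Hx; apply HP; lra. }
  exists K. split; auto. intros y d Hy Hd Hyd.
  destruct (Req_dec d 0) as [->|Hne].
  - replace (sum_f_R0 _ n) with (f y).
    + rewrite Rplus_0_r, Rminus_diag, Rabs_R0. simpl; lra.
    + clear. induction n; cbn [sum_f_R0].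
      * simpl. field.
      * rewrite <- IHn. simpl pow. unfold Rdiv. ring.
  - destruct (Taylor_Lagrange f n y (y + d)) as [z [Hz E]]; [lra| |].
    + intros t Ht k Hk. apply smooth_ex_derive_n; auto. apply HP; lra.
    + replace (y + d - y) with d in E by ring. rewrite E.
      replace (_ + _ - _) with (d ^ S n / INR (fact (S n)) * Derive_n f (S n) z)
        by (unfold Rminus; ring).
      rewrite Rabs_mult, Rmult_comm.
      assert (H1 : 0 <= d ^ S n) by (apply pow_le; lra).
      assert (H2 : 1 <= INR (fact (S n))) by (change 1 with (INR 1); apply le_INR, lt_O_fact).
      apply Rmult_le_compat; auto using Rabs_pos; [apply HB'; lra|].
      rewrite Rabs_right.
      * rewrite <- (Rmult_1_r (d ^ S n)) at 2. apply mul_le_l; auto.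
        rewrite <- Rinv_1. apply inv_le; lra.
      * apply Rle_ge, mul_pos; auto. left; apply inv_pos; lra.
Qed.

Lemma Cre_Csum n F : Cre (Csum (S n) F) = sum_f_R0 (fun i => Cre (F i)) n.
Proof. induction n; [simpl; ring|]. cbn [sum_f_R0]. rewrite <- IHn. reflexivity. Qed.
Lemma Cim_Csum n F : Cim (Csum (S n) F) = sum_f_R0 (fun i => Cim (F i)) n.
Proof. induction n; [simpl; ring|]. cbn [sum_f_R0]. rewrite <- IHn. reflexivity. Qed.

Lemma ctaylor f L B : csm D f -> 0 <= B -> exists K, 0 <= K /\ forall y d, 0 <= y -> 0 <= d -> y + d <= B ->
  Cnorm (f (y + d)%R - Csum L (fun l => RtoC (d ^ l / INR (fact l)) * cDn l f y))%cx <= K * d ^ L.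
Proof.
  intros Hf HB. destruct L.
  - destruct (csm_bounded D f 0 B Hf HB) as [K [HK H]]; [intros; apply HP; lra|].
    exists K. split; auto. intros y d Hy Hd Hyd. simpl.
    replace (f (y + d)%R - C0)%cx with (f (y + d)) by ring. rewrite Rmult_1_r. apply H; lra.
  - destruct Hf as [H1 H2].
    destruct (rtaylor _ L B H1 HB) as [K1 [a1 b1]]. destruct (rtaylor _ L B H2 HB) as [K2 [a2 b2]].
    exists (K1 + K2). split; [lra|]. intros y d Hy Hd Hyd.
    le_via Cnorm_le_sum.
    specialize (b1 y d Hy Hd Hyd). specialize (b2 y d Hy Hd Hyd).
    unfold Csub. cbn [Cre Cim Cadd Copp]. rewrite Cre_Csum, Cim_Csum.
    rewrite Rmult_plus_distr_r. apply Rplus_le_compat.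
    + eapply Rle_trans; [right|exact b1]. f_equal. unfold Rminus. f_equal. f_equal.
      apply sum_eq. intros i _. simpl; ring.
    + eapply Rle_trans; [right|exact b2]. f_equal. unfold Rminus. f_equal. f_equal.
      apply sum_eq. intros i _. simpl; ring.
Qed.
End Taylor.

(** * Euler-Maclaurin sums *)

Section EulerMaclaurin.
Variable D : R -> Prop.
Hypothesis HO : open D.
Hypothesis HS : forall x t, D x -> 0 <= t <= 1 -> D (t * x).
Hypothesis HP : forall x, 0 <= x -> D x.
Variables lo hi : R.
Hypothesis Hlo : 0 < lo.
Hypothesis Hlohi : lo <= hi.
Variable Q : nat -> Prop.
Variable M : nat -> nat.
Variables a b : R.
Hypothesis Ha : 0 <= a <= 1.
Hypothesis Hb : 0 <= b <= 1.
Hypothesis HM : forall N, (1 <= N)%nat -> Q N -> 2 * INR (M N) = INR N + b - a.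

Definition posR (x : R) : Prop := 0 < x.
Definition box (x : R) : Prop := lo <= x <= hi.
Notation XP := (Xp Q R box (csm posR)).

Lemma posR_open : open posR.
Proof. apply open_gt. Qed.
Lemma pos_bdd f : csm posR f -> exists K, forall x, box x -> Cnorm (f x) <= K.
Proof.
  intros H. destruct (csm_bounded posR f lo hi H Hlohi) as [K [_ HK]].
  - intros x Hx; unfold posR; lra.
  - exists K. exact HK.
Qed.
Lemma pos_const k : csm posR (fun _ => k). Proof. apply csm_const, posR_open. Qed.
Lemma pos_add f g : csm posR f -> csm posR g -> csm posR (fun x => f x + g x)%cx.
Proof. apply csm_add, posR_open. Qed.
Lemma pos_mul f g : csm posR f -> csm posR g -> csm posR (fun x => f x * g x)%cx.
Proof. apply csm_mul, posR_open. Qed.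
Lemma pos_exp f : csm posR f -> csm posR (fun x => Cexp (f x)).
Proof. apply csm_exp, posR_open. Qed.
Hint Resolve pos_bdd pos_const pos_add pos_mul pos_exp : cf.

Lemma pos_of_D f : csm D f -> csm posR f.
Proof.
  apply csm_subset. intros x Hx; apply HP; unfold posR in Hx; lra.
Qed.
Lemma pos_RtoC_mono (k : R) l : csm posR (fun x => RtoC (k * x ^ l)).
Proof.
  apply (csm_RtoC posR posR_open (fun x => k * x ^ l)). apply smooth_mult; auto using posR_open, smooth_const.
  apply smooth_pow; auto using posR_open. apply smooth_id, posR_open.
Qed.
Lemma pos_comp_scale (f : R -> Cplx) (al : R) : 0 <= al -> csm D f -> csm posR (fun x => f (al * x)).
Proof.
  intros Hal [H1 H2].
  assert (Hs : smooth posR (fun x => al * x))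
    by (apply smooth_mult; auto using posR_open, smooth_const; apply smooth_id, posR_open).
  assert (Hm : forall x, posR x -> D (al * x)) by (intros x Hx; apply HP; unfold posR in Hx; nra).
  split; [apply (smooth_comp posR D (fun x => Cre (f x)))|apply (smooth_comp posR D (fun x => Cim (f x)))];
  auto using posR_open.
Qed.

(** Taylor expansion of f at al x with increment be x/N. The terms are powers of 1/N with smooth
    coefficients, the remainder is O(N^-r). *)
Lemma XP_shift r f al be : csm D f -> 0 <= al -> 0 <= be ->
  XP r (fun N x => f (al * x + be * x * eps N)).
Proof.
  intros Hf Hal Hbe.
  assert (HB : 0 <= (al + be) * hi) by nra.
  destruct (ctaylor D HP f r _ Hf HB) as [K [HK HT]].
  apply (Xp_ext _ _ _ _ r (fun N x =>
    Csum r (fun l => RtoC (be ^ l / INR (fact l) * x ^ l) * cDn l f (al * x)%R * RtoC (eps N ^ l)) +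
    (f (al * x + be * x * eps N)%R - Csum r (fun l => RtoC ((be * x * eps N) ^ l / INR (fact l)) * cDn l f (al * x)%R)))%cx).
  { apply evt_all. intros N x HN _ Hx.
    rewrite (Csum_ext r _ (fun l => RtoC ((be * x * eps N) ^ l / INR (fact l)) * cDn l f (al * x)%R)%cx).
    - ring.
    - intros k _. replace ((be * x * eps N) ^ k / INR (fact k)) with (be ^ k / INR (fact k) * x ^ k * eps N ^ k)
        by (rewrite !Rpow_mult_distr; unfold Rdiv; ring).
      rewrite (RtoC_mul _ (eps N ^ k)). ring. }
  apply Xp_add; auto with cf.
  - apply (Xp_sum Q R box (csm posR)) with
      (F := fun l N x => (RtoC (be ^ l / INR (fact l) * x ^ l) * cDn l f (al * x)%R * RtoC (eps N ^ l))%cx); auto with cf.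
    intros l Hl.
    apply (Xp_ext _ _ _ _ r (fun N x => RtoC (eps N ^ l) * (RtoC (be ^ l / INR (fact l) * x ^ l) * cDn l f (al * x)%R))%cx).
    + apply evt_all; intros; ring.
    + apply (Xp_le Q R box (csm posR)) with (r := (r + l)%nat); auto with cf; [lia|].
      apply (Xp_epsk Q R box (csm posR)) with (H := fun N x => (RtoC (be ^ l / INR (fact l) * x ^ l) * cDn l f (al * x)%R)%cx); auto with cf.
      apply Xp_cf with (h := fun x => (RtoC (be ^ l / INR (fact l) * x ^ l) * cDn l f (al * x)%R)%cx); auto with cf.
      apply pos_mul; [apply pos_RtoC_mono|]. apply (pos_comp_scale (cDn l f)); auto. apply csm_cDn; auto.
  - apply (Xp_err Q R box (csm posR)) with (K := K * (be * hi) ^ r); auto with cf.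
    apply evt_all. intros N x HN _ [Hx1 Hx2].
    generalize (eps_pos N HN) (eps_le1 N HN); intros e1 e2.
    assert (0 <= be * x) by nra.
    eapply Rle_trans; [apply HT; nra|].
    rewrite (Rpow_mult_distr (be * x)), <- Rmult_assoc. apply mul_le_r; [apply pow_le; lra|].
    apply mul_le_l; auto. apply pow_incr; nra.
Qed.

(** The nodes are (2i - b) x/N for i = 1, ..., M, with step 2x/N. By [HM] the last one is x - a x/N,
    so a and b record the offsets at the two ends. The even factors of (q)_N lead to b = 0, the odd
    ones to b = 1. *)
Definition Sm (f : R -> Cplx) (N : nat) (x : R) : Cplx :=
  Csum (M N) (fun i => f ((2 * INR (S i) - b) * x * eps N)).

Lemma M_le N : (1 <= N)%nat -> Q N -> INR (M N) <= INR N.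
Proof. intros HN HQ. generalize (HM N HN HQ) (le_INR 1 N HN). simpl. lra. Qed.

(** The nodes stay below x, and one further step adds at most 2x; hence the common range 3 [hi] for
    the Taylor estimates. *)
Lemma node_range N x i : (1 <= N)%nat -> Q N -> box x -> (i < M N)%nat ->
  0 <= (2 * INR (S i) - b) * x * eps N /\
  (2 * INR (S i) - b) * x * eps N + 2 * x * eps N <= 3 * hi.
Proof.
  intros HN HQ [Hx1 Hx2] Hi.
  generalize (eps_pos N HN) (eps_le1 N HN) (eps_INR N HN) (HM N HN HQ) (le_INR _ _ Hi) (pos_INR i).
  rewrite S_INR. intros e1 e2 e3 e4 e5 e6.
  assert (0 <= x * eps N) by nra.
  split; [rewrite Rmult_assoc; apply mul_pos; lra|].
  replace (_ + _) with ((2 * INR (S i) - b + 2) * (x * eps N)) by (rewrite S_INR; ring).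
  apply Rle_trans with ((INR N + 2) * (x * eps N)).
  - apply mul_le_r; auto. rewrite S_INR; lra.
  - replace ((INR N + 2) * (x * eps N)) with (x * (INR N * eps N) + 2 * (x * eps N)) by ring.
    nra.
Qed.

(* Taylor expansion of the primitive of f at the nodes, summed over the nodes. *)
Lemma Sm_taylor f L : csm D f -> exists K, 0 <= K /\ forall N x, (1 <= N)%nat -> Q N -> box x ->
  Cnorm (cprim f ((2 - a) * x * eps N + x) - cprim f ((2 - b) * x * eps N)
    - Csum L (fun l => RtoC ((2 * x * eps N) ^ S l / INR (fact (S l))) * Sm (cDn l f) N x))%cx
  <= K * eps N ^ L.
Proof.
  intros Hf. set (G := cprim f).
  assert (HG : csm D G) by (apply csm_cprim; auto).
  assert (HB : 0 <= 3 * hi) by lra.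
  destruct (ctaylor D HP G (S L) (3 * hi) HG HB) as [K [HK HT]].
  exists (K * (2 * hi) ^ S L). split; [apply mul_pos; auto; apply pow_le; lra|].
  intros N x HN HQ Hx.
  set (nd := fun i => (2 * INR (S i) - b) * x * eps N).
  assert (Hn : forall i, nd (S i) = nd i + 2 * x * eps N).
  { intros i; unfold nd. rewrite (S_INR (S i)). ring. }
  assert (E0 : (2 - b) * x * eps N = nd 0%nat) by (unfold nd; simpl; ring).
  assert (E1 : (2 - a) * x * eps N + x = nd (M N)).
  { unfold nd. rewrite S_INR. generalize (HM N HN HQ) (eps_INR N HN). intros e1 e2.
    replace ((2 * (INR (M N) + 1) - b) * x * eps N) with ((2 * INR (M N) + 2 - b) * x * eps N) by ring.
    rewrite e1. transitivity ((2 - a) * x * eps N + x * (INR N * eps N)); [rewrite e2; ring|ring]. }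
  rewrite E0, E1, <- (Csum_telescope (M N) (fun i => G (nd i))).
  assert (ED : forall l y, D y -> cDn (S l) G y = cDn l f y).
  { intros l y Hy. destruct Hf as [f1 f2].
    apply cx_eq; cbn [cDn Cre Cim].
    - replace (S l) with (l + 1)%nat by lia. rewrite <- Derive_n_comp. apply Derive_n_ext_loc.
      apply (filter_imp D); [|apply HO, Hy]. intros u Hu. simpl.
      apply is_derive_unique. apply (cprim_der D HO HS f u (conj f1 f2) Hu).
    - replace (S l) with (l + 1)%nat by lia. rewrite <- Derive_n_comp. apply Derive_n_ext_loc.
      apply (filter_imp D); [|apply HO, Hy]. intros u Hu. simpl.
      apply is_derive_unique. apply (cprim_der D HO HS f u (conj f1 f2) Hu). }
  replace (Csum L (fun l => RtoC ((2 * x * eps N) ^ S l / INR (fact (S l))) * Sm (cDn l f) N x)%cx)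
    with (Csum (M N) (fun i => Csum L (fun l => RtoC ((2 * x * eps N) ^ S l / INR (fact (S l))) * cDn (S l) G (nd i)))%cx).
  2:{ rewrite Csum_swap. apply Csum_ext. intros l _. rewrite Csum_scal. f_equal.
      apply Csum_ext. intros i Hi. apply ED, HP. apply node_range; auto. }
  replace (_ - _)%cx with (Csum (M N) (fun i => (G (nd (S i)) - G (nd i)) -
     Csum L (fun l => RtoC ((2 * x * eps N) ^ S l / INR (fact (S l))) * cDn (S l) G (nd i))))%cx.
  2:{ transitivity (Csum (M N) (fun i => (G (nd (S i)) - G (nd i)) + - C1 *
     Csum L (fun l => RtoC ((2 * x * eps N) ^ S l / INR (fact (S l))) * cDn (S l) G (nd i))))%cx.
      - apply Csum_ext; intros; ring.
      - rewrite Csum_add, Csum_scal. ring. }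
  generalize (eps_pos N HN) (eps_INR N HN); intros e1 e2.
  assert (B : Cnorm (Csum (M N) (fun i => (G (nd (S i)) - G (nd i)) -
     Csum L (fun l => RtoC ((2 * x * eps N) ^ S l / INR (fact (S l))) * cDn (S l) G (nd i))))%cx
     <= INR (M N) * (K * (2 * hi * eps N) ^ S L)).
  { apply Csum_norm. intros i Hi. destruct (node_range N x i HN HQ Hx Hi) as [r1 r2].
    destruct Hx as [Hx1 Hx2].
    rewrite Hn. eapply Rle_trans; [|eapply Rle_trans; [apply (HT (nd i) (2 * x * eps N)); auto; nra|]].
    - right. f_equal. rewrite Csum_S_l. simpl pow. simpl INR.
      replace (1 / 1) with 1 by field. change (RtoC 1) with C1.
      change (cDn 0 G (nd i)) with (mkC (Cre (G (nd i))) (Cim (G (nd i)))).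
      replace (mkC (Cre (G (nd i))) (Cim (G (nd i)))) with (G (nd i)) by (apply cx_eq; reflexivity).
      ring.
    - apply mul_le_l; auto. apply pow_incr. split; [nra|].
      apply mul_le_r; lra. }
  le_via B.
  apply Rle_trans with (INR N * (K * (2 * hi * eps N) ^ S L)).
  - apply mul_le_r; [apply mul_pos; auto; apply pow_le; nra|]. apply M_le; auto.
  - right. rewrite (Rpow_mult_distr (2 * hi) (eps N)). simpl (eps N ^ S L).
    transitivity (K * (2 * hi) ^ S L * eps N ^ L * (INR N * eps N)); [ring|rewrite e2; ring].
Qed.

Lemma Sm_bdd f : csm D f -> exists K, 0 <= K /\ forall N x, (1 <= N)%nat -> Q N -> box x ->
  Cnorm (RtoC (eps N) * Sm f N x)%cx <= K.
Proof.
  intros Hf. destruct (csm_bounded D f 0 (3 * hi) Hf) as [K [HK HB]]; [lra|intros; apply HP; lra|].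
  exists K. split; auto. intros N x HN HQ Hx. rewrite Cnorm_mul, Cnorm_RtoC.
  generalize (eps_pos N HN) (eps_INR N HN); intros e1 e2. rewrite Rabs_right by lra.
  assert (Cnorm (Sm f N x) <= INR (M N) * K).
  { apply Csum_norm. intros i Hi. destruct (node_range N x i HN HQ Hx Hi) as [r1 r2].
    apply HB. destruct Hx. nra. }
  generalize (M_le N HN HQ); intros.
  apply Rle_trans with (eps N * (INR N * K)).
  - apply mul_le_l; [lra|]. le_via H. apply mul_le_r; auto.
  - right. transitivity (K * (INR N * eps N)); [ring|rewrite e2; ring].
Qed.

(** [Sm_taylor] is solved for its first term (2x/N) [Sm f]. The boundary values of the primitive
    expand by [XP_shift]. The remaining sums involve derivatives of f and carry additional powers of
    1/N, so the induction hypothesis at the lower order applies to them. *)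
Lemma euler_maclaurin r : forall f, csm D f -> XP r (fun N x => RtoC (eps N) * Sm f N x)%cx.
Proof.
  induction r; intros f Hf.
  - destruct (Sm_bdd f Hf) as [K [_ HK]]. exists K. apply evt_all; auto.
  - destruct (Sm_taylor f (S r) Hf) as [K [HK HT]].
    set (rem := fun N x => (cprim f ((2 - a) * x * eps N + x) - cprim f ((2 - b) * x * eps N)
      - Csum (S r) (fun l => RtoC ((2 * x * eps N) ^ S l / INR (fact (S l))) * Sm (cDn l f) N x))%cx).
    assert (Hix : csm posR (fun x => RtoC (/ (2 * x)))).
    { apply (csm_RtoC posR posR_open (fun x => / (2 * x))). apply smooth_inv; auto using posR_open.
      - apply smooth_mult; auto using posR_open, smooth_const; apply smooth_id, posR_open.
      - unfold posR; intros; lra. }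
    apply (Xp_ext _ _ _ _ (S r) (fun N x =>
      RtoC (/ (2 * x)) * (cprim f (1 * x + (2 - a) * x * eps N) - cprim f (0 * x + (2 - b) * x * eps N) - rem N x)
      - Csum r (fun l => RtoC (2 ^ S l / INR (fact (S (S l))) * x ^ S l) * (RtoC (eps N ^ S l) * (RtoC (eps N) * Sm (cDn (S l) f) N x))))%cx).
    { apply evt_all. intros N x HN HQ [Hx1 Hx2]. unfold rem. rewrite Csum_S_l.
      replace (1 * x + (2 - a) * x * eps N) with ((2 - a) * x * eps N + x) by ring.
      replace (0 * x + (2 - b) * x * eps N) with ((2 - b) * x * eps N) by ring.
      replace (Csum r (fun l => RtoC (2 ^ S l / INR (fact (S (S l))) * x ^ S l) * (RtoC (eps N ^ S l) * (RtoC (eps N) * Sm (cDn (S l) f) N x))))%cx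
        with (RtoC (/ (2 * x)) * Csum r (fun i => RtoC ((2 * x * eps N) ^ S (S i) / INR (fact (S (S i)))) * Sm (cDn (S i) f) N x))%cx.
      2:{ rewrite <- Csum_scal. apply Csum_ext. intros l _.
          transitivity (RtoC (/ (2 * x) * ((2 * x * eps N) ^ S (S l) / INR (fact (S (S l))))) * Sm (cDn (S l) f) N x)%cx.
          - rewrite RtoC_mul; ring.
          - replace (/ (2 * x) * ((2 * x * eps N) ^ S (S l) / INR (fact (S (S l)))))
              with (2 ^ S l / INR (fact (S (S l))) * x ^ S l * (eps N ^ S l * eps N)).
            + rewrite !RtoC_mul. ring.
            + rewrite !Rpow_mult_distr. simpl pow. field. split; [apply INR_fact_neq_0|lra]. }
      assert (E : Sm (cDn 0 f) N x = Sm f N x).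
      { apply Csum_ext. intros i _. apply cx_eq; reflexivity. }
      rewrite E.
      assert (E2 : (RtoC (/ (2 * x)) * RtoC ((2 * x * eps N) ^ 1 / INR (fact 1)))%cx = RtoC (eps N)).
      { rewrite <- RtoC_mul. f_equal. simpl. field. lra. }
      rewrite <- E2. ring. }
    apply Xp_sub; auto with cf.
    + apply (Xp_scal Q R box (csm posR)) with (k := fun x => RtoC (/ (2 * x))); auto with cf.
      apply Xp_sub; auto with cf; [apply Xp_sub; auto with cf|].
      * apply XP_shift; try lra. apply csm_cprim; auto.
      * apply XP_shift; try lra. apply csm_cprim; auto.
      * apply (Xp_err Q R box (csm posR)) with (K := K); auto with cf. apply evt_all. auto.
    + apply (Xp_sum Q R box (csm posR)) with (F := fun l N x =>
       (RtoC (2 ^ S l / INR (fact (S (S l))) * x ^ S l) * (RtoC (eps N ^ S l) * (RtoC (eps N) * Sm (cDn (S l) f) N x)))%cx); auto with cf.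
      intros l Hl. apply (Xp_scal Q R box (csm posR)) with (k := fun x => RtoC (2 ^ S l / INR (fact (S (S l))) * x ^ S l)); auto with cf.
      { apply pos_RtoC_mono. }
      apply (Xp_le Q R box (csm posR)) with (r := (r + S l)%nat); auto with cf; [lia|].
      apply (Xp_epsk Q R box (csm posR)) with (H := fun N x => (RtoC (eps N) * Sm (cDn (S l) f) N x)%cx); auto with cf.
      apply IHr. apply csm_cDn; auto.
Qed.

Lemma cprim_taylor f : csm D f -> exists K, 0 <= K /\ forall y d, 0 <= y -> 0 <= d -> y + d <= 3 * hi ->
  Cnorm (cprim f (y + d) - (cprim f y + RtoC d * f y))%cx <= K * d ^ 2.
Proof.
  intros Hf. destruct (ctaylor D HP (cprim f) 2 (3 * hi)) as [K [HK HT]]; [apply csm_cprim; auto|lra|].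
  exists K. split; auto. intros y d Hy Hd Hyd.
  eapply Rle_trans; [right|apply (HT y d); auto]. f_equal. f_equal. cbn [Csum].
  assert (E0 : cDn 0 (cprim f) y = cprim f y) by (apply cx_eq; reflexivity).
  assert (E1 : cDn 1 (cprim f) y = f y).
  { change (cDn 1 (cprim f) y) with (cD (cprim f) y).
    apply cD_unique. apply (cprim_der D HO HS); auto. }
  rewrite E0, E1. simpl. replace (1 / 1) with 1 by field. replace (d * 1 / 1) with d by field.
  change (RtoC 1) with C1. ring.
Qed.

(** The term of order N and the constant term are made explicit. [Sm_taylor] for f with two terms
    contains the sum of f' over the nodes; the same lemma for f' with one term evaluates that sum as
    f(x) - f(0), up to the factor 2x/N and O(1/N). Combining the two turns the offsets 2 - a and 2 -
    b into 1 - a and 1 - b. *)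
Lemma em_second_order f : csm D f -> exists K, 0 <= K /\ forall N x, (1 <= N)%nat -> Q N -> box x ->
  Cnorm (Sm f N x - RtoC (INR N) * (RtoC (/ (2 * x)) * cprim f x)
    - (RtoC ((1 - a) / 2) * f x - RtoC ((1 - b) / 2) * f 0%R))%cx <= K * eps N.
Proof.
  intros Hf.
  assert (Hf1 : csm D (cDn 1 f)) by (apply csm_cDn; auto).
  destruct (Sm_taylor f 2 Hf) as [K1 [HK1 T1]].
  destruct (Sm_taylor (cDn 1 f) 1 Hf1) as [K2 [HK2 T2]].
  destruct (cprim_taylor f Hf) as [K3 [HK3 T3]].
  destruct (ctaylor D HP f 1 (3 * hi) Hf) as [K4 [HK4 T4]]; [lra|].
  exists (/ (2 * lo) * (K1 + K3 * (2 * hi) ^ 2 + K3 * (2 * hi) ^ 2 + hi * (K2 + K4 * (2 * hi) + K4 * (2 * hi)))).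
  split.
  { assert (0 < / (2 * lo)) by (apply inv_pos; lra).
    apply mul_pos; [lra|]. nra. }
  intros N x HN HQ Hx.
  generalize (eps_pos N HN) (eps_le1 N HN) (eps_INR N HN); intros e1 e2 e3.
  specialize (T1 N x HN HQ Hx). specialize (T2 N x HN HQ Hx). destruct Hx as [Hx1 Hx2].
  (* The primitive of f' is known in closed form, so the identity [T2] becomes a statement about
     values of f. *)
  assert (F : forall y, D y -> cprim (cDn 1 f) y = (f y - f 0%R)%cx).
  { intros y Hy. rewrite (chadamard D HS f y Hf Hy).
    change (cprim (cDn 1 f) y) with (RtoC y * chav (cD f) y)%cx. ring. }
  assert (Q1 : 0 <= (2 - a) * x * eps N) by (apply mul_pos; [apply mul_pos|]; lra).
  assert (Q2 : 0 <= (2 - b) * x * eps N) by (apply mul_pos; [apply mul_pos|]; lra).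
  rewrite !F in T2 by (apply HP; lra). cbn [Csum] in T1, T2.
  set (d1 := (2 - a) * x * eps N) in *. set (d2 := (2 - b) * x * eps N) in *.
  assert (R1 : 0 <= d1 <= 2 * hi * eps N).
  { split; [exact Q1|]. apply mul_le_r; nra. }
  assert (R2 : 0 <= d2 <= 2 * hi * eps N).
  { split; [exact Q2|]. apply mul_le_r; nra. }
  assert (U1 := T3 x d1). assert (U2 := T3 0 d2). assert (V1 := T4 x d1). assert (V2 := T4 0 d2).
  specialize (U1 ltac:(lra) ltac:(lra) ltac:(nra)). specialize (U2 ltac:(lra) ltac:(lra) ltac:(nra)).
  specialize (V1 ltac:(lra) ltac:(lra) ltac:(nra)). specialize (V2 ltac:(lra) ltac:(lra) ltac:(nra)).
  rewrite Rplus_0_l in U2, V2. rewrite (Rplus_comm x) in U1, V1.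
  rewrite cprim_0 in U2. cbn [Csum] in V1, V2.
  assert (Z : forall y, cDn 0 f y = f y) by (intros; apply cx_eq; reflexivity).
  rewrite Z in *.
  assert (S0 : Sm (cDn 0 f) N x = Sm f N x).
  { apply Csum_ext. intros i _. apply Z. }
  rewrite S0 in T1.
  assert (S1 : Sm (cDn 0 (cDn 1 f)) N x = Sm (cDn 1 f) N x).
  { apply Csum_ext. intros i _. apply cx_eq; reflexivity. }
  rewrite S1 in T2.
  set (Sf := Sm f N x) in *.
  set (A1 := (cprim f (d1 + x) - cprim f d2 - _)%cx) in T1.
  set (A2 := (f (d1 + x)%R - f 0%R - (f d2 - f 0%R) - _)%cx) in T2.
  set (B1 := (cprim f (d1 + x) - _)%cx) in U1. set (B2 := (cprim f d2 - _)%cx) in U2.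
  set (W1 := (f (d1 + x)%R - _)%cx) in V1. set (W2 := (f d2 - _)%cx) in V2.
  assert (HI : (RtoC (2 * x * eps N) * RtoC (/ (2 * x)) * RtoC (INR N) = C1)%cx).
  { rewrite <- !RtoC_mul. unfold C1. f_equal. transitivity (INR N * eps N); [field; lra|auto]. }
  assert (E : (Sf - RtoC (INR N) * (RtoC (/ (2 * x)) * cprim f x)
    - (RtoC ((1 - a) / 2) * f x - RtoC ((1 - b) / 2) * f 0%R) =
    RtoC (/ (2 * x)) * RtoC (INR N) * (B1 - B2 - A1 + RtoC (x * eps N) * (A2 - W1 + W2)))%cx).
  { unfold A1, A2, B1, B2, W1, W2. simpl pow. simpl INR. unfold d1, d2.
    transitivity ((RtoC (2 * x * eps N) * RtoC (/ (2 * x)) * RtoC (INR N)) * (Sf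
        - (RtoC ((1 - a) / 2) * f x - RtoC ((1 - b) / 2) * f 0%R)) - RtoC (INR N) * (RtoC (/ (2 * x)) * cprim f x))%cx.
    { rewrite HI. ring. }
    replace (1 / 1) with 1 by field.
    replace (2 * x * eps N * 1 / 1) with (2 * x * eps N) by field.
    replace (2 * x * eps N * (2 * x * eps N * 1) / (1 + 1)) with (x * eps N * (2 * x * eps N)) by field.
    replace ((1 - a) / 2) with (/2 - a * / 2) by field. replace ((1 - b) / 2) with (/2 - b * / 2) by field.
    rewrite !RtoC_sub, !RtoC_mul, !RtoC_sub, ?RtoC_mul. change (RtoC 1) with C1. change (RtoC 0) with C0.
    replace (RtoC 2) with (C1 + C1)%cx in * by (apply cx_eq; simpl; ring).
    assert (H3 : (RtoC (/ 2) = / (C1 + C1))%cx).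
    { replace (C1 + C1)%cx with (RtoC 2) by (apply cx_eq; simpl; ring). apply RtoC_inv; lra. }
    rewrite H3. field. intros Hc; apply (f_equal Cre) in Hc; simpl in Hc; lra. }
  rewrite E. rewrite !Cnorm_mul, !Cnorm_RtoC.
  assert (Hl : 0 < / (2 * lo)) by (apply inv_pos; lra).
  assert (Hxl : 0 < / (2 * x) <= / (2 * lo)).
  { split; [apply inv_pos; lra|apply inv_le; lra]. }
  rewrite (Rabs_right (/ (2 * x))) by lra. rewrite (Rabs_right (INR N)) by (apply Rle_ge, pos_INR).
  assert (NB : Cnorm (B1 - B2 - A1 + RtoC (x * eps N) * (A2 - W1 + W2))%cx <=
    (K1 + K3 * (2 * hi) ^ 2 + K3 * (2 * hi) ^ 2 + hi * (K2 + K4 * (2 * hi) + K4 * (2 * hi))) * (eps N * eps N)).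
  { le_via Cnorm_triang. rewrite Cnorm_mul, Cnorm_RtoC, (Rabs_right (x * eps N)) by nra.
    assert (P1 : Cnorm (B1 - B2 - A1)%cx <= K3 * d1 ^ 2 + K3 * d2 ^ 2 + K1 * eps N ^ 2).
    { le_via Cnorm_sub_le. generalize (Cnorm_sub_le B1 B2). lra. }
    assert (P2 : Cnorm (A2 - W1 + W2)%cx <= K2 * eps N ^ 1 + K4 * d1 ^ 1 + K4 * d2 ^ 1).
    { le_via Cnorm_triang. generalize (Cnorm_sub_le A2 W1). lra. }
    assert (d1 ^ 2 <= (2 * hi * eps N) ^ 2) by (apply pow_incr; lra).
    assert (d2 ^ 2 <= (2 * hi * eps N) ^ 2) by (apply pow_incr; lra).
    assert (P3 : Cnorm (A2 - W1 + W2)%cx <= (K2 + K4 * (2 * hi) + K4 * (2 * hi)) * eps N) by nra.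
    assert (P4 : x * eps N * Cnorm (A2 - W1 + W2)%cx <= hi * eps N * ((K2 + K4 * (2 * hi) + K4 * (2 * hi)) * eps N)).
    { apply Rmult_le_compat; auto using Cnorm_nonneg; nra. }
    assert (P5 : Cnorm (B1 - B2 - A1)%cx <= K3 * (2 * hi * eps N) ^ 2 + K3 * (2 * hi * eps N) ^ 2 + K1 * eps N ^ 2) by nra.
    nra. }
  set (KK := K1 + _ + _ + _) in *.
  apply Rle_trans with (/ (2 * lo) * INR N * (KK * (eps N * eps N))).
  - apply Rmult_le_compat; auto using Cnorm_nonneg.
    + apply mul_pos; [lra|apply pos_INR].
    + apply mul_le_r; [apply pos_INR|lra].
  - right. transitivity (/ (2 * lo) * KK * eps N * (INR N * eps N)); [ring|rewrite e3; ring].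
Qed.

Hypothesis HQinf : forall n, exists N, (n <= N)%nat /\ Q N.

(** The uniqueness principle behind every identification of a leading coefficient: a constant that
    is O(1/N) along an infinite set of N vanishes. *)
Lemma eps_limit_eq (z : Cplx) (K : R) (n : nat) :
  (forall N, (n <= N)%nat -> Q N -> Cnorm z <= K * eps N) -> z = C0.
Proof.
  intros H. apply Cnorm_eq0. destruct (Cnorm_nonneg z) as [Hz|Hz]; auto. exfalso.
  assert (HK : 0 < Rabs K + 1) by (generalize (Rabs_pos K); lra).
  destruct (eps_small (Cnorm z / (Rabs K + 1))) as [N0 [HN0 HE]].
  { apply Rdiv_lt_0_compat; auto. }
  destruct (HQinf (n + N0)) as [N [HN HQN]].
  specialize (H N ltac:(lia) HQN). specialize (HE N ltac:(lia)).
  assert (e := eps_pos N ltac:(lia)).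
  assert (eps N * (Rabs K + 1) < Cnorm z).
  { apply (Rmult_lt_compat_r (Rabs K + 1)) in HE; auto. unfold Rdiv in HE.
    rewrite Rmult_assoc, Rinv_l in HE by lra. lra. }
  assert (K <= Rabs K) by apply Rle_abs. nra.
Qed.

(** The leading coefficient [h0] of [Sm f]/N is identified with 1/(2x) times the primitive of f by
    comparison with [em_second_order]. Subtracting N times it leaves exactly the remainder [H1],
    which has an expansion. This form can be placed in an exponential. *)
Lemma em_exponent r f : csm D f ->
  XP r (fun N x => Sm f N x - RtoC (INR N) * (RtoC (/ (2 * x)) * cprim f x))%cx.
Proof.
  intros Hf. destruct (euler_maclaurin (S r) f Hf) as (h0 & H1 & A & B & C).
  apply (Xp_ext _ _ _ _ r H1); auto.
  destruct (em_second_order f Hf) as [K [HK HT]].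
  destruct (csm_bounded D f 0 hi Hf) as [K0 [HK0 HB0]]; [lra|intros; apply HP; lra|].
  destruct (Xp_bdd Q R box (csm posR) pos_bdd r H1 B) as [K1 [n1 [Hn1 HB1]]].
  destruct C as [n2 [Hn2 HC]].
  assert (E : forall x, box x -> h0 x = (RtoC (/ (2 * x)) * cprim f x)%cx).
  { intros x Hx.
    cut ((h0 x - RtoC (/ (2 * x)) * cprim f x)%cx = C0).
    { intros E. replace (h0 x) with (h0 x - RtoC (/ (2 * x)) * cprim f x + RtoC (/ (2 * x)) * cprim f x)%cx by ring.
      rewrite E; ring. }
    apply (eps_limit_eq _ (K + K0 + K0 + K1) (n1 + n2)). intros N HN HQN.
    specialize (HT N x ltac:(lia) HQN Hx). specialize (HB1 N ltac:(lia) HQN x Hx). specialize (HC N ltac:(lia) HQN x Hx).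
    generalize (eps_pos N ltac:(lia)) (eps_le1 N ltac:(lia)) (eps_INR N ltac:(lia)); intros e1 e2 e3.
    assert (e4 : (RtoC (eps N) * RtoC (INR N) = C1)%cx) by (rewrite <- RtoC_mul; unfold C1; f_equal; lra).
    replace (h0 x - RtoC (/ (2 * x)) * cprim f x)%cx with
      (RtoC (eps N) * ((Sm f N x - RtoC (INR N) * (RtoC (/ (2 * x)) * cprim f x)
         - (RtoC ((1 - a) / 2) * f x - RtoC ((1 - b) / 2) * f 0%R))
         + (RtoC ((1 - a) / 2) * f x - RtoC ((1 - b) / 2) * f 0%R) - H1 N x))%cx.
    2:{ transitivity ((RtoC (eps N) * Sm f N x - (RtoC (eps N) * RtoC (INR N)) * (RtoC (/ (2 * x)) * cprim f x)) - RtoC (eps N) * H1 N x)%cx; [ring|].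
        rewrite e4, HC. ring. }
    rewrite Cnorm_mul, Cnorm_RtoC, Rabs_right by lra. rewrite Rmult_comm.
    apply mul_le_r; [lra|].
    le_via Cnorm_sub_le. apply Rplus_le_compat; auto.
    le_via Cnorm_triang. apply Rplus_le_compat; [nra|].
    le_via Cnorm_sub_le. rewrite !Cnorm_mul, !Cnorm_RtoC.
    destruct Hx as [x1 x2].
    assert (b1 := HB0 x ltac:(lra)). assert (b2 := HB0 0 ltac:(lra)).
    rewrite !Rabs_right by lra. intros. nra. }
  exists n2. split; auto. intros N HN HQN x Hx. specialize (HC N HN HQN x Hx).
  rewrite E in HC by auto.
  assert (e4 : (RtoC (eps N) * RtoC (INR N) = C1)%cx).
  { rewrite <- RtoC_mul; unfold C1; f_equal. generalize (eps_INR N ltac:(lia)); lra. }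
  transitivity (RtoC (INR N) * (RtoC (eps N) * H1 N x))%cx.
  - transitivity ((RtoC (eps N) * RtoC (INR N)) * H1 N x)%cx; [rewrite e4; ring|ring].
  - replace (RtoC (eps N) * H1 N x)%cx with (RtoC (eps N) * Sm f N x - RtoC (/ (2 * x)) * cprim f x)%cx by (rewrite HC; ring).
    transitivity ((RtoC (eps N) * RtoC (INR N)) * Sm f N x - RtoC (INR N) * (RtoC (/ (2 * x)) * cprim f x))%cx; [ring|rewrite e4; ring].
Qed.
End EulerMaclaurin.

(** * Exponentially small and polynomially bounded sequences *)

Lemma exp_le a b : a <= b -> exp a <= exp b.
Proof. intros [H|H]; [left; now apply exp_increasing|rewrite H; lra]. Qed.

Lemma exp_pow_nat x n : exp x ^ n = exp (INR n * x).
Proof.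
  induction n; [simpl; rewrite Rmult_0_l, exp_0; auto|].
  rewrite S_INR. simpl pow. rewrite IHn, <- exp_plus. f_equal; ring.
Qed.

Lemma exp_neg_pow c k : 0 < c -> exists K, 0 < K /\ forall N, (1 <= N)%nat -> exp (- c * INR N) * INR N ^ k <= K.
Proof.
  intros Hc. destruct k.
  - exists 1. split; [lra|]. intros N HN. simpl. rewrite Rmult_1_r, <- exp_0. apply exp_le.
    generalize (pos_INR N). nra.
  - exists ((INR (S k) / c) ^ S k).
    assert (Hk : 0 < INR (S k)) by (apply lt_0_INR; lia).
    split; [apply pow_lt, Rdiv_lt_0_compat; auto|].
    intros N HN. assert (HN' : 0 < INR N) by (apply lt_0_INR; lia).
    set (y := c / INR (S k) * INR N).
    assert (Hy : 0 < y) by (apply mul_lt_pos; auto; apply Rdiv_lt_0_compat; auto).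
    assert (E : exp (- c * INR N) = exp (- y) ^ S k).
    { rewrite exp_pow_nat. f_equal. unfold y. field. lra. }
    rewrite E, <- Rpow_mult_distr. apply pow_incr. split.
    + apply mul_pos; [left; apply exp_pos|lra].
    + rewrite exp_Ropp. assert (H1 := exp_ineq1 y ltac:(lra)).
      apply Rle_trans with (/ y * INR N).
      * apply mul_le_r; [lra|]. apply inv_le; lra.
      * right. unfold y. field. repeat split; lra.
Qed.

Definition ES (a : nat -> Cplx) : Prop :=
  exists K c, 0 < c /\ forall N, (1 <= N)%nat -> Cnorm (a N) <= K * exp (- c * INR N).
Definition PB (b : nat -> Cplx) : Prop :=
  exists K k, forall N, (1 <= N)%nat -> Cnorm (b N) <= K * INR N ^ k.

Lemma ES_mul_PB a b : ES a -> PB b -> ES (fun N => a N * b N)%cx.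
Proof.
  intros (K & c & Hc & Ha) (K' & k & Hb).
  destruct (exp_neg_pow (c / 2) k) as [K2 [HK2 HE]]; [lra|].
  exists (Rabs K * Rabs K' * K2), (c / 2). split; [lra|]. intros N HN.
  specialize (Ha N HN). specialize (Hb N HN). specialize (HE N HN).
  rewrite Cnorm_mul.
  assert (HN' : 0 <= INR N ^ k) by (apply pow_le, pos_INR).
  assert (p1 := exp_pos (- c * INR N)). assert (p2 := exp_pos (- (c/2) * INR N)).
  apply Rle_trans with ((Rabs K * exp (- c * INR N)) * (Rabs K' * INR N ^ k)).
  - apply Rmult_le_compat; auto using Cnorm_nonneg.
    + le_via Ha. apply mul_le_r; [lra|apply Rle_abs].
    + le_via Hb. apply mul_le_r; [lra|apply Rle_abs].
  - replace (- c * INR N) with (- (c/2) * INR N + - (c/2) * INR N) by field. rewrite exp_plus.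
    set (e := exp (- (c/2) * INR N)) in *.
    replace (Rabs K * (e * e) * (Rabs K' * INR N ^ k)) with (Rabs K * Rabs K' * e * (e * INR N ^ k)) by ring.
    replace (Rabs K * Rabs K' * K2 * e) with (Rabs K * Rabs K' * e * K2) by ring.
    apply mul_le_l; auto. generalize (Rabs_pos K) (Rabs_pos K'). intros.
    apply mul_pos; [apply mul_pos|]; lra.
Qed.
Lemma ES_add a b : ES a -> ES b -> ES (fun N => a N + b N)%cx.
Proof.
  intros (K & c & Hc & Ha) (K' & c' & Hc' & Hb).
  exists (Rabs K + Rabs K'), (Rmin c c'). split; [apply Rmin_pos; auto|]. intros N HN.
  le_via Cnorm_triang. specialize (Ha N HN); specialize (Hb N HN).
  assert (HN' := pos_INR N).
  assert (E1 : exp (- c * INR N) <= exp (- Rmin c c' * INR N))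
    by (apply exp_le; generalize (Rmin_l c c'); nra).
  assert (E2 : exp (- c' * INR N) <= exp (- Rmin c c' * INR N))
    by (apply exp_le; generalize (Rmin_r c c'); nra).
  generalize (exp_pos (- c * INR N)) (exp_pos (- c' * INR N)) (Rle_abs K) (Rle_abs K') (Rabs_pos K) (Rabs_pos K').
  intros. nra.
Qed.
Lemma PB_const k : PB (fun _ => k).
Proof. exists (Cnorm k), 0%nat. intros; simpl; lra. Qed.
Lemma ES_scal k a : ES a -> ES (fun N => k * a N)%cx.
Proof.
  intros H. destruct (ES_mul_PB a (fun _ => k) H (PB_const k)) as (K & c & Hc & HH).
  exists K, c. split; auto. intros N HN. eapply Rle_trans; [right|apply (HH N HN)]. f_equal; ring.
Qed.
Lemma ES_eps a r : ES a -> exists K, forall N, (1 <= N)%nat -> Cnorm (a N) <= K * eps N ^ r.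
Proof.
  intros (K & c & Hc & Ha). destruct (exp_neg_pow c r Hc) as [K2 [HK2 HE]].
  exists (Rabs K * K2). intros N HN. eapply Rle_trans; [apply Ha; auto|].
  assert (E : INR N ^ r * eps N ^ r = 1) by (rewrite <- Rpow_mult_distr, eps_INR, pow1; auto).
  assert (e0 : 0 <= eps N ^ r) by (apply pow_le; left; apply eps_pos; auto).
  apply Rle_trans with (Rabs K * exp (- c * INR N)).
  - apply mul_le_r; [left; apply exp_pos|apply Rle_abs].
  - rewrite Rmult_assoc. apply mul_le_l; [apply Rabs_pos|].
    replace (exp (- c * INR N)) with (exp (- c * INR N) * INR N ^ r * eps N ^ r) by (rewrite Rmult_assoc, E; ring).
    apply mul_le_r; auto.
Qed.

(** Expansions of sequences are expansions over a one-point space, so the calculus of [Xp] carries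
    over. *)
Definition Sq (Q : nat -> Prop) (r : nat) (a : nat -> Cplx) : Prop :=
  Xp Q unit (fun _ => True) (fun _ => True) r (fun N _ => a N).

Lemma unit_bdd (f : unit -> Cplx) : True -> exists K, forall x, True -> Cnorm (f x) <= K.
Proof. intros _; exists (Cnorm (f tt)). intros [] _; lra. Qed.

Lemma Sq_err Q r a K : (forall N, (1 <= N)%nat -> Q N -> Cnorm (a N) <= K * eps N ^ r) -> Sq Q r a.
Proof. intros H. apply (Xp_err Q unit) with (K := K); auto. apply evt_all; auto. Qed.
Lemma Sq_ES Q r a : ES a -> Sq Q r a.
Proof. intros H. destruct (ES_eps a r H) as [K HK]. apply Sq_err with K; auto. Qed.
Lemma Sq_const Q r k : Sq Q r (fun _ => k).
Proof. apply (Xp_cf Q unit) with (h := fun _ => k); auto using unit_bdd. Qed.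
Lemma Sq_add Q r a b : Sq Q r a -> Sq Q r b -> Sq Q r (fun N => a N + b N)%cx.
Proof. apply (Xp_add Q unit); auto. Qed.
Lemma Sq_mul Q r a b : Sq Q r a -> Sq Q r b -> Sq Q r (fun N => a N * b N)%cx.
Proof. apply (Xp_mul Q unit); auto using unit_bdd. Qed.
Lemma Sq_opp Q r a : Sq Q r a -> Sq Q r (fun N => - a N)%cx.
Proof. intros H. apply (Xp_opp Q unit) with (H := fun N _ => a N); auto using unit_bdd. Qed.
Lemma Sq_ext Q r a b : (exists N0, (1 <= N0)%nat /\ forall N, (N0 <= N)%nat -> Q N -> a N = b N) -> Sq Q r a -> Sq Q r b.
Proof. intros [N0 [H0 H]]. apply (Xp_ext Q unit). exists N0; split; auto. Qed.

(** * Laplace's method *)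

Definition itv (e x : R) : Prop := - e < x < e.
Lemma itv_open e : open (itv e).
Proof. apply open_and; [apply open_gt|apply open_lt]. Qed.
Lemma itv_star e x t : itv e x -> 0 <= t <= 1 -> itv e (t * x).
Proof. unfold itv; intros [H1 H2] [H3 H4]; split; nra. Qed.

(* Only ratios to this Gaussian integral are ever expanded, so its value is not needed. *)
Definition Gam (N : nat) : R := RInt (fun x => exp (- (INR N / 2) * (x * x))) (-1) 1.

Lemma Gam_integrand_der N x : is_derive (fun x => exp (- (INR N / 2) * (x * x))) x
  (exp (- (INR N / 2) * (x * x)) * (- (INR N / 2) * (2 * x))).
Proof.
  apply (dcomp exp); [apply dexp|]. eapply is_derive_val.
  - apply dmult; [apply dconst|apply dmult; apply did].
  - cbv beta; ring.
Qed.
Lemma Gam_integrable N a b : ex_RInt (fun x => exp (- (INR N / 2) * (x * x))) a b.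
Proof.
  apply (ex_RInt_continuous (V := RV)). intros z _.
  eapply dcont, Gam_integrand_der.
Qed.

(** On [0,1] one has x^2 <= x, and the integral of exp (-N x/2) is elementary. This bound makes
    1/[Gam] polynomially bounded and (1/N)/[Gam] bounded. *)
Lemma Gam_lower : exists k, 0 < k /\ forall N, (1 <= N)%nat -> k * eps N <= Gam N.
Proof.
  exists (2 * (1 - exp (- / 2))).
  assert (He : exp (- / 2) < 1) by (rewrite <- exp_0; apply exp_increasing; lra).
  split; [lra|]. intros N HN.
  assert (HN1 : 1 <= INR N) by (change 1 with (INR 1); apply le_INR; auto).
  unfold Gam. rewrite <- (RInt_Chasles (V := RV) _ (-1) 0 1) by apply Gam_integrable.
  change plus with Rplus.
  assert (H1 : 0 <= RInt (fun x => exp (- (INR N / 2) * (x * x))) (-1) 0).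
  { apply RInt_ge_0; [lra|apply Gam_integrable|intros; left; apply exp_pos]. }
  set (F := fun x => - (2 / INR N) * exp (- (INR N / 2) * x)).
  assert (HD : forall x, is_derive F x (exp (- (INR N / 2) * x))).
  { intros x. eapply is_derive_val.
    - apply dmult; [apply dconst|]. apply (dcomp exp); [apply dexp|]. apply dmult; [apply dconst|apply did].
    - cbv beta. field. lra. }
  assert (HC : forall x, continuous (fun x => exp (- (INR N / 2) * x)) x).
  { intros x. eapply dcont. apply (dcomp exp); [apply dexp|]. apply dmult; [apply dconst|apply did]. }
  assert (HI : is_RInt (fun x => exp (- (INR N / 2) * x)) 0 1 (F 1 - F 0)).
  { apply (is_RInt_derive (V := RV) F); auto. }
  assert (H2 : F 1 - F 0 <= RInt (fun x => exp (- (INR N / 2) * (x * x))) 0 1).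
  { rewrite <- (is_RInt_unique _ _ _ _ HI). apply RInt_le; [lra|eexists; exact HI|apply Gam_integrable|].
    intros x Hx. apply exp_le. assert (x * x <= x) by nra. nra. }
  unfold F in H2. rewrite Rmult_0_r, exp_0 in H2.
  assert (H3 : exp (- (INR N / 2) * 1) <= exp (- / 2)) by (apply exp_le; lra).
  apply Rle_trans with (2 / INR N * (1 - exp (- (INR N / 2) * 1))).
  - assert (Hi : 0 < / INR N) by (apply inv_pos; lra).
    set (X := exp (- (INR N / 2) * 1)) in *.
    replace (2 / INR N * (1 - X)) with (2 * (1 - X) * / INR N) by (unfold Rdiv; ring).
    apply mul_le_r; lra.
  - lra.
Qed.
Lemma Gam_pos N : (1 <= N)%nat -> 0 < Gam N.
Proof.
  intros HN. destruct Gam_lower as [k [Hk H]]. generalize (H N HN) (eps_pos N HN). nra.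
Qed.
Lemma PB_Gam_inv : PB (fun N => RtoC (/ Gam N)).
Proof.
  destruct Gam_lower as [k [Hk H]]. exists (/ k), 1%nat. intros N HN.
  assert (HN' : 0 < INR N) by (apply lt_0_INR; lia).
  assert (HG := Gam_pos N HN). unfold eps in H.
  rewrite Cnorm_RtoC, Rabs_right by (left; apply inv_pos; auto).
  rewrite pow_1. replace (/ k * INR N) with (/ (k * / INR N)) by (field; lra).
  apply inv_le; auto. apply mul_lt_pos; auto. now apply inv_pos.
Qed.

Definition gf (N : nat) (w : Cplx) : Cplx := Cexp (RtoC (- (INR N / 2)) * (w * w))%cx.
Lemma gf_Hol N : exists g', Hol (fun _ => True) (gf N) g'.
Proof.
  eexists. apply (Hol_exp _ (fun w => RtoC (- (INR N / 2)) * (w * w))%cx).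
  apply Hol_mul; [apply Hol_const|]. apply (Hol_mul _ (fun w => w)); apply Hol_id.
Qed.
Lemma star_open_True : star_open (fun _ => True).
Proof. split; auto. intros. exists (mkposreal 1 Rlt_0_1). auto. Qed.

Lemma gf_prim_odd N w : star_prim (gf N) (- w)%cx = (- star_prim (gf N) w)%cx.
Proof.
  unfold star_prim. replace (CInt (fun t => gf N (RtoC t * - w)%cx) 0 1) with (CInt (fun t => gf N (RtoC t * w)%cx) 0 1).
  - ring.
  - apply CInt_ext. intros t _. unfold gf. f_equal. ring.
Qed.

Lemma gf_prim_Gam N : star_prim (gf N) C1 = RtoC (Gam N / 2).
Proof.
  destruct (gf_Hol N) as [g' Hg].
  assert (E : CInt (fun u => gf N (RtoC u) * C1)%cx (-1) 1 = (star_prim (gf N) (RtoC 1) - star_prim (gf N) (RtoC (-1)))%cx).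
  { apply (star_curve_CInt (fun _ => True) (gf N) g' (fun _ => True) RtoC (fun _ => C1));
    auto using star_open_True, open_true, cder_id, ccont_const. lra. }
  replace (RtoC (-1)) with (- C1)%cx in E by (apply cx_eq; simpl; ring).
  rewrite gf_prim_odd in E. change (RtoC 1) with C1 in E.
  assert (E2 : CInt (fun u => gf N (RtoC u) * C1)%cx (-1) 1 = RtoC (Gam N)).
  { transitivity (CInt (fun u => RtoC (exp (- (INR N / 2) * (u * u)))) (-1) 1).
    - apply CInt_ext. intros x _. unfold gf. rewrite <- !RtoC_mul, Cexp_RtoC. ring.
    - apply cx_eq; simpl; [reflexivity|]. rewrite (RInt_const (V := RV)).
      unfold scal; simpl; unfold mult; simpl; ring. }
  rewrite E2 in E. replace (Gam N / 2) with (/ 2 * Gam N) by field. rewrite RtoC_mul, E.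
  apply cx_eq; simpl; field.
Qed.

(** The two primitives differ by the integral of the Gaussian over the segment from 1 to w. There Re
    u - Im u and Re u + Im u are both at least m, and their product is Re (u^2), so the integrand is
    exponentially small. *)
Lemma gf_far w : 0 < Cre w -> 0 < Cre (w * w)%cx -> ES (fun N => star_prim (gf N) w - RtoC (Gam N / 2))%cx.
Proof.
  intros H1 H2. simpl in H2.
  assert (p0 : 0 < Cre w - Cim w) by nra. assert (q0 : 0 < Cre w + Cim w) by nra.
  set (m := Rmin 1 (Rmin (Cre w - Cim w) (Cre w + Cim w))).
  assert (Hm : 0 < m <= 1 /\ m <= Cre w - Cim w /\ m <= Cre w + Cim w).
  { unfold m. generalize (Rmin_l 1 (Rmin (Cre w - Cim w) (Cre w + Cim w))) (Rmin_r 1 (Rmin (Cre w - Cim w) (Cre w + Cim w)))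
      (Rmin_l (Cre w - Cim w) (Cre w + Cim w)) (Rmin_r (Cre w - Cim w) (Cre w + Cim w)).
    intros. repeat split; try lra. repeat apply Rmin_pos; lra. }
  exists (2 * Cnorm (w - C1)%cx), (m * m / 2). split; [nra|]. intros N HN.
  destruct (gf_Hol N) as [g' Hg].
  rewrite <- gf_prim_Gam.
  replace (star_prim (gf N) w) with (star_prim (gf N) (C1 + (w - C1))%cx) by (f_equal; ring).
  rewrite <- (star_seg_CInt (fun _ => True) (gf N) g') by auto using star_open_True.
  eapply Rle_trans; [apply (CInt_bound _ 0 1 (Cnorm (w - C1)%cx * exp (- (m * m / 2) * INR N))); [lra| |]|].
  - apply ex_CInt_cont. intros x _. apply ccont_mul; [|apply ccont_const].
    eapply cder_ccont, (hol_der _ _ _ Hg); [apply cder_lin|auto].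
  - intros x Hx. rewrite Cnorm_mul, Rmult_comm. apply mul_le_l; [apply Cnorm_nonneg|].
    unfold gf. rewrite Cnorm_exp. apply exp_le.
    assert (HN' := pos_INR N).
    set (u := lin C1 (w - C1) x).
    assert (Eu : Cre u - Cim u = (1 - x) + x * (Cre w - Cim w)) by (unfold u, lin; simpl; ring).
    assert (Fu : Cre u + Cim u = (1 - x) + x * (Cre w + Cim w)) by (unfold u, lin; simpl; ring).
    assert (m * m <= (Cre u - Cim u) * (Cre u + Cim u)).
    { apply Rmult_le_compat; try lra; nra. }
    replace (Cre (RtoC (- (INR N / 2)) * (u * u))%cx)
      with (- (INR N / 2 * ((Cre u - Cim u) * (Cre u + Cim u)))) by (simpl; ring).
    assert (INR N / 2 * (m * m) <= INR N / 2 * ((Cre u - Cim u) * (Cre u + Cim u)))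
      by (apply mul_le_l; lra).
    lra.
  - right; ring.
Qed.

Lemma hav0_at0 f : hav 0 f 0 = f 0.
Proof.
  unfold hav. rewrite (RInt_ext _ (fun _ => f 0)).
  - rewrite (RInt_const (V := RV)). unfold scal; simpl; unfold mult; simpl; ring.
  - intros x _. rewrite Rmult_0_r. simpl; ring.
Qed.
Lemma chav_at0 f : chav f 0 = f 0.
Proof. apply cx_eq; simpl; apply hav0_at0. Qed.

Lemma Cexp_half_log z : 0 < Cre z -> let v := Cexp (RtoC (/ 2) * Clog z)%cx in
  (v * v)%cx = z /\ 0 < Cre v.
Proof.
  intros H v. split.
  - unfold v. rewrite <- Cexp_add.
    replace (RtoC (/ 2) * Clog z + RtoC (/ 2) * Clog z)%cx with (Clog z) by (apply cx_eq; simpl; field).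
    now apply Cexp_Clog.
  - cbn [Cexp Cre]. apply mul_lt_pos; [apply exp_pos|].
    generalize (Clog_im_bound z H) PI_RGT_0. intros. apply cos_gt_0; cbn [Cmul Cim Cre RtoC]; lra.
Qed.

Section Laplace.
Variable D : R -> Prop.
Hypothesis HO : open D.
Hypothesis HS : forall x t, D x -> 0 <= t <= 1 -> D (t * x).
Hypothesis D0 : D 0.
Variable psi : R -> Cplx.
Hypothesis Hpsi : csm D psi.
Hypothesis psi_0 : psi 0 = C0.
Hypothesis psi_1 : cD psi 0 = C0.
Let kap := (- cD (cD psi) 0%R)%cx.
Hypothesis Hkap : 0 < Cre kap.

Let psi1 := chav (cD psi).
Let psi2 := chav (cD psi1).

Lemma psi1_csm : csm D psi1.
Proof. apply csm_chav; auto. apply csm_cD; auto. Qed.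
Lemma psi2_csm : csm D psi2.
Proof. apply csm_chav; auto. apply csm_cD, psi1_csm. Qed.
Lemma psi_eq1 x : D x -> psi x = (RtoC x * psi1 x)%cx.
Proof. intros Hx. rewrite (chadamard D HS psi x Hpsi Hx), psi_0. unfold psi1. ring. Qed.
Lemma psi_eq2 x : D x -> psi x = (RtoC (x * x) * psi2 x)%cx.
Proof.
  intros Hx. rewrite psi_eq1, (chadamard D HS psi1 x psi1_csm Hx) by auto.
  replace (psi1 0) with C0 by (unfold psi1; rewrite chav_at0; auto).
  rewrite RtoC_mul. unfold psi2. ring.
Qed.
Lemma psi2_at0 : (- (RtoC 2 * psi2 0%R))%cx = kap.
Proof.
  unfold psi2, kap. rewrite chav_at0. f_equal.
  assert (H : forall x, D x -> cD psi x = (psi1 x + RtoC x * cD psi1 x)%cx).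
  { intros x Hx. apply cD_unique.
    apply cder_ext_loc with (fun t => RtoC t * psi1 t)%cx.
    - apply (filter_imp D); [|apply HO, Hx]. intros t Ht; symmetry; now apply psi_eq1.
    - eapply cder_val; [apply cder_mul; [apply cder_id|apply (csm_cder D); auto; apply psi1_csm]|].
      cbv beta; ring. }
  symmetry. apply cD_unique.
  apply cder_ext_loc with (fun x => psi1 x + RtoC x * cD psi1 x)%cx.
  - apply (filter_imp D); [|apply HO, D0]. intros t Ht; symmetry; now apply H.
  - eapply cder_val.
    + apply cder_add; [apply (csm_cder D); auto; apply psi1_csm|].
      apply cder_mul; [apply cder_id|apply (csm_cder D); auto; apply csm_cD, psi1_csm].
    + apply cx_eq; simpl; ring.
Qed.

(** v is a square root of -2 psi/x^2. With y = x v the phase becomes psi = -y^2/2, an exact Gaussian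
    in the new complex coordinate y. *)
Let v := fun x => Cexp (RtoC (/ 2) * Clog (- (RtoC 2 * psi2 x)))%cx.
Let y := fun x => (RtoC x * v x)%cx.

Lemma itv_exists (P : R -> Prop) : locally 0 P -> exists e, 0 < e /\ forall x, itv e x -> P x.
Proof.
  intros [e He]. exists e. split; [apply cond_pos|]. intros x Hx. apply He.
  unfold ball; simpl; unfold AbsRing_ball, abs, minus, plus, opp; simpl.
  apply Rabs_def1; unfold itv in Hx; lra.
Qed.

(** The conditions under which y is a coordinate on the interval: the square root is taken in the
    right half-plane and y' has no zero. *)
Definition good (e : R) : Prop := 0 < e /\ forall x, itv e x ->
  D x /\ 0 < Cre (- (RtoC 2 * psi2 x))%cx /\ 0 < Cnorm2 (cD y x).

Lemma v_csm_gen E : open E -> (forall x, E x -> D x /\ 0 < Cre (- (RtoC 2 * psi2 x))%cx) -> csm E v.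
Proof.
  intros HE H. apply csm_exp; auto. apply csm_mul; auto; [apply csm_const; auto|].
  apply csm_log; auto; [|intros x Hx; apply H; auto].
  apply csm_opp, csm_mul; auto; [apply csm_const; auto|].
  apply (csm_subset D); [intros x Hx; apply H; auto|exact psi2_csm].
Qed.
Lemma y_csm_gen E : open E -> (forall x, E x -> D x /\ 0 < Cre (- (RtoC 2 * psi2 x))%cx) -> csm E y.
Proof.
  intros HE H. apply csm_mul; auto; [|apply v_csm_gen; auto].
  apply csm_RtoC; auto. apply smooth_id; auto.
Qed.
Lemma y_der0_gen E : open E -> E 0 -> (forall x, E x -> D x /\ 0 < Cre (- (RtoC 2 * psi2 x))%cx) -> cD y 0 = v 0.
Proof.
  intros HE E0 H. apply cD_unique. eapply cder_val.
  - apply cder_mul; [apply cder_id|apply (csm_cder E v); auto; apply v_csm_gen; auto].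
  - change (RtoC 0) with C0. ring.
Qed.

Lemma good_exists : exists e, good e.
Proof.
  assert (L1 : locally 0 (fun x => 0 < Cre (- (RtoC 2 * psi2 x))%cx)).
  { assert (C := csm_ccont D psi2 0 psi2_csm D0).
    assert (C' : ccont (fun x => - (RtoC 2 * psi2 x))%cx 0) by (apply ccont_opp, ccont_mul; auto using ccont_const).
    apply C'. apply (open_gt 0). rewrite psi2_at0. exact Hkap. }
  destruct (itv_exists _ (filter_and _ _ (HO 0 D0) L1)) as [e1 [He1 H1]].
  assert (I0 : itv e1 0) by (unfold itv; lra).
  assert (Hy := y_csm_gen (itv e1) (itv_open e1) H1).
  assert (E0 := y_der0_gen (itv e1) (itv_open e1) I0 H1).
  assert (L2 : locally 0 (fun x => 0 < Cnorm2 (cD y x))).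
  { assert (C : continuous (fun x => Cnorm2 (cD y x)) 0).
    { apply (smooth_cont (itv e1)); auto. apply smooth_norm2; [apply itv_open|]. apply csm_cD; auto. }
    apply C. apply (open_gt 0). rewrite E0. apply Cnorm2_pos. apply Cexp_neq0. }
  destruct (itv_exists _ (filter_and _ _ (itv_open e1 0 I0) L2)) as [e2 [He2 H2]].
  exists e2. split; auto. intros x Hx. destruct (H2 x Hx) as [h1 h2]. destruct (H1 x h1). auto.
Qed.

Definition LI (d : R) (h : R -> Cplx) (N : nat) : Cplx :=
  CInt (fun x => Cexp (RtoC (INR N) * psi x) * h x)%cx (- d) d.

Section Fixed.
Variables e d : R.
Hypothesis He : good e.
Hypothesis Hd : 0 < d < e.
Let E := itv e.
Let EO : open E := itv_open e.

Lemma E_of x : - d <= x <= d -> E x.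
Proof. unfold E, itv; lra. Qed.
Lemma E_0 : E 0.
Proof. apply E_of; lra. Qed.
Lemma E_good x : E x -> D x /\ 0 < Cre (- (RtoC 2 * psi2 x))%cx.
Proof. intros Hx. destruct He as [_ H]. destruct (H x Hx) as (a & b & _). auto. Qed.
Lemma v_csm : csm E v. Proof. apply v_csm_gen; auto. apply E_good. Qed.
Lemma y_csm : csm E y. Proof. apply y_csm_gen; auto. apply E_good. Qed.
Lemma psi_csm_E : csm E psi.
Proof. apply (csm_subset D); [intros x Hx; apply E_good; auto|exact Hpsi]. Qed.
Lemma v_sq x : E x -> (v x * v x)%cx = (- (RtoC 2 * psi2 x))%cx.
Proof. intros Hx. apply (Cexp_half_log (- (RtoC 2 * psi2 x))%cx), E_good; auto. Qed.
Lemma y_sq x : E x -> (y x * y x)%cx = (- (RtoC 2 * psi x))%cx.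
Proof.
  intros Hx. rewrite psi_eq2 by (apply E_good; auto). unfold y.
  transitivity (RtoC (x * x) * (v x * v x))%cx; [rewrite RtoC_mul; ring|]. rewrite v_sq by auto. ring.
Qed.
Lemma y_der_neq0 x : E x -> cD y x <> C0.
Proof.
  intros Hx E0. destruct He as [_ H]. destruct (H x Hx) as (_ & _ & h). rewrite E0 in h.
  unfold Cnorm2 in h; simpl in h; lra.
Qed.
Lemma v_neq0 x : v x <> C0.
Proof. apply Cexp_neq0. Qed.
Lemma psi_der x : E x -> cD psi x = (- (y x * cD y x))%cx.
Proof.
  intros Hx. apply cD_unique.
  apply cder_ext_loc with (fun t => RtoC (- / 2) * (y t * y t))%cx.
  - apply (filter_imp E); [|apply EO, Hx]. intros t Ht. rewrite y_sq by auto. apply cx_eq; simpl; field.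
  - assert (Hc := csm_cder E y x y_csm Hx).
    eapply cder_val; [apply cder_scal, cder_mul; exact Hc|]. apply cx_eq; simpl; field.
Qed.
Lemma psi_re_le x : E x -> Cre (psi x) <= 0.
Proof.
  intros Hx. destruct (E_good x Hx) as [h1 h2]. rewrite psi_eq2 by auto. simpl in *. nra.
Qed.
Lemma psi_re_lt x : E x -> x <> 0 -> Cre (psi x) < 0.
Proof.
  intros Hx Hx0. destruct (E_good x Hx) as [h1 h2]. rewrite psi_eq2 by auto. simpl in *.
  assert (0 < x * x) by (apply Rsqr_pos_lt in Hx0; exact Hx0). nra.
Qed.

Lemma phase_ccont h N x : csm E h -> E x -> ccont (fun x => Cexp (RtoC (INR N) * psi x) * h x)%cx x.
Proof.
  intros Hh Hx. apply ccont_mul; [|eapply csm_ccont; eauto].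
  eapply cder_ccont. apply cder_exp, cder_scal. apply (csm_cder E); auto. apply psi_csm_E.
Qed.
Lemma LI_ex h N : csm E h -> ex_CInt (fun x => Cexp (RtoC (INR N) * psi x) * h x)%cx (- d) d.
Proof.
  intros Hh. apply ex_CInt_cont. intros x Hx. minmax Hx.
  apply phase_ccont; auto. apply E_of; auto.
Qed.

Lemma LI_bdd h : csm E h -> exists K, forall N, Cnorm (LI d h N) <= K.
Proof.
  intros Hh. destruct (csm_bounded E h (- d) d Hh) as [K [HK HB]]; [lra|apply E_of|].
  exists (2 * K * (d - - d)). intros N. apply CInt_bound; [lra|apply LI_ex; auto|].
  intros x Hx. rewrite Cnorm_mul, Cnorm_exp.
  assert (exp (Cre (RtoC (INR N) * psi x)%cx) <= 1).
  { rewrite <- exp_0. apply exp_le. simpl. generalize (psi_re_le x (E_of x Hx)) (pos_INR N). nra. }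
  specialize (HB x Hx). generalize (exp_pos (Cre (RtoC (INR N) * psi x)%cx)) (Cnorm_nonneg (h x)). nra.
Qed.

(** Substituting y turns the integral into that of exp (-N y^2/2) from y(-d) to y(d). Both y(d) and
    -y(-d) satisfy the hypotheses of [gf_far], since y^2 = x^2 v^2 and v^2 has positive real
    part. *)
Lemma LI_y' : ES (fun N => LI d (cD y) N - RtoC (Gam N))%cx.
Proof.
  assert (Hpos : E d) by (apply E_of; lra). assert (Hneg : E (- d)) by (apply E_of; lra).
  assert (HN : forall N, (1 <= N)%nat -> (LI d (cD y) N - RtoC (Gam N))%cx =
    ((star_prim (gf N) (y d) - RtoC (Gam N / 2)) + (star_prim (gf N) (- y (- d)%R) - RtoC (Gam N / 2)))%cx).
  { intros N HN. destruct (gf_Hol N) as [g' Hg].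
    rewrite gf_prim_odd.
    transitivity ((star_prim (gf N) (y d) - star_prim (gf N) (y (- d)%R)) - RtoC (Gam N))%cx.
    - f_equal.
      rewrite <- (star_curve_CInt (fun _ => True) (gf N) g' E y (cD y)); auto using star_open_True; try lra.
      + apply CInt_ext. intros x Hx. minmax Hx.
        f_equal. unfold gf. f_equal. rewrite y_sq by (apply E_of; lra). apply cx_eq; simpl; field.
      + intros u Hu; apply (csm_cder E); auto; apply y_csm.
      + intros u Hu; apply (csm_ccont E); auto; apply csm_cD, y_csm.
      + intros u Hu; split; auto. apply E_of; auto.
    - apply cx_eq; simpl; field. }
  destruct (Cexp_half_log _ (proj2 (E_good d Hpos))) as [a1 a2].
  destruct (Cexp_half_log _ (proj2 (E_good (- d) Hneg))) as [b1 b2].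
  fold (v d) in a1, a2. fold (v (- d)) in b1, b2.
  assert (G1 : ES (fun N => star_prim (gf N) (y d) - RtoC (Gam N / 2))%cx).
  { apply gf_far; unfold y.
    - cbn [Cre Cim Cmul RtoC Copp]; nra.
    - replace (RtoC d * v d * (RtoC d * v d))%cx with (RtoC (d * d) * (v d * v d))%cx by (rewrite RtoC_mul; ring).
      rewrite a1. destruct (E_good d Hpos) as [_ h]. cbn [Cre Cim Cmul RtoC Copp] in *; assert (0 < d * d) by nra; nra. }
  assert (G2 : ES (fun N => star_prim (gf N) (- y (- d)%R) - RtoC (Gam N / 2))%cx).
  { apply gf_far; unfold y.
    - cbn [Cre Cim Cmul RtoC Copp]; nra.
    - replace (- (RtoC (- d) * v (- d)%R) * - (RtoC (- d) * v (- d)%R))%cx with (RtoC (d * d) * (v (- d)%R * v (- d)%R))%cx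
        by (replace (d * d) with (- d * - d) by ring; rewrite RtoC_mul; ring).
      rewrite b1. destruct (E_good (- d) Hneg) as [_ h]. cbn [Cre Cim Cmul RtoC Copp] in *; assert (0 < d * d) by nra; nra. }
  destruct (ES_add _ _ G1 G2) as (K & c & Hc & HH). exists K, c. split; auto.
  intros N HN1. rewrite HN by auto. apply HH; auto.
Qed.

(** The amplitude is written as h = al y' + psi' k. The multiple of y' integrates to al [Gam] up to
    an exponentially small error. The second term is integrated by parts, which gains 1/N, replaces
    k by -k' and leaves boundary terms where Re psi < 0. *)
Lemma LI_step h : csm E h -> exists h', csm E h' /\ exists B, ES B /\
  forall N, (1 <= N)%nat -> LI d h N =
   (h 0%R / v 0%R * RtoC (Gam N) + B N + RtoC (eps N) * LI d h' N)%cx.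
Proof.
  intros Hh. set (al := (h 0%R / v 0%R)%cx).
  set (n := fun x => (h x - al * cD y x)%cx).
  assert (Hn : csm E n) by (apply csm_sub; auto; apply csm_mul; auto; [apply csm_const; auto|apply csm_cD, y_csm]).
  assert (n0 : n 0 = C0).
  { unfold n, al. rewrite (y_der0_gen E); auto using E_0, E_good. field. apply v_neq0. }
  set (n1 := chav (cD n)).
  assert (ES' : forall x t, E x -> 0 <= t <= 1 -> E (t * x)) by (intros; now apply itv_star).
  assert (Hn1 : csm E n1) by (apply csm_chav; auto; apply csm_cD; auto).
  assert (En : forall x, E x -> n x = (RtoC x * n1 x)%cx).
  { intros x Hx. rewrite (chadamard E ES' n x Hn Hx), n0. unfold n1; ring. }
  (* Since psi' = -x v y', this choice gives psi' k = x n1 = h - al y'; it is smooth because only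
     the simple zero at 0 had to be cancelled. *)
  set (k := fun x => (- n1 x * / (v x * cD y x))%cx).
  assert (Hvy : forall x, E x -> (v x * cD y x)%cx <> C0).
  { intros; apply Cmul_neq0; auto using v_neq0, y_der_neq0. }
  assert (Hk : csm E k).
  { apply csm_mul; auto; [apply csm_opp; auto|]. apply csm_inv; auto. apply csm_mul; auto; [apply v_csm|apply csm_cD, y_csm]. }
  assert (Ek : forall x, E x -> h x = (al * cD y x + cD psi x * k x)%cx).
  { intros x Hx. rewrite psi_der by auto. unfold k. change (y x) with (RtoC x * v x)%cx.
    transitivity (al * cD y x + n x)%cx; [unfold n; ring|]. rewrite En by auto. field.
    specialize (y_der_neq0 x Hx). specialize (v_neq0 x). tauto. }
  exists (fun x => - cD k x)%cx. split; [apply csm_opp; auto; apply csm_cD; auto|].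
  set (Bd := fun N => (Cexp (RtoC (INR N) * psi d) * k d - Cexp (RtoC (INR N) * psi (- d)%R) * k (- d)%R)%cx).
  exists (fun N => al * (LI d (cD y) N - RtoC (Gam N)) + RtoC (eps N) * Bd N)%cx. split.
  - apply ES_add; [apply ES_scal, LI_y'|].
    assert (HB : ES Bd).
    { assert (H1 := psi_re_lt d (E_of d ltac:(lra)) ltac:(lra)).
      assert (H2 := psi_re_lt (- d) (E_of (- d) ltac:(lra)) ltac:(lra)).
      assert (G : forall z w, Cre z < 0 -> ES (fun N => Cexp (RtoC (INR N) * z) * w)%cx).
      { intros z w Hz. exists (Cnorm w), (- Cre z). split; [lra|]. intros N HN.
        rewrite Cnorm_mul, Cnorm_exp, Rmult_comm. right. f_equal. f_equal. simpl. ring. }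
      apply (ES_add (fun N => Cexp (RtoC (INR N) * psi d) * k d)%cx (fun N => - (Cexp (RtoC (INR N) * psi (- d)%R) * k (- d)%R))%cx).
      - apply G; auto.
      - destruct (G _ (k (- d)) H2) as (K & c & Hc & HH). exists K, c. split; auto.
        intros N HN. rewrite Cnorm_opp. apply HH; auto. }
    destruct (ES_mul_PB Bd (fun N => RtoC (eps N)) HB) as (K & c & Hc & HH).
    { exists 1, 0%nat. intros N HN. generalize (eps_pos N HN) (eps_le1 N HN). intros.
      rewrite Cnorm_RtoC, Rabs_right by lra. simpl; lra. }
    exists K, c. split; auto. intros N HN. eapply Rle_trans; [right|apply (HH N HN)]. f_equal; ring.
  - intros N HN.
    assert (HcDk : csm E (cD k)) by (apply csm_cD; auto).
    assert (Hcp : csm E (cD psi)) by (apply csm_cD; apply psi_csm_E).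
    assert (I1 : LI d h N = (al * LI d (cD y) N + LI d (fun x => cD psi x * k x) N)%cx).
    { unfold LI. rewrite <- CInt_scal, <- CInt_add.
      - apply CInt_ext. intros x Hx. minmax Hx.
        rewrite (Ek x) by (apply E_of; lra). ring.
      - apply ex_CInt_scal, LI_ex, csm_cD, y_csm.
      - apply (LI_ex (fun x => cD psi x * k x)%cx). apply csm_mul; auto.
      - apply LI_ex, csm_cD, y_csm. }
    assert (I2 : (RtoC (INR N) * LI d (fun x => cD psi x * k x)%cx N + LI d (cD k) N)%cx = Bd N).
    { unfold LI. rewrite <- CInt_scal, <- CInt_add.
      - apply (CInt_derive (fun x => Cexp (RtoC (INR N) * psi x) * k x)%cx).
        + intros x Hx. minmax Hx. assert (Ex := E_of x Hx).
          eapply cder_val.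
          * apply cder_mul; [apply cder_exp, cder_scal, (csm_cder E); auto; apply psi_csm_E|apply (csm_cder E); auto].
          * cbv beta; ring.
        + intros x Hx. minmax Hx. assert (Ex := E_of x Hx).
          apply ccont_add; [apply ccont_mul; [apply ccont_const|]|]; apply (phase_ccont (fun x => _)); auto.
          apply csm_mul; auto.
      - apply ex_CInt_scal. apply (LI_ex (fun x => cD psi x * k x)%cx). apply csm_mul; auto.
      - apply LI_ex; auto.
      - apply (LI_ex (fun x => cD psi x * k x)%cx). apply csm_mul; auto. }
    assert (I3 : LI d (fun x => - cD k x)%cx N = (- LI d (cD k) N)%cx).
    { unfold LI. transitivity (CInt (fun x => (- C1) * (Cexp (RtoC (INR N) * psi x) * cD k x))%cx (- d) d).
      - apply CInt_ext. intros; ring.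
      - rewrite CInt_scal by (apply LI_ex; auto). ring. }
    assert (e4 : (RtoC (eps N) * RtoC (INR N) = C1)%cx).
    { rewrite <- RtoC_mul; unfold C1; f_equal. generalize (eps_INR N HN); lra. }
    rewrite I1, I3, <- I2.
    transitivity (al * LI d (cD y) N + (RtoC (eps N) * RtoC (INR N)) * LI d (fun x => cD psi x * k x) N)%cx; [rewrite e4|]; ring.
Qed.

Lemma Gam_cancel N : (1 <= N)%nat -> (RtoC (/ Gam N) * RtoC (Gam N))%cx = C1.
Proof.
  intros HN. rewrite <- RtoC_mul. unfold C1; f_equal. apply Rinv_l. generalize (Gam_pos N HN); lra.
Qed.

(** The trivial bound on [LI] only controls the quotient by 1/[Gam]. One application of [LI_step]
    supplies the factor 1/N that makes (1/N)/[Gam] bounded. *)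
Lemma LI_Gam_bdd h : csm E h -> exists K, forall N, (1 <= N)%nat -> Cnorm (RtoC (/ Gam N) * LI d h N)%cx <= K.
Proof.
  intros Hh. destruct (LI_step h Hh) as (h' & Hh' & B & HB & HN).
  destruct (LI_bdd h' Hh') as [K1 HK1].
  destruct (ES_eps _ 0 (ES_mul_PB _ _ HB PB_Gam_inv)) as [K2 HK2].
  destruct Gam_lower as [k [Hk HG]].
  exists (Cnorm (h 0%R / v 0%R)%cx + K2 + / k * Rabs K1). intros N H1. rewrite HN by auto.
  replace (RtoC (/ Gam N) * (h 0%R / v 0%R * RtoC (Gam N) + B N + RtoC (eps N) * LI d h' N))%cx
    with ((h 0%R / v 0%R * (RtoC (/ Gam N) * RtoC (Gam N)) + B N * RtoC (/ Gam N)) + RtoC (/ Gam N) * RtoC (eps N) * LI d h' N)%cx by ring.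
  rewrite Gam_cancel by auto.
  le_via Cnorm_triang. apply Rplus_le_compat.
  - le_via Cnorm_triang. apply Rplus_le_compat.
    + right; f_equal; ring.
    + eapply Rle_trans; [apply HK2; auto|]. simpl; lra.
  - rewrite <- RtoC_mul, Cnorm_mul, Cnorm_RtoC.
    generalize (Gam_pos N H1) (eps_pos N H1); intros g1 g2.
    rewrite Rabs_right by (left; apply mul_lt_pos; auto; now apply inv_pos).
    apply Rmult_le_compat; auto using Cnorm_nonneg.
    + left; apply mul_lt_pos; auto; now apply inv_pos.
    + apply Rle_trans with (/ (k * eps N) * eps N).
      * apply mul_le_r; [lra|]. apply inv_le; auto. apply mul_lt_pos; auto.
      * right; field; lra.
    + eapply Rle_trans; [apply HK1|apply Rle_abs].
Qed.

Lemma laplace_leading h : csm E h -> exists K, forall N, (1 <= N)%nat ->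
  Cnorm (RtoC (/ Gam N) * LI d h N - h 0%R / v 0%R)%cx <= K * eps N.
Proof.
  intros Hh. destruct (LI_step h Hh) as (h' & Hh' & B & HB & HN).
  destruct (LI_Gam_bdd h' Hh') as [K1 HK1].
  destruct (ES_eps _ 1 (ES_mul_PB _ _ HB PB_Gam_inv)) as [K2 HK2].
  exists (K2 + K1). intros N H1. rewrite HN by auto.
  replace (RtoC (/ Gam N) * (h 0%R / v 0%R * RtoC (Gam N) + B N + RtoC (eps N) * LI d h' N) - h 0%R / v 0%R)%cx
    with (h 0%R / v 0%R * (RtoC (/ Gam N) * RtoC (Gam N)) - h 0%R / v 0%R + B N * RtoC (/ Gam N) + RtoC (eps N) * (RtoC (/ Gam N) * LI d h' N))%cx by ring.
  rewrite Gam_cancel by auto.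
  replace (h 0%R / v 0%R * C1 - h 0%R / v 0%R + B N * RtoC (/ Gam N))%cx with (B N * RtoC (/ Gam N))%cx by ring.
  le_via Cnorm_triang. rewrite Rmult_plus_distr_r. apply Rplus_le_compat.
  - eapply Rle_trans; [apply HK2; auto|]. simpl; lra.
  - generalize (eps_pos N H1); intros. rewrite Cnorm_mul, Cnorm_RtoC, Rabs_right, Rmult_comm by lra.
    apply mul_le_r; [lra|auto].
Qed.

Lemma laplace_expansion Q r : forall h, csm E h -> Sq Q r (fun N => RtoC (/ Gam N) * LI d h N)%cx.
Proof.
  induction r; intros h Hh.
  - destruct (LI_Gam_bdd h Hh) as [K HK]. exists K. apply evt_all; auto.
  - destruct (LI_step h Hh) as (h' & Hh' & B & HB & HN).
    apply (Sq_ext Q _ (fun N => h 0%R / v 0%R + B N * RtoC (/ Gam N) + RtoC (eps N) * (RtoC (/ Gam N) * LI d h' N))%cx).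
    + exists 1%nat; split; auto. intros N H1 _. rewrite HN by auto.
      transitivity (h 0%R / v 0%R * C1 + B N * RtoC (/ Gam N) + RtoC (eps N) * (RtoC (/ Gam N) * LI d h' N))%cx; [ring|].
      rewrite <- (Gam_cancel N H1). ring.
    + apply Sq_add; [apply Sq_add; [apply Sq_const|]|].
      * apply Sq_ES, ES_mul_PB; auto. apply PB_Gam_inv.
      * apply (Xp_eps Q unit) with (H := fun N _ => (RtoC (/ Gam N) * LI d h' N)%cx); auto. apply IHr; auto.
Qed.
End Fixed.

Lemma v_at0 : v 0 = Cexp (RtoC (/ 2) * Clog kap)%cx.
Proof. unfold v. now rewrite psi2_at0. Qed.
End Laplace.

(** The half-width d stays free below [e0], so that a user can shrink the window to meet further
    conditions. The square root in the limit is the principal one, because v is defined through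
    [Clog]. *)
Lemma laplace D psi : open D -> (forall x t, D x -> 0 <= t <= 1 -> D (t * x)) -> D 0 ->
  csm D psi -> psi 0 = C0 -> cD psi 0 = C0 -> 0 < Cre (- cD (cD psi) 0%R)%cx ->
  exists e0, 0 < e0 /\ forall e d, 0 < d < e -> e <= e0 ->
    (forall x, itv e x -> D x /\ (x <> 0 -> Cre (psi x) < 0)) /\
    forall h, csm (itv e) h ->
      (forall Q r, Sq Q r (fun N => RtoC (/ Gam N) * LI psi d h N)%cx) /\
      exists K, forall N, (1 <= N)%nat ->
        Cnorm (RtoC (/ Gam N) * LI psi d h N - h 0%R / Cexp (RtoC (/ 2) * Clog (- cD (cD psi) 0%R)))%cx <= K * eps N.
Proof.
  intros HO HS D0 Hpsi p0 p1 Hk.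
  destruct (good_exists D HO HS D0 psi Hpsi p0 Hk) as [e0 [He0 G]].
  exists e0. split; auto. intros e d Hd He.
  assert (Ge : good D psi e).
  { split; [lra|]. intros x Hx. apply G. unfold itv in *; lra. }
  split.
  - intros x Hx. split; [apply Ge, Hx|]. intros Hx0.
    destruct Ge as [_ Ge]. destruct (Ge x Hx) as (h1 & h2 & _).
    rewrite (psi_eq2 D) by auto.
    assert (0 < x * x) by (apply Rsqr_pos_lt in Hx0; exact Hx0).
    cbn [Cre Cim Cmul RtoC Copp] in *; nra.
  - intros h Hh. rewrite <- (v_at0 D HO HS D0 psi Hpsi p0). split.
    + intros Q r. apply (laplace_expansion D) with (e := e); auto.
    + apply (laplace_leading D) with (e := e); auto.
Qed.

(** * Polynomials given by coefficient sequences *)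

Definition ev (f : nat -> R) (n : nat) (t : Cplx) : Cplx :=
  Csum (S n) (fun i => RtoC (f i) * Cpown t i)%cx.

Lemma ev_S_l f n t : ev f (S n) t = (RtoC (f 0%nat) + t * ev (fun i => f (S i)) n t)%cx.
Proof.
  unfold ev. rewrite Csum_S_l, <- Csum_scal. f_equal; [simpl; ring|].
  apply Csum_ext. intros; simpl; ring.
Qed.
Lemma ev_ext f g n t : (forall i, (i <= n)%nat -> f i = g i) -> ev f n t = ev g n t.
Proof. intros H; apply Csum_ext. intros i Hi. rewrite H; auto; lia. Qed.
Lemma ev_stable f A n t : (forall i, (A < i)%nat -> f i = 0) -> (A <= n)%nat -> ev f n t = ev f A t.
Proof.
  intros H; induction 1; auto. unfold ev in *. cbn [Csum] in *. rewrite IHle, (H (S m)) by lia.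
  change (RtoC 0) with C0. ring.
Qed.
Lemma ev_add f g n t : ev (fun i => f i + g i) n t = (ev f n t + ev g n t)%cx.
Proof. unfold ev. rewrite <- Csum_add. apply Csum_ext. intros; rewrite RtoC_add; ring. Qed.
Lemma ev_scal k f n t : ev (fun i => k * f i) n t = (RtoC k * ev f n t)%cx.
Proof. unfold ev. rewrite <- Csum_scal. apply Csum_ext. intros; rewrite RtoC_mul; ring. Qed.

Lemma conv_0 f g : conv f g 0 = f 0%nat * g 0%nat.
Proof. reflexivity. Qed.
Lemma conv_S f g n : conv f g (S n) = f 0%nat * g (S n) + conv (fun i => f (S i)) g n.
Proof.
  unfold conv. rewrite decomp_sum by lia. f_equal.
Qed.
Lemma conv_zero_l g n : conv (fun _ => 0) g n = 0.
Proof.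
  apply sum_eq_R0. intros; ring.
Qed.

Lemma conv_ext f g f' g' n : (forall i, (i <= n)%nat -> f i = f' i) -> (forall i, (i <= n)%nat -> g i = g' i) ->
  conv f g n = conv f' g' n.
Proof. intros H1 H2. apply sum_eq. intros i Hi. rewrite H1, H2 by lia. auto. Qed.

Lemma conv_support f g A B : (forall i, (A < i)%nat -> f i = 0) -> (forall i, (B < i)%nat -> g i = 0) ->
  forall n, (A + B < n)%nat -> conv f g n = 0.
Proof.
  intros Hf Hg n Hn. apply sum_eq_R0. intros i Hi.
  destruct (le_lt_dec i A); [rewrite (Hg (n - i)%nat) by lia|rewrite Hf by auto]; ring.
Qed.

Lemma ev_conv g B t : (forall i, (B < i)%nat -> g i = 0) ->
  forall A f, (forall i, (A < i)%nat -> f i = 0) -> ev (conv f g) (A + B) t = (ev f A t * ev g B t)%cx.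
Proof.
  intros Hg. induction A; intros f Hf.
  - transitivity (ev (fun n => f 0%nat * g n) B t).
    + apply ev_ext. intros [|i] Hi; [reflexivity|]. rewrite conv_S.
      rewrite (conv_ext _ g (fun _ => 0) g i), conv_zero_l by (intros; auto; apply Hf; lia). ring.
    + rewrite ev_scal. unfold ev at 2. simpl. ring.
  - change (S A + B)%nat with (S (A + B)). rewrite !ev_S_l.
    rewrite (ev_ext (fun i => conv f g (S i)) (fun i => f 0%nat * g (S i) + conv (fun i => f (S i)) g i)) by (intros; apply conv_S).
    rewrite ev_add, ev_scal, (IHA (fun i => f (S i))) by (intros; apply Hf; lia).
    rewrite conv_0, RtoC_mul.
    assert (E : ev g B t = (RtoC (g 0%nat) + t * ev (fun i => g (S i)) (A + B) t)%cx).
    { rewrite <- ev_S_l. symmetry. apply ev_stable; auto. lia. }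
    rewrite E. ring.
Qed.

Lemma conv_low f g a b : (forall i, (i < a)%nat -> f i = 0) -> (forall i, (i < b)%nat -> g i = 0) ->
  (forall n, (n < a + b)%nat -> conv f g n = 0) /\ conv f g (a + b) = f a * g b.
Proof.
  intros Hf Hg. split.
  - intros n Hn. apply sum_eq_R0. intros i Hi.
    destruct (le_lt_dec a i); [rewrite (Hg (n - i)%nat) by lia|rewrite Hf by auto]; ring.
  - unfold conv.
    assert (G : forall n (F : nat -> R) a, (a <= n)%nat -> (forall i, (i <= n)%nat -> i <> a -> F i = 0) -> sum_f_R0 F n = F a).
    { clear. induction n; intros F a Ha H.
      - simpl. f_equal; lia.
      - cbn [sum_f_R0]. destruct (Nat.eq_dec a (S n)) as [->|Hne].
        + rewrite sum_eq_R0 by (intros; apply H; lia). ring.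
        + rewrite (IHn F a), (H (S n)) by (auto; lia). ring. }
    rewrite (G (a + b)%nat _ a); [f_equal; f_equal; lia|lia|].
    intros i Hi Hne. destruct (le_lt_dec a i); [rewrite (Hg (a + b - i)%nat) by lia|rewrite Hf by auto]; ring.
Qed.

Lemma conv_inv c n : c 0%nat <> 0 -> conv c (inv_series c) n = if Nat.eqb n 0 then 1 else 0.
Proof.
  intros Hc.
  assert (HL : forall n, length (inv_series_list c n) = S n).
  { induction n0; simpl; auto. rewrite length_app, IHn0; simpl; lia. }
  (* The list only grows at its end, so entries computed earlier are final and can be read off from
     any longer list. *)
  assert (HN : forall n k, (k <= n)%nat -> nth k (inv_series_list c n) 0 = inv_series c k).
  { induction n0; intros k Hk.
    - replace k with 0%nat by lia. reflexivity.
    - destruct (Nat.eq_dec k (S n0)) as [->|Hne]; [reflexivity|].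
      cbn [inv_series_list]. rewrite app_nth1 by (rewrite HL; lia). apply IHn0; lia. }
  destruct n; simpl Nat.eqb.
  - rewrite conv_0. unfold inv_series; simpl. field; auto.
  - rewrite conv_S.
    assert (E : inv_series c (S n) = (- / c 0%nat) * conv (fun i => c (S i)) (inv_series c) n).
    { unfold inv_series at 1. cbn [inv_series_list]. rewrite app_nth2 by (rewrite HL; lia).
      rewrite HL, Nat.sub_diag. simpl nth. f_equal. apply sum_eq. intros i Hi. rewrite HN by lia. reflexivity. }
    rewrite E. field; auto.
Qed.

(** * The q-Pochhammer product at q = t - 1 *)

Definition binc (j n : nat) : R := if Nat.leb n j then Binomial.C j n * (-1) ^ (j - n) else 0.

Lemma binc_S j n : binc (S j) (S n) = binc j n - binc j (S n).
Proof.
  unfold binc. destruct (le_lt_dec (S n) j) as [H|H].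
  - rewrite !leb_correct by lia. rewrite <- pascal by lia.
    replace (S j - S n)%nat with (S (j - S n)) by lia. replace (j - n)%nat with (S (j - S n)) by lia. simpl; ring.
  - rewrite (leb_correct_conv j (S n)) by lia. simpl Nat.leb. destruct (le_lt_dec n j) as [H'|H'].
    + assert (G : forall j, Binomial.C j j = 1).
      { intros i. unfold Binomial.C. rewrite Nat.sub_diag. change (INR (fact 0)) with 1. field. apply INR_fact_neq_0. }
      replace n with j by lia. rewrite leb_correct, !G, !Nat.sub_diag by lia. simpl; ring.
    + rewrite !leb_correct_conv by lia. ring.
Qed.
Lemma binc_S0 j : binc (S j) 0 = - binc j 0.
Proof.
  assert (G : forall j, Binomial.C j 0 = 1).
  { intros i. unfold Binomial.C. rewrite Nat.sub_0_r. change (INR (fact 0)) with 1. field. apply INR_fact_neq_0. }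
  unfold binc. simpl Nat.leb. rewrite !G, !Nat.sub_0_r. simpl pow. ring.
Qed.
Lemma binc_support j n : (j < n)%nat -> binc j n = 0.
Proof. intros H. unfold binc. now rewrite leb_correct_conv. Qed.
Lemma ev_binc j t : ev (binc j) j t = Cpown (t - C1)%cx j.
Proof.
  induction j.
  - simpl. unfold binc, Binomial.C. simpl. apply cx_eq; simpl; field.
  - rewrite ev_S_l. simpl Cpown. rewrite <- IHj.
    rewrite (ev_ext _ (fun i => binc j i + -1 * binc j (S i))) by (intros; rewrite binc_S; ring).
    rewrite ev_add, ev_scal, binc_S0, RtoC_opp.
    rewrite <- (ev_stable (binc j) j (S j) t) at 2 by (auto using binc_support).
    replace (RtoC (-1)) with (- C1)%cx by (apply cx_eq; simpl; ring).
    ring_simplify. rewrite <- (ev_stable (binc j) j (S j) t), (ev_S_l (binc j)) by (auto using binc_support). ring.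
Qed.

Lemma qfactor_support j n : (1 <= j)%nat -> (j < n)%nat -> qfactor j n = 0.
Proof.
  intros Hj Hn. unfold qfactor. rewrite leb_correct_conv by lia. destruct n; [lia|]. simpl; ring.
Qed.
Lemma ev_qfactor j t : ev (qfactor j) j t = (C1 - Cpown (t - C1) j)%cx.
Proof.
  rewrite (ev_ext _ (fun i => (if Nat.eqb i 0 then 1 else 0) + -1 * binc j i))
    by (intros; unfold qfactor, binc; ring).
  rewrite ev_add, ev_scal, ev_binc.
  replace (RtoC (-1)) with (- C1)%cx by (apply cx_eq; simpl; ring).
  rewrite (ev_stable _ 0 j) by (first [lia | intros [|i] Hi; [lia|reflexivity]]).
  unfold ev. simpl. change (RtoC 1) with C1. ring.
Qed.

Fixpoint qpoch (N : nat) (q : Cplx) : Cplx :=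
  match N with O => C1 | S N' => qpoch N' q * (C1 - Cpown q N) end%cx.

Lemma qpoch_coef_ev N : exists B, (forall i, (B < i)%nat -> qpoch_coef N i = 0) /\
  forall t, ev (qpoch_coef N) B t = qpoch N (t - C1)%cx.
Proof.
  induction N as [|N [B [HB HE]]].
  - exists 0%nat. split; [intros [|i] Hi; [lia|reflexivity]|].
    intros t. unfold ev; simpl. change (RtoC 1) with C1. ring.
  - exists (B + S N)%nat. split.
    + simpl. apply conv_support; auto. intros; apply qfactor_support; auto; lia.
    + intros t. cbn [qpoch_coef qpoch].
      rewrite ev_conv; auto; [|intros; apply qfactor_support; auto; lia].
      rewrite HE, ev_qfactor. reflexivity.
Qed.

(** The factor 1 - (t-1)^j has constant term 1 - (-1)^j. It equals 2 for odd j; for even j it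
    vanishes while the linear coefficient is nonzero. So the order of vanishing increases by one
    exactly at even j. *)
Lemma qpoch_coef_low N : (forall i, (i < N / 2)%nat -> qpoch_coef N i = 0) /\ qpoch_coef N (N / 2)%nat <> 0.
Proof.
  induction N as [|N [H1 H2]].
  - split; [simpl; lia|simpl; lra].
  - cbn [qpoch_coef].
    assert (Q0 : qfactor (S N) 0 = 1 - (-1) ^ S N).
    { unfold qfactor, Binomial.C. simpl Nat.eqb. simpl Nat.leb. rewrite Nat.sub_0_r. simpl (fact 0). simpl (INR 1).
      field. apply INR_fact_neq_0. }
    destruct (Nat.Even_or_Odd (S N)) as [[k Hk]|[k Hk]].
    + assert (E0 : qfactor (S N) 0 = 0) by (rewrite Q0, Hk, pow_1_even; ring).
      assert (E1 : qfactor (S N) 1 <> 0).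
      { unfold qfactor. simpl Nat.eqb. rewrite leb_correct by lia. unfold Binomial.C.
        assert (0 < INR (S N)) by (apply lt_0_INR; lia).
        replace (S N - 1)%nat with N by lia. rewrite fact_simpl, mult_INR. simpl (fact 1). simpl (INR 1).
        replace (INR (S N) * INR (fact N) / (1 * INR (fact N))) with (INR (S N)) by (field; apply INR_fact_neq_0).
        assert (P : (-1) ^ N <> 0) by (apply pow_nonzero; lra).
        intros E. apply P. apply Rmult_eq_reg_l with (INR (S N)); lra. }
      assert (D : (S N / 2 = N / 2 + 1)%nat).
      { rewrite Hk. rewrite Nat.mul_comm, Nat.div_mul by lia.
        replace N with (2 * (k - 1) + 1)%nat by lia.
        rewrite (Nat.mul_comm 2), Nat.div_add_l by lia. simpl. lia. }
      rewrite D. destruct (conv_low (qpoch_coef N) (qfactor (S N)) (N / 2) 1 H1) as [G1 G2].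
      { intros i Hi. replace i with 0%nat by lia. auto. }
      split; auto. rewrite G2. apply Rmult_integral_contrapositive; auto.
    + assert (E0 : qfactor (S N) 0 = 2).
      { rewrite Q0, Hk. replace (2 * k + 1)%nat with (S (2 * k)) by lia. rewrite pow_1_odd; ring. }
      assert (D : (S N / 2 = N / 2 + 0)%nat).
      { rewrite Hk. replace N with (k * 2)%nat by lia. rewrite Nat.div_mul by lia.
        rewrite (Nat.mul_comm 2), Nat.div_add_l by lia. simpl. lia. }
      rewrite D. destruct (conv_low (qpoch_coef N) (qfactor (S N)) (N / 2) 0 H1) as [G1 G2]; [lia|].
      split; auto. rewrite G2, E0. apply Rmult_integral_contrapositive; split; auto; lra.
Qed.

(* 1/(t^(e+1) g(t)) is the polar part sum h_j t^(j-e-1) minus W(t)/g(t), where g(t) = (q)_N/t^k. *)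
Lemma laurent_split N e : exists (g W : nat -> R) (Bg Bw : nat),
  let h := inv_series (fun n => qpoch_coef N (N / 2 + n)%nat) in
  g 0%nat <> 0 /\
  (forall t, (Cpown t (N / 2) * ev g Bg t)%cx = qpoch N (t - C1)%cx) /\
  (forall t, (ev g Bg t * ev h e t)%cx = (C1 + Cpown t (S e) * ev W Bw t)%cx).
Proof.
  destruct (qpoch_coef_ev N) as [B [HB HE]]. destruct (qpoch_coef_low N) as [L1 L2].
  set (k := (N / 2)%nat) in *. set (g := fun n => qpoch_coef N (k + n)%nat).
  set (h := inv_series g).
  (* Truncating the inverse series at e makes it a polynomial; its product with g agrees with 1 up
     to degree e, and the rest is divisible by t^(e+1). *)
  set (hh := fun i => if Nat.leb i e then h i else 0).
  assert (Hg0 : g 0%nat <> 0) by (unfold g; rewrite Nat.add_0_r; auto).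
  assert (Hgs : forall i, (B < i)%nat -> g i = 0) by (intros; apply HB; lia).
  assert (Hhs : forall i, (e < i)%nat -> hh i = 0) by (intros; unfold hh; now rewrite leb_correct_conv).
  exists g, (fun i => conv g hh (S e + i)%nat), B, B. split; [auto|split].
  - intros t. rewrite <- HE, <- (ev_stable (qpoch_coef N) B (k + B)) by (auto; lia).
    clearbody k.
    assert (G : forall (f : nat -> R) k, (forall i, (i < k)%nat -> f i = 0) ->
      (Cpown t k * ev (fun n => f (k + n)%nat) B t)%cx = ev f (k + B) t).
    { clear. intros f k; revert f. induction k; intros f H.
      - change (0 + B)%nat with B. simpl Cpown. rewrite (ev_ext _ f) by auto. ring.
      - change (S k + B)%nat with (S (k + B)). rewrite ev_S_l, <- (IHk (fun i => f (S i))) by (intros; apply H; lia).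
        rewrite H by lia. change (fun n => f (S k + n)%nat) with (fun n => f (S (k + n))).
        simpl Cpown. change (RtoC 0) with C0. ring. }
    apply G; auto.
  - intros t. rewrite (ev_ext h hh) by (intros i Hi; unfold hh; now rewrite leb_correct).
    rewrite <- ev_conv by auto.
    assert (HC : forall n, (n <= e)%nat -> conv g hh n = if Nat.eqb n 0 then 1 else 0).
    { intros n Hn. rewrite <- (conv_inv g n Hg0). apply conv_ext; auto.
      intros i Hi. unfold hh. rewrite leb_correct by lia. reflexivity. }
    assert (HCs := conv_support g hh B e Hgs Hhs).
    generalize (conv g hh) HC HCs. clear. intros f HC HCs.
    rewrite <- (ev_stable f (B + e) (S e + B)) by (auto; lia).
    assert (G : forall k (f : nat -> R), ev f (k + B) t = (Csum k (fun i => RtoC (f i) * Cpown t i) + Cpown t k * ev (fun n => f (k + n)%nat) B t)%cx).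
    { clear. induction k; intros f.
      - change (0 + B)%nat with B. simpl Csum. simpl Cpown. change (fun n => f (0 + n)%nat) with f. ring.
      - change (S k + B)%nat with (S (k + B)). rewrite ev_S_l, IHk, Csum_S_l. simpl Cpown.
        change (fun n => f (S k + n)%nat) with (fun n => f (S (k + n))).
        rewrite (Csum_ext k (fun i => RtoC (f (S i)) * (t * Cpown t i))%cx (fun i => t * (RtoC (f (S i)) * Cpown t i))%cx) by (intros; ring).
        rewrite Csum_scal. ring. }
    rewrite G. f_equal.
    rewrite Csum_S_l. rewrite (HC 0%nat) by lia. simpl.
    rewrite (Csum_ext e _ (fun _ => C0)).
    + change (RtoC 1) with C1. assert (Z : forall n, Csum n (fun _ => C0) = C0) by (induction n; simpl; [auto|rewrite IHn; ring]).
      rewrite Z; ring.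
    + intros i Hi. rewrite (HC (S i)) by lia. simpl. change (RtoC 0) with C0. ring.
Qed.

(** * Contour representation of the Laurent coefficients *)

(* Throughout, [q = - exp s], so that [t = q + 1] is [tt s]. *)
Definition tt (s : Cplx) : Cplx := (C1 - Cexp s)%cx.
(* A star-shaped set about [0] avoiding the other zeros of [(q)_N], which are purely imaginary. *)
Definition slit (N : nat) (s : Cplx) : Prop := Cre s <> 0 \/ Rabs (Cim s) < PI / INR N.
(** The form t^(-m-1) dq/(q)_N pulled back to s; the last factor is dq/ds. *)
Definition integrand (m : Z) (N : nat) (s : Cplx) : Cplx :=
  (/ qpoch N (- Cexp s) * Cpowz (tt s) (- m - 1) * (- Cexp s))%cx.

Lemma Cpown_S z n : Cpown z (S n) = (z * Cpown z n)%cx.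
Proof. reflexivity. Qed.
Lemma Cpown_add z a b : Cpown z (a + b) = (Cpown z a * Cpown z b)%cx.
Proof. induction a; simpl; [ring|]. rewrite IHa; ring. Qed.
Lemma Cpown_neq0 z n : z <> C0 -> Cpown z n <> C0.
Proof.
  intros H; induction n; simpl; [|now apply Cmul_neq0].
  intros E; apply (f_equal Cre) in E; simpl in E; lra.
Qed.
Lemma Cpown_mul z w n : Cpown (z * w)%cx n = (Cpown z n * Cpown w n)%cx.
Proof. induction n; simpl; [ring|]. rewrite IHn; ring. Qed.
Lemma Cpowz_sub z a b m : z <> C0 -> m = (Z.of_nat a - Z.of_nat b)%Z ->
  Cpowz z m = (Cpown z a / Cpown z b)%cx.
Proof.
  intros Hz ->. destruct (le_lt_dec b a) as [H|H].
  - replace (Z.of_nat a - Z.of_nat b)%Z with (Z.of_nat (a - b)) by lia.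
    replace a with (b + (a - b))%nat at 2 by lia. rewrite Cpown_add.
    destruct (a - b)%nat as [|n].
    + simpl. field. now apply Cpown_neq0.
    + simpl Z.of_nat. unfold Cpowz. rewrite SuccNat2Pos.id_succ. field. now apply Cpown_neq0.
  - replace (Z.of_nat a - Z.of_nat b)%Z with (- Z.of_nat (b - a))%Z by lia.
    replace b with (a + (b - a))%nat at 2 by lia. rewrite Cpown_add.
    destruct (b - a)%nat as [|n] eqn:E; [lia|].
    simpl Z.opp. unfold Cpowz. rewrite SuccNat2Pos.id_succ. field.
    split; now apply Cpown_neq0.
Qed.

Lemma cos_eq_1 x : Rabs x < 2 * PI -> cos x = 1 -> x = 0.
Proof.
  intros H E. assert (Hc : mkC 0 x = C0).
  { apply Cexp_inj_im.
    - rewrite Cexp_0. apply cx_eq; simpl; rewrite exp_0, ?E; [ring|].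
      assert (S := sin2_cos2 x). unfold Rsqr in S. rewrite E in S.
      assert (sin x * sin x = 0) by lra. apply Rmult_integral in H0. destruct H0 as [->| ->]; ring.
    - simpl. rewrite Rminus_0_r. exact H. }
  now apply (f_equal Cim) in Hc.
Qed.
Lemma cos_gt_m1 x : Rabs x < PI -> -1 < cos x.
Proof.
  intros H. replace x with (2 * (x / 2)) by field. rewrite cos_2a_cos.
  assert (0 < cos (x / 2)) by (apply Rabs_def2 in H; apply cos_gt_0; lra). nra.
Qed.

Lemma neg_exp_pown s j : Cpown (- Cexp s)%cx j = (RtoC ((-1) ^ j) * Cexp (RtoC (INR j) * s))%cx.
Proof.
  replace (- Cexp s)%cx with (RtoC (-1) * Cexp s)%cx by (apply cx_eq; simpl; ring).
  rewrite Cpown_mul, <- Cexp_nat. f_equal.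
  induction j; simpl; [reflexivity|]. rewrite IHj, <- RtoC_mul. reflexivity.
Qed.

Lemma exp_re_eq1 z : Cnorm (Cexp z) = 1 -> Cre z = 0.
Proof. rewrite Cnorm_exp. intros H. rewrite <- exp_0 in H. now apply exp_inv. Qed.

(** A zero forces |exp s| = 1, hence Re s = 0 and |j Im s| < PI. For even j this leaves only j Im s
    = 0, and for odd j the cosine would have to be -1, which is impossible in that range. *)
Lemma slit_factor_neq0 N s j : slit N s -> s <> C0 -> (1 <= j <= N)%nat ->
  (C1 - Cpown (- Cexp s) j)%cx <> C0.
Proof.
  intros Hs Hs0 Hj E.
  assert (E1 : Cpown (- Cexp s)%cx j = C1).
  { replace (Cpown (- Cexp s)%cx j) with (C1 - (C1 - Cpown (- Cexp s) j))%cx by ring. rewrite E; ring. }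
  assert (Hj0 : 0 < INR j) by (apply lt_0_INR; lia).
  assert (Hr : Cre s = 0).
  { apply exp_re_eq1. rewrite <- (Rabs_right (Cnorm (Cexp s))) by (apply Rle_ge, Cnorm_nonneg).
    assert (P : Cnorm (Cexp s) ^ j = 1).
    { rewrite <- (Cnorm_opp (Cexp s)), <- Cnorm_pown, E1. apply Cnorm_1. }
    assert (p := exp_pos (Cre s)). rewrite <- Cnorm_exp in p.
    rewrite Rabs_right by lra.
    destruct (Rtotal_order (Cnorm (Cexp s)) 1) as [h|[h|h]]; auto.
    - assert (Cnorm (Cexp s) ^ j < 1) by (apply pow_lt_1_compat; [lra|lia]). lra.
    - assert (1 < Cnorm (Cexp s) ^ j) by (apply Rlt_pow_R1; [lra|lia]). lra. }
  destruct Hs as [Hs|Hs]; [lra|].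
  assert (Hi : Cim s <> 0) by (intros Hi; apply Hs0; apply cx_eq; auto).
  assert (HN : 0 < INR N) by (apply lt_0_INR; lia).
  assert (B : Rabs (INR j * Cim s) < PI).
  { rewrite Rabs_mult, Rabs_right by lra.
    apply Rle_lt_trans with (INR N * Rabs (Cim s)).
    - apply mul_le_r; [apply Rabs_pos|]. apply le_INR; lia.
    - apply (Rmult_lt_compat_l (INR N)) in Hs; auto. replace (INR N * (PI / INR N)) with PI in Hs by (field; lra). exact Hs. }
  rewrite neg_exp_pown in E1. apply (f_equal Cre) in E1. simpl in E1. rewrite Hr in E1.
  replace (INR j * 0 - 0 * Cim s) with 0 in E1 by ring.
  replace (INR j * Cim s + 0 * 0) with (INR j * Cim s) in E1 by ring. rewrite exp_0 in E1.
  assert (G : (-1) ^ j = 1 \/ (-1) ^ j = -1).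
  { clear. induction j; simpl; [left; auto|]. destruct IHj as [->| ->]; [right|left]; ring. }
  destruct G as [G|G]; rewrite G in E1.
  - assert (INR j * Cim s = 0). { apply cos_eq_1; [generalize PI_RGT_0; lra|lra]. }
    apply Rmult_integral in H. lra.
  - generalize (cos_gt_m1 _ B). lra.
Qed.

Lemma slit_tt_neq0 N s : (1 <= N)%nat -> slit N s -> s <> C0 -> tt s <> C0.
Proof.
  intros HN Hs Hs0 E. unfold tt in E.
  assert (E1 : Cexp s = C1) by (replace (Cexp s) with (C1 - (C1 - Cexp s))%cx by ring; rewrite E; ring).
  assert (Hr : Cre s = 0) by (apply exp_re_eq1; rewrite E1; apply Cnorm_1).
  destruct Hs as [Hs|Hs]; [lra|].
  assert (HN' : 1 <= INR N) by (change 1 with (INR 1); apply le_INR; auto).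
  apply Hs0, cx_eq; auto. simpl. apply cos_eq_1.
  - eapply Rlt_le_trans; [exact Hs|]. assert (/ INR N <= 1) by (rewrite <- Rinv_1; apply inv_le; lra).
    generalize PI_RGT_0. nra.
  - apply (f_equal Cre) in E1. simpl in E1. rewrite Hr, exp_0 in E1. lra.
Qed.

Lemma qpoch_neq0 N s : slit N s -> s <> C0 -> qpoch N (- Cexp s)%cx <> C0.
Proof.
  intros Hs Hs0.
  assert (G : forall n, (n <= N)%nat -> qpoch n (- Cexp s)%cx <> C0).
  { induction n; intros Hn; cbn [qpoch].
    - intros E; apply (f_equal Cre) in E; simpl in E; lra.
    - apply Cmul_neq0; [apply IHn; lia|]. apply (slit_factor_neq0 N); auto; lia. }
  apply G; auto.
Qed.

Lemma slit_star_open N : (1 <= N)%nat -> star_open (slit N).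
Proof.
  intros HN. assert (HN' : 0 < INR N) by (apply lt_0_INR; lia).
  assert (HP : 0 < PI / INR N) by (apply Rdiv_lt_0_compat; auto; apply PI_RGT_0).
  split.
  - intros z t [Hz|Hz] Ht.
    + destruct (Req_dec t 0) as [->|Hne].
      * right. simpl. replace (0 * Cim z + 0 * Cre z) with 0 by ring. now rewrite Rabs_R0.
      * left. simpl. rewrite Rmult_0_l, Rminus_0_r. now apply Rmult_integral_contrapositive.
    + right. simpl. rewrite Rmult_0_l, Rplus_0_r, Rabs_mult, (Rabs_right t) by lra.
      generalize (Rabs_pos (Cim z)). nra.
  - intros g x y [H1 H2] [Hz|Hz].
    + assert (Hp : 0 < Rabs (Cre (g x y))) by (now apply Rabs_pos_lt).
      generalize (H1 (mkposreal _ Hp)). apply locally_2d_impl, locally_2d_forall. intros u v H. simpl in H.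
      left. intros E. rewrite E in H. unfold Rminus in H. rewrite Rplus_0_l, Rabs_Ropp in H. lra.
    + assert (Hp : 0 < PI / INR N - Rabs (Cim (g x y))) by lra.
      generalize (H2 (mkposreal _ Hp)). apply locally_2d_impl, locally_2d_forall. intros u v H. simpl in H.
      right. generalize (Rabs_triang (Cim (g u v) - Cim (g x y)) (Cim (g x y))).
      replace (Cim (g u v) - Cim (g x y) + Cim (g x y)) with (Cim (g u v)) by ring. lra.
Qed.

Lemma Hol_ev D f f' c n : Hol D f f' -> exists h', Hol D (fun z => ev c n (f z)) h'.
Proof.
  intros H. unfold ev. generalize (S n). clear n. induction n as [|n [h' IH]]; cbn [Csum].
  - eexists; apply Hol_const.
  - destruct (Hol_pown D f f' n H) as [p' Hp].
    eexists. eapply Hol_add; [exact IH|]. eapply (Hol_mul _ (fun _ => RtoC (c n))); [apply Hol_const|exact Hp].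
Qed.
Lemma Hol_tt D : Hol D tt (fun z => - Cexp z)%cx.
Proof.
  apply Hol_val with (fun z => C0 + - (Cexp z * C1))%cx; [|intros; ring].
  apply (Hol_add _ (fun _ => C1)); [apply Hol_const|]. apply Hol_opp. apply (Hol_exp _ (fun z => z)), Hol_id.
Qed.

Definition seg (F : Cplx -> Cplx) (a b : Cplx) : Cplx :=
  CInt (fun u => F (lin a (b - a) u) * (b - a))%cx 0 1.

Lemma lin_0 a d : lin a d 0 = a.
Proof. unfold lin. change (RtoC 0) with C0. ring. Qed.
Lemma lin_1 a b : lin a (b - a) 1 = b.
Proof. unfold lin. change (RtoC 1) with C1. ring. Qed.

(** Termwise primitive of the polar terms h_j t^(j-e-1) with j < e. The term j = e is omitted here,
    as its primitive is a logarithm. *)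
Definition polar_prim (h : nat -> R) (e : nat) (t : Cplx) : Cplx :=
  Csum e (fun j => RtoC (h j * - / INR (e - j)) * / Cpown t (e - j))%cx.

Lemma cder_pown f x l n : cder f x l ->
  cder (fun u => Cpown (f u) (S n)) x (RtoC (INR (S n)) * Cpown (f x) n * l)%cx.
Proof.
  intros H. induction n.
  - simpl. eapply cder_val; [apply cder_mul; [exact H|apply cder_const]|]. cbv beta. change (RtoC 1) with C1. ring.
  - eapply cder_val; [apply (cder_mul f (fun u => Cpown (f u) (S n))); [exact H|apply IHn]|].
    rewrite (S_INR (S n)), RtoC_add, !Cpown_S. change (RtoC 1) with C1. ring.
Qed.

Lemma polar_prim_der h e f x l : cder f x l -> f x <> C0 ->
  cder (fun u => polar_prim h e (f u)) x (Csum e (fun j => RtoC (h j) * Cpown (f x) j) / Cpown (f x) (S e) * l)%cx.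
Proof.
  intros H Hx.
  assert (G : forall n, (n <= e)%nat -> cder (fun u => Csum n (fun j => RtoC (h j * - / INR (e - j)) * / Cpown (f u) (e - j)))%cx x
    (Csum n (fun j => RtoC (h j) * Cpown (f x) j) / Cpown (f x) (S e) * l)%cx).
  { induction n; intros Hn; cbn [Csum].
    - eapply cder_val; [apply cder_const|]. field. apply Cpown_neq0; auto.
    - eapply cder_val.
      + apply cder_add; [apply IHn; lia|]. apply cder_scal.
        replace (e - n)%nat with (S (e - n - 1)) by lia. apply cder_inv; [apply cder_pown; exact H|].
        apply Cpown_neq0; auto.
      + set (p := (e - n - 1)%nat).
        assert (Ep : (e - n = S p)%nat) by (unfold p; lia). rewrite ?Ep.
        assert (Hp : INR (S p) <> 0) by (apply not_0_INR; lia).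
        rewrite RtoC_mul, RtoC_opp, RtoC_inv by auto.
        replace (S e) with (S p + (n + 1))%nat by (unfold p; lia). rewrite !Cpown_add, !Cpown_S. change (Cpown (f x) 0) with C1.
        apply RtoC_neq0 in Hp.
        field. repeat split; auto; apply Cpown_neq0; auto. }
  apply G; auto.
Qed.

Definition isreal (z : Cplx) : Prop := Cim z = 0.
Lemma isreal_mul z w : isreal z -> isreal w -> isreal (z * w)%cx.
Proof. unfold isreal; simpl; intros -> ->; ring. Qed.
Lemma isreal_add z w : isreal z -> isreal w -> isreal (z + w)%cx.
Proof. unfold isreal; simpl; intros -> ->; ring. Qed.
Lemma isreal_opp z : isreal z -> isreal (- z)%cx.
Proof. unfold isreal; simpl; intros ->; ring. Qed.
Lemma isreal_inv z : isreal z -> isreal (/ z)%cx.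
Proof. unfold isreal; simpl; intros ->; unfold Rdiv; ring. Qed.
Lemma isreal_exp z : isreal z -> isreal (Cexp z).
Proof. unfold isreal; simpl; intros ->; rewrite sin_0; ring. Qed.
Lemma isreal_RtoC a : isreal (RtoC a). Proof. reflexivity. Qed.
Lemma isreal_pown z n : isreal z -> isreal (Cpown z n).
Proof. intros H; induction n; simpl; [reflexivity|now apply isreal_mul]. Qed.
Lemma isreal_Csum n F : (forall i, isreal (F i)) -> isreal (Csum n F).
Proof. intros H; induction n; simpl; [reflexivity|apply isreal_add; auto]. Qed.
Lemma isreal_tt z : isreal z -> isreal (tt z).
Proof. intros H. apply isreal_add; [reflexivity|]. now apply isreal_opp, isreal_exp. Qed.
Lemma isreal_star_prim f z : (forall z, isreal z -> isreal (f z)) -> isreal z -> isreal (star_prim f z).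
Proof.
  intros Hf Hz. apply isreal_mul; auto. unfold isreal, CInt; simpl.
  rewrite (RInt_ext _ (fun _ => 0)).
  - rewrite (RInt_const (V := RV)). unfold scal; simpl; unfold mult; simpl; ring.
  - intros x _. apply Hf. apply isreal_mul; auto. reflexivity.
Qed.

Lemma Clog_rot_right w : 0 < Cre w -> Cim w < 0 -> Clog (Ci * w)%cx = (Clog w + mkC 0 (PI / 2))%cx.
Proof.
  intros H1 H2. assert (H3 : 0 < Cre (Ci * w)%cx) by (simpl; lra).
  apply Cexp_inj_im.
  - rewrite Cexp_add, !Cexp_Clog by auto. replace (Cexp (mkC 0 (PI / 2))) with Ci; [ring|].
    apply cx_eq; simpl; rewrite exp_0, ?cos_PI2, ?sin_PI2; ring.
  - generalize (Clog_im_bound _ H1) (Clog_im_bound _ H3) PI_RGT_0. cbn [Cim Cadd]. intros. apply Rabs_def1; lra.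
Qed.
Lemma Clog_rot_left w : Cre w < 0 -> Cim w < 0 -> Clog (Ci * w)%cx = (Clog (- w) - mkC 0 (PI / 2))%cx.
Proof.
  intros H1 H2. assert (H3 : 0 < Cre (Ci * w)%cx) by (simpl; lra).
  assert (H4 : 0 < Cre (- w)%cx) by (simpl; lra).
  apply Cexp_inj_im.
  - rewrite Cexp_sub, !Cexp_Clog by auto. replace (Cexp (mkC 0 (PI / 2))) with Ci.
    + apply cx_eq; simpl; unfold Cnorm2; simpl; field.
    + apply cx_eq; simpl; rewrite exp_0, ?cos_PI2, ?sin_PI2; ring.
  - generalize (Clog_im_bound _ H3) (Clog_im_bound _ H4) PI_RGT_0. unfold Csub. cbn [Cim Cadd Copp]. intros. apply Rabs_def1; lra.
Qed.

Lemma qpoch_Hol N : exists q', Hol (fun _ => True) (fun s => qpoch N (- Cexp s)%cx) q'.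
Proof.
  induction N as [|n [q' IH]]; cbn [qpoch].
  - eexists; apply Hol_const.
  - destruct (Hol_pown (fun _ => True) (fun s => - Cexp s)%cx _ (S n)
      (Hol_opp _ _ _ (Hol_exp _ (fun z => z) _ (Hol_id _)))) as [p' Hp].
    eexists. eapply Hol_mul; [exact IH|]. eapply (Hol_add _ (fun _ => C1)); [apply Hol_const|].
    apply Hol_opp, Hp.
Qed.

Lemma integrand_ccont m N (z : R -> Cplx) (u : R) d : (1 <= N)%nat -> cder z u d -> slit N (z u) -> z u <> C0 ->
  ccont (fun u => integrand m N (z u)) u.
Proof.
  intros HN Hz s1 s2. assert (Ht := slit_tt_neq0 N _ HN s1 s2).
  assert (Htd : cder (fun u => tt (z u)) u (- Cexp (z u) * d)%cx) by (apply (hol_der (fun _ => True) _ _ (Hol_tt _)); auto).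
  apply ccont_mul; [apply ccont_mul|].
  - destruct (qpoch_Hol N) as [q' Hq].
    eapply cder_ccont. apply cder_inv; [|apply qpoch_neq0; auto].
    apply (hol_der _ _ _ Hq); [exact Hz|auto].
  - generalize (- m - 1)%Z. intros [|p|p].
    + apply ccont_const.
    + destruct (Pos2Nat.is_succ p) as [n En]. unfold Cpowz. rewrite En.
      eapply cder_ccont, (cder_pown (fun u => tt (z u))), Htd.
    + destruct (Pos2Nat.is_succ p) as [n En]. unfold Cpowz. rewrite En.
      eapply cder_ccont. apply cder_inv; [apply (cder_pown (fun u => tt (z u))), Htd|]. apply Cpown_neq0; auto.
  - eapply cder_ccont. apply cder_opp, cder_exp, Hz.
Qed.

Section Contour.
Variables (m : Z) (N e : nat).
Hypothesis HN : (1 <= N)%nat.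
Hypothesis He : Z.of_nat e = (m + Z.of_nat (N / 2))%Z.
Variables (g W : nat -> R) (Bg Bw : nat).
Let h := inv_series (fun n => qpoch_coef N (N / 2 + n)%nat).
Hypothesis Hg0 : g 0%nat <> 0.
Hypothesis Hg : forall t, (Cpown t (N / 2) * ev g Bg t)%cx = qpoch N (t - C1)%cx.
Hypothesis HW : forall t, (ev g Bg t * ev h e t)%cx = (C1 + Cpown t (S e) * ev W Bw t)%cx.

Definition reg_part (s : Cplx) : Cplx := (ev W Bw (tt s) * / ev g Bg (tt s) * (- Cexp s))%cx.

(** Away from s = 0 this follows from t^k g = (q)_N, and at s = 0 the value is the nonzero constant
    term. Hence the regular part is holomorphic across s = 0. *)
Lemma slit_g_neq0 s : slit N s -> ev g Bg (tt s) <> C0.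
Proof.
  intros Hs E.
  destruct (classic (s = C0)) as [->|Hs0].
  - replace (tt C0) with C0 in E by (unfold tt; rewrite Cexp_0; ring).
    unfold ev in E. rewrite Csum_S_l, (Csum_ext Bg _ (fun _ => C0)) in E by (intros; simpl; ring).
    assert (Z : forall n, Csum n (fun _ => C0) = C0) by (induction n; simpl; [auto|rewrite IHn; ring]).
    rewrite Z in E. apply Hg0, RtoC_inj. change (RtoC 0) with C0. rewrite <- E. simpl; ring.
  - apply (qpoch_neq0 N s Hs Hs0). replace (- Cexp s)%cx with (tt s - C1)%cx by (unfold tt; ring).
    rewrite <- Hg, E; ring.
Qed.

Lemma reg_Hol : exists r', Hol (slit N) reg_part r'.
Proof.
  destruct (Hol_ev (slit N) tt _ W Bw (Hol_tt _)) as [w' Hw].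
  destruct (Hol_ev (slit N) tt _ g Bg (Hol_tt _)) as [g' Hg'].
  eexists. apply Hol_mul.
  - eapply Hol_mul; [exact Hw|]. apply (Hol_inv _ _ _ Hg'). apply slit_g_neq0.
  - apply Hol_opp. apply (Hol_exp _ (fun z => z)), Hol_id.
Qed.

Lemma integrand_split s : slit N s -> s <> C0 -> integrand m N s =
  (Csum e (fun j => RtoC (h j) * Cpown (tt s) j) / Cpown (tt s) (S e) * (- Cexp s)
   + RtoC (h e) * (- Cexp s / tt s) - reg_part s)%cx.
Proof.
  intros Hs Hs0. assert (Ht := slit_tt_neq0 N s HN Hs Hs0). assert (Hgn := slit_g_neq0 s Hs).
  unfold integrand, reg_part. rewrite (Cpowz_sub _ (N / 2) (S e)) by (auto; lia).
  replace (- Cexp s)%cx with (tt s - C1)%cx at 1 by (unfold tt; ring). rewrite <- Hg.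
  specialize (HW (tt s)). unfold ev at 2 in HW. cbn [Csum] in HW.
  set (t := tt s) in *. set (G := ev g Bg t) in *. set (w := ev W Bw t) in *.
  set (S0 := Csum e _) in *. rewrite Cpown_S in *. set (P := Cpown t e) in *.
  assert (HP : P <> C0) by (apply Cpown_neq0; auto).
  set (K := Cpown t (N / 2)). assert (HK : K <> C0) by (apply Cpown_neq0; auto).
  assert (E : (C1 = G * (S0 + RtoC (h e) * P) - t * P * w)%cx) by (rewrite HW; ring).
  transitivity (C1 * (/ G * / (t * P)) * - Cexp s)%cx; [field; repeat split; auto|].
  rewrite E at 1. field. repeat split; auto.
Qed.

(** The branch [lg] of log t is left open, because no single principal branch serves the whole half
    contour. *)
Lemma seg_formula a b (lg : Cplx -> Cplx) :
  (forall u, 0 <= u <= 1 -> slit N (lin a (b - a) u) /\ lin a (b - a) u <> C0) ->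
  (forall u, 0 <= u <= 1 -> cder (fun u => lg (lin a (b - a) u)) u
     (- Cexp (lin a (b - a) u) / tt (lin a (b - a) u) * (b - a))%cx) ->
  seg (integrand m N) a b =
   ((polar_prim h e (tt b) + RtoC (h e) * lg b - star_prim reg_part b)
   - (polar_prim h e (tt a) + RtoC (h e) * lg a - star_prim reg_part a))%cx.
Proof.
  intros Hsl Hlg. destruct reg_Hol as [r' Hr]. assert (HD := slit_star_open N HN).
  unfold seg. set (d := (b - a)%cx) in *. set (z := lin a d) in *.
  assert (Htd : forall u, cder (fun u => tt (z u)) u (- Cexp (z u) * d)%cx).
  { intros u. apply (hol_der (fun _ => True) _ _ (Hol_tt _)); [apply cder_lin|auto]. }
  assert (Hpd : forall u, 0 <= u <= 1 -> cder (fun u => polar_prim h e (tt (z u))) u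
      (Csum e (fun j => RtoC (h j) * Cpown (tt (z u)) j) / Cpown (tt (z u)) (S e) * (- Cexp (z u)) * d)%cx).
  { intros u Hu. destruct (Hsl u Hu). eapply cder_val.
    - apply (polar_prim_der h e (fun u => tt (z u))); [apply Htd|]. apply (slit_tt_neq0 N); auto.
    - cbv beta; ring. }
  assert (Hreg : forall u, 0 <= u <= 1 -> cder (fun u => star_prim reg_part (z u)) u (reg_part (z u) * d)%cx).
  { intros u Hu. destruct (Hsl u Hu).
    apply (star_prim_der (slit N) reg_part r' HD Hr (fun _ => True) z (fun _ => d)); auto using open_true, ccont_const.
    intros; apply cder_lin. }
  assert (Hall : forall u, 0 <= u <= 1 -> cder (fun u => polar_prim h e (tt (z u)) + RtoC (h e) * lg (z u) - star_prim reg_part (z u))%cx u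
      (integrand m N (z u) * d)%cx).
  { intros u Hu. destruct (Hsl u Hu). eapply cder_val.
    - apply cder_sub; [apply cder_add; [apply Hpd; auto|apply cder_scal, Hlg; auto]|apply Hreg; auto].
    - rewrite integrand_split by auto. ring. }
  rewrite (CInt_derive (fun u => polar_prim h e (tt (z u)) + RtoC (h e) * lg (z u) - star_prim reg_part (z u))%cx).
  - unfold z. rewrite lin_0. unfold d. rewrite lin_1. reflexivity.
  - intros u Hu. minmax Hu. auto.
  - intros u Hu. minmax Hu. destruct (Hsl u Hu) as [s1 s2].
    apply ccont_mul; [|apply ccont_const]. apply (integrand_ccont m N z u d); auto. apply cder_lin.
Qed.

(** In the t-plane the path runs from the negative axis through Im t < 0 to the positive axis. The
    logarithms of -t, i t, i t and t are principal on the four segments. The polar and regular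
    primitives are continuous at the corners and real at the ends, so only the two jumps of PI/2
    between branches survive, each multiplied by h_e. *)
Lemma contour_sum p0 p1 p2 p3 p4 : isreal p0 -> isreal p4 ->
  (forall u, 0 <= u <= 1 -> slit N (lin p0 (p1 - p0) u) /\ Cre (tt (lin p0 (p1 - p0) u)) < 0) ->
  (forall u, 0 <= u <= 1 -> slit N (lin p1 (p2 - p1) u) /\ Cim (tt (lin p1 (p2 - p1) u)) < 0) ->
  (forall u, 0 <= u <= 1 -> slit N (lin p2 (p3 - p2) u) /\ Cim (tt (lin p2 (p3 - p2) u)) < 0) ->
  (forall u, 0 <= u <= 1 -> slit N (lin p3 (p4 - p3) u) /\ 0 < Cre (tt (lin p3 (p4 - p3) u))) ->
  Cim (seg (integrand m N) p0 p1 + seg (integrand m N) p1 p2 + seg (integrand m N) p2 p3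
       + seg (integrand m N) p3 p4)%cx = PI * h e.
Proof.
  intros R0 R4 H1 H2 H3 H4.
  assert (Z : forall s, tt s <> C0 -> s <> C0).
  { intros s Hs ->. apply Hs. unfold tt. rewrite Cexp_0; ring. }
  assert (Hlog : forall (k : Cplx) a b u, k <> C0 -> 0 < Cre (k * tt (lin a (b - a) u))%cx ->
    cder (fun u => Clog (k * tt (lin a (b - a) u)))%cx u (- Cexp (lin a (b - a) u) / tt (lin a (b - a) u) * (b - a))%cx).
  { intros k a b u Hk Hp. eapply cder_val.
    - apply cder_log; [|exact Hp]. apply cder_scal.
      apply (hol_der (fun _ => True) _ _ (Hol_tt _)); [apply cder_lin|auto].
    - cbv beta. set (t := tt _) in *.
      assert (t <> C0) by (intros E; rewrite E in Hp; simpl in Hp; lra).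
      field. auto. }
  assert (Hm1 : (- C1)%cx <> C0) by (apply Cre_neq0; simpl; lra).
  assert (Hci : Ci <> C0) by (apply Cim_neq0; simpl; lra).
  assert (H1n : C1 <> C0) by (apply Cre_neq0; simpl; lra).
  rewrite (seg_formula p0 p1 (fun s => Clog (- C1 * tt s)%cx)).
  2:{ intros u Hu; destruct (H1 u Hu); split; auto. apply Z, Cre_neq0; lra. }
  2:{ intros u Hu; destruct (H1 u Hu). apply Hlog; auto. simpl in *; lra. }
  rewrite (seg_formula p1 p2 (fun s => Clog (Ci * tt s)%cx)).
  2:{ intros u Hu; destruct (H2 u Hu); split; auto. apply Z, Cim_neq0; lra. }
  2:{ intros u Hu; destruct (H2 u Hu). apply Hlog; auto. simpl in *; lra. }
  rewrite (seg_formula p2 p3 (fun s => Clog (Ci * tt s)%cx)).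
  2:{ intros u Hu; destruct (H3 u Hu); split; auto. apply Z, Cim_neq0; lra. }
  2:{ intros u Hu; destruct (H3 u Hu). apply Hlog; auto. simpl in *; lra. }
  rewrite (seg_formula p3 p4 (fun s => Clog (C1 * tt s)%cx)).
  2:{ intros u Hu; destruct (H4 u Hu); split; auto. apply Z, Cre_neq0; lra. }
  2:{ intros u Hu; destruct (H4 u Hu). apply Hlog; auto. simpl in *; lra. }
  destruct (H1 0) as [_ A0]; [lra|]. destruct (H1 1) as [_ A1]; [lra|]. destruct (H2 0) as [_ B1]; [lra|].
  destruct (H3 1) as [_ B3]; [lra|]. destruct (H4 0) as [_ C3]; [lra|]. destruct (H4 1) as [_ C4]; [lra|].
  rewrite ?lin_0, ?lin_1 in *.
  rewrite (Clog_rot_left (tt p1)), (Clog_rot_right (tt p3)) by auto.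
  replace (- C1 * tt p1)%cx with (- tt p1)%cx by ring.
  replace (C1 * tt p3)%cx with (tt p3)%cx by ring.
  assert (Hre : forall s, isreal s -> isreal (polar_prim h e (tt s) - star_prim reg_part s)%cx).
  { intros s Hs. apply isreal_add.
    - apply isreal_Csum. intros i. apply isreal_mul; [reflexivity|]. apply isreal_inv, isreal_pown, isreal_tt, Hs.
    - apply isreal_opp, isreal_star_prim; auto. intros z Hz.
      apply isreal_mul; [apply isreal_mul|].
      + apply isreal_Csum. intros i; apply isreal_mul; [reflexivity|]. apply isreal_pown, isreal_tt, Hz.
      + apply isreal_inv, isreal_Csum. intros i; apply isreal_mul; [reflexivity|]. apply isreal_pown, isreal_tt, Hz.
      + apply isreal_opp, isreal_exp, Hz. }
  assert (Hlr : forall w, isreal w -> 0 < Cre w -> Cim (Clog w) = 0).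
  { intros w Hw Hp. replace w with (RtoC (Cre w)) by (apply cx_eq; auto). rewrite Clog_RtoC; auto. }
  assert (L0 : Cim (Clog (- C1 * tt p0)%cx) = 0).
  { apply Hlr; [apply isreal_mul; [apply isreal_opp, isreal_RtoC|apply isreal_tt, R0]|simpl in *; lra]. }
  assert (L4 : Cim (Clog (C1 * tt p4)%cx) = 0).
  { apply Hlr; [apply isreal_mul; [apply isreal_RtoC|apply isreal_tt, R4]|simpl in *; lra]. }
  assert (P0 := Hre p0 R0). assert (P4 := Hre p4 R4). unfold isreal, Csub in P0, P4. cbn [Cim Cadd Copp] in P0, P4.
  cbn [Cim Cre Cadd Copp Cmul RtoC]. unfold Csub in *. cbn [Cim Cre Cadd Copp Cmul RtoC] in *.
  rewrite L0, L4.
  match goal with |- ?l = ?r => cut (l - r = 0); [lra|] end.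
  ring_simplify.
  lra.
Qed.
End Contour.

Lemma A_coef_contour m N p0 p1 p2 p3 p4 : (1 <= N)%nat -> (0 <= m + Z.of_nat (N / 2))%Z ->
  isreal p0 -> isreal p4 ->
  (forall u, 0 <= u <= 1 -> slit N (lin p0 (p1 - p0) u) /\ Cre (tt (lin p0 (p1 - p0) u)) < 0) ->
  (forall u, 0 <= u <= 1 -> slit N (lin p1 (p2 - p1) u) /\ Cim (tt (lin p1 (p2 - p1) u)) < 0) ->
  (forall u, 0 <= u <= 1 -> slit N (lin p2 (p3 - p2) u) /\ Cim (tt (lin p2 (p3 - p2) u)) < 0) ->
  (forall u, 0 <= u <= 1 -> slit N (lin p3 (p4 - p3) u) /\ 0 < Cre (tt (lin p3 (p4 - p3) u))) ->
  PI * A_coef m N = Cim (seg (integrand m N) p0 p1 + seg (integrand m N) p1 p2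
     + seg (integrand m N) p2 p3 + seg (integrand m N) p3 p4)%cx.
Proof.
  intros HN Hm R0 R4 H1 H2 H3 H4.
  set (e := Z.to_nat (m + Z.of_nat (N / 2))).
  destruct (laurent_split N e) as (g & W & Bg & Bw & G1 & G2 & G3).
  rewrite (contour_sum m N e HN ltac:(lia) g W Bg Bw G1 G2 G3); auto.
  f_equal. unfold A_coef.
  destruct (Z.ltb_spec (m + Z.of_nat (N / 2)) 0); [lia|]. reflexivity.
Qed.

(** * Logarithms of the factors along the ray *)

Definition allR (x : R) : Prop := True.
Lemma allR_open : open allR. Proof. apply open_true. Qed.
Lemma allR_star : forall x t, allR x -> 0 <= t <= 1 -> allR (t * x). Proof. exact (fun _ _ _ _ => I). Qed.
Lemma allR_pos : forall x, 0 <= x -> allR x. Proof. exact (fun _ _ => I). Qed.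

Section LogLift.
Variable u : R -> Cplx.
Hypothesis Hu : csm allR u.
Hypothesis Hu0 : forall x, u x <> C0.
Variable k0 : Cplx.
Hypothesis Hk0 : Cexp k0 = u 0.

(** A smooth logarithm along a curve that avoids 0 but may leave the domain of the principal
    branch. *)
Definition loglift (x : R) : Cplx := (k0 + cprim (fun x => cD u x / u x) x)%cx.
Lemma logder_csm : csm allR (fun x => cD u x / u x)%cx.
Proof.
  apply csm_mul; [apply allR_open|apply csm_cD, Hu|]. apply csm_inv; auto. apply allR_open.
Qed.
Lemma loglift_csm : csm allR loglift.
Proof.
  apply csm_add; [apply allR_open|apply csm_const, allR_open|].
  apply csm_cprim; auto using allR_open, allR_star, logder_csm.
Qed.
Lemma loglift_der x : cder loglift x (cD u x / u x)%cx.
Proof.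
  eapply cder_val.
  - apply cder_add; [apply cder_const|].
    apply (cprim_der allR allR_open allR_star); [apply logder_csm|exact I].
  - cbv beta; ring.
Qed.
Lemma loglift_0 : loglift 0 = k0.
Proof. unfold loglift. rewrite cprim_0. ring. Qed.
Lemma loglift_exp x : 0 <= x -> Cexp (loglift x) = u x.
Proof.
  intros Hx.
  assert (E : (u x * Cexp (- loglift x) = u 0%R * Cexp (- loglift 0%R))%cx).
  { apply (cder_zero_const (fun x => u x * Cexp (- loglift x))%cx 0 x); auto.
    intros t Ht. eapply cder_val.
    - apply cder_mul; [apply (csm_cder allR); auto; exact I|apply cder_exp, cder_opp, loglift_der].
    - cbv beta. field. auto. }
  rewrite loglift_0, !Cexp_opp, Hk0 in E. assert (H1 := Cexp_neq0 (loglift x)).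
  assert (E2 : (u x / Cexp (loglift x))%cx = C1).
  { unfold Cdiv. rewrite E. field. auto. }
  transitivity (u x / Cexp (loglift x) * Cexp (loglift x))%cx; [rewrite E2; ring|field; auto].
Qed.
Lemma loglift_Clog x : 0 <= x -> (forall t, 0 <= t <= x -> 0 < Cre (u t)) -> k0 = Clog (u 0) ->
  loglift x = Clog (u x).
Proof.
  intros Hx Hp Hk.
  assert (E : (loglift x - Clog (u x) = loglift 0%R - Clog (u 0%R))%cx).
  { apply (cder_zero_const (fun x => loglift x - Clog (u x))%cx 0 x); auto.
    intros t Ht. eapply cder_val.
    - apply cder_sub; [apply loglift_der|apply cder_log; [apply (csm_cder allR); auto; exact I|auto]].
    - ring. }
  rewrite loglift_0, Hk in E. replace (Clog (u 0) - Clog (u 0))%cx with C0 in E by ring.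
  replace (loglift x) with (loglift x - Clog (u x) + Clog (u x))%cx by ring. rewrite E; ring.
Qed.
End LogLift.

Section Ray.
Variable z0 : Cplx.
Hypothesis Hz0 : Cre z0 < 0.
Let c := (RtoC (/ 2) * z0)%cx.

Definition rayE (x : R) : Cplx := Cexp (RtoC x * (RtoC (/ 2) * z0))%cx.
Lemma rayE_cder x : cder rayE x (c * rayE x)%cx.
Proof.
  unfold rayE. eapply cder_val; [apply cder_exp, cder_mul; [apply cder_id|apply cder_const]|].
  cbv beta. fold c. ring.
Qed.
Lemma rayE_csm : csm allR rayE.
Proof.
  apply csm_exp; [apply allR_open|]. apply csm_mul; [apply allR_open| |apply csm_const, allR_open].
  apply csm_RtoC; [apply allR_open|apply smooth_id, allR_open].
Qed.
Lemma c_neq0 : c <> C0.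
Proof. apply Cre_neq0. unfold c; simpl. lra. Qed.
Lemma rayE_0 : rayE 0 = C1.
Proof. unfold rayE. change (RtoC 0) with C0. rewrite <- Cexp_0. f_equal; ring. Qed.
Lemma rayE_norm x : Cnorm (rayE x) = exp (x * (Cre z0 / 2)).
Proof. unfold rayE. rewrite Cnorm_exp. f_equal. simpl. field. Qed.
Lemma rayE_norm_neq1 x : x <> 0 -> Cnorm (rayE x) <> 1.
Proof.
  intros Hx E. rewrite rayE_norm, <- exp_0 in E. apply exp_inv in E.
  apply Rmult_integral in E. lra.
Qed.
Lemma rayE_norm_lt1 x : 0 < x -> Cnorm (rayE x) < 1.
Proof. intros Hx. rewrite rayE_norm, <- exp_0. apply exp_increasing. nra. Qed.

(** The quotient (1 - exp (x c))/(-x c), smooth through x = 0 with value 1 there. It has no zero on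
    the real line, so its logarithm [rayf] is smooth at 0, as the Euler-Maclaurin sums require. *)
Definition ray1 (x : R) : Cplx := (/ c * chav (cD rayE) x)%cx.
Lemma ray1_csm : csm allR ray1.
Proof.
  apply csm_mul; [apply allR_open|apply csm_const, allR_open|].
  apply csm_chav; auto using allR_open, allR_star. apply csm_cD, rayE_csm.
Qed.
Lemma ray1_eq x : (C1 - rayE x)%cx = (- (RtoC x * c) * ray1 x)%cx.
Proof.
  rewrite (chadamard allR allR_star rayE x rayE_csm I), rayE_0. unfold ray1. field. apply c_neq0.
Qed.
Lemma ray1_0 : ray1 0 = C1.
Proof.
  unfold ray1. rewrite chav_at0, (cD_unique _ _ _ (rayE_cder 0)), rayE_0. field. apply c_neq0.
Qed.
Lemma ray1_neq0 x : ray1 x <> C0.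
Proof.
  intros E. destruct (Req_dec x 0) as [->|Hx].
  - rewrite ray1_0 in E. apply (f_equal Cre) in E; simpl in E; lra.
  - assert (E2 := ray1_eq x). rewrite E in E2. apply (rayE_norm_neq1 x Hx).
    replace (rayE x) with (C1 - (C1 - rayE x))%cx by ring. rewrite E2.
    replace (C1 - - (RtoC x * c) * C0)%cx with C1 by ring. apply Cnorm_1.
Qed.
Definition ray2 (x : R) : Cplx := (C1 + rayE x)%cx.
Lemma ray2_csm : csm allR ray2.
Proof. apply csm_add; [apply allR_open|apply csm_const, allR_open|apply rayE_csm]. Qed.
Lemma ray2_neq0 x : ray2 x <> C0.
Proof.
  intros E. destruct (Req_dec x 0) as [->|Hx].
  - unfold ray2 in E. rewrite rayE_0 in E. apply (f_equal Cre) in E; simpl in E; lra.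
  - apply (rayE_norm_neq1 x Hx). replace (rayE x) with (ray2 x - C1)%cx by (unfold ray2; ring).
    rewrite E. replace (C0 - C1)%cx with (- C1)%cx by ring. rewrite Cnorm_opp. apply Cnorm_1.
Qed.

Definition rayf : R -> Cplx := loglift ray1 C0.
Definition rayg : R -> Cplx := loglift ray2 (RtoC (ln 2)).
Lemma rayf_csm : csm allR rayf.
Proof. apply loglift_csm; [apply ray1_csm|apply ray1_neq0]. Qed.
Lemma rayg_csm : csm allR rayg.
Proof. apply loglift_csm; [apply ray2_csm|apply ray2_neq0]. Qed.
Lemma rayf_exp x : 0 <= x -> Cexp (rayf x) = ray1 x.
Proof.
  apply loglift_exp; [apply ray1_csm|apply ray1_neq0|]. now rewrite Cexp_0, ray1_0.
Qed.
Lemma ray2_0 : ray2 0 = RtoC 2.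
Proof. unfold ray2. rewrite rayE_0. apply cx_eq; simpl; ring. Qed.
Lemma rayg_exp x : 0 <= x -> Cexp (rayg x) = ray2 x.
Proof.
  apply loglift_exp; [apply ray2_csm|apply ray2_neq0|]. rewrite Cexp_RtoC, exp_ln by lra. now rewrite ray2_0.
Qed.
Lemma rayf_0 : rayf 0 = C0.
Proof. apply loglift_0. Qed.
Lemma rayg_Clog x : 0 <= x -> rayg x = Clog (ray2 x).
Proof.
  intros Hx. apply loglift_Clog; auto using ray2_csm, ray2_neq0.
  - intros t Ht. destruct (Req_dec t 0) as [->|Hne]; [rewrite ray2_0; simpl; lra|].
    unfold ray2. assert (h1 := Cre_le_norm (rayE t)). assert (h2 := rayE_norm_lt1 t ltac:(lra)).
    assert (h3 : Rabs (Cre (rayE t)) < 1) by lra. apply Rabs_def2 in h3. cbn [Cre Cadd C1 RtoC]. cbn [Cre RtoC]. lra.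
  - rewrite ray2_0, Clog_RtoC by lra. reflexivity.
Qed.

Definition fnodes (b y : R) (F : R -> Cplx) (n : nat) : Cplx := Csum n (fun i => F ((2 * INR (S i) - b) * y)).

Lemma Csum_S_eq n F : Csum (S n) F = (Csum n F + F n)%cx.
Proof. reflexivity. Qed.

Lemma qpoch_S N q : qpoch (S N) q = (qpoch N q * (C1 - Cpown q (S N)))%cx.
Proof. reflexivity. Qed.

(** The factor splits into its linear part in y, which contributes a power and a factorial to the
    product, and the exponential of a smooth function of 2(k+1)y. *)
Lemma ray_even k y : 0 < y -> (C1 - Cpown (- rayE y) (2 * S k) =
  - (RtoC y * z0) * RtoC (INR (S k)) * Cexp (rayf ((2 * INR (S k) - 0) * y)))%cx.
Proof.
  intros Hy. unfold rayE at 1. rewrite neg_exp_pown, pow_1_even.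
  replace (RtoC 1 * Cexp (RtoC (INR (2 * S k)) * (RtoC y * (RtoC (/ 2) * z0))))%cx
    with (rayE ((2 * INR (S k) - 0) * y)).
  - rewrite ray1_eq, rayf_exp.
    + unfold c. rewrite RtoC_mul. replace (RtoC (2 * INR (S k) - 0)) with (RtoC 2 * RtoC (INR (S k)))%cx by (apply cx_eq; simpl; ring).
      assert (E : (RtoC 2 * RtoC (/ 2) = C1)%cx) by (apply cx_eq; simpl; field).
      transitivity (- (RtoC y * ((RtoC 2 * RtoC (/ 2)) * z0)) * RtoC (INR (S k)) * ray1 ((2 * INR (S k) - 0) * y))%cx; [ring|].
      rewrite E. ring.
    + generalize (pos_INR (S k)). intros. apply mul_pos; lra.
  - unfold rayE. change (RtoC 1) with C1.
    transitivity (Cexp (RtoC (INR (2 * S k)) * (RtoC y * (RtoC (/ 2) * z0))))%cx; [|ring].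
    f_equal. rewrite mult_INR. change (INR 2) with 2. apply cx_eq; simpl; ring.
Qed.
Lemma ray_odd k y : 0 < y -> (C1 - Cpown (- rayE y) (S (2 * k)) = Cexp (rayg ((2 * INR (S k) - 1) * y)))%cx.
Proof.
  intros Hy. unfold rayE at 1. rewrite neg_exp_pown, pow_1_odd, rayg_exp.
  - unfold ray2, rayE. rewrite S_INR, mult_INR, (S_INR k). change (INR 2) with 2.
    replace (RtoC ((2 * (INR k + 1) - 1) * y) * (RtoC (/ 2) * z0))%cx
      with (RtoC (2 * INR k + 1) * (RtoC y * (RtoC (/ 2) * z0)))%cx by (apply cx_eq; simpl; ring).
    replace (RtoC (-1)) with (- C1)%cx by (apply cx_eq; simpl; ring). ring.
  - rewrite S_INR. generalize (pos_INR k). intros. apply mul_pos; lra.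
Qed.

Lemma ray_product_even y k : 0 < y -> qpoch (2 * k) (- rayE y)%cx =
  (Cpown (- (RtoC y * z0)) k * RtoC (INR (fact k)) * Cexp (fnodes 0 y rayf k + fnodes 1 y rayg k))%cx.
Proof.
  intros Hy. induction k.
  - change (2 * 0)%nat with 0%nat. unfold fnodes. cbn [qpoch Csum Cpown].
    replace (C0 + C0)%cx with C0 by ring. rewrite Cexp_0. change (INR (fact 0)) with 1. change (RtoC 1) with C1. ring.
  - assert (E1 := ray_even k y Hy). assert (E2 := ray_odd k y Hy).
    replace (2 * S k)%nat with (S (S (2 * k))) in * by lia.
    rewrite !qpoch_S, IHk, E1, E2.
    unfold fnodes. rewrite !Csum_S_eq, Cpown_S, !Cexp_add, fact_simpl, mult_INR, RtoC_mul. ring.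
Qed.
Lemma ray_product y n : 0 < y -> qpoch n (- rayE y)%cx =
  (Cpown (- (RtoC y * z0)) (n / 2) * RtoC (INR (fact (n / 2))) *
   Cexp (fnodes 0 y rayf (n / 2) + fnodes 1 y rayg (n - n / 2)))%cx.
Proof.
  intros Hy. destruct (Nat.Even_or_Odd n) as [[k ->]|[k ->]].
  - replace (2 * k / 2)%nat with k by (rewrite Nat.mul_comm, Nat.div_mul; lia).
    replace (2 * k - k)%nat with k by lia. now apply ray_product_even.
  - replace ((2 * k + 1) / 2)%nat with k by (rewrite (Nat.mul_comm 2), Nat.div_add_l by lia; simpl; lia).
    replace (2 * k + 1 - k)%nat with (S k) by lia. replace (2 * k + 1)%nat with (S (2 * k)) by lia.
    rewrite qpoch_S, ray_product_even, ray_odd by auto.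
    unfold fnodes. rewrite !Csum_S_eq, !Cexp_add. ring.
Qed.

(** * Expansion of 1/(q)_N on the ray *)

Definition par (a : nat) (N : nat) : Prop := (N mod 2 = a)%nat.
(* The product [M! (2/N)^(M+1) e^(N/2)], [M = N/2], collects the zeros split off at [s = 0];
   by Stirling it is asymptotic to [sqrt 2] times [Gam N]. *)
Definition sig (N : nat) : R := INR (fact (N / 2)) * (2 * eps N) ^ S (N / 2) * exp (INR N / 2) / Gam N.
Definition rayS (N : nat) (x : R) : Cplx :=
  (Sm (fun N => N / 2)%nat 0 rayf N x + Sm (fun N => N - N / 2)%nat 1 rayg N x)%cx.
Definition rayA (x : R) : Cplx := (RtoC (/ (2 * x)) * (cprim rayf x + cprim rayg x))%cx.
(** All terms of -log (q)_N proportional to N: those from (-x z0/N)^M and from M! with M = (N -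
    a)/2, and the leading part of the node sums. The powers of 1/N from the first two cancel up to a
    single factor. The bounded terms and the parity corrections a/2 are left in [rayH]. *)
Definition rayP (x : R) : Cplx :=
  (RtoC (/ 2 + / 2 * ln 2 - / 2 * ln x) - RtoC (/ 2) * Clog (- z0) - rayA x)%cx.
Definition rayH (a : nat) (N : nat) (x : R) : Cplx :=
  (RtoC (/ sig N) * Cexp (RtoC (INR a / 2) * (Clog (- z0) + RtoC (ln x)) + RtoC ((1 - INR a / 2) * ln 2)
     - (rayS N x - RtoC (INR N) * rayA x)))%cx.

Lemma par_INR a N : par a N -> 2 * INR (N / 2) = INR N - INR a.
Proof.
  intros H. assert (E := Nat.div_mod_eq N 2). rewrite H in E.
  rewrite E at 2. rewrite plus_INR, mult_INR. simpl; ring.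
Qed.
Lemma par_inf a : (a < 2)%nat -> forall n, exists N, (n <= N)%nat /\ par a N.
Proof.
  intros Ha n. exists (2 * n + a)%nat. split; [lia|]. unfold par.
  rewrite Nat.add_comm, Nat.mul_comm, Nat.Div0.mod_add. now apply Nat.mod_small.
Qed.

Lemma sig_pos N : (1 <= N)%nat -> 0 < sig N.
Proof.
  intros HN. apply Rdiv_lt_0_compat; [|now apply Gam_pos].
  apply mul_lt_pos; [apply mul_lt_pos|apply exp_pos].
  - apply lt_0_INR, lt_O_fact.
  - apply pow_lt. generalize (eps_pos N HN); lra.
Qed.

Lemma Cpown_RtoC a n : Cpown (RtoC a) n = RtoC (a ^ n).
Proof. induction n; simpl; [reflexivity|]. rewrite IHn, <- RtoC_mul. reflexivity. Qed.

Lemma ray_inverse a N x : (a < 2)%nat -> (1 <= N)%nat -> par a N -> 0 < x ->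
  (/ qpoch N (- Cexp (RtoC (x * eps N) * (RtoC (/ 2) * z0))))%cx =
  (RtoC (eps N / Gam N) * Cexp (RtoC (INR N) * rayP x) * rayH a N x)%cx.
Proof.
  intros Ha HN Hp Hx. assert (He := eps_pos N HN). assert (HG := Gam_pos N HN). assert (Hs := sig_pos N HN).
  change (Cexp (RtoC (x * eps N) * (RtoC (/ 2) * z0)))%cx with (rayE (x * eps N)).
  rewrite ray_product by (apply mul_lt_pos; auto).
  assert (ES0 : (fnodes 0 (x * eps N) rayf (N / 2) + fnodes 1 (x * eps N) rayg (N - N / 2))%cx = rayS N x).
  { apply (f_equal2 Cadd); apply Csum_ext; intros i _; [apply (f_equal rayf)|apply (f_equal rayg)]; ring. }
  rewrite ES0. set (S := rayS N x). set (M := (N / 2)%nat) in *.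
  assert (HM := par_INR a N Hp). fold M in HM.
  assert (E1 : Cpown (- (RtoC (x * eps N) * z0))%cx M = Cexp (RtoC (INR M) * (RtoC (ln x + ln (eps N)) + Clog (- z0)))%cx).
  { rewrite Cexp_nat, Cexp_add, Cexp_RtoC, Cexp_Clog by (simpl; lra).
    rewrite exp_plus, !exp_ln by auto. f_equal. ring. }
  (* The definition of [sig] solved for the factorial, so that its growth is explicit and only a
     slowly varying factor remains. *)
  assert (Hf : RtoC (INR (fact M)) = (RtoC (sig N * Gam N) * Cexp (RtoC (- INR N / 2 - (INR M + 1) * (ln 2 + ln (eps N)))))%cx).
  { rewrite Cexp_RtoC, <- RtoC_mul. f_equal. unfold sig. fold M.
    assert (Ep : (2 * eps N) ^ Datatypes.S M = exp ((INR M + 1) * (ln 2 + ln (eps N)))).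
    { rewrite <- S_INR, <- exp_pow_nat, exp_plus, !exp_ln by lra. reflexivity. }
    rewrite Ep. set (A := (INR M + 1) * (ln 2 + ln (eps N))).
    replace (- INR N / 2 - A) with (- (A + INR N / 2)) by field. rewrite exp_Ropp, exp_plus.
    field. split; [apply Rgt_not_eq, exp_pos|split; [apply Rgt_not_eq, exp_pos|lra]]. }
  rewrite E1, Hf.
  assert (HsG : RtoC (sig N * Gam N) <> C0) by (apply RtoC_neq0; nra).
  transitivity (/ RtoC (sig N * Gam N) * Cexp (- (RtoC (INR M) * (RtoC (ln x + ln (eps N)) + Clog (- z0))
     + RtoC (- INR N / 2 - (INR M + 1) * (ln 2 + ln (eps N))) + S)))%cx.
  { rewrite Cexp_opp, !Cexp_add. field. repeat split; auto using Cexp_neq0. }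
  unfold rayH.
  transitivity (RtoC (/ (sig N * Gam N)) * (RtoC (eps N) * Cexp (RtoC (INR N) * rayP x +
    (RtoC (INR a / 2) * (Clog (- z0) + RtoC (ln x)) + RtoC ((1 - INR a / 2) * ln 2)
     - (rayS N x - RtoC (INR N) * rayA x)))))%cx.
  2:{ rewrite Cexp_add. replace (/ (sig N * Gam N)) with (/ Gam N * / sig N) by (field; lra).
      unfold Rdiv. rewrite !RtoC_mul. ring. }
  rewrite <- RtoC_inv by nra. f_equal.
  replace (RtoC (eps N)) with (Cexp (RtoC (ln (eps N)))) by (rewrite Cexp_RtoC, exp_ln; auto).
  rewrite <- Cexp_add. f_equal. unfold rayP. fold S. set (A := rayA x). set (L := Clog (- z0)).
  replace (INR M) with ((INR N - INR a) / 2) by lra. clearbody S A L. clear.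
  apply cx_eq; simpl; field.
Qed.

Variables lo hi : R.
Hypothesis Hlo : 0 < lo.
Hypothesis Hlohi : lo <= hi.

Section Parity.
Variable a : nat.
Hypothesis Ha : (a < 2)%nat.

Lemma INR_a : 0 <= INR a <= 1.
Proof. split; [apply pos_INR|]. change 1 with (INR 1). apply le_INR; lia. Qed.
Lemma HMe : forall N, (1 <= N)%nat -> par a N -> 2 * INR (N / 2) = INR N + 0 - INR a.
Proof. intros N _ Hp. rewrite (par_INR a N Hp). ring. Qed.
Lemma HMo : forall N, (1 <= N)%nat -> par a N -> 2 * INR (N - N / 2) = INR N + 1 - (1 - INR a).
Proof.
  intros N _ Hp. rewrite minus_INR by (apply Nat.div_le_upper_bound; lia).
  generalize (par_INR a N Hp). lra.
Qed.

Notation XP := (Xp (par a) R (box lo hi) (csm posR)).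

Lemma rayS_expansion r : XP r (fun N x => rayS N x - RtoC (INR N) * rayA x)%cx.
Proof.
  assert (Ia := INR_a).
  apply (Xp_ext _ _ _ _ _ (fun N x => (Sm (fun N => N / 2)%nat 0 rayf N x - RtoC (INR N) * (RtoC (/ (2 * x)) * cprim rayf x))
    + (Sm (fun N => N - N / 2)%nat 1 rayg N x - RtoC (INR N) * (RtoC (/ (2 * x)) * cprim rayg x)))%cx).
  { apply evt_all. intros. unfold rayS, rayA. ring. }
  apply Xp_add; [apply pos_add| |].
  - apply (em_exponent allR allR_open allR_star allR_pos lo hi Hlo Hlohi (par a) _ (INR a) 0); try lra.
    + apply HMe.
    + apply par_inf; auto.
    + apply rayf_csm.
  - apply (em_exponent allR allR_open allR_star allR_pos lo hi Hlo Hlohi (par a) _ (1 - INR a) 1); try lra.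
    + apply HMo.
    + apply par_inf; auto.
    + apply rayg_csm.
Qed.

(** The offsets are (a, 0) for the even factors and (1 - a, 1) for the odd ones. The contribution at
    0 vanishes in the first sum because [rayf] is 0 there, and in the second because b = 1. *)
Lemma rayS_limit : exists K, forall N x, (1 <= N)%nat -> par a N -> box lo hi x ->
  Cnorm (rayS N x - RtoC (INR N) * rayA x - (RtoC ((1 - INR a) / 2) * rayf x + RtoC (INR a / 2) * rayg x))%cx <= K * eps N.
Proof.
  assert (Ia := INR_a).
  destruct (em_second_order allR allR_open allR_star allR_pos lo hi Hlo Hlohi (par a) (fun N => N / 2)%nat (INR a) 0 ltac:(lra) ltac:(lra) HMe rayf rayf_csm) as [K1 [_ H1]].
  destruct (em_second_order allR allR_open allR_star allR_pos lo hi Hlo Hlohi (par a) (fun N => N - N / 2)%nat (1 - INR a) 1 ltac:(lra) ltac:(lra) HMo rayg rayg_csm) as [K2 [_ H2]].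
  exists (K1 + K2). intros N x HN Hp Hx. specialize (H1 N x HN Hp Hx). specialize (H2 N x HN Hp Hx).
  rewrite rayf_0 in H1. replace ((1 - 1) / 2) with 0 in H2 by field.
  replace (1 - (1 - INR a)) with (INR a) in H2 by ring.
  rewrite Rmult_plus_distr_r. eapply Rle_trans; [|apply Rplus_le_compat; [exact H1|exact H2]].
  eapply Rle_trans; [right|apply Cnorm_triang]. f_equal. unfold rayS, rayA. change (RtoC 0) with C0. ring.
Qed.
End Parity.
End Ray.

(** If b = beta + b1/N, then 1/b = 1/beta - b1/(N beta b). The factor 1/b on the right is only
    wanted to one order less, which gives the induction. The limit beta keeps b away from 0 and
    identifies its leading coefficient. *)
Lemma Sq_inv Q (HQ : forall n, exists N, (n <= N)%nat /\ Q N) beta b K :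
  beta <> C0 -> (forall N, (1 <= N)%nat -> Q N -> Cnorm (b N - beta)%cx <= K * eps N) ->
  forall r, Sq Q r b -> Sq Q r (fun N => / b N)%cx.
Proof.
  intros Hb HK. assert (Hbp := Cnorm_pos beta Hb).
  assert (Hlow : exists N0, (1 <= N0)%nat /\ forall N, (N0 <= N)%nat -> Q N -> Cnorm beta / 2 <= Cnorm (b N)).
  { assert (HKp : 0 < Rabs K + 1) by (generalize (Rabs_pos K); lra).
    destruct (eps_small (Cnorm beta / 2 / (Rabs K + 1))) as [N0 [H0 H1]].
    { apply Rdiv_lt_0_compat; lra. }
    exists N0. split; auto. intros N HN HQN. specialize (H1 N HN). specialize (HK N ltac:(lia) HQN).
    assert (He := eps_pos N ltac:(lia)).
    assert (H2 : eps N * (Rabs K + 1) < Cnorm beta / 2).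
    { apply (Rmult_lt_compat_r (Rabs K + 1)) in H1; auto.
      replace (Cnorm beta / 2 / (Rabs K + 1) * (Rabs K + 1)) with (Cnorm beta / 2) in H1 by (field; lra). exact H1. }
    generalize (Cnorm_sub_ge beta (beta - b N)%cx). rewrite (Cnorm_sub_sym beta (b N)).
    replace (beta - (beta - b N))%cx with (b N) by ring. generalize (Rle_abs K). nra. }
  destruct Hlow as [N0 [H0 Hlow]].
  induction r; intros HS.
  - exists (/ (Cnorm beta / 2)). exists N0. split; auto. intros N HN HQN _ _.
    specialize (Hlow N HN HQN). rewrite Cnorm_inv.
    + apply inv_le; lra.
    + intros E; rewrite E, Cnorm_0 in Hlow; lra.
  - assert (HSr := Xp_down Q unit _ _ unit_bdd r _ HS).
    destruct HS as (h0 & b1 & _ & HB & n1 & Hn1 & HE).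
    destruct (Xp_bdd Q unit _ _ unit_bdd r _ HB) as [K1 [n2 [Hn2 HK1]]].
    assert (E0 : h0 Datatypes.tt = beta).
    { cut ((h0 Datatypes.tt - beta)%cx = C0).
      { intros E. replace (h0 Datatypes.tt) with (h0 Datatypes.tt - beta + beta)%cx by ring. rewrite E; ring. }
      apply (eps_limit_eq Q HQ _ (K + K1) (n1 + n2)). intros N HN HQN.
      specialize (HE N ltac:(lia) HQN Datatypes.tt I). specialize (HK1 N ltac:(lia) HQN Datatypes.tt I).
      specialize (HK N ltac:(lia) HQN).
      assert (He := eps_pos N ltac:(lia)).
      replace (h0 Datatypes.tt - beta)%cx with ((b N - beta) - RtoC (eps N) * b1 N Datatypes.tt)%cx by (rewrite HE; ring).
      le_via Cnorm_sub_le. rewrite Cnorm_mul, Cnorm_RtoC, Rabs_right by lra. nra. }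
    apply (Sq_ext Q _ (fun N => / beta + RtoC (eps N) * (- / beta * (b1 N Datatypes.tt * / b N)))%cx).
    + exists (N0 + n1)%nat. split; [lia|]. intros N HN HQN.
      specialize (Hlow N ltac:(lia) HQN).
      assert (Hbn : b N <> C0) by (intros E; rewrite E, Cnorm_0 in Hlow; lra).
      specialize (HE N ltac:(lia) HQN Datatypes.tt I). rewrite E0 in HE.
      transitivity (/ beta + - / beta * (RtoC (eps N) * b1 N Datatypes.tt * / b N))%cx; [ring|].
      replace (RtoC (eps N) * b1 N Datatypes.tt)%cx with (b N - beta)%cx by (rewrite HE; ring).
      field. auto.
    + apply Sq_add; [apply Sq_const|].
      apply (Xp_eps Q unit) with (H := fun N _ => (- / beta * (b1 N Datatypes.tt * / b N))%cx); auto.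
      apply Sq_mul; [apply Sq_const|]. apply Sq_mul; auto.
      apply (Xp_ext Q unit) with (H := b1); auto. apply evt_all. intros N [] _ _ _. reflexivity.
Qed.

(** * Stirling's series for the factorial *)

Definition gint (k : nat) (u : R) : R := u ^ k * exp (- u).
Lemma gint_der k u : is_derive (gint k) u (INR k * u ^ pred k * exp (- u) - gint k u).
Proof.
  unfold gint. eapply is_derive_val.
  - apply dmult; [apply pow_der|]. apply (dcomp exp); [apply dexp|apply dopp, did].
  - cbv beta; ring.
Qed.
Lemma gint_int k a b : ex_RInt (gint k) a b.
Proof.
  apply (ex_RInt_continuous (V := RV)). intros; eapply dcont, gint_der.
Qed.

Lemma gint_S k T : RInt (gint (S k)) 0 T = INR (S k) * RInt (gint k) 0 T - gint (S k) T.
Proof.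
  assert (H : is_RInt (fun u => INR (S k) * gint k u - gint (S k) u) 0 T (gint (S k) T - gint (S k) 0)).
  { apply (is_RInt_derive (V := RV) (gint (S k))).
    - intros x _. eapply is_derive_val; [apply gint_der|]. unfold gint; simpl pred; ring.
    - intros x _. eapply dcont. apply dminus; [apply dmult; [apply dconst|apply gint_der]|apply gint_der]. }
  apply (is_RInt_unique (V := RV)) in H. rewrite (RInt_minus (V := RV)) in H.
  - rewrite (RInt_scal (V := RV)) in H by apply gint_int.
    unfold minus, plus, opp, scal in H; simpl in H; unfold mult in H; simpl in H.
    replace (gint (S k) 0) with 0 in H by (unfold gint; simpl; ring).
    change (match k with 0%nat => 1 | S _ => INR k + 1 end) with (INR (S k)) in H. lra.
  - apply (ex_RInt_scal (V := R_NormedModule)). apply gint_int.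
  - apply gint_int.
Qed.

Lemma gint_0 T : RInt (gint 0) 0 T = 1 - exp (- T).
Proof.
  apply is_RInt_unique. replace (1 - exp (- T)) with (- exp (- T) - - exp (- 0)) by (rewrite Ropp_0, exp_0; ring).
  apply (is_RInt_derive (V := RV) (fun u => - exp (- u))).
  - intros x _. eapply is_derive_val.
    + apply dopp, (dcomp exp); [apply dexp|apply dopp, did].
    + unfold gint; simpl; ring.
  - intros x _. eapply dcont, gint_der.
Qed.

(** By parts, the tail for k+1 is (k+1) times the tail for k plus T^(k+1) exp (-T). The Taylor bound
    for exp (T/2) gives T^(k+1) exp (-T) <= (k+1)! 2^(k+1) exp (-T/2). The base 3 absorbs both,
    since 3^k + 2 * 3^k = 3^(k+1). *)
Lemma factorial_tail k T : 0 <= T ->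
  0 <= INR (fact k) - RInt (gint k) 0 T <= INR (fact k) * (3 ^ k * exp (- (T / 2))).
Proof.
  intros HT. induction k.
  - rewrite gint_0. simpl. assert (exp (- T) <= exp (- (T / 2))) by (apply exp_le; lra).
    generalize (exp_pos (- T)). lra.
  - rewrite gint_S, fact_simpl, mult_INR.
    set (F := INR (fact k)) in *. set (I := RInt (gint k) 0 T) in *.
    assert (Hk : 0 < INR (S k)) by (apply lt_0_INR; lia).
    assert (HF : 0 < F) by (apply lt_0_INR, lt_O_fact).
    assert (G0 : 0 <= gint (S k) T) by (apply mul_pos; [apply pow_le; auto|left; apply exp_pos]).
    assert (G1 : gint (S k) T <= INR (S k) * F * (2 ^ S k * exp (- (T / 2)))).
    { unfold gint. assert (Ht := ElemFct.exp_ge_taylor (T / 2) (S k) ltac:(lra)).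
      assert (Hterm : (T / 2) ^ S k / INR (fact (S k)) <= exp (T / 2)).
      { le_to Ht. cbn [sum_f_R0].
        assert (0 <= sum_f_R0 (fun k => (T / 2) ^ k / INR (fact k)) k).
        { apply cond_pos_sum. intros n. apply Rdiv_le_0_compat; [apply pow_le; lra|apply INR_fact_lt_0]. }
        lra. }
      assert (Hf : INR (fact (S k)) = INR (S k) * F) by (unfold F; rewrite fact_simpl, mult_INR; auto).
      rewrite Hf in Hterm.
      assert (Hb : (T / 2) ^ S k <= INR (S k) * F * exp (T / 2)).
      { apply (mul_le_r (INR (S k) * F)) in Hterm; [|nra].
        replace ((T / 2) ^ S k / (INR (S k) * F) * (INR (S k) * F)) with ((T / 2) ^ S k) in Hterm by (field; split; lra). lra. }
      replace (T ^ S k) with (2 ^ S k * (T / 2) ^ S k) by (rewrite <- Rpow_mult_distr; f_equal; field).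
      replace (exp (- T)) with (exp (- (T / 2)) * exp (- (T / 2))) by (rewrite <- exp_plus; f_equal; field).
      assert (P : exp (T / 2) * exp (- (T / 2)) = 1) by (rewrite <- exp_plus, Rplus_opp_r, exp_0; auto).
      set (e := exp (- (T / 2))) in *.
      assert (H2 : 0 < 2 ^ S k) by (apply pow_lt; lra).
      replace (INR (S k) * F * (2 ^ S k * e)) with (2 ^ S k * (INR (S k) * F * exp (T / 2)) * (e * e))
        by (transitivity (2 ^ S k * (INR (S k) * F) * e * (exp (T / 2) * e)); [ring|rewrite P; ring]).
      apply mul_le_r; [nra|]. apply mul_le_l; lra. }
    split; [nra|].
    assert (P23 : 2 ^ S k <= 2 * 3 ^ k).
    { simpl. apply mul_le_l; [lra|]. apply pow_incr; lra. }
    assert (He := exp_pos (- (T / 2))). set (e := exp (- (T / 2))) in *.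
    replace (3 ^ S k) with (3 ^ k + 2 * 3 ^ k) by (simpl; ring).
    assert (INR (S k) * F * (2 ^ S k * e) <= INR (S k) * F * (2 * 3 ^ k * e)).
    { apply mul_le_l; [nra|]. apply mul_le_r; lra. }
    nra.
Qed.

(** The Gamma integrand after the substitution u = N y/2, normalised to the value 1 at its
    approximate peak y = 1. *)
Definition yint (N : nat) (y : R) : R := y ^ (N / 2) * exp (- (INR N / 2) * (y - 1)).
Lemma yint_cont N y : continuous (yint N) y.
Proof.
  eapply dcont. apply dmult; [apply pow_der|].
  apply (dcomp exp); [apply dexp|]. apply dmult; [apply dconst|apply dminus; [apply did|apply dconst]].
Qed.
Lemma yint_int N a b : ex_RInt (yint N) a b.
Proof. apply (ex_RInt_continuous (V := RV)). intros; apply yint_cont. Qed.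

Lemma factorial_rescale N : (1 <= N)%nat ->
  RInt (gint (N / 2)) 0 (2 * INR N) * (2 * eps N) ^ S (N / 2) * exp (INR N / 2) = RInt (yint N) 0 4.
Proof.
  intros HN. assert (Hp : 0 < INR N) by (apply lt_0_INR; lia). set (k := (N / 2)%nat).
  assert (H := RInt_comp_lin (V := RV) (gint k) (INR N / 2) 0 0 4 (gint_int k _ _)).
  replace (INR N / 2 * 0 + 0) with 0 in H by ring. replace (INR N / 2 * 4 + 0) with (2 * INR N) in H by field.
  rewrite <- H.
  rewrite (RInt_ext (yint N) (fun y => ((2 * eps N) ^ S k * exp (INR N / 2)) * (INR N / 2 * gint k (INR N / 2 * y + 0)))).
  - rewrite (RInt_scal (V := RV) (fun y => INR N / 2 * gint k (INR N / 2 * y + 0))).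
    + unfold scal; simpl; unfold mult; simpl. ring.
    + apply (ex_RInt_continuous (V := RV)). intros z _.
      eapply dcont. apply dmult; [apply dconst|]. apply (dcomp (gint k)); [apply gint_der|].
      apply dplus; [apply dmult; [apply dconst|apply did]|apply dconst].
  - intros y _. unfold yint, gint. fold k.
    match goal with |- ?p = ?q => change (@eq R p q) end.
    replace (- (INR N / 2) * (y - 1)) with (INR N / 2 + - (INR N / 2 * y + 0)) by ring. rewrite exp_plus.
    replace (INR N / 2 * y + 0) with (INR N / 2 * y) by ring. rewrite (Rpow_mult_distr (INR N / 2)).
    assert (E : (2 * eps N) ^ S k * (INR N / 2) ^ S k = 1).
    { rewrite <- Rpow_mult_distr. replace (2 * eps N * (INR N / 2)) with 1 by (unfold eps; field; lra). apply pow1. }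
    transitivity (((2 * eps N) ^ S k * (INR N / 2) ^ S k) * (y ^ k * (exp (INR N / 2) * exp (- (INR N / 2 * y))))).
    + rewrite E; ring.
    + simpl ((INR N / 2) ^ S k). ring.
Qed.

Lemma yexp_le y y1 : 0 <= y -> 0 < y1 -> (y <= y1 <= 1 \/ 1 <= y1 <= y) -> y * exp (1 - y) <= y1 * exp (1 - y1).
Proof.
  intros Hy Hy1 H.
  assert (G : y <= y1 * exp (y - y1)).
  { assert (B : 1 + (y - y1) / y1 <= exp ((y - y1) / y1)).
    { destruct (Req_dec ((y - y1) / y1) 0) as [->|Hne]; [rewrite exp_0; lra|]. left; now apply exp_ineq1. }
    assert (B2 : exp ((y - y1) / y1) <= exp (y - y1)).
    { apply exp_le. apply Rmult_le_reg_r with y1; auto.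
      replace ((y - y1) / y1 * y1) with (y - y1) by (field; lra). nra. }
    replace y with (y1 * (1 + (y - y1) / y1)) at 1 by (field; lra).
    apply mul_le_l; lra. }
  replace (1 - y1) with (1 - y + (y - y1)) by ring. rewrite exp_plus.
  generalize (exp_pos (1 - y)). nra.
Qed.
Lemma yexp_lt1 y : 0 < y -> y <> 1 -> y * exp (1 - y) < 1.
Proof.
  intros H Hne. assert (B := exp_ineq1 (y - 1) ltac:(lra)).
  replace (1 - y) with (- (y - 1)) by ring. rewrite exp_Ropp.
  assert (P := exp_pos (y - 1)). apply Rmult_lt_reg_r with (exp (y - 1)); auto.
  rewrite Rmult_assoc, Rinv_l by lra. lra.
Qed.

Lemma par_or N : par 0 N \/ par 1 N.
Proof. unfold par. generalize (Nat.mod_upper_bound N 2 ltac:(lia)). lia. Qed.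
Lemma half_bounds N : INR N - 1 <= 2 * INR (N / 2) <= INR N.
Proof.
  destruct (par_or N) as [H|H]; generalize (par_INR _ _ H); simpl; lra.
Qed.

(** The function y exp (1 - y) increases up to 1 and decreases afterwards, so beyond [y1] it is at
    most its value there, which is less than 1. This number is raised to the power N/2. *)
Lemma yint_far y1 : 0 < y1 -> y1 <> 1 -> exists K c, 0 < c /\ forall N y, (1 <= N)%nat -> 0 <= y ->
  (y <= y1 <= 1 \/ 1 <= y1 <= y) -> 0 <= yint N y <= K * exp (- c * INR N).
Proof.
  intros H1 H2. set (ph := y1 * exp (1 - y1)).
  assert (Hph : 0 < ph < 1) by (split; [apply mul_lt_pos; auto; apply exp_pos|now apply yexp_lt1]).
  assert (Hl : ln ph < 0) by (rewrite <- ln_1; apply ln_increasing; lra).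
  exists (exp (/ 2) * exp (- ln ph / 2)), (- ln ph / 2). split; [lra|]. intros N y HN Hy H.
  assert (HM := half_bounds N). set (k := (N / 2)%nat) in *.
  assert (E : yint N y = (y * exp (1 - y)) ^ k * exp ((INR N - 2 * INR k) / 2 * (1 - y))).
  { unfold yint. rewrite Rpow_mult_distr, exp_pow_nat, Rmult_assoc, <- exp_plus. f_equal. f_equal. field. }
  assert (B := yexp_le y y1 Hy H1 H). fold ph in B.
  assert (P : 0 <= y * exp (1 - y)) by (apply mul_pos; auto; left; apply exp_pos).
  rewrite E. split.
  - apply mul_pos; [now apply pow_le|left; apply exp_pos].
  - assert (B1 : (y * exp (1 - y)) ^ k <= exp (- ln ph / 2) * exp (- (- ln ph / 2) * INR N)).
    { apply Rle_trans with (ph ^ k); [apply pow_incr; lra|].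
      rewrite <- exp_plus. rewrite <- (exp_ln ph) at 1 by lra. rewrite exp_pow_nat. apply exp_le. nra. }
    assert (B2 : exp ((INR N - 2 * INR k) / 2 * (1 - y)) <= exp (/ 2)) by (apply exp_le; nra).
    replace (exp (/ 2) * exp (- ln ph / 2) * exp (- (- ln ph / 2) * INR N))
      with (exp (- ln ph / 2) * exp (- (- ln ph / 2) * INR N) * exp (/ 2)) by ring.
    apply Rmult_le_compat; auto; [now apply pow_le|left; apply exp_pos].
Qed.

Definition spsi (x : R) : Cplx := RtoC (/ 2 * (ln (1 + x) - x)).
(** The amplitude (1 + x)^(-a/2) corrects for the exponent being (N - a)/2 instead of N/2. *)
Definition sh (a : nat) (x : R) : Cplx := RtoC (exp (- (INR a / 2) * ln (1 + x))).

Lemma smooth_ln1 : smooth (itv 1) (fun x => ln (1 + x)).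
Proof.
  apply (smooth_comp (itv 1) (fun x => 0 < x) ln (fun x => 1 + x)); auto using itv_open, open_gt, smooth_ln.
  - apply smooth_plus; auto using itv_open, smooth_const. apply smooth_id, itv_open.
  - unfold itv; intros; lra.
Qed.
Lemma spsi_csm : csm (itv 1) spsi.
Proof.
  apply (csm_RtoC _ (itv_open 1) (fun x => / 2 * (ln (1 + x) - x))).
  apply smooth_mult; auto using itv_open, smooth_const.
  apply smooth_minus; auto using itv_open, smooth_ln1. apply smooth_id, itv_open.
Qed.
Lemma sh_csm a e : e <= 1 -> csm (itv e) (sh a).
Proof.
  intros He. apply (csm_RtoC _ (itv_open e) (fun x => exp (- (INR a / 2) * ln (1 + x)))).
  apply (smooth_comp (itv e) (fun _ => True) exp); auto using itv_open, open_true, smooth_exp.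
  apply smooth_mult; auto using itv_open, smooth_const.
  apply (smooth_subset (itv 1)); [unfold itv; intros; lra|apply smooth_ln1].
Qed.
Lemma spsi_der x : itv 1 x -> cD spsi x = RtoC (/ 2 * (/ (1 + x) - 1)).
Proof.
  intros Hx. apply cD_unique, cder_RtoC. eapply is_derive_val.
  - apply dmult; [apply dconst|]. apply dminus; [|apply did].
    apply (dcomp ln (fun x => 1 + x)); [apply dln; unfold itv in Hx; lra|apply dplus; [apply dconst|apply did]].
  - cbv beta; ring.
Qed.
Lemma spsi_der2 : cD (cD spsi) 0 = RtoC (- / 2).
Proof.
  assert (I0 : itv 1 0) by (unfold itv; lra).
  apply cD_unique. apply cder_ext_loc with (fun x => RtoC (/ 2 * (/ (1 + x) - 1))).
  - apply (filter_imp (itv 1)); [|apply itv_open, I0]. intros; symmetry; now apply spsi_der.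
  - apply cder_RtoC. eapply is_derive_val.
    + apply dmult; [apply dconst|]. apply dminus; [|apply dconst].
      apply (dinv (fun x => 1 + x)); [apply dplus; [apply dconst|apply did]|lra].
    + cbv beta; field.
Qed.

Lemma yint_middle a d N : par a N -> (1 <= N)%nat -> 0 < d < 1 ->
  RtoC (RInt (yint N) (1 - d) (1 + d)) = LI spsi d (sh a) N.
Proof.
  intros Hp HN Hd. assert (HM := par_INR a N Hp).
  assert (H := RInt_comp_lin (V := RV) (yint N) 1 1 (- d) d (yint_int N _ _)).
  replace (1 * - d + 1) with (1 - d) in H by ring. replace (1 * d + 1) with (1 + d) in H by ring.
  rewrite <- H. unfold LI.
  rewrite (CInt_ext _ (fun x => RtoC (scal 1 (yint N (1 * x + 1))))).
  - apply cx_eq; simpl; [reflexivity|]. rewrite (RInt_const (V := RV)).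
    unfold scal; simpl; unfold mult; simpl; ring.
  - intros x Hx. minmax Hx.
    unfold spsi, sh. rewrite <- RtoC_mul, Cexp_RtoC, <- RtoC_mul. f_equal.
    unfold yint.
    rewrite Rmult_1_l. replace ((1 * x + 1) ^ (N / 2)) with (exp (INR (N / 2) * ln (1 + x))).
    + rewrite <- !exp_plus. f_equal. replace (INR (N / 2)) with ((INR N - INR a) / 2) by lra. field.
    + rewrite <- exp_pow_nat, exp_ln by lra. f_equal; ring.
Qed.

(** After rescaling, [sig] is a Gamma integral divided by [Gam]. Its middle part is a Laplace
    integral with second derivative -1/2 at the peak, which gives the limit 1/sqrt(1/2) = sqrt 2.
    Everything else is exponentially small. *)
Lemma stirling a : (a < 2)%nat ->
  (forall r, Sq (par a) r (fun N => RtoC (/ sig N))) /\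
  exists K n, (1 <= n)%nat /\ forall N, (n <= N)%nat -> par a N -> Cnorm (RtoC (sig N) - RtoC (exp (/ 2 * ln 2)))%cx <= K * eps N.
Proof.
  intros Ha.
  assert (I0 : itv 1 0) by (unfold itv; lra).
  destruct (laplace (itv 1) spsi) as [e0 [He0 HL]]; auto using itv_open, spsi_csm.
  { intros; now apply itv_star. }
  { unfold spsi. rewrite Rplus_0_r, ln_1. apply cx_eq; simpl; ring. }
  { rewrite spsi_der by auto. apply cx_eq; simpl; field. }
  { rewrite spsi_der2. simpl; lra. }
  set (e := Rmin e0 1). assert (He : 0 < e <= e0 /\ e <= 1).
  { unfold e. generalize (Rmin_l e0 1) (Rmin_r e0 1) (Rmin_pos e0 1). lra. }
  set (d := e / 2). destruct (HL e d ltac:(unfold d; lra) ltac:(lra)) as [_ HL2].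
  destruct (HL2 (sh a) (sh_csm a e ltac:(lra))) as [HS [KL HKL]].
  rewrite spsi_der2 in HKL.
  assert (Ev : (sh a 0%R / Cexp (RtoC (/ 2) * Clog (- RtoC (- / 2))))%cx = RtoC (exp (/ 2 * ln 2))).
  { replace (- RtoC (- / 2))%cx with (RtoC (/ 2)) by (apply cx_eq; simpl; ring).
    rewrite Clog_RtoC by lra. rewrite <- RtoC_mul, Cexp_RtoC.
    unfold sh. rewrite Rplus_0_r, ln_1, Rmult_0_r, exp_0. rewrite ln_Rinv by lra.
    rewrite <- RtoC_div by (apply Rgt_not_eq, exp_pos). f_equal.
    replace (/ 2 * - ln 2) with (- (/ 2 * ln 2)) by ring. rewrite exp_Ropp. field. apply Rgt_not_eq, exp_pos. }
  rewrite Ev in HKL.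
  set (L := fun N => (RtoC (/ Gam N) * LI spsi d (sh a) N)%cx) in *.
  destruct (yint_far (1 - d)) as (K1 & c1 & Hc1 & F1); [unfold d; lra|unfold d; lra|].
  destruct (yint_far (1 + d)) as (K2 & c2 & Hc2 & F2); [unfold d; lra|unfold d; lra|].
  set (o := fun N => RInt (yint N) 0 (1 - d) + RInt (yint N) (1 + d) 4).
  assert (Ho : ES (fun N => RtoC (o N))).
  { assert (G1 : ES (fun N => RtoC (RInt (yint N) 0 (1 - d)))).
    { exists K1, c1. split; auto. intros N HN. rewrite Cnorm_RtoC.
      eapply Rle_trans; [apply (abs_RInt_le_const _ 0 (1 - d) (K1 * exp (- c1 * INR N)))|].
      - unfold d; lra.
      - apply yint_int.
      - intros t Ht. destruct (F1 N t HN ltac:(lra)) as [f1 f2]; [left; unfold d in *; lra|]. rewrite Rabs_right; lra.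
      - destruct (F1 N (1 - d) HN ltac:(unfold d; lra)) as [f1 f2]; [left; unfold d in *; lra|].
        assert (0 <= 1 - d - 0 <= 1) by (unfold d; lra). nra. }
    assert (G2 : ES (fun N => RtoC (RInt (yint N) (1 + d) 4))).
    { exists (3 * K2), c2. split; auto. intros N HN. rewrite Cnorm_RtoC.
      eapply Rle_trans; [apply (abs_RInt_le_const _ (1 + d) 4 (K2 * exp (- c2 * INR N)))|].
      - unfold d; lra.
      - apply yint_int.
      - intros t Ht. destruct (F2 N t HN) as [f1 f2]; [unfold d in *; lra|right; unfold d in *; lra|]. rewrite Rabs_right; lra.
      - destruct (F2 N (1 + d) HN ltac:(unfold d; lra)) as [f1 f2]; [right; unfold d in *; lra|].
        assert (0 <= 4 - (1 + d) <= 3) by (unfold d; lra). nra. }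
    destruct (ES_add _ _ G1 G2) as (K & c & Hc & HH). exists K, c; split; auto. intros N HN.
    unfold o. rewrite RtoC_add. apply HH; auto. }
  (* The relative tail beyond u = 2N, that is y = 4. By [factorial_tail] it is at most 3^(N/2) exp
     (-N), which decays because ln 3 < 2. *)
  set (th := fun N => (INR (fact (N / 2)) - RInt (gint (N / 2)) 0 (2 * INR N)) / INR (fact (N / 2))).
  assert (Hth : forall N, (1 <= N)%nat -> 0 <= th N <= exp (- (1 - / 2 * ln 3) * INR N)).
  { intros N HN. assert (Hf := INR_fact_lt_0 (N / 2)).
    destruct (factorial_tail (N / 2) (2 * INR N)) as [t1 t2]; [generalize (pos_INR N); lra|].
    unfold th. split; [apply Rdiv_le_0_compat; auto|].
    apply Rmult_le_reg_r with (INR (fact (N / 2))); auto. unfold Rdiv. rewrite Rmult_assoc, Rinv_l, Rmult_1_r by lra.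
    le_via t2. rewrite Rmult_comm. apply mul_le_r; [lra|].
    rewrite <- (exp_ln 3) at 1 by lra. rewrite exp_pow_nat, <- exp_plus. apply exp_le.
    assert (HM := half_bounds N). assert (0 < ln 3) by (rewrite <- ln_1; apply ln_increasing; lra). nra. }
  assert (Hl3 : 0 < 1 - / 2 * ln 3).
  { assert (ln 3 < 2); [|lra]. rewrite <- (ln_exp 2). apply ln_increasing; [lra|].
    generalize (exp_ineq1 2 ltac:(lra)). lra. }
  assert (ESth : ES (fun N => RtoC (th N))).
  { exists 1, (1 - / 2 * ln 3). split; auto. intros N HN. destruct (Hth N HN).
    rewrite Cnorm_RtoC, Rabs_right; lra. }
  assert (Key : forall N, (1 <= N)%nat -> par a N ->
     (RtoC (sig N) * (C1 - RtoC (th N)) = L N + RtoC (o N) * RtoC (/ Gam N))%cx).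
  { intros N HN Hp. unfold L. rewrite <- (yint_middle a d N Hp HN) by (unfold d; lra).
    unfold C1. rewrite <- RtoC_sub, <- !RtoC_mul, <- RtoC_add. f_equal.
    unfold sig, th. assert (HG := Gam_pos N HN). assert (Hf := INR_fact_lt_0 (N / 2)).
    transitivity (RInt (gint (N / 2)) 0 (2 * INR N) * (2 * eps N) ^ S (N / 2) * exp (INR N / 2) / Gam N).
    - field. split; lra.
    - rewrite factorial_rescale by auto.
      rewrite <- (RInt_Chasles (V := RV) (yint N) 0 (1 - d) 4) by apply yint_int.
      rewrite <- (RInt_Chasles (V := RV) (yint N) (1 - d) (1 + d) 4) by apply yint_int.
      change plus with Rplus. unfold o. field. lra. }
  set (b := fun N => (L N + RtoC (o N) * RtoC (/ Gam N))%cx) in *.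
  assert (Hb : forall r, Sq (par a) r b).
  { intros r. apply Sq_add; [apply HS|]. apply Sq_ES, ES_mul_PB; auto. apply PB_Gam_inv. }
  set (beta := RtoC (exp (/ 2 * ln 2))) in *.
  assert (Hbeta : beta <> C0) by (apply RtoC_neq0, Rgt_not_eq, exp_pos).
  destruct (ES_eps _ 1 (ES_mul_PB _ _ Ho PB_Gam_inv)) as [Ko HKo].
  assert (HbK : forall N, (1 <= N)%nat -> Cnorm (b N - beta)%cx <= (KL + Ko) * eps N).
  { intros N HN. replace (b N - beta)%cx with ((L N - beta) + RtoC (o N) * RtoC (/ Gam N))%cx by (unfold b; ring).
    le_via Cnorm_triang. rewrite Rmult_plus_distr_r. apply Rplus_le_compat; [exact (HKL N HN)|].
    eapply Rle_trans; [exact (HKo N HN)|]. rewrite pow_1; lra. }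
  assert (Hth2 : exists n, (1 <= n)%nat /\ forall N, (n <= N)%nat -> th N <= / 2).
  { destruct (ES_eps _ 1 ESth) as [Kt HKt]. destruct (eps_small (/ 2 / (Rabs Kt + 1))) as [n [Hn Hsm]].
    - apply Rdiv_lt_0_compat; [lra|generalize (Rabs_pos Kt); lra].
    - exists n. split; auto. intros N HN. specialize (Hsm N HN). specialize (HKt N ltac:(lia)).
      rewrite Cnorm_RtoC, pow_1 in HKt. assert (Hkp : 0 < Rabs Kt + 1) by (generalize (Rabs_pos Kt); lra).
      apply (Rmult_lt_compat_r (Rabs Kt + 1)) in Hsm; auto.
      replace (/ 2 / (Rabs Kt + 1) * (Rabs Kt + 1)) with (/ 2) in Hsm by (field; lra).
      generalize (Rle_abs (th N)) (Rle_abs Kt) (eps_pos N ltac:(lia)). nra. }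
  destruct Hth2 as [n2 [Hn2 Hth2]].
  split.
  - intros r. apply (Sq_ext (par a) _ (fun N => (C1 - RtoC (th N)) * / b N)%cx).
    + exists n2. split; auto. intros N HN Hp. specialize (Hth2 N HN).
      assert (Hs := sig_pos N ltac:(lia)). unfold b. rewrite <- Key by (auto; lia).
      rewrite RtoC_inv by lra.
      assert (Hr1 : RtoC (sig N) <> C0) by (apply RtoC_neq0; lra).
      assert (Hr2 : (C1 - RtoC (th N))%cx <> C0) by (apply Cre_neq0; simpl; lra).
      field. auto.
    + apply Sq_mul; [apply Sq_add; [apply Sq_const|apply Sq_opp, Sq_ES, ESth]|].
      apply (Sq_inv (par a) (par_inf a Ha) beta b (KL + Ko)); auto.
  - destruct (ES_eps _ 1 ESth) as [Kt HKt].
    exists (2 * (KL + Ko + Cnorm beta * Kt)), n2. split; auto. intros N HN Hp.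
    specialize (Hth2 N HN). destruct (Hth N ltac:(lia)) as [t0 _].
    specialize (HKt N ltac:(lia)). rewrite Cnorm_RtoC, pow_1, Rabs_right in HKt by lra.
    specialize (HbK N ltac:(lia)). specialize (Key N ltac:(lia) Hp). fold (b N) in Key.
    assert (Hne : (C1 - RtoC (th N))%cx <> C0) by (apply Cre_neq0; simpl; lra).
    replace (RtoC (sig N) - beta)%cx with ((b N - beta + beta * RtoC (th N)) * / (C1 - RtoC (th N)))%cx
      by (rewrite <- Key; field; auto).
    rewrite Cnorm_mul, Cnorm_inv by auto.
    assert (Hi : / Cnorm (C1 - RtoC (th N))%cx <= 2).
    { unfold C1. rewrite <- RtoC_sub, Cnorm_RtoC, Rabs_right by lra.
      replace 2 with (/ / 2) by field. apply inv_le; lra. }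
    assert (Hc := Cnorm_pos _ Hne). apply inv_pos in Hc.
    assert (Hn : Cnorm (b N - beta + beta * RtoC (th N))%cx <= (KL + Ko + Cnorm beta * Kt) * eps N).
    { le_via Cnorm_triang. rewrite Cnorm_mul, Cnorm_RtoC, Rabs_right by lra.
      generalize (Cnorm_nonneg beta). nra. }
    generalize (Cnorm_nonneg (b N - beta + beta * RtoC (th N))%cx). nra.
Qed.

(** * The dilogarithm *)

(** A limit with an explicit rate, the same for all |w| <= 1. Uniformity lets the truncation index
    be balanced against the distance of w from 1. *)
Definition Dil (w l : Cplx) : Prop := forall n, (1 <= n)%nat -> Cnorm (Li2_partial w n - l)%cx <= / INR n.
(** Partial sums of -log (1 - w), which arise as w times the derivative of [Li2_partial]. *)
Fixpoint Log1p (w : Cplx) (M : nat) : Cplx :=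
  match M with O => C0 | S M' => Log1p w M' + RtoC (/ INR (S M')) * Cpown w (S M') end%cx.
Fixpoint Geo (w : Cplx) (M : nat) : Cplx :=
  match M with O => C0 | S M' => Geo w M' + Cpown w M' end%cx.

Lemma Li2_S w n : Li2_partial w (S n) = (Li2_partial w n + RtoC (/ INR (S n) * / INR (S n)) * Cpown w (S n))%cx.
Proof.
  cbn [Li2_partial]. f_equal. unfold Cdiv. rewrite <- RtoC_inv.
  - replace (/ INR (S n) ^ 2) with (/ INR (S n) * / INR (S n)).
    + ring.
    + assert (INR (S n) <> 0) by (apply not_0_INR; lia). field; auto.
  - apply pow_nonzero, not_0_INR; lia.
Qed.
Lemma Log1p_S w n : Log1p w (S n) = (Log1p w n + RtoC (/ INR (S n)) * Cpown w (S n))%cx.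
Proof. reflexivity. Qed.
Lemma Geo_S w n : Geo w (S n) = (Geo w n + Cpown w n)%cx.
Proof. reflexivity. Qed.
Lemma Geo_eq w n : ((C1 - w) * Geo w n = C1 - Cpown w n)%cx.
Proof.
  induction n; [simpl; ring|]. rewrite Geo_S, Cpown_S.
  transitivity ((C1 - w) * Geo w n + (C1 - w) * Cpown w n)%cx; [ring|]. rewrite IHn; ring.
Qed.

Lemma Log1p_der f x l M : cder f x l -> cder (fun t => Log1p (f t) M) x (Geo (f x) M * l)%cx.
Proof.
  intros H. induction M.
  - apply (cder_val _ _ C0); [exact (cder_const C0 x)|simpl; ring].
  - eapply cder_val.
    + apply (cder_add (fun t => Log1p (f t) M) (fun t => RtoC (/ INR (S M)) * Cpown (f t) (S M))%cx); [exact IHM|].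
      apply cder_scal, cder_pown, H.
    + rewrite Geo_S. transitivity (Geo (f x) M * l + (RtoC (/ INR (S M)) * RtoC (INR (S M))) * Cpown (f x) M * l)%cx; [ring|].
      rewrite <- RtoC_mul, Rinv_l by (apply not_0_INR; lia). change (RtoC 1) with C1; ring.
Qed.
Lemma Li2_der f x l M : cder f x l -> f x <> C0 ->
  cder (fun t => Li2_partial (f t) M) x (Log1p (f x) M * (l / f x))%cx.
Proof.
  intros H Hx. induction M.
  - apply (cder_val _ _ C0); [exact (cder_const C0 x)|simpl; ring].
  - apply cder_ext with (fun t => Li2_partial (f t) M + RtoC (/ INR (S M) * / INR (S M)) * Cpown (f t) (S M))%cx.
    { intros; now rewrite Li2_S. }
    eapply cder_val; [apply cder_add; [exact IHM|apply cder_scal, cder_pown, H]|].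
    rewrite Log1p_S, Cpown_S, RtoC_mul.
    assert (E : (RtoC (/ INR (S M)) * RtoC (INR (S M)) = C1)%cx).
    { rewrite <- RtoC_mul, Rinv_l by (apply not_0_INR; lia). reflexivity. }
    transitivity (Log1p (f x) M * (l / f x) + RtoC (/ INR (S M)) * (RtoC (/ INR (S M)) * RtoC (INR (S M))) * Cpown (f x) M * l)%cx; [ring|].
    rewrite E. field; auto.
Qed.

Lemma one_minus_re w : Cnorm w < 1 -> 0 < Cre (C1 - w)%cx.
Proof. intros H. generalize (Cre_le_norm w) (Rle_abs (Cre w)). simpl. lra. Qed.

Lemma Clog_1 : Clog C1 = C0.
Proof. unfold C1. rewrite Clog_RtoC, ln_1 by lra. reflexivity. Qed.

(** Along t w, the geometric sum in the derivative combines with that of the logarithm to -w (t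
    w)^M/(1 - t w), which is then integrated from 0 to 1. *)
Lemma Log1p_error w M : Cnorm w < 1 ->
  Cnorm (Log1p w M + Clog (C1 - w))%cx <= 2 * (Cnorm w ^ S M / (1 - Cnorm w)).
Proof.
  intros Hw. assert (Hw0 := Cnorm_nonneg w).
  assert (Hn : forall t, 0 <= t <= 1 -> Cnorm (RtoC t * w)%cx <= Cnorm w).
  { intros t Ht. rewrite Cnorm_mul, Cnorm_RtoC, Rabs_right by lra. nra. }
  assert (B : Cnorm ((Log1p (RtoC 1 * w) M + Clog (C1 - RtoC 1 * w)) - (Log1p (RtoC 0 * w) M + Clog (C1 - RtoC 0 * w)))%cx
    <= 2 * (Cnorm w ^ S M / (1 - Cnorm w)) * (1 - 0)).
  { apply (cder_MVT (fun t => Log1p (RtoC t * w) M + Clog (C1 - RtoC t * w))%cx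
      (fun t => - (w * Cpown (RtoC t * w) M) / (C1 - RtoC t * w))%cx); [lra| |].
    - intros t Ht. assert (Hp := one_minus_re (RtoC t * w)%cx ltac:(specialize (Hn t Ht); lra)).
      assert (Hd : cder (fun t => RtoC t * w)%cx t w).
      { eapply cder_val; [apply cder_mul; [apply cder_id|apply cder_const]|cbv beta; ring]. }
      assert (Hne : (C1 - RtoC t * w)%cx <> C0) by (apply Cre_neq0; lra).
      eapply cder_val.
      + apply cder_add; [apply (Log1p_der _ _ _ M Hd)|].
        apply cder_log; [apply cder_sub; [apply cder_const|exact Hd]|exact Hp].
      + assert (G := Geo_eq (RtoC t * w)%cx M).
        replace (Geo (RtoC t * w) M) with ((C1 - Cpown (RtoC t * w) M) / (C1 - RtoC t * w))%cx by (rewrite <- G; field; auto).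
        field. auto.
    - intros t Ht. specialize (Hn t Ht).
      assert (Hp := one_minus_re (RtoC t * w)%cx ltac:(lra)).
      assert (Hne : (C1 - RtoC t * w)%cx <> C0) by (apply Cre_neq0; lra).
      rewrite Cnorm_div, Cnorm_opp, Cnorm_mul, Cnorm_pown by auto.
      assert (Hg : 1 - Cnorm w <= Cnorm (C1 - RtoC t * w)%cx).
      { generalize (Cnorm_sub_ge C1 (RtoC t * w)%cx). rewrite Cnorm_1. lra. }
      apply Rmult_le_compat.
      + apply mul_pos; auto. apply pow_le, Cnorm_nonneg.
      + left; apply inv_pos; lra.
      + simpl. apply mul_le_l; auto. apply pow_incr. split; [apply Cnorm_nonneg|auto].
      + apply inv_le; lra. }
  change (RtoC 1) with C1 in B. change (RtoC 0) with C0 in B.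
  replace (C1 * w)%cx with w in B by ring. replace (C0 * w)%cx with C0 in B by ring.
  replace (C1 - C0)%cx with C1 in B by ring. rewrite Clog_1 in B.
  assert (Z : Log1p C0 M = C0).
  { clear. induction M; [reflexivity|]. rewrite Log1p_S, IHM, Cpown_S. ring. }
  rewrite Z in B. replace (Log1p w M + Clog (C1 - w))%cx with (Log1p w M + Clog (C1 - w) - (C0 + C0))%cx by ring.
  lra.
Qed.

Lemma Clog_1m_bound w : Cnorm w < 1 -> Cnorm (Clog (C1 - w)) <= 2 * (Cnorm w / (1 - Cnorm w)).
Proof.
  intros H. generalize (Log1p_error w 0 H). rewrite pow_1.
  replace (Log1p w 0 + Clog (C1 - w))%cx with (Clog (C1 - w)) by (simpl; ring). auto.
Qed.

Lemma pow_cv0 r C e : 0 <= r < 1 -> 0 < e -> exists n0, forall n, (n0 <= n)%nat -> C * r ^ n <= e.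
Proof.
  intros Hr He. destruct (pow_lt_1_zero r ltac:(rewrite Rabs_right; lra) (e / (Rabs C + 1))) as [n0 H].
  - apply Rdiv_lt_0_compat; auto. generalize (Rabs_pos C); lra.
  - exists n0. intros n Hn. specialize (H n Hn). assert (P : 0 <= r ^ n) by (apply pow_le; lra).
    rewrite Rabs_right in H by lra. assert (HC : 0 < Rabs C + 1) by (generalize (Rabs_pos C); lra).
    apply (Rmult_lt_compat_r (Rabs C + 1)) in H; auto.
    replace (e / (Rabs C + 1) * (Rabs C + 1)) with e in H by (field; lra).
    generalize (Rle_abs C). nra.
Qed.

Lemma Li2_tail w n k : Cnorm w <= 1 -> (1 <= n)%nat -> Cnorm (Li2_partial w (n + k) - Li2_partial w n)%cx <= / INR n - / INR (n + k).
Proof.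
  intros Hw Hn. induction k.
  - rewrite Nat.add_0_r. replace (Li2_partial w n - Li2_partial w n)%cx with C0 by ring. rewrite Cnorm_0. lra.
  - rewrite Nat.add_succ_r, Li2_S.
    replace (Li2_partial w (n + k) + _ - Li2_partial w n)%cx with
      ((Li2_partial w (n + k) - Li2_partial w n) + RtoC (/ INR (S (n + k)) * / INR (S (n + k))) * Cpown w (S (n + k)))%cx by ring.
    le_via Cnorm_triang.
    assert (Hp : 0 < INR (n + k)) by (apply lt_0_INR; lia).
    assert (P1 : Cnorm (Cpown w (S (n + k))) <= 1).
    { rewrite Cnorm_pown, <- (pow1 (S (n + k))). apply pow_incr. split; [apply Cnorm_nonneg|auto]. }
    assert (P2 : / INR (S (n + k)) * / INR (S (n + k)) <= / INR (n + k) - / INR (S (n + k))).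
    { rewrite S_INR. set (a := INR (n + k)) in *.
      replace (/ a - / (a + 1)) with (/ a * / (a + 1)) by (field; lra).
      apply mul_le_r; [left; apply inv_pos; lra|apply inv_le; lra]. }
    rewrite Cnorm_mul, Cnorm_RtoC, Rabs_right.
    +
      nra.
    + apply Rle_ge, mul_pos; left; apply inv_pos, lt_0_INR; lia.
Qed.

Lemma is_Li2_Dil w l : Cnorm w <= 1 -> is_Li2 w l -> Dil w l.
Proof.
  intros Hw [H1 H2] n Hn.
  apply Rnot_lt_le. intros Hc. set (d := Cnorm (Li2_partial w n - l)%cx - / INR n) in *.
  assert (Hd : 0 < d) by (unfold d; lra).
  destruct (H1 (d / 2) ltac:(lra)) as [n1 G1]. destruct (H2 (d / 2) ltac:(lra)) as [n2 G2].
  specialize (G1 (n + (n1 + n2))%nat ltac:(lia)). specialize (G2 (n + (n1 + n2))%nat ltac:(lia)).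
  unfold Rdist in G1, G2.
  assert (T := Li2_tail w n (n1 + n2) Hw Hn).
  assert (B : Cnorm (Li2_partial w (n + (n1 + n2)) - l)%cx < d).
  { eapply Rle_lt_trans; [apply Cnorm_le_sum|]. simpl. unfold Rminus in *. lra. }
  assert (T2 := Cnorm_triang (Li2_partial w n - Li2_partial w (n + (n1 + n2))) (Li2_partial w (n + (n1 + n2)) - l)).
  rewrite Cnorm_sub_sym in T.
  replace (Li2_partial w n - Li2_partial w (n + (n1 + n2)) + (Li2_partial w (n + (n1 + n2)) - l))%cx with (Li2_partial w n - l)%cx in T2 by ring.
  assert (0 < / INR (n + (n1 + n2))) by (apply inv_pos, lt_0_INR; lia).
  unfold d in *. lra.
Qed.

Lemma Dil_exists w : Cnorm w <= 1 -> exists l, Dil w l.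
Proof.
  intros Hw.
  assert (G : forall g : Cplx -> R, (forall z, Rabs (g z) <= Cnorm z) -> (forall y z, g (y - z)%cx = g y - g z) ->
    exists l, Un_cv (fun n => g (Li2_partial w n)) l).
  { intros g Hg Hs. destruct (Rcomplete.R_complete (fun n => g (Li2_partial w n))) as [l Hl]; [|exists l; exact Hl].
    intros e He. destruct (archimed_cor1 (e / 2)) as [n0 [Hn0 Hn0']]; [lra|]. exists n0.
    assert (T : forall n, (n0 <= n)%nat -> Rabs (g (Li2_partial w n) - g (Li2_partial w n0)) <= / INR n0).
    { intros n Hn. rewrite <- Hs. le_via Hg. replace n with (n0 + (n - n0))%nat by lia.
      eapply Rle_trans; [apply Li2_tail; auto|]. assert (0 < / INR (n0 + (n - n0))) by (apply inv_pos, lt_0_INR; lia). lra. }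
    intros n m Hn Hm. unfold Rdist. generalize (T n Hn) (T m Hm). intros t1 t2.
    replace (g (Li2_partial w n) - g (Li2_partial w m)) with ((g (Li2_partial w n) - g (Li2_partial w n0)) - (g (Li2_partial w m) - g (Li2_partial w n0))) by ring.
    generalize (Rabs_triang (g (Li2_partial w n) - g (Li2_partial w n0)) (- (g (Li2_partial w m) - g (Li2_partial w n0)))).
    rewrite Rabs_Ropp. unfold Rminus in *. lra. }
  destruct (G Cre Cre_le_norm) as [l1 H1]; [intros; simpl; ring|].
  destruct (G Cim Cim_le_norm) as [l2 H2]; [intros; simpl; ring|].
  exists (mkC l1 l2). apply is_Li2_Dil; auto. split; auto.
Qed.

Lemma small_eq (z : Cplx) K : (forall n, (1 <= n)%nat -> Cnorm z <= K * / INR n) -> z = C0.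
Proof.
  intros H. apply (eps_limit_eq (fun _ => True) (fun n => ex_intro _ n (conj (le_n n) I)) z K 1). intros N HN _.
  apply H; auto.
Qed.
Lemma small_eq_e (z : Cplx) : (forall e, 0 < e -> Cnorm z <= e) -> z = C0.
Proof.
  intros H. apply small_eq with 1. intros n Hn. rewrite Rmult_1_l. apply H, inv_pos, lt_0_INR; lia.
Qed.
Lemma csub_eq0 z w : (z - w)%cx = C0 -> z = w.
Proof. intros E. replace z with (z - w + w)%cx by ring. rewrite E; ring. Qed.

Lemma Cpown_1m w k : Cnorm w <= 1 -> Cnorm (C1 - Cpown w k)%cx <= INR k * Cnorm (C1 - w)%cx.
Proof.
  intros Hw. induction k.
  - simpl. replace (C1 - C1)%cx with C0 by ring. rewrite Cnorm_0; lra.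
  - rewrite Cpown_S, S_INR. replace (C1 - w * Cpown w k)%cx with ((C1 - w) + w * (C1 - Cpown w k))%cx by ring.
    le_via Cnorm_triang. rewrite Cnorm_mul.
    generalize (Cnorm_nonneg w) (Cnorm_nonneg (C1 - Cpown w k)%cx). nra.
Qed.
Lemma Li2_near1 w n : Cnorm w <= 1 -> Cnorm (Li2_partial C1 n - Li2_partial w n)%cx <= INR n * Cnorm (C1 - w)%cx.
Proof.
  intros Hw. induction n.
  - simpl. replace (C0 - C0)%cx with C0 by ring. rewrite Cnorm_0; lra.
  - rewrite !Li2_S.
    assert (P1 : Cpown C1 (S n) = C1) by (clear; induction n; [simpl; ring|rewrite Cpown_S, IHn; ring]).
    rewrite P1. set (q := / INR (S n) * / INR (S n)). rewrite (S_INR n).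
    replace (Li2_partial C1 n + RtoC q * C1 - (Li2_partial w n + RtoC q * Cpown w (S n)))%cx
      with ((Li2_partial C1 n - Li2_partial w n) + RtoC q * (C1 - Cpown w (S n)))%cx by ring.
    le_via Cnorm_triang. rewrite Rmult_plus_distr_r, Rmult_1_l. apply Rplus_le_compat; auto.
    rewrite Cnorm_mul, Cnorm_RtoC.
    assert (Hk : 1 <= INR (S n)) by (change 1 with (INR 1); apply le_INR; lia).
    assert (Hi : 0 < / INR (S n) <= 1).
    { split; [apply inv_pos; lra|]. rewrite <- Rinv_1. apply inv_le; lra. }
    assert (Hq : 0 <= q) by (unfold q; nra).
    rewrite Rabs_right by lra. assert (B := Cpown_1m w (S n) Hw).
    apply Rle_trans with (q * (INR (S n) * Cnorm (C1 - w)%cx)); [apply mul_le_l; auto|].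
    unfold q. replace (/ INR (S n) * / INR (S n) * (INR (S n) * Cnorm (C1 - w)%cx)) with (/ INR (S n) * Cnorm (C1 - w)%cx) by (field; lra).
    generalize (Cnorm_nonneg (C1 - w)%cx). nra.
Qed.
(** Continuity of Li2 at the boundary point 1. Both tails cost 1/n and the partial sums differ by at
    most n |1 - w|; the index n is free. *)
Lemma Dil_near1 w l z n : Cnorm w <= 1 -> (1 <= n)%nat -> Dil w l -> Dil C1 z ->
  Cnorm (l - z)%cx <= 2 * / INR n + INR n * Cnorm (C1 - w)%cx.
Proof.
  intros Hw Hn Hl Hz. specialize (Hl n Hn). specialize (Hz n Hn). assert (B := Li2_near1 w n Hw).
  replace (l - z)%cx with ((Li2_partial C1 n - z) - (Li2_partial w n - l) - (Li2_partial C1 n - Li2_partial w n))%cx by ring.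
  le_via Cnorm_sub_le.
  generalize (Cnorm_sub_le (Li2_partial C1 n - z) (Li2_partial w n - l)). lra.
Qed.
Lemma Dil_first w l : Cnorm w < 1 -> Dil w l -> Cnorm (l - w)%cx <= Cnorm w ^ 2 / (4 * (1 - Cnorm w)).
Proof.
  intros Hw Hl. assert (H0 := Cnorm_nonneg w). set (r := Cnorm w) in *.
  assert (B : forall n, Cnorm (Li2_partial w (S n) - w)%cx <= / 4 * (r ^ 2 * (1 - r ^ n) / (1 - r))).
  { induction n.
    - rewrite Li2_S. simpl Li2_partial. change (INR 1) with 1. rewrite Rinv_1, Rmult_1_l. change (RtoC 1) with C1.
      simpl Cpown. replace (C0 + C1 * (w * C1) - w)%cx with C0 by ring. rewrite Cnorm_0. simpl.
      right; field; lra.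
    - rewrite Li2_S. set (q := / INR (S (S n)) * / INR (S (S n))).
      replace (Li2_partial w (S n) + RtoC q * Cpown w (S (S n)) - w)%cx with ((Li2_partial w (S n) - w) + RtoC q * Cpown w (S (S n)))%cx by ring.
      le_via Cnorm_triang. rewrite Cnorm_mul, Cnorm_RtoC, Cnorm_pown.
      assert (Hk : 2 <= INR (S (S n))) by (change 2 with (INR 2); apply le_INR; lia).
      assert (Hi : 0 < / INR (S (S n)) <= / 2) by (split; [apply inv_pos; lra|apply inv_le; lra]).
      assert (Hq : 0 <= q <= / 4) by (unfold q; split; nra).
      rewrite Rabs_right by lra.
      replace (/ 4 * (r ^ 2 * (1 - r ^ S n) / (1 - r))) with (/ 4 * (r ^ 2 * (1 - r ^ n) / (1 - r)) + / 4 * r ^ S (S n)) by (simpl; field; lra).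
      apply Rplus_le_compat; auto. apply mul_le_r; [apply pow_le; auto|lra]. }
  apply Rnot_lt_le. intros Hc.
  set (d := Cnorm (l - w)%cx - r ^ 2 / (4 * (1 - r))) in *. assert (Hd : 0 < d) by (unfold d; lra).
  destruct (archimed_cor1 d Hd) as [n [Hn1 Hn2]].
  specialize (Hl n Hn2). destruct n as [|n]; [lia|]. specialize (B n).
  assert (T := Cnorm_sub_le (Li2_partial w (S n) - w) (Li2_partial w (S n) - l)).
  replace (Li2_partial w (S n) - w - (Li2_partial w (S n) - l))%cx with (l - w)%cx in T by ring.
  assert (B2 : / 4 * (r ^ 2 * (1 - r ^ n) / (1 - r)) <= r ^ 2 / (4 * (1 - r))).
  { replace (r ^ 2 / (4 * (1 - r))) with (/ 4 * (r ^ 2 * 1 / (1 - r))) by (field; lra).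
    apply mul_le_l; [lra|]. apply mul_le_r; [left; apply inv_pos; lra|].
    apply mul_le_l; [apply pow_le; auto|]. assert (0 <= r ^ n) by (apply pow_le; auto). lra. }
  unfold d in *. lra.
Qed.

(* Euler's reflection formula: the sum is constant along the points [1 - t v],
   and tends to [Li2 1] as [t -> 0]. *)
Lemma Dil_reflection w0 v l1 l2 z : (w0 + v)%cx = C1 -> Cnorm w0 < 1 -> Cnorm v < 1 ->
  Dil w0 l1 -> Dil v l2 -> Dil C1 z -> (l1 + l2 + Clog w0 * Clog v)%cx = z.
Proof.
  intros Hwv Hw Hv H1 H2 Hz. apply csub_eq0.
  assert (Hv1 : (C1 - v)%cx = w0) by (rewrite <- Hwv; ring).
  assert (Hw1 : (C1 - w0)%cx = v) by (rewrite <- Hwv; ring).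
  assert (Rv : 0 < Cre v) by (rewrite <- Hw1; now apply one_minus_re).
  assert (nv := Cnorm_nonneg v). assert (nw := Cnorm_nonneg w0).
  set (W := fun t => (C1 - RtoC t * v)%cx).
  assert (HWn : forall t, 0 <= t <= 1 -> Cnorm (W t) <= 1 - t * (1 - Cnorm w0)).
  { intros t Ht. unfold W. replace (C1 - RtoC t * v)%cx with (RtoC (1 - t) + RtoC t * w0)%cx by (rewrite <- Hv1; apply cx_eq; simpl; ring).
    le_via Cnorm_triang. rewrite Cnorm_mul, !Cnorm_RtoC, !Rabs_right by lra. lra. }
  assert (HWl : forall t, 0 <= t <= 1 -> 1 - Cnorm v <= Cnorm (W t)).
  { intros t Ht. unfold W. generalize (Cnorm_sub_ge C1 (RtoC t * v)%cx).
    rewrite Cnorm_1, Cnorm_mul, Cnorm_RtoC, Rabs_right by lra. nra. }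
  assert (HTv : forall t, 0 <= t <= 1 -> Cnorm (RtoC t * v)%cx = t * Cnorm v).
  { intros t Ht. rewrite Cnorm_mul, Cnorm_RtoC, Rabs_right by lra. auto. }
  (* Constancy between t0 and 1 is proved for partial sums: the derivative then consists of two
     errors of [Log1p], geometrically small in M as long as t0 > 0 is fixed. *)
  assert (Const : forall t0 a b, 0 < t0 <= 1 -> Dil (W t0) a -> Dil (RtoC t0 * v)%cx b ->
     (l1 + l2 + Clog w0 * Clog v)%cx = (a + b + Clog (W t0) * (RtoC (ln t0) + Clog v))%cx).
  { intros t0 a b Ht0 Ha Hb. apply csub_eq0, small_eq_e. intros e He.
    set (F := fun M t => (Li2_partial (W t) M + Li2_partial (RtoC t * v) M + Clog (W t) * (RtoC (ln t) + Clog v))%cx).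
    set (q := 1 - t0 * (1 - Cnorm w0)).
    assert (Hq : 0 <= q < 1) by (unfold q; nra).
    assert (HF : forall M, Cnorm (F M 1 - F M t0)%cx <= 2 * (/ (1 - Cnorm v) * (2 * (q ^ S M / (1 - q))) + / t0 * (2 * (Cnorm v ^ S M / (1 - Cnorm v)))) * (1 - t0)).
    { intros M. apply (cder_MVT (F M) (fun t => - (v / W t) * (Log1p (W t) M + Clog (C1 - W t)) + / RtoC t * (Log1p (RtoC t * v) M + Clog (C1 - RtoC t * v)))%cx); [lra| |].
      - intros t Ht.
        assert (Hp : 0 < Cre (W t)) by (apply one_minus_re; rewrite HTv by lra; nra).
        assert (Wn : W t <> C0) by (apply Cre_neq0; lra).
        assert (vn : v <> C0) by (apply Cre_neq0; lra).
        assert (tn : RtoC t <> C0) by (apply RtoC_neq0; lra).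
        assert (dv : cder (fun t => RtoC t * v)%cx t v).
        { eapply cder_val; [apply cder_mul; [apply cder_id|apply cder_const]|cbv beta; ring]. }
        assert (dW : cder W t (- v)%cx).
        { eapply cder_val; [apply cder_sub; [apply cder_const|exact dv]|ring]. }
        eapply cder_val.
        + apply cder_add; [apply cder_add; [apply Li2_der; [exact dW|auto]|apply Li2_der; [exact dv|now apply Cmul_neq0]]|].
          apply cder_mul; [apply cder_log; [exact dW|exact Hp]|].
          apply cder_add; [apply cder_RtoC, dln; lra|apply cder_const].
        + replace (C1 - W t)%cx with (RtoC t * v)%cx by (unfold W; ring).
          rewrite Clog_mul_RtoC by (auto; lra). rewrite RtoC_inv by lra. fold (W t). field. auto.
      - intros t Ht. assert (Ht1 : 0 <= t <= 1) by lra.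
        assert (W1 := HWn t Ht1). assert (W2 := HWl t Ht1).
        assert (Wq : Cnorm (W t) <= q) by (unfold q; nra).
        assert (Wn : W t <> C0) by (intros E; rewrite E, Cnorm_0 in W2; lra).
        assert (tn : RtoC t <> C0) by (apply RtoC_neq0; lra).
        le_via Cnorm_triang. apply Rplus_le_compat.
        + rewrite Cnorm_mul, Cnorm_opp, Cnorm_div by auto. apply Rmult_le_compat; auto using Cnorm_nonneg.
          * apply Rdiv_le_0_compat; lra.
          * replace (/ (1 - Cnorm v)) with (1 * / (1 - Cnorm v)) by ring.
            apply Rmult_le_compat; try lra; [left; apply inv_pos; lra|apply inv_le; lra].
          * eapply Rle_trans; [apply Log1p_error; lra|]. apply mul_le_l; [lra|].
            apply Rmult_le_compat.
            -- apply pow_le, Cnorm_nonneg.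
            -- left; apply inv_pos; lra.
            -- apply pow_incr; split; [apply Cnorm_nonneg|auto].
            -- apply inv_le; lra.
        + rewrite Cnorm_mul, Cnorm_inv, Cnorm_RtoC, Rabs_right by (auto; lra).
          assert (Hb1 := HTv t Ht1).
          apply Rmult_le_compat; auto using Cnorm_nonneg.
          * left; apply inv_pos; lra.
          * apply inv_le; lra.
          * eapply Rle_trans; [apply Log1p_error; rewrite Hb1; nra|]. apply mul_le_l; [lra|].
            apply Rmult_le_compat.
            -- apply pow_le; nra.
            -- left; apply inv_pos; nra.
            -- apply pow_incr; nra.
            -- apply inv_le; nra. }
    destruct (pow_cv0 q (2 * (/ (1 - Cnorm v) * (2 * (q / (1 - q)))) * (1 - t0)) (e / 8) Hq ltac:(lra)) as [n1 G1].
    destruct (pow_cv0 (Cnorm v) (2 * (/ t0 * (2 * (Cnorm v / (1 - Cnorm v)))) * (1 - t0)) (e / 8) ltac:(lra) ltac:(lra)) as [n2 G2].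
    destruct (archimed_cor1 (e / 8) ltac:(lra)) as [n3 [G3 G3']].
    set (M := (n1 + n2 + n3)%nat).
    assert (HM : / INR M <= e / 8).
    { left. eapply Rle_lt_trans; [|exact G3]. apply inv_le; [apply lt_0_INR; lia|apply le_INR; unfold M; lia]. }
    specialize (G1 M ltac:(unfold M; lia)). specialize (G2 M ltac:(unfold M; lia)). specialize (HF M).
    assert (HM1 : (1 <= M)%nat) by (unfold M; lia).
    specialize (H1 M HM1). specialize (H2 M HM1). specialize (Ha M HM1). specialize (Hb M HM1).
    assert (EF : F M 1 = (Li2_partial w0 M + Li2_partial v M + Clog w0 * Clog v)%cx).
    { unfold F, W. rewrite ln_1. change (RtoC 1) with C1. change (RtoC 0) with C0.
      replace (C1 * v)%cx with v by ring. rewrite Hv1. replace (C0 + Clog v)%cx with (Clog v) by ring. reflexivity. }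
    rewrite EF in HF. unfold F in HF.
    assert (HF2 : 2 * (/ (1 - Cnorm v) * (2 * (q ^ S M / (1 - q))) + / t0 * (2 * (Cnorm v ^ S M / (1 - Cnorm v)))) * (1 - t0) <= e / 4).
    { eapply Rle_trans; [|replace (e / 4) with (e / 8 + e / 8) by field; apply Rplus_le_compat; [exact G1|exact G2]].
      right. simpl. field. repeat split; lra. }
    match type of HF with Cnorm (?p - ?r)%cx <= _ => set (p0 := p) in *; set (r0 := r) in * end.
    replace (l1 + l2 + Clog w0 * Clog v - (a + b + Clog (W t0) * (RtoC (ln t0) + Clog v)))%cx
      with ((p0 - r0) + (Li2_partial (W t0) M - a) + (Li2_partial (RtoC t0 * v) M - b) - (Li2_partial w0 M - l1) - (Li2_partial v M - l2))%cx
      by (unfold p0, r0; ring).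
    le_via Cnorm_sub_le.
    eapply Rle_trans; [apply Rplus_le_compat_r, Cnorm_sub_le|].
    eapply Rle_trans; [apply Rplus_le_compat_r, Rplus_le_compat_r, Cnorm_triang|].
    eapply Rle_trans; [apply Rplus_le_compat_r, Rplus_le_compat_r, Rplus_le_compat_r, Cnorm_triang|]. lra. }
  set (B := 2 + Cnorm v + 2 * Cnorm v / (1 - Cnorm v) + (2 * Cnorm v / (1 - Cnorm v)) * (2 + Cnorm (Clog v))).
  apply small_eq with (B + 1). intros k Hk.
  assert (Hkp : 1 <= INR k) by (change 1 with (INR 1); apply le_INR; auto).
  (* The choice t0 = 1/k^2 balances [Dil_near1]: the tails give 2/k and the partial sums k t0 = 1/k.
     It also beats the logarithm of t0 in the product term. *)
  set (t0 := / INR k * / INR k).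
  assert (Hik : 0 < / INR k <= 1) by (split; [apply inv_pos; lra|rewrite <- Rinv_1; apply inv_le; lra]).
  assert (Ht0 : 0 < t0 <= 1) by (unfold t0; nra).
  assert (Wt : Cnorm (W t0) <= 1) by (eapply Rle_trans; [apply HWn; lra|nra]).
  assert (Tv := HTv t0 ltac:(lra)).
  assert (Tv1 : Cnorm (RtoC t0 * v)%cx < 1) by nra.
  destruct (Dil_exists (W t0) Wt) as [a Ha]. destruct (Dil_exists (RtoC t0 * v)%cx ltac:(lra)) as [b Hb].
  rewrite (Const t0 a b Ht0 Ha Hb).
  assert (N1 := Dil_near1 (W t0) a z k Wt Hk Ha Hz).
  replace (C1 - W t0)%cx with (RtoC t0 * v)%cx in N1 by (unfold W; ring). rewrite Tv in N1.
  assert (N2 := Dil_first _ b Tv1 Hb). rewrite Tv in N2.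
  assert (N3 := Clog_1m_bound _ Tv1). rewrite Tv in N3.
  assert (i2 : / (1 - t0 * Cnorm v) <= / (1 - Cnorm v)) by (apply inv_le; nra).
  assert (i3 : 0 < / (1 - t0 * Cnorm v)) by (apply inv_pos; nra).
  assert (N3' : Cnorm (Clog (W t0)) <= 2 * Cnorm v / (1 - Cnorm v) * t0).
  { le_via N3. unfold Rdiv.
    replace (2 * Cnorm v * / (1 - Cnorm v) * t0) with (2 * (t0 * Cnorm v * / (1 - Cnorm v))) by ring.
    apply mul_le_l; [lra|]. apply mul_le_l; nra. }
  assert (Nb : Cnorm b <= 2 * Cnorm v / (1 - Cnorm v) * t0).
  { replace b with ((b - RtoC t0 * v) + RtoC t0 * v)%cx by ring. le_via Cnorm_triang. rewrite Tv.
    assert ((t0 * Cnorm v) ^ 2 / (4 * (1 - t0 * Cnorm v)) <= t0 * Cnorm v * / (1 - Cnorm v)).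
    { replace ((t0 * Cnorm v) ^ 2 / (4 * (1 - t0 * Cnorm v))) with ((t0 * Cnorm v) * ((t0 * Cnorm v) / 4 * / (1 - t0 * Cnorm v))) by (field; nra).
      rewrite (Rmult_assoc t0). rewrite (Rmult_assoc t0). apply mul_le_l; [lra|]. apply mul_le_l; [lra|].
      apply Rle_trans with (1 * / (1 - t0 * Cnorm v)); [|lra]. apply mul_le_r; [lra|]. nra. }
    assert (I1 : 1 <= / (1 - Cnorm v)) by (rewrite <- Rinv_1 at 1; apply inv_le; lra).
    replace (2 * Cnorm v / (1 - Cnorm v) * t0) with (t0 * Cnorm v * / (1 - Cnorm v) + t0 * Cnorm v * / (1 - Cnorm v)) by (unfold Rdiv; ring).
    apply Rplus_le_compat; [eapply Rle_trans; [exact N2|assumption]|]. rewrite <- (Rmult_1_r (t0 * Cnorm v)) at 1. apply mul_le_l; [nra|exact I1]. }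
  assert (Nl : Cnorm (RtoC (ln t0) + Clog v)%cx <= (2 + Cnorm (Clog v)) * INR k).
  { le_via Cnorm_triang. rewrite Cnorm_RtoC.
    assert (El : ln t0 = - (2 * ln (INR k))).
    { unfold t0. rewrite ln_mult, ln_Rinv by (try apply inv_pos; lra). ring. }
    assert (Lk : 0 <= ln (INR k) <= INR k).
    { split; [rewrite <- ln_1; destruct Hkp as [h|h]; [left; apply ln_increasing; lra|rewrite <- h; lra]|].
      assert (h := exp_ineq1_le (ln (INR k))). rewrite exp_ln in h by lra. lra. }
    rewrite El, Rabs_Ropp, Rabs_right by lra. generalize (Cnorm_nonneg (Clog v)). nra. }
  replace (a + b + Clog (W t0) * (RtoC (ln t0) + Clog v) - z)%cx with ((a - z) + b + Clog (W t0) * (RtoC (ln t0) + Clog v))%cx by ring.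
  le_via Cnorm_triang. rewrite Cnorm_mul.
  eapply Rle_trans; [apply Rplus_le_compat_r, Cnorm_triang|].
  assert (P : Cnorm (Clog (W t0)) * Cnorm (RtoC (ln t0) + Clog v)%cx <= (2 * Cnorm v / (1 - Cnorm v) * t0) * ((2 + Cnorm (Clog v)) * INR k)).
  { apply Rmult_le_compat; auto using Cnorm_nonneg. }
  assert (E0 : t0 * INR k = / INR k) by (unfold t0; field; lra).
  assert (Q0 : 0 <= 2 * Cnorm v / (1 - Cnorm v)) by (apply Rdiv_le_0_compat; lra).
  assert (T1 : t0 <= / INR k) by (unfold t0; nra).
  unfold B.
  replace ((2 * Cnorm v / (1 - Cnorm v) * t0) * ((2 + Cnorm (Clog v)) * INR k)) with
     (2 * Cnorm v / (1 - Cnorm v) * (2 + Cnorm (Clog v)) * (t0 * INR k)) in P by ring.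
  rewrite E0 in P.
  replace (INR k * (t0 * Cnorm v)) with (Cnorm v * (t0 * INR k)) in N1 by ring. rewrite E0 in N1.
  set (Q := 2 * Cnorm v / (1 - Cnorm v)) in *.
  assert (Q * t0 <= Q * / INR k) by (apply mul_le_l; auto).
  lra.
Qed.

(** * The exponent on the ray *)

Lemma Cre_RtoC_mul a z : Cre (RtoC a * z)%cx = a * Cre z.
Proof. simpl; ring. Qed.

Section RayP.
Variable z0 : Cplx.
Hypothesis Hz0 : Cre z0 < 0.
Notation c := (RtoC (/ 2) * z0)%cx.
Notation w x := (Cexp (RtoC x * z0)%cx).

Lemma w_norm x : Cnorm (w x) = exp (x * Cre z0).
Proof. rewrite Cnorm_exp. f_equal. simpl. ring. Qed.
Lemma w_lt1 x : 0 < x -> Cnorm (w x) < 1.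
Proof. intros Hx. rewrite w_norm, <- exp_0. apply exp_increasing. nra. Qed.
Lemma w_mono x y : x <= y -> Cnorm (w y) <= Cnorm (w x).
Proof. intros H. rewrite !w_norm. apply exp_le. nra. Qed.
Lemma w_sq x : w x = (rayE z0 x * rayE z0 x)%cx.
Proof. unfold rayE. rewrite <- Cexp_add. f_equal. apply cx_eq; simpl; field. Qed.
Lemma w_cder x : cder (fun x => w x) x (z0 * w x)%cx.
Proof.
  eapply cder_val; [apply cder_exp, cder_mul; [apply cder_id|apply cder_const]|cbv beta; ring].
Qed.

(** After multiplication by -c, [ray1] becomes (1 - exp (x c))/x for x > 0, whose real part is
    positive. So the principal branch is available for this product along the whole ray. *)
Lemma rayf_Clog x : 0 <= x -> rayf z0 x = (Clog (- c * ray1 z0 x) - Clog (- c))%cx.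
Proof.
  intros Hx.
  assert (Hp : forall t, 0 <= t -> 0 < Cre (- c * ray1 z0 t)%cx).
  { intros t Ht. destruct (Req_dec t 0) as [->|Hne].
    - rewrite (ray1_0 z0 Hz0). simpl. lra.
    - assert (E := ray1_eq z0 Hz0 t). assert (P := one_minus_re (rayE z0 t) (rayE_norm_lt1 z0 Hz0 t ltac:(lra))).
      rewrite E in P. replace (- (RtoC t * c) * ray1 z0 t)%cx with (RtoC t * (- c * ray1 z0 t))%cx in P by ring.
      rewrite Cre_RtoC_mul in P.
      nra. }
  assert (E : (rayf z0 x - Clog (- c * ray1 z0 x) = rayf z0 0%R - Clog (- c * ray1 z0 0%R))%cx).
  { apply (cder_zero_const (fun x => rayf z0 x - Clog (- c * ray1 z0 x))%cx 0 x); auto.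
    intros t Ht. eapply cder_val.
    - apply (cder_sub (rayf z0) (fun x => Clog (- c * ray1 z0 x)%cx)); [exact (loglift_der _ (ray1_csm z0) (ray1_neq0 z0 Hz0) C0 t)|].
      apply cder_log; [apply cder_mul; [apply cder_const|apply (csm_cder allR); [apply ray1_csm|exact I]]|apply Hp; lra].
    - cbv beta. assert (n1 := ray1_neq0 z0 Hz0 t). field.
      split; [exact n1|apply Cre_neq0; simpl; lra]. }
  rewrite (rayf_0 z0), (ray1_0 z0 Hz0) in E.
  replace (- c * C1)%cx with (- c)%cx in E by ring.
  replace (rayf z0 x) with (rayf z0 x - Clog (- c * ray1 z0 x) + Clog (- c * ray1 z0 x))%cx by ring. rewrite E. ring.
Qed.

(** Even and odd factors recombine: with w = E^2 one has 1 - w = (1 - E)(1 + E), and all three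
    numbers lie in the right half-plane. *)
Lemma ray_log_sum x : 0 < x ->
  (Clog (- z0) + RtoC (ln x - ln 2) + rayf z0 x + rayg z0 x = Clog (C1 - w x))%cx.
Proof.
  intros Hx.
  assert (HE := rayE_norm_lt1 z0 Hz0 x Hx).
  assert (P1 := one_minus_re _ HE).
  assert (P2 := one_minus_re (- rayE z0 x)%cx ltac:(rewrite Cnorm_opp; exact HE)).
  replace (C1 - - rayE z0 x)%cx with (C1 + rayE z0 x)%cx in P2 by ring.
  assert (P3 := one_minus_re _ (w_lt1 x Hx)).
  assert (E3 : (C1 - w x)%cx = ((C1 - rayE z0 x) * (C1 + rayE z0 x))%cx) by (rewrite w_sq; ring).
  rewrite E3 in P3 |- *. rewrite Clog_mul by auto.
  rewrite rayf_Clog by lra. rewrite (rayg_Clog z0 Hz0) by lra. unfold ray2.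
  assert (E := ray1_eq z0 Hz0 x). rewrite E in P1 |- *.
  replace (- (RtoC x * c) * ray1 z0 x)%cx with (RtoC x * (- c * ray1 z0 x))%cx in * by ring.
  set (q := (- c * ray1 z0 x)%cx) in *.
  rewrite (Clog_mul_RtoC x q) by (auto; rewrite Cre_RtoC_mul in P1; nra).
  replace (- c)%cx with (RtoC (/ 2) * (- z0))%cx by ring.
  rewrite Clog_mul_RtoC by (simpl; lra).
  rewrite ln_Rinv by lra. unfold Rminus. rewrite RtoC_add, !RtoC_opp. ring.
Qed.

Definition rayU (x : R) : Cplx := (RtoC x * rayP z0 x)%cx.
Lemma rayU_eq x : 0 < x -> rayU x =
  (RtoC (x * (/ 2 + / 2 * ln 2 - / 2 * ln x)) - RtoC (x / 2) * Clog (- z0) - RtoC (/ 2) * (cprim (rayf z0) x + cprim (rayg z0) x))%cx.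
Proof.
  intros Hx. unfold rayU, rayP, rayA.
  replace (RtoC (/ (2 * x))) with (RtoC (/ 2) * / RtoC x)%cx.
  - unfold Rdiv. rewrite !RtoC_mul. field. apply RtoC_neq0; lra.
  - rewrite <- RtoC_inv, <- RtoC_mul by lra. f_equal. field. lra.
Qed.
(** Multiplying P by x removes the averaging in [rayA], and the derivatives of the remaining terms
    add up to the logarithm of [ray_log_sum]. *)
Lemma rayU_der x : 0 < x -> cder rayU x (- RtoC (/ 2) * Clog (C1 - w x))%cx.
Proof.
  intros Hx.
  apply (cder_ext_loc (fun x => RtoC (x * (/ 2 + / 2 * ln 2 - / 2 * ln x)) - RtoC (x / 2) * Clog (- z0) - RtoC (/ 2) * (cprim (rayf z0) x + cprim (rayg z0) x))%cx).
  { apply filter_imp with (fun t => 0 < t); [intros t Ht; now rewrite rayU_eq|]. apply (open_gt 0 x Hx). }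
  eapply cder_val.
  - apply cder_sub; [apply cder_sub|].
    + apply cder_RtoC. apply dmult; [apply did|]. apply dminus; [apply dconst|]. apply dmult; [apply dconst|apply dln, Hx].
    + apply cder_mul; [apply cder_RtoC; unfold Rdiv; apply dmult; [apply did|apply dconst]|apply cder_const].
    + apply cder_scal, cder_add; apply (cprim_der allR allR_open allR_star); try exact I; [apply rayf_csm|apply rayg_csm]; auto.
  - rewrite <- ray_log_sum by auto. apply cx_eq; simpl; field; lra.
Qed.

Lemma rayP_der x : 0 < x -> cder (rayP z0) x ((- RtoC (/ 2) * Clog (C1 - w x) - rayP z0 x) / RtoC x)%cx.
Proof.
  intros Hx. assert (nx : RtoC x <> C0) by (apply RtoC_neq0; lra).
  apply (cder_ext_loc (fun x => / RtoC x * rayU x)%cx).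
  { apply filter_imp with (fun t => 0 < t); [|apply (open_gt 0 x Hx)].
    intros t Ht. unfold rayU. field. apply RtoC_neq0; lra. }
  eapply cder_val; [apply cder_mul; [apply cder_inv; [apply cder_id|auto]|apply rayU_der, Hx]|].
  unfold rayU. field. auto.
Qed.

Lemma rayP_csm : csm posR (rayP z0).
Proof.
  assert (HO := posR_open).
  assert (Hi : smooth posR (fun x => x)) by (apply smooth_id; auto).
  assert (Hl : smooth posR ln) by apply smooth_ln.
  assert (Hf : csm posR (cprim (rayf z0))).
  { apply (pos_of_D allR allR_pos), csm_cprim; auto using allR_open, allR_star. apply rayf_csm; auto. }
  assert (Hg : csm posR (cprim (rayg z0))).
  { apply (pos_of_D allR allR_pos), csm_cprim; auto using allR_open, allR_star. apply rayg_csm; auto. }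
  apply (csm_ext posR HO (fun x => / RtoC x * (RtoC (x * (/ 2 + / 2 * ln 2 - / 2 * ln x)) - RtoC (x * / 2) * Clog (- z0) - RtoC (/ 2) * (cprim (rayf z0) x + cprim (rayg z0) x)))%cx).
  { intros x Hx. change (x * / 2) with (x / 2). rewrite <- rayU_eq by exact Hx. unfold rayU. field. apply RtoC_neq0. unfold posR in Hx. lra. }
  apply csm_mul; auto.
  - apply csm_inv; auto; [apply csm_RtoC; auto|]. intros x Hx. apply RtoC_neq0. unfold posR in Hx; lra.
  - apply csm_sub; auto; [apply csm_sub; auto|].
    + apply csm_RtoC; auto. apply smooth_mult; auto. apply smooth_minus; auto; [apply smooth_const; auto|].
      apply smooth_mult; auto; apply smooth_const; auto.
    + apply csm_mul; auto; [|apply csm_const; auto]. apply csm_RtoC; auto. apply smooth_mult; auto; apply smooth_const; auto.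
    + apply csm_mul; auto; [apply csm_const; auto|]. apply csm_add; auto.
Qed.

(** This is x^2 P'. Its derivative is elementary, so the sign of Re P' near the saddle can be read
    off from monotonicity. *)
Definition rayQ (x : R) : Cplx := (- (RtoC (x / 2) * Clog (C1 - w x)) - rayU x)%cx.
Lemma rayP_der_Q x : 0 < x -> cder (rayP z0) x (rayQ x / RtoC (x * x))%cx.
Proof.
  intros Hx. eapply cder_val; [apply rayP_der, Hx|]. unfold rayQ, rayU, Rdiv. rewrite !RtoC_mul. field. apply RtoC_neq0; lra.
Qed.
Lemma rayQ_der x : 0 < x -> cder rayQ x (RtoC (x / 2) * (z0 * w x / (C1 - w x)))%cx.
Proof.
  intros Hx. assert (P3 := one_minus_re _ (w_lt1 x Hx)).
  assert (n : (C1 - w x)%cx <> C0) by (apply Cre_neq0; lra).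
  eapply cder_val.
  - apply cder_sub; [apply cder_opp, cder_mul|apply rayU_der, Hx].
    + apply cder_RtoC. apply dmult; [apply did|apply dconst].
    + apply cder_log; [apply cder_sub; [apply cder_const|apply w_cder]|exact P3].
  - cbv beta. replace (1 * / 2 + x * 0) with (/ 2) by ring. unfold Rdiv. field. exact n.
Qed.

(** Both 2 z0 x P(x) and Li2 (exp (x z0)) have derivative -z0 log (1 - exp (x z0)). As x tends to 0
    the first tends to 0 and the second to Li2(1). *)
Lemma rayP_Dil x l z : 0 < x -> Dil (w x) l -> Dil C1 z -> (RtoC (2 * x) * z0 * rayP z0 x)%cx = (l - z)%cx.
Proof.
  intros Hx Hl Hz. apply csub_eq0.
  assert (nz := Cnorm_nonneg z0).
  assert (Const : forall t0 l0, 0 < t0 <= x -> Dil (w t0) l0 ->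
     (RtoC 2 * z0 * rayU x - l = RtoC 2 * z0 * rayU t0 - l0)%cx).
  { intros t0 l0 Ht0 Hl0. apply csub_eq0, small_eq_e. intros e He.
    set (q := Cnorm (w t0)). assert (Hq1 : q < 1) by (apply w_lt1; lra). assert (Hq0 : 0 <= q) by apply Cnorm_nonneg.
    assert (B : forall M, Cnorm ((RtoC 2 * z0 * rayU x - Li2_partial (w x) M) - (RtoC 2 * z0 * rayU t0 - Li2_partial (w t0) M))%cx
       <= 2 * (Cnorm z0 * (2 * (q ^ S M / (1 - q)))) * (x - t0)).
    { intros M. apply (cder_MVT (fun t => RtoC 2 * z0 * rayU t - Li2_partial (w t) M)%cx
        (fun t => - z0 * (Log1p (w t) M + Clog (C1 - w t)))%cx); [lra| |].
      - intros t Ht. eapply cder_val.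
        + apply cder_sub; [apply cder_scal, rayU_der; lra|]. apply Li2_der; [apply w_cder|apply Cexp_neq0].
        + assert (n := Cexp_neq0 (RtoC t * z0)%cx).
          transitivity (- (RtoC 2 * RtoC (/ 2)) * z0 * Clog (C1 - w t) - Log1p (w t) M * z0)%cx; [field; auto|].
          rewrite <- RtoC_mul. replace (2 * / 2) with 1 by field. change (RtoC 1) with C1. ring.
      - intros t Ht. rewrite Cnorm_mul, Cnorm_opp. apply mul_le_l; auto.
        assert (Hw1 : Cnorm (w t) <= q) by (apply w_mono; lra).
        eapply Rle_trans; [apply Log1p_error; lra|]. apply mul_le_l; [lra|].
        apply Rmult_le_compat.
        + apply pow_le, Cnorm_nonneg.
        + left; apply inv_pos; lra.
        + apply pow_incr; split; [apply Cnorm_nonneg|auto].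
        + apply inv_le; lra. }
    destruct (pow_cv0 q (2 * (Cnorm z0 * (2 * (q / (1 - q)))) * (x - t0)) (e / 4) ltac:(lra) ltac:(lra)) as [n1 G1].
    destruct (archimed_cor1 (e / 4) ltac:(lra)) as [n3 [G3 G3']].
    set (M := (n1 + n3)%nat). specialize (G1 M ltac:(unfold M; lia)).
    assert (HM : / INR M <= e / 4).
    { left. eapply Rle_lt_trans; [|exact G3]. apply inv_le; [apply lt_0_INR; lia|apply le_INR; unfold M; lia]. }
    specialize (Hl M ltac:(unfold M; lia)). specialize (Hl0 M ltac:(unfold M; lia)). specialize (B M).
    replace (2 * (Cnorm z0 * (2 * (q ^ S M / (1 - q)))) * (x - t0)) with (2 * (Cnorm z0 * (2 * (q / (1 - q)))) * (x - t0) * q ^ M) in B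
      by (simpl; field; lra).
    match type of B with Cnorm (?p - ?r)%cx <= _ => set (p0 := p) in *; set (r0 := r) in * end.
    replace (RtoC 2 * z0 * rayU x - l - (RtoC 2 * z0 * rayU t0 - l0))%cx with
      ((p0 - r0) + (Li2_partial (w x) M - l) - (Li2_partial (w t0) M - l0))%cx by (unfold p0, r0; ring).
    le_via Cnorm_sub_le.
    eapply Rle_trans; [apply Rplus_le_compat_r, Cnorm_triang|]. lra. }
  destruct (csm_bounded allR (fun t => rayf z0 t + rayg z0 t)%cx 0 x) as [K1 [HK1 B1]]; [|lra|intros; exact I|].
  { apply csm_add; [apply allR_open|apply rayf_csm|apply rayg_csm]; auto. }
  destruct (csm_bounded allR (ray1 z0) 0 (2 * x)) as [K2 [HK2 B2]]; [apply ray1_csm|lra|intros; exact I|].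
  set (KU := (1 + ln 2 + Rabs (ln x) + 2 + Cnorm (Clog (- z0)) + 2 * K1) * x).
  apply small_eq with (2 * Cnorm z0 * KU + 2 + 2 * x * Cnorm c * K2). intros k Hk.
  assert (Hkp : 1 <= INR k) by (change 1 with (INR 1); apply le_INR; auto).
  set (i := / INR k). assert (Hi : 0 < i <= 1) by (split; [apply inv_pos; lra|unfold i; rewrite <- Rinv_1; apply inv_le; lra]).
  (* With t0 = x/k^2 the value U(t0), of size t0 (1 + |ln t0|), is O(1/k), and so is the bound of
     [Dil_near1] at index k. *)
  set (t0 := x * (i * i)).
  assert (Ht0 : 0 < t0 <= x * i) by (unfold t0; split; [apply mul_lt_pos; nra|apply mul_le_l; nra]).
  assert (Ht1 : t0 <= x) by nra.
  assert (Wt : Cnorm (w t0) <= 1) by (left; apply w_lt1; lra).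
  destruct (Dil_exists (w t0) Wt) as [l0 Hl0].
  assert (E := Const t0 l0 ltac:(lra) Hl0).
  replace (RtoC (2 * x) * z0 * rayP z0 x - (l - z))%cx with ((RtoC 2 * z0 * rayU x - l) + z)%cx by (unfold rayU; rewrite RtoC_mul; ring).
  rewrite E.
  assert (N1 := Dil_near1 (w t0) l0 z k Wt Hk Hl0 Hz).
  assert (N2 : Cnorm (C1 - w t0)%cx <= 2 * t0 * Cnorm c * K2).
  { replace (w t0) with (rayE z0 (2 * t0)) by (unfold rayE; f_equal; apply cx_eq; simpl; field).
    rewrite (ray1_eq z0 Hz0), Cnorm_mul, Cnorm_opp, (Cnorm_mul (RtoC (2 * t0)) c), Cnorm_RtoC, Rabs_right by lra.
    apply mul_le_l; [|apply B2; lra]. apply mul_pos; [lra|apply Cnorm_nonneg]. }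
  assert (N3 : Cnorm (rayU t0) <= KU * i).
  { rewrite rayU_eq by lra.
    assert (V : Cnorm ((cprim (rayf z0) t0 + cprim (rayg z0) t0) - (cprim (rayf z0) 0%R + cprim (rayg z0) 0%R))%cx <= 2 * K1 * (t0 - 0)).
    { apply (cder_MVT (fun t => cprim (rayf z0) t + cprim (rayg z0) t)%cx (fun t => rayf z0 t + rayg z0 t)%cx); [lra| |intros; apply B1; lra].
      intros t _. apply cder_add; apply (cprim_der allR allR_open allR_star); try exact I; [apply rayf_csm|apply rayg_csm]; auto. }
    rewrite !cprim_0 in V. set (pp := (cprim (rayf z0) t0 + cprim (rayg z0) t0)%cx) in *.
    replace (pp - (C0 + C0))%cx with pp in V by ring.
    assert (Ll : Rabs (ln t0) <= Rabs (ln x) + 2 * INR k).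
    {
      unfold t0. rewrite ln_mult, ln_mult by (lra || nra). unfold i. rewrite ln_Rinv by lra.
      assert (Lk : 0 <= ln (INR k) <= INR k).
      { split; [rewrite <- ln_1; destruct Hkp as [h|h]; [left; apply ln_increasing; lra|rewrite <- h; lra]|].
        assert (h := exp_ineq1_le (ln (INR k))). rewrite exp_ln in h by lra. lra. }
      le_via Rabs_triang. rewrite (Rabs_left1 (- ln (INR k) + - ln (INR k))) by lra. lra. }
    assert (L2 : 0 < ln 2) by (rewrite <- ln_1; apply ln_increasing; lra).
    le_via Cnorm_sub_le.
    eapply Rle_trans; [apply Rplus_le_compat_r, Cnorm_sub_le|].
    rewrite !Cnorm_mul, !Cnorm_RtoC.
    rewrite (Rabs_right (t0 / 2)), (Rabs_right (/ 2)) by lra.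
    rewrite Rabs_mult, (Rabs_right t0) by lra.
    assert (A1 : Rabs (/ 2 + / 2 * ln 2 - / 2 * ln t0) <= 1 + ln 2 + Rabs (ln x) + INR k).
    { generalize (Rabs_triang (/ 2 + / 2 * ln 2) (- (/ 2 * ln t0))).
      rewrite Rabs_Ropp, Rabs_mult, (Rabs_right (/ 2)), (Rabs_right (/ 2 + / 2 * ln 2)) by lra. unfold Rminus.
      generalize (Rabs_pos (ln x)). lra. }
    assert (A2 : t0 * INR k = x * i) by (unfold t0, i; field; lra).
    assert (A3 := Cnorm_nonneg (Clog (- z0))). assert (A4 := Rabs_pos (ln x)).
    assert (A6 : t0 * (1 + ln 2 + Rabs (ln x)) <= x * i * (1 + ln 2 + Rabs (ln x))) by (apply mul_le_r; lra).
    unfold KU. nra. }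
  replace (RtoC 2 * z0 * rayU t0 - l0 + z)%cx with (RtoC 2 * z0 * rayU t0 - (l0 - z))%cx by ring.
  le_via Cnorm_sub_le. rewrite !Cnorm_mul, Cnorm_RtoC, (Rabs_right 2) by lra.
  assert (A9 : 2 * Cnorm z0 * Cnorm (rayU t0) <= 2 * Cnorm z0 * (KU * i)) by (apply mul_le_l; lra).
  assert (A10 : INR k * Cnorm (C1 - w t0)%cx <= INR k * (2 * t0 * Cnorm c * K2)) by (apply mul_le_l; lra).
  replace (INR k * (2 * t0 * Cnorm c * K2)) with (2 * x * Cnorm c * K2 * i) in A10 by (unfold t0, i; field; lra).
  fold i in N1. rewrite Cnorm_mul in A10. lra.
Qed.

End RayP.

(** * Numerical bounds *)

Lemma mono_of_der (f g : R -> R) a b : a <= b -> (forall t, a <= t <= b -> is_derive f t (g t)) ->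
  (forall t, a <= t <= b -> 0 <= g t) -> f a <= f b.
Proof.
  intros Hab Hd Hg. destruct Hab as [Hab| -> ]; [|lra].
  destruct (MVT_cor2 f g a b Hab) as [x [E Hx]].
  { intros t Ht. apply is_derive_Reals, Hd, Ht. }
  specialize (Hg x ltac:(lra)). nra.
Qed.

Lemma exp_ge_taylor4 x : 0 <= x -> 1 + x + x ^ 2 / 2 + x ^ 3 / 6 + x ^ 4 / 24 <= exp x.
Proof. intros Hx. assert (T := ElemFct.exp_ge_taylor x 4 Hx). simpl in *. lra. Qed.
Lemma exp_neg_ge_taylor3 x : 0 <= x -> 1 - x + x ^ 2 / 2 - x ^ 3 / 6 <= exp (- x).
Proof.
  assert (D : forall s, is_derive (fun t => exp (- t)) s (- exp (- s))).
  { intros s. eapply is_derive_val; [apply (dcomp exp); [apply dexp|apply dopp, did]|]. cbv beta; ring. }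
  assert (A0 : forall x, 0 <= x -> 1 - x <= exp (- x)) by (intros t _; generalize (exp_ineq1_le (- t)); lra).
  assert (A1 : forall x, 0 <= x -> exp (- x) <= 1 - x + x ^ 2 / 2).
  { intros t Ht. assert (B := mono_of_der (fun t => (1 - t + t ^ 2 / 2) - exp (- t)) (fun t => (- 1 + t) - (- exp (- t))) 0 t Ht).
    cbv beta in B. rewrite Ropp_0, exp_0 in B.
    enough (1 - 0 + 0 ^ 2 / 2 - 1 <= 1 - t + t ^ 2 / 2 - exp (- t)) by lra. apply B.
    - intros s Hs. apply dminus; [auto_derive; auto; field|apply D].
    - intros s Hs. specialize (A0 s (proj1 Hs)). lra. }
  intros Hx. assert (B := mono_of_der (fun t => exp (- t) - (1 - t + t ^ 2 / 2 - t ^ 3 / 6)) (fun t => - exp (- t) - (- 1 + t - t ^ 2 / 2)) 0 x Hx).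
  cbv beta in B. rewrite Ropp_0, exp_0 in B.
  enough (1 - (1 - 0 + 0 ^ 2 / 2 - 0 ^ 3 / 6) <= exp (- x) - (1 - x + x ^ 2 / 2 - x ^ 3 / 6)) by lra. apply B.
  - intros s Hs. apply dminus; [apply D|auto_derive; auto; field].
  - intros s Hs. specialize (A1 s (proj1 Hs)). lra.
Qed.
Lemma exp_le_inv x y : 0 < y -> / y <= exp x -> exp (- x) <= y.
Proof.
  intros Hy H. rewrite exp_Ropp, <- (Rinv_inv y). apply inv_le; auto. apply inv_pos; auto.
Qed.
Lemma atan_bounds s : 0 <= s -> s - s ^ 3 / 3 <= atan s <= s - s ^ 3 / 3 + s ^ 5 / 5.
Proof.
  intros Hs.
  assert (D : forall s, is_derive atan s (/ (1 + s ^ 2))).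
  { intros t. apply is_derive_Reals. generalize (derivable_pt_lim_atan t). replace (t²) with (t ^ 2) by (unfold Rsqr; ring). auto. }
  split.
  - assert (B := mono_of_der (fun t => atan t - (t - t ^ 3 / 3)) (fun t => / (1 + t ^ 2) - (1 - t ^ 2)) 0 s Hs).
    cbv beta in B. rewrite atan_0 in B. enough (0 - (0 - 0 ^ 3 / 3) <= atan s - (s - s ^ 3 / 3)) by lra. apply B.
    + intros t Ht. apply dminus; [apply D|auto_derive; auto; field].
    + intros t Ht. replace (/ (1 + t ^ 2) - (1 - t ^ 2)) with (t ^ 4 / (1 + t ^ 2)) by (field; nra).
      apply Rdiv_le_0_compat; [apply pow_le; lra|nra].
  - assert (B := mono_of_der (fun t => (t - t ^ 3 / 3 + t ^ 5 / 5) - atan t) (fun t => (1 - t ^ 2 + t ^ 4) - / (1 + t ^ 2)) 0 s Hs).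
    cbv beta in B. rewrite atan_0 in B. enough (0 - 0 ^ 3 / 3 + 0 ^ 5 / 5 - 0 <= s - s ^ 3 / 3 + s ^ 5 / 5 - atan s) by lra. apply B.
    + intros t Ht. apply dminus; [auto_derive; auto; field|apply D].
    + intros t Ht. replace (1 - t ^ 2 + t ^ 4 - / (1 + t ^ 2)) with (t ^ 6 / (1 + t ^ 2)) by (field; nra).
      apply Rdiv_le_0_compat; [apply pow_le; lra|nra].
Qed.
Lemma PI_bounds : 3.141 <= PI <= 3.142.
Proof.
  assert (H := PI_2_3_7_ineq 1). destruct H as [H1 H2].
  assert (H := PI_2_3_7_ineq 2). destruct H as [_ H3].
  unfold tg_alt, PI_2_3_7_tg, Ratan_seq in *. simpl in *. field_simplify in H1. field_simplify in H3. lra.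
Qed.

Lemma Cnorm_lt z r : 0 <= r -> Cnorm2 z < r * r -> Cnorm z < r.
Proof. intros Hr H. rewrite <- Cnorm_sqr in H. nra. Qed.

Section Numeric.
Variable w0 : Cplx.
Hypothesis Hap : Cnorm (Csub w0 w0_approx) < / 1000000.

Lemma w0_box : 0.916196 <= Cre w0 <= 0.916199 /\ - 0.18246 <= Cim w0 <= - 0.182457.
Proof.
  assert (H1 := Cre_le_norm (Csub w0 w0_approx)). assert (H2 := Cim_le_norm (Csub w0 w0_approx)).
  simpl in H1, H2.
  assert (H3 := Rabs_def2 _ _ (Rle_lt_trans _ _ _ H1 Hap)). assert (H4 := Rabs_def2 _ _ (Rle_lt_trans _ _ _ H2 Hap)). lra.
Qed.
Lemma w0_norm2 : 0.87270 <= Cnorm2 w0 <= 0.87272.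
Proof.
  destruct w0_box as [[a b] [u v]]. unfold Cnorm2. split; nra.
Qed.
Lemma v_norm2 : 0.0403 <= Cnorm2 (C1 - w0)%cx <= 0.0404.
Proof. destruct w0_box as [[a b] [u v]]. unfold Cnorm2. simpl. split; nra. Qed.
Lemma w0_lt1 : Cnorm w0 < 1.
Proof. apply Cnorm_lt; [lra|]. generalize w0_norm2. lra. Qed.
Lemma v_lt1 : Cnorm (C1 - w0)%cx < 1.
Proof. apply Cnorm_lt; [lra|]. generalize v_norm2. lra. Qed.
Lemma w0_re : 0 < Cre w0. Proof. generalize w0_box. lra. Qed.
Lemma v_re : 0 < Cre (C1 - w0)%cx. Proof. generalize w0_box. simpl. lra. Qed.

(** This yields Re P(1) >= 0.0335, the threshold that all other contributions have to stay below. *)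
Lemma ln_w0 : ln (Cnorm w0) <= - 0.067.
Proof.
  destruct (Clog_re w0) as [E|E]; [|generalize w0_norm2; lra]. simpl in E.
  assert (H : Cnorm2 w0 <= exp (- (0.134))).
  { eapply Rle_trans; [|apply exp_neg_ge_taylor3; lra]. generalize w0_norm2. lra. }
  assert (ln (Cnorm2 w0) <= - (0.134)); [|lra].
  rewrite <- (ln_exp (- (0.134))). destruct H as [H|H]; [left; apply ln_increasing; auto; generalize w0_norm2; lra|rewrite H; lra].
Qed.
Notation z0 := (z0_of w0).
Lemma z0_re : - 1.61 <= Cre z0 <= - 1.6.
Proof.
  change (Cre z0) with (0 + Cre (Clog (C1 - w0)%cx)).
  destruct (Clog_re (C1 - w0)%cx) as [E|E]; [|generalize v_norm2; lra].
  assert (H1 : Cnorm2 (C1 - w0)%cx < exp (- (3.2))).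
  (* Splitting the exponent into 16 equal parts, and into 4 below, brings the arguments into the
     range where short Taylor polynomials are sharp enough. *)
  { replace (- (3.2)) with (INR 16 * (- (0.2))) by (rewrite INR_IZR_INZ; simpl; lra). rewrite <- exp_pow_nat.
    assert (h : 0.8186 <= exp (- (0.2))) by (eapply Rle_trans; [|apply exp_neg_ge_taylor3; lra]; lra).
    apply Rlt_le_trans with (0.8186 ^ 16); [generalize v_norm2; lra|apply pow_incr; lra]. }
  assert (H2 : exp (- (3.22)) < Cnorm2 (C1 - w0)%cx).
  { apply Rle_lt_trans with (/ 24.85); [|generalize v_norm2; lra].
    apply exp_le_inv; [lra|]. replace 3.22 with (INR 4 * 0.805) by (rewrite INR_IZR_INZ; simpl; lra). rewrite <- exp_pow_nat.
    assert (h : 2.2333 <= exp 0.805) by (eapply Rle_trans; [|apply exp_ge_taylor4; lra]; lra).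
    apply Rle_trans with (2.2333 ^ 4); [lra|apply pow_incr; lra]. }
  assert (P := v_norm2).
  apply ln_increasing in H1; [|lra]. apply ln_increasing in H2; [|apply exp_pos]. rewrite ln_exp in H1, H2. lra.
Qed.
Lemma z0_im : 7.42 <= Cim z0 <= 7.43.
Proof.
  change (Cim z0) with (2 * PI + Cim (Clog (C1 - w0)%cx)).
  rewrite (Clog_rp _ v_re). cbn [Cim].
  destruct w0_box as [[a b] [u v]]. set (X := Cre (C1 - w0)%cx). set (Y := Cim (C1 - w0)%cx).
  assert (HX : 0.083801 <= X <= 0.083804) by (unfold X; simpl; lra).
  assert (HY : 0.182457 <= Y <= 0.18246) by (unfold Y; simpl; lra).
  set (s := X / Y).
  assert (Hs : 0.459 <= s <= 0.4595).
  { assert (s * Y = X) by (unfold s; field; lra). split; nra. }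
  (* The argument of 1 - w0 exceeds PI/4, so it is computed as PI/2 - atan s with s < 1/2, where the
     Taylor bounds are accurate. *)
  replace (Y / X) with (/ s) by (unfold s; field; lra).
  rewrite atan_inv by lra. assert (A := atan_bounds s ltac:(lra)). assert (P := PI_bounds).
  assert (s ^ 3 <= 0.4595 ^ 3) by (apply pow_incr; lra). assert (0.459 ^ 3 <= s ^ 3) by (apply pow_incr; lra).
  assert (s ^ 5 <= 0.4595 ^ 5) by (apply pow_incr; lra). lra.
Qed.
Lemma z0_exp : Cexp z0 = (C1 - w0)%cx.
Proof.
  unfold z0_of. rewrite Cexp_add, Cexp_Clog by apply v_re.
  replace (Cexp (mkC 0 (2 * PI))) with C1; [ring|].
  apply cx_eq; simpl; rewrite exp_0, ?cos_2PI, ?sin_2PI; ring.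
Qed.
End Numeric.

Lemma zeta2 z : Dil C1 z -> Cim z = 0 /\ Cre z <= 1.65.
Proof.
  intros H.
  assert (P1 : forall n, Cpown C1 n = C1) by (induction n; [reflexivity|rewrite Cpown_S, IHn; ring]).
  assert (I : forall n, Cim (Li2_partial C1 n) = 0).
  { induction n; [reflexivity|]. rewrite Li2_S, P1. simpl. rewrite IHn. ring. }
  split.
  - assert (E : RtoC (Cim z) = C0).
    { apply small_eq with 1. intros n Hn. rewrite Cnorm_RtoC. specialize (H n Hn).
      assert (B := Cim_le_norm (Li2_partial C1 n - z)%cx). simpl in B. rewrite (I n) in B.
      replace (0 + - Cim z) with (- Cim z) in B by ring. rewrite Rabs_Ropp in B. lra. }
    apply (f_equal Cre) in E. exact E.
  (* Ten terms of the series are about 1.5498, and the tail bound adds 0.1. *)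
  - assert (B := Rle_trans _ _ _ (Cre_le_norm (Li2_partial C1 10 - z)%cx) (H 10%nat ltac:(lia))).
    apply Rabs_le_between in B. destruct B as [B _].
    rewrite !Li2_S, !P1 in B. simpl in B. field_simplify in B. lra.
Qed.

Lemma exp_ge_inv x y : 0 < y -> exp x <= / y -> y <= exp (- x).
Proof.
  intros Hy H. rewrite exp_Ropp, <- (Rinv_inv y). apply inv_le; auto. apply exp_pos.
Qed.

Lemma Rmult_le_0_l a b : 0 <= a -> b <= 0 -> a * b <= 0.
Proof. nra. Qed.
Lemma Rmult_le_0_r a b : a <= 0 -> 0 <= b -> a * b <= 0.
Proof. nra. Qed.

(** * The size of Re P along the ray *)

Section Profile.
Variable z0 : Cplx.
Hypothesis Hre : - 1.61 <= Cre z0 <= - 1.6.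
Hypothesis Him : 7.42 <= Cim z0 <= 7.43.
Variable zeta : Cplx.
Hypothesis Hzeta : Dil C1 zeta.
Let Hz0 : Cre z0 < 0. Proof. lra. Qed.
Notation x0 := (- Cre z0).
Notation y0 := (Cim z0).
Notation E r := (exp (- (r * x0))).

(** The identity 2 r z0 P = Li2(w) - Li2(1) is multiplied by the conjugate of z0, which isolates Re
    P. Then Li2(w) is replaced by w with the error of [Dil_first], weighted by |z0| <= 7.61, and
    Li2(1) is at most 1.65. *)
Lemma rayP_upper r : 0 < r -> exp (r * Cre z0) < 1 ->
  2 * r * (x0 * x0 + y0 * y0) * Cre (rayP z0 r) <=
  1.65 * x0 + E r * (- x0 * cos (r * y0) + y0 * sin (r * y0)) + 7.61 * (E r ^ 2 / (4 * (1 - E r))).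
Proof.
  intros Hr HE.
  destruct (Dil_exists (Cexp (RtoC r * z0)%cx)) as [l Hl]; [left; now apply w_lt1|].
  assert (D := rayP_Dil z0 Hz0 r l zeta Hr Hl Hzeta).
  assert (F := Dil_first _ l (w_lt1 z0 Hz0 r Hr) Hl). rewrite w_norm in F.
  destruct (zeta2 zeta Hzeta) as [Z1 Z2].
  set (e := (l - Cexp (RtoC r * z0))%cx) in *.
  set (zc := mkC (Cre z0) (- Cim z0)).
  assert (Nz : Cnorm zc <= 7.61).
  { left. apply Cnorm_lt; [lra|]. unfold Cnorm2, zc. simpl. nra. }
  assert (G : Cre (e * zc)%cx <= 7.61 * (exp (r * Cre z0) ^ 2 / (4 * (1 - exp (r * Cre z0))))).
  { eapply Rle_trans; [eapply Rle_trans; [apply Rle_abs|apply Cre_le_norm]|]. rewrite Cnorm_mul, Rmult_comm.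
    apply Rmult_le_compat; auto using Cnorm_nonneg. }
  replace (- (r * x0)) with (r * Cre z0) by ring.
  assert (D1 := f_equal Cre D). assert (D2 := f_equal Cim D).
  replace l with (e + Cexp (RtoC r * z0))%cx in D1, D2 by (unfold e; ring).
  set (p := rayP z0 r) in *. clearbody p e.
  simpl in D1, D2, G. rewrite Z1 in D2.
  replace (r * Cre z0 - 0 * Cim z0) with (r * Cre z0) in D1, D2 by ring.
  replace (r * Cim z0 + 0 * Cre z0) with (r * Cim z0) in D1, D2 by ring.
  set (ex := exp (r * Cre z0)) in *.
  replace (2 * r * (x0 * x0 + y0 * y0) * Cre p) with
    (Cre z0 * (((2 * r) * Cre z0 - 0 * Cim z0) * Cre p - ((2 * r) * Cim z0 + 0 * Cre z0) * Cim p) +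
     Cim z0 * (((2 * r) * Cre z0 - 0 * Cim z0) * Cim p + ((2 * r) * Cim z0 + 0 * Cre z0) * Cre p)) by ring.
  rewrite D1, D2.
  assert (x0 * Cre zeta <= x0 * 1.65) by (apply mul_le_l; lra).
  match goal with |- _ <= _ + ?t + _ => set (tt0 := t) end.
  apply Rle_trans with (x0 * Cre zeta + tt0 + (Cre e * Cre z0 - Cim e * - Cim z0)); [unfold tt0; right; ring|].
  lra.
Qed.

(** Here 57.6 is a lower bound for |z0|^2, and 0.033 is a target just below the certified value
    0.0335 at the saddle. *)
Lemma rayP_lt r B : 0.63 <= r ->
  1.65 * x0 + E r * (- x0 * cos (r * y0) + y0 * sin (r * y0)) + 7.61 * (E r ^ 2 / (4 * (1 - E r))) <= B ->
  B <= 2 * r * 57.6 * 0.033 -> Cre (rayP z0 r) <= 0.033.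
Proof.
  intros Hr H HB.
  assert (HE : exp (r * Cre z0) < 1) by (rewrite <- exp_0; apply exp_increasing; nra).
  assert (U := rayP_upper r ltac:(lra) HE).
  assert (N : 57.6 <= x0 * x0 + y0 * y0) by nra.
  apply Rnot_lt_le. intros Hc.
  assert (2 * r * 57.6 * 0.033 < 2 * r * (x0 * x0 + y0 * y0) * Cre (rayP z0 r)); [|lra].
  apply Rlt_le_trans with (2 * r * 57.6 * Cre (rayP z0 r)).
  - apply Rmult_lt_compat_l; lra.
  - apply mul_le_r; [lra|]. apply mul_le_l; lra.
Qed.
Lemma E_bound r a b : 0 < b < 1 -> / b <= exp a -> a <= r * x0 -> 0 < E r <= b /\ E r ^ 2 / (4 * (1 - E r)) <= E r * (b / (4 * (1 - b))).
Proof.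
  intros Hb H Ha.
  assert (P : 0 < E r) by apply exp_pos.
  assert (Q : E r <= b). { eapply Rle_trans; [|apply (exp_le_inv a); [lra|exact H]]. apply exp_le. lra. }
  split; [split; auto|]. set (e := E r) in *.
  replace (e ^ 2 / (4 * (1 - e))) with (e * (e / (4 * (1 - e)))) by (field; lra).
  apply mul_le_l; [lra|]. apply Rmult_le_compat; try lra.
  - left; apply inv_pos; lra.
  - apply inv_le; lra.
Qed.

Lemma rayP_left r : 3 * PI / 2 <= r * y0 <= 2 * PI -> Cre (rayP z0 r) <= 0.033.
Proof.
  intros [H1 H2]. assert (P := PI_bounds).
  assert (Hr : 0.634 <= r) by nra.
  set (u := 2 * PI - r * y0).
  assert (Ec : cos (r * y0) = cos u).
  { unfold u. replace (- (2 * PI - r * y0)) with (r * y0 - 2 * PI) by ring.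
    rewrite cos_minus, cos_2PI, sin_2PI. ring. }
  assert (Es : sin (r * y0) = - sin u).
  { unfold u. replace (- (2 * PI - r * y0)) with (r * y0 - 2 * PI) by ring.
    rewrite sin_minus, cos_2PI, sin_2PI. ring. }
  assert (X : 1.6 * r <= r * x0 <= 1.61 * r) by nra.
  (* At least PI/6 away from 2 PI the negative sine supplies the saving, -y0/2 <= -3.71; closer to 2
     PI the cosine does, -1.6 * 0.86 = -1.376. *)
  destruct (Rle_dec (PI / 6) u) as [Hu|Hu].
  - assert (Hs : / 2 <= sin u).
    { replace (/ 2) with (sin (PI / 6)) by (rewrite sin_PI6; field). apply sin_incr_1; unfold u in *; lra. }
    assert (Hc : 0 <= cos u) by (apply cos_ge_0; unfold u in *; lra).
    destruct (E_bound r 1 (0.4)) as [[e1 e2] e3]; [lra| |lra|].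
    { eapply Rle_trans; [|apply exp_ge_taylor4; lra]. lra. }
    assert (T : E r * (- x0 * cos (r * y0) + y0 * sin (r * y0)) <= E r * - 3.71).
    { apply mul_le_l; [lra|]. nra. }
    (* The Li2(1) term is at most 1.65 * 1.61 = 2.6565. For r > 0.7 this already fits below 2 r *
       57.6 * 0.033. For smaller r the net saving, at least 2.44 times exp (-r x0), is needed, hence
       the lower bound 0.29 on the exponential. *)
    destruct (Rle_dec r 0.7) as [H7|H7].
    + apply rayP_lt with (2.6565 - 2.44 * 0.29); [lra| |lra].
      assert (L : 0.29 <= E r).
      { apply exp_ge_inv; [lra|]. apply Rle_trans with (exp 1.127); [apply exp_le; lra|].
        rewrite <- (Ropp_involutive 1.127). apply exp_le_inv; [apply inv_pos; lra|].
        replace (- (1.127)) with (INR 4 * (- (0.28175))) by (rewrite INR_IZR_INZ; simpl; lra). rewrite <- exp_pow_nat.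
        assert (h : 0.754 <= exp (- (0.28175))) by (eapply Rle_trans; [|apply exp_neg_ge_taylor3; lra]; lra).
        apply Rle_trans with (0.754 ^ 4); [lra|apply pow_incr; lra]. }
      lra.
    + apply rayP_lt with 2.6565; [lra| |lra]. lra.
  - assert (Hs : 0 <= sin u) by (apply sin_ge_0; unfold u in *; lra).
    assert (Hc : 0.86 <= cos u).
    { apply Rle_trans with (cos (PI / 6)).
      - rewrite cos_PI6. assert (1.72 <= sqrt 3); [|lra]. rewrite <- (sqrt_square 1.72) by lra. apply sqrt_le_1; lra.
      - apply cos_decr_1; unfold u in *; lra. }
    assert (Hr2 : 0.775 <= r) by (unfold u in Hu; nra).
    destruct (E_bound r 1.24 (0.3)) as [[e1 e2] e3]; [lra| |lra|].
    { eapply Rle_trans; [|apply exp_ge_taylor4; lra]. lra. }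
    assert (T : E r * (- x0 * cos (r * y0) + y0 * sin (r * y0)) <= E r * - 1.376).
    { apply mul_le_l; [lra|]. nra. }
    apply rayP_lt with 2.6565; [lra| |lra]. lra.
Qed.

Lemma rayP_right r : 8 * PI / 3 <= r * y0 -> Cre (rayP z0 r) <= 0.033.
Proof.
  intros H1. assert (P := PI_bounds).
  assert (Hr : 1.127 <= r) by nra.
  assert (X : 1.6 * r <= r * x0) by nra.
  destruct (E_bound r 1.8 0.18) as [[e1 e2] e3]; [lra| |lra|].
  { replace 1.8 with (0.9 + 0.9) by lra. rewrite exp_plus.
    assert (h : 2.45 <= exp 0.9) by (eapply Rle_trans; [|apply exp_ge_taylor4; lra]; lra). nra. }
  assert (T : - x0 * cos (r * y0) + y0 * sin (r * y0) <= 7.61).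
  { assert (S := sin2_cos2 (r * y0)). unfold Rsqr in S. set (s := sin (r * y0)) in *. set (c := cos (r * y0)) in *.
    assert (N : x0 * x0 + y0 * y0 <= 7.61 * 7.61) by nra.
    assert (I : (- x0 * c + y0 * s) * (- x0 * c + y0 * s) <= 7.61 * 7.61).
    { apply Rle_trans with ((x0 * x0 + y0 * y0) * (s * s + c * c)); [|rewrite S; lra].
      replace ((x0 * x0 + y0 * y0) * (s * s + c * c)) with ((- x0 * c + y0 * s) * (- x0 * c + y0 * s) + (x0 * s + y0 * c) * (x0 * s + y0 * c)) by ring.
      assert (0 <= (x0 * s + y0 * c) * (x0 * s + y0 * c)) by apply Rle_0_sqr. lra. }
    nra. }
  assert (T2 : E r * (- x0 * cos (r * y0) + y0 * sin (r * y0)) <= E r * 7.61) by (apply mul_le_l; lra).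
  apply rayP_lt with (2.6565 + 7.61 * 0.19); [lra| |lra]. lra.
Qed.

(** With u = r y0 - 2 PI in [0, 2 PI/3], the sign reduces to x0 exp (-r x0) <= x0 cos u + y0 sin u.
    The right side is at least x0: for u <= PI/2 because cos u + sin u >= 1, beyond because sin u >=
    1/2 while y0 is large. *)
Lemma rayQ_decr r : 2 * PI <= r * y0 <= 8 * PI / 3 ->
  Cre (RtoC (r / 2) * (z0 * Cexp (RtoC r * z0) / (C1 - Cexp (RtoC r * z0))))%cx <= 0.
Proof.
  intros [H1 H2]. assert (P := PI_bounds). assert (Hr : 0 < r) by nra.
  rewrite Cre_RtoC_mul.
  assert (W := w_lt1 z0 Hz0 r Hr). assert (W2 := one_minus_re _ W). rewrite w_norm in W.
  set (e := exp (r * Cre z0)) in *. assert (He : 0 < e) by apply exp_pos.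
  set (u := r * y0 - 2 * PI).
  assert (Ec : cos (r * y0) = cos u).
  { unfold u. rewrite cos_minus, cos_2PI, sin_2PI. ring. }
  assert (Es : sin (r * y0) = sin u).
  { unfold u. rewrite sin_minus, cos_2PI, sin_2PI. ring. }
  assert (T : x0 <= x0 * cos u + y0 * sin u).
  { destruct (Rle_dec u (PI / 2)) as [Hu|Hu].
    - assert (0 <= cos u) by (apply cos_ge_0; unfold u in *; lra).
      assert (0 <= sin u) by (apply sin_ge_0; unfold u in *; lra).
      assert (S := sin2_cos2 u). unfold Rsqr in S.
      assert (1 <= cos u + sin u) by nra. nra.
    - assert (- / 2 <= cos u).
      { replace (- / 2) with (cos (2 * (PI / 3))) by (rewrite cos_2PI3; field). apply cos_decr_1; unfold u in *; lra. }
      assert (/ 2 <= sin u).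
      { rewrite <- (sin_PI_x u). replace (/ 2) with (sin (PI / 6)) by (rewrite sin_PI6; field). apply sin_incr_1; unfold u in *; lra. }
      nra. }
  set (d := (C1 - Cexp (RtoC r * z0))%cx) in *.
  assert (Hd : 0 < Cnorm2 d) by (apply Cnorm2_pos, Cre_neq0; lra).
  assert (K : Cre (z0 * Cexp (RtoC r * z0) / d)%cx = e * (x0 * e - (x0 * cos u + y0 * sin u)) / Cnorm2 d).
  { assert (S := sin2_cos2 u). unfold Rsqr in S.
    transitivity (e * (x0 * e * (sin u * sin u + cos u * cos u) - (x0 * cos u + y0 * sin u)) / Cnorm2 d); [|rewrite S; field; lra].
    unfold d. simpl. replace (r * Cre z0 - 0 * Cim z0) with (r * Cre z0) by ring.
    replace (r * Cim z0 + 0 * Cre z0) with (r * Cim z0) by ring. rewrite Ec, Es. fold e. field.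
    unfold d in Hd. lra. }
  rewrite K.
  assert (x0 * e <= x0) by nra.
  assert (e * (x0 * e - (x0 * cos u + y0 * sin u)) <= 0) by (set (q := x0 * cos u + y0 * sin u) in *; nra).
  assert (Hi : 0 < / Cnorm2 d) by (apply inv_pos; lra).
  apply Rmult_le_0_l; [lra|]. apply Rmult_le_0_r; lra.
Qed.

(** In the middle range Re Q decreases through its zero at 1, so Re P increases before 1 and
    decreases after it, and the values at 1 - d and 1 + d dominate. In the outer ranges the bound
    0.033 leaves a gap of 0.0005. *)
Lemma ray_off_saddle d : Cre (rayQ z0 1) = 0 -> 0.0335 <= Cre (rayP z0 1) -> 0 < d < 0.1 ->
  Cre (rayP z0 (1 - d)) < Cre (rayP z0 1) -> Cre (rayP z0 (1 + d)) < Cre (rayP z0 1) ->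
  exists del, 0 < del /\ forall r, 3 * PI / 2 <= r * y0 -> (r <= 1 - d \/ 1 + d <= r) ->
    Cre (rayP z0 r) <= Cre (rayP z0 1) - del.
Proof.
  intros Q1 P1 Hd L1 L2. assert (P := PI_bounds).
  set (del := Rmin 0.0005 (Rmin (Cre (rayP z0 1) - Cre (rayP z0 (1 - d))) (Cre (rayP z0 1) - Cre (rayP z0 (1 + d))))).
  assert (M1 : del <= 0.0005) by apply Rmin_l.
  assert (M2 : del <= Cre (rayP z0 1) - Cre (rayP z0 (1 - d))) by (eapply Rle_trans; [apply Rmin_r|apply Rmin_l]).
  assert (M3 : del <= Cre (rayP z0 1) - Cre (rayP z0 (1 + d))) by (eapply Rle_trans; [apply Rmin_r|apply Rmin_r]).
  assert (M0 : 0 < del) by (repeat apply Rmin_glb_lt; lra).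
  exists del. split; auto. intros r Hr Hc.
  destruct (Rle_dec (r * y0) (2 * PI)) as [h1|h1]; [assert (B := rayP_left r (conj Hr h1)); lra|].
  destruct (Rle_dec (8 * PI / 3) (r * y0)) as [h2|h2]; [assert (B := rayP_right r h2); lra|].
  assert (QD : forall a b, 2 * PI <= a * y0 -> b * y0 <= 8 * PI / 3 -> a <= b -> Cre (rayQ z0 b) <= Cre (rayQ z0 a)).
  { intros a b Ha Hb Hab.
    assert (B := mono_of_der (fun t => - Cre (rayQ z0 t)) (fun t => - Cre (RtoC (t / 2) * (z0 * Cexp (RtoC t * z0) / (C1 - Cexp (RtoC t * z0))))%cx) a b Hab).
    enough (- Cre (rayQ z0 a) <= - Cre (rayQ z0 b)) by lra. apply B.
    - intros t Ht. apply dopp. apply (proj1 (rayQ_der z0 Hz0 t ltac:(nra))).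
    - intros t Ht. assert (R := rayQ_decr t ltac:(split; nra)). lra. }
  assert (PD : forall t, 0 < t -> is_derive (fun t => Cre (rayP z0 t)) t (Cre (rayQ z0 t) / (t * t))).
  { intros t Ht. eapply is_derive_val; [apply (proj1 (rayP_der_Q z0 Hz0 t Ht))|].
    unfold Cdiv. rewrite <- RtoC_inv by nra. simpl. field. lra. }
  destruct Hc as [Hc|Hc].
  - assert (B := mono_of_der (fun t => Cre (rayP z0 t)) (fun t => Cre (rayQ z0 t) / (t * t)) r (1 - d) Hc).
    enough (Cre (rayP z0 r) <= Cre (rayP z0 (1 - d))) by lra. apply B.
    + intros t Ht. apply PD. nra.
    + intros t Ht. apply Rdiv_le_0_compat; [|nra]. rewrite <- Q1. apply QD; nra.
  - assert (B := mono_of_der (fun t => - Cre (rayP z0 t)) (fun t => - (Cre (rayQ z0 t) / (t * t))) (1 + d) r Hc).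
    enough (- Cre (rayP z0 (1 + d)) <= - Cre (rayP z0 r)) by lra. apply B.
    + intros t Ht. apply dopp, PD. nra.
    + intros t Ht. assert (Qn : Cre (rayQ z0 t) <= 0) by (rewrite <- Q1; apply QD; nra).
      replace (- (Cre (rayQ z0 t) / (t * t))) with (- Cre (rayQ z0 t) / (t * t)) by (field; lra).
      apply Rdiv_le_0_compat; nra.
Qed.
End Profile.

(** * Products of sines *)

Fixpoint Rpr (n : nat) (f : nat -> R) : R := match n with O => 1 | S n' => Rpr n' f * f n' end.
Lemma Rpr_ext n f g : (forall i, (i < n)%nat -> f i = g i) -> Rpr n f = Rpr n g.
Proof. induction n; intros H; simpl; auto. rewrite IHn, H; auto. Qed.
Lemma Rpr_mult n f g : Rpr n (fun i => f i * g i) = Rpr n f * Rpr n g.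
Proof. induction n; simpl; [ring|rewrite IHn; ring]. Qed.
Lemma Rpr_nonneg n f : (forall i, (i < n)%nat -> 0 <= f i) -> 0 <= Rpr n f.
Proof. induction n; intros H; simpl; [lra|]. apply mul_pos; auto. Qed.
Lemma Rpr_pos n f : (forall i, (i < n)%nat -> 0 < f i) -> 0 < Rpr n f.
Proof. induction n; intros H; simpl; [lra|]. apply mul_lt_pos; auto. Qed.
Lemma Rpr_le n f g : (forall i, (i < n)%nat -> 0 <= f i <= g i) -> Rpr n f <= Rpr n g.
Proof.
  induction n; intros H; simpl; [lra|]. apply Rmult_le_compat; [|apply H; lia| |apply H; lia].
  - apply Rpr_nonneg. intros i Hi; apply H; lia.
  - apply IHn. intros; apply H; lia.
Qed.
Lemma Rpr_const n k : Rpr n (fun _ => k) = k ^ n.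
Proof. induction n; simpl; [auto|rewrite IHn; ring]. Qed.
Lemma Rpr_add n m f : Rpr (n + m) f = Rpr n f * Rpr m (fun i => f (n + i)%nat).
Proof.
  induction m; simpl; [rewrite Nat.add_0_r; ring|]. rewrite Nat.add_succ_r. simpl. rewrite IHm. ring.
Qed.
Lemma Rpr_head n f : Rpr (S n) f = f 0%nat * Rpr n (fun i => f (S i)).
Proof. induction n; [simpl; ring|]. change (Rpr (S (S n)) f) with (Rpr (S n) f * f (S n)). rewrite IHn. simpl. ring. Qed.
Lemma Rpr_rev n f : Rpr n f = Rpr n (fun i => f (n - S i)%nat).
Proof.
  induction n; [reflexivity|]. rewrite (Rpr_head n (fun i => f (S n - S i)%nat)).
  simpl Rpr. rewrite Rmult_comm, IHn. f_equal. f_equal. lia.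
Qed.
Lemma Rpr_pairs n f : Rpr (2 * n) f = Rpr n (fun i => f (2 * i)%nat * f (S (2 * i))).
Proof.
  induction n; [reflexivity|]. replace (2 * S n)%nat with (S (S (2 * n))) by lia.
  simpl Rpr in *. rewrite IHn. ring.
Qed.

Definition sp (th : R) (i : nat) : R := 2 * sin (INR (S i) * th).

Lemma INR_S_bound i n : (i < n)%nat -> 0 < INR (S i) <= INR n.
Proof. intros H. split; [apply lt_0_INR; lia|apply le_INR; lia]. Qed.

(* The reflection [i -> K - i] and the duplication formula turn the square of the
   product into the product over the even multiples, which dominates it. *)
Lemma sine_product_ge1 K : (1 <= K)%nat -> 1 <= Rpr (K - 1) (sp (PI / (2 * INR K))).
Proof.
  intros HK. set (th := PI / (2 * INR K)). assert (P := PI_RGT_0).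
  assert (Kp : 1 <= INR K) by (change 1 with (INR 1); apply le_INR; auto).
  assert (HKt : INR K * th = PI / 2) by (unfold th; field; lra).
  set (n := (K - 1)%nat). assert (Kn : INR K = INR n + 1) by (rewrite <- S_INR; f_equal; unfold n; lia).
  assert (Fpos : forall i, (i < n)%nat -> 0 < sp th i).
  { intros i Hi. destruct (INR_S_bound i n Hi) as [a b].
    unfold sp. assert (0 < sin (INR (S i) * th)); [|lra]. apply sin_gt_0; nra. }
  set (A := Rpr n (sp th)). assert (HA : 0 < A) by (apply Rpr_pos; auto).
  assert (Hrev : forall i, (i < n)%nat -> INR (S (n - S i)) = INR K - INR (S i)).
  { intros i Hi. rewrite Kn, !S_INR, minus_INR, S_INR by lia. ring. }
  assert (Sq1 : A * A = Rpr n (sp (2 * th))).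
  { unfold A at 2. rewrite Rpr_rev. unfold A. rewrite <- Rpr_mult. apply Rpr_ext. intros i Hi.
    unfold sp. rewrite (Hrev i Hi).
    replace ((INR K - INR (S i)) * th) with (PI / 2 - INR (S i) * th) by lra. rewrite sin_shift.
    replace (INR (S i) * (2 * th)) with (2 * (INR (S i) * th)) by ring. rewrite sin_2a. ring. }
  assert (Gsym : forall i, (i < n)%nat -> sp (2 * th) (n - S i) = sp (2 * th) i).
  { intros i Hi. unfold sp. rewrite (Hrev i Hi).
    replace ((INR K - INR (S i)) * (2 * th)) with (PI - INR (S i) * (2 * th)) by lra. now rewrite sin_PI_x. }
  assert (Comp : forall L, (2 * L <= n)%nat -> Rpr (2 * L) (sp th) <= Rpr L (sp (2 * th)) * Rpr L (sp (2 * th))).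
  { intros L HL. rewrite Rpr_pairs, <- Rpr_mult. apply Rpr_le. intros i Hi.
    assert (p1 := Fpos (2 * i)%nat ltac:(lia)). assert (p2 := Fpos (S (2 * i)) ltac:(lia)).
    assert (E : sp th (S (2 * i)) = sp (2 * th) i).
    { unfold sp. f_equal. f_equal. replace (INR (S (S (2 * i)))) with (2 * INR (S i)) by (rewrite !S_INR, mult_INR; simpl; ring). ring. }
    split; [apply mul_pos; lra|]. rewrite E in p2 |- *. apply mul_le_r; [lra|].
    rewrite <- E. apply mul_le_l; [lra|].
    rewrite (S_INR (S (2 * i))) in *.
    assert (c := INR_S_bound (2 * i) n ltac:(lia)). apply sin_incr_1; nra. }
  assert (Main : A <= A * A).
  { rewrite Sq1. destruct (Nat.Even_or_Odd n) as [[L HL]|[L HL]].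
    - unfold A. rewrite HL at 2. rewrite HL at 1.
      replace (2 * L)%nat with (L + L)%nat at 2 by lia.
      rewrite Rpr_add, (Rpr_rev L (fun i => sp (2 * th) (L + i))).
      rewrite (Rpr_ext L (fun i => sp (2 * th) (L + (L - S i))) (sp (2 * th))).
      + apply Comp. lia.
      + intros i Hi. rewrite <- Gsym by lia. f_equal. lia.
    - unfold A. rewrite HL at 2. rewrite HL at 1.
      replace (2 * L + 1)%nat with (L + 1 + L)%nat at 2 by lia. rewrite Nat.add_1_r.
      change (L + (L + 0))%nat with (2 * L)%nat.
      rewrite Rpr_add, (Rpr_rev L (fun i => sp (2 * th) (L + 1 + i))).
      rewrite (Rpr_ext L (fun i => sp (2 * th) (L + 1 + (L - S i))) (sp (2 * th))).
      + rewrite Nat.add_1_r. simpl Rpr.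
        assert (Em : sp (2 * th) L = 2).
        { unfold sp. replace (INR (S L) * (2 * th)) with (PI / 2); [rewrite sin_PI2; ring|].
          rewrite <- HKt, Kn, HL, S_INR, plus_INR, mult_INR. simpl. ring. }
        rewrite Em. assert (C := Comp L ltac:(lia)).
        assert (B : 0 < sp th (2 * L) <= 2).
        { split; [apply Fpos; lia|]. unfold sp. generalize (SIN_bound (INR (S (2 * L)) * th)). lra. }
        assert (0 <= Rpr (2 * L) (sp th)) by (apply Rpr_nonneg; intros; left; apply Fpos; lia).
        apply Rle_trans with (Rpr L (sp (2 * th)) * Rpr L (sp (2 * th)) * 2); [|right; ring].
        change (L + (L + 0))%nat with (2 * L)%nat. apply Rmult_le_compat; lra.
      + intros i Hi. rewrite <- Gsym by lia. f_equal. lia. }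
  nra.
Qed.

(** By the product formula, 2 cos v cos w is cos (v + w) + cos (v - w), and each summand is at least
    sqrt 2/2. *)
Lemma cos_pair v w : Rabs (v + w) <= PI / 4 -> Rabs (v - w) <= PI / 4 -> sqrt 2 <= 2 * (cos v * cos w).
Proof.
  intros H1 H2.
  assert (C : forall x, Rabs x <= PI / 4 -> sqrt 2 / 2 <= cos x).
  { intros x Hx. replace (sqrt 2 / 2) with (cos (PI / 4)).
    - assert (E : cos x = cos (Rabs x)) by (unfold Rabs; destruct (Rcase_abs x); [now rewrite cos_neg|auto]).
      rewrite E. apply cos_decr_1; try lra; generalize (Rabs_pos x); lra.
    - rewrite cos_PI4. assert (0 < sqrt 2) by (apply sqrt_lt_R0; lra). assert (S := sqrt_sqrt 2 ltac:(lra)).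
      apply Rmult_eq_reg_l with (sqrt 2); [|lra]. field_simplify; [|lra]. simpl. rewrite Rmult_1_r, S. field. }
  assert (A := C _ H1). assert (B := C _ H2). rewrite cos_plus in A. rewrite cos_minus in B. lra.
Qed.

(** K is N/3 rounded up, the first index where the angle reaches PI/2. The factors before K dominate
    the product of [sine_product_ge1]. Those with index from K to M - 1 are paired by reflection,
    each pair giving at least 2 sqrt 2 by [cos_pair]; pairing uses every factor twice, hence the
    square in the statement. The last factor is at least 1. *)
Lemma axis_product N : (6 <= N)%nat ->
  0 < Rpr (N / 2) (sp (3 * PI / (2 * INR N))) /\
  (2 * sqrt 2) ^ (N / 2 - (N + 2) / 3) <= Rpr (N / 2) (sp (3 * PI / (2 * INR N))) ^ 2.
Proof.
  intros HN. set (M := (N / 2)%nat). set (K := ((N + 2) / 3)%nat). set (al := 3 * PI / (2 * INR N)).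
  assert (P := PI_RGT_0).
  assert (E1 := Nat.div_mod_eq N 2). assert (B1 := Nat.mod_upper_bound N 2 ltac:(lia)).
  assert (E2 := Nat.div_mod_eq (N + 2) 3). assert (B2 := Nat.mod_upper_bound (N + 2) 3 ltac:(lia)).
  assert (HNp : 6 <= INR N) by (change 6 with (INR 6) || (replace 6 with (INR 6) by (simpl; ring)); apply le_INR; auto).
  assert (HNa : INR N * al = 3 * PI / 2) by (unfold al; field; lra).
  assert (HM : 2 * INR M <= INR N) by (rewrite <- (mult_INR 2); apply le_INR; lia).
  assert (HK1 : INR N <= 3 * INR K) by (replace 3 with (INR 3) by (simpl; ring); rewrite <- mult_INR; apply le_INR; lia).
  assert (HK2 : 3 * INR K <= INR N + 2) by (replace 3 with (INR 3) by (simpl; ring); replace 2 with (INR 2) by (simpl; ring);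
    rewrite <- mult_INR, <- plus_INR; apply le_INR; lia).
  assert (HKM : (K <= M)%nat) by lia. assert (HK0 : (2 <= K)%nat) by lia.
  assert (Ma : INR M * al <= 3 * PI / 4) by nra.
  assert (Ka : PI / 2 <= INR K * al) by nra.
  assert (Pos : forall i, (i < M)%nat -> 0 < sp al i).
  { intros i Hi. destruct (INR_S_bound i M Hi) as [a b]. unfold sp.
    assert (0 < sin (INR (S i) * al)); [|lra]. apply sin_gt_0; nra. }
  split; [apply Rpr_pos; auto|].
  assert (F1 : 1 <= Rpr (K - 1) (sp al)).
  { eapply Rle_trans; [apply (sine_product_ge1 K); lia|]. apply Rpr_le. intros i Hi.
    destruct (INR_S_bound i (K - 1) Hi) as [a b]. rewrite minus_INR in b by lia. simpl (INR 1) in b.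
    set (th := PI / (2 * INR K)).
    assert (HKt : INR K * th = PI / 2) by (unfold th; field; lra).
    unfold sp. split.
    - assert (0 <= sin (INR (S i) * th)); [|lra]. apply sin_ge_0; nra.
    - apply mul_le_l; [lra|]. apply sin_incr_1; nra. }
  set (n2 := (M - K)%nat). assert (HMs : M = S ((K - 1) + n2)) by (unfold n2; lia).
  assert (F3 : 1 <= sp al (K - 1 + n2)).
  { unfold sp. rewrite <- HMs. assert (/ 2 <= sin (INR M * al)); [|lra].
    rewrite <- sin_PI_x. replace (/ 2) with (sin (PI / 6)) by (rewrite sin_PI6; field).
    assert (INR K <= INR M) by (apply le_INR; auto). apply sin_incr_1; nra. }
  set (S2 := Rpr n2 (fun i => sp al (K - 1 + i))).
  assert (F2 : (2 * sqrt 2) ^ n2 <= S2 * S2).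
  { unfold S2 at 2. rewrite Rpr_rev. unfold S2. rewrite <- Rpr_mult, <- Rpr_const. apply Rpr_le. intros i Hi.
    assert (Sp := sqrt_lt_R0 2 ltac:(lra)). split; [lra|].
    unfold sp.
    replace (S (K - 1 + i)) with (K + i)%nat by lia. replace (S (K - 1 + (n2 - S i))) with (M - 1 - i)%nat by (unfold n2 in *; lia).
    assert (HiM : (i + 1 + K <= M)%nat) by (unfold n2 in *; lia).
    assert (HiR := le_INR _ _ HiM). rewrite !plus_INR in HiR. simpl (INR 1) in HiR. assert (Hi0 := pos_INR i).
    rewrite !minus_INR, plus_INR by lia. simpl (INR 1).
    assert (C := cos_pair ((INR K + INR i) * al - PI / 2) ((INR M - 1 - INR i) * al - PI / 2)).
    rewrite <- (sin_shift ((INR K + INR i) * al - PI / 2)), <- (sin_shift ((INR M - 1 - INR i) * al - PI / 2)) in C.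
    replace (PI / 2 - ((INR K + INR i) * al - PI / 2)) with (PI - (INR K + INR i) * al) in C by field.
    replace (PI / 2 - ((INR M - 1 - INR i) * al - PI / 2)) with (PI - (INR M - 1 - INR i) * al) in C by field.
    rewrite !sin_PI_x in C.
    assert (sqrt 2 <= 2 * (sin ((INR K + INR i) * al) * sin ((INR M - 1 - INR i) * al))); [|lra].
    apply C.
    - rewrite Rabs_right; nra.
    - apply Rabs_le. split; nra. }
  assert (S2p : 0 < S2) by (apply Rpr_pos; intros i Hi; apply Pos; lia).
  rewrite HMs. simpl Rpr. rewrite Rpr_add. fold S2.
  assert (X : S2 <= Rpr (K - 1) (sp al) * S2 * sp al (K - 1 + n2)).
  { replace S2 with (1 * S2 * 1) at 1 by ring. apply Rmult_le_compat; try lra; try nra. }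
  apply Rle_trans with (S2 * S2); auto. nra.
Qed.

Lemma axis_product_exp N : (6 <= N)%nat ->
  exp ((INR N / 8 - 7 / 8) * ln 2) <= Rpr (N / 2) (sp (3 * PI / (2 * INR N))).
Proof.
  intros HN. destruct (axis_product N HN) as [H1 H2].
  set (M := (N / 2)%nat) in *. set (K := ((N + 2) / 3)%nat) in *. set (B := Rpr M _) in *.
  assert (E1 := Nat.div_mod_eq N 2). assert (B1 := Nat.mod_upper_bound N 2 ltac:(lia)).
  assert (E2 := Nat.div_mod_eq (N + 2) 3).
  assert (L2 : 0 < ln 2) by (rewrite <- ln_1; apply ln_increasing; lra).
  assert (S : 2 * sqrt 2 = exp (3 / 2 * ln 2)).
  { replace (3 / 2 * ln 2) with (ln 2 + / 2 * ln 2) by field. rewrite exp_plus, exp_ln by lra. f_equal.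
    rewrite <- Rpower_sqrt by lra. reflexivity. }
  rewrite S, exp_pow_nat in H2.
  assert (HM : INR N <= 2 * INR M + 1) by (rewrite <- (mult_INR 2), <- S_INR; apply le_INR; lia).
  assert (HK2 : 3 * INR K <= INR N + 2) by (replace 3 with (INR 3) by (simpl; ring); replace 2 with (INR 2) by (simpl; ring);
    rewrite <- mult_INR, <- plus_INR; apply le_INR; lia).
  assert (HKM : (K <= M)%nat) by lia. rewrite minus_INR in H2 by auto.
  set (e := exp ((INR N / 8 - 7 / 8) * ln 2)).
  assert (e * e <= B ^ 2); [|simpl in *; nra].
  le_to H2. unfold e. rewrite <- exp_plus. apply exp_le. nra.
Qed.

(** * Lower bounds for (q)_N away from the ray *)

Lemma qpoch_norm N q : Cnorm (qpoch N q) = Rpr N (fun i => Cnorm (C1 - Cpown q (S i))%cx).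
Proof.
  induction N; [apply Cnorm_1|]. rewrite qpoch_S, Cnorm_mul, IHN. reflexivity.
Qed.

(** With v = j h, the exponents become summable in j at the cost of sqrt N: the sum of j^(-1/2) up
    to N is at most 2 sqrt N. *)
Lemma one_minus_exp_ge v : 0 < v -> exp (- / sqrt v) <= 1 - exp (- v).
Proof.
  intros Hv. assert (Hs := sqrt_lt_R0 v Hv). set (u := / sqrt v). assert (Hu : 0 < u) by (apply inv_pos; auto).
  assert (Huv : u * u * v = 1) by (unfold u; rewrite <- (sqrt_sqrt v) at 3 by lra; field; lra).
  assert (E1 : 1 + u * u <= exp u).
  { eapply Rle_trans; [|apply exp_ge_taylor4; lra]. assert (0 <= u ^ 4) by (apply pow_le; lra).
    enough (0 <= u * (1 - u / 2 + u * u / 6)) by (simpl in *; lra). apply mul_pos; nra. }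
  assert (E2 := exp_ineq1_le v).
  rewrite !exp_Ropp.
  apply Rle_trans with (/ (1 + u * u)); [apply inv_le; nra|].
  apply Rle_trans with (1 - / (1 + v)); [|assert (/ exp v <= / (1 + v)) by (apply inv_le; lra); lra].
  right. assert (Hv' : v = / (u * u)) by (apply Rmult_eq_reg_l with (u * u); [rewrite Huv; field; lra|nra]). rewrite Hv'. field. split; [lra|]. nra.
Qed.

(** Only the moduli are used: each factor is at least 1 - exp (-j h) on either side of the unit
    circle. *)
Lemma qpoch_vertical N s h : 0 < h -> Rabs (Cre s) = h ->
  exp (- (2 * sqrt (INR N) * / sqrt h)) <= Cnorm (qpoch N (- Cexp s)%cx).
Proof.
  intros Hh Hs. rewrite qpoch_norm. assert (sh := sqrt_lt_R0 h Hh). set (k := / sqrt h). assert (Hk : 0 < k) by (apply inv_pos; auto).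
  induction N.
  - simpl. rewrite sqrt_0. right. rewrite <- exp_0. f_equal. ring.
  - set (j := INR (S N)).
    assert (Hj : 0 < j) by (apply lt_0_INR; lia). assert (sj := sqrt_lt_R0 j Hj).
    assert (F : exp (- (k * / sqrt j)) <= Cnorm (C1 - Cpown (- Cexp s) (S N))%cx).
    { apply Rle_trans with (1 - exp (- (j * h))).
      - eapply Rle_trans; [|apply one_minus_exp_ge; nra]. right. f_equal. f_equal. rewrite sqrt_mult by lra. unfold k. field. lra.
      - assert (Hn : Cnorm (Cpown (- Cexp s) (S N)) = exp (j * Cre s)).
        { rewrite Cnorm_pown, Cnorm_opp, Cnorm_exp, exp_pow_nat. reflexivity. }
        unfold Rabs in Hs. destruct (Rcase_abs (Cre s)).
        + assert (B := Cnorm_sub_ge C1 (Cpown (- Cexp s) (S N))). rewrite Hn, Cnorm_1 in B.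
          replace (- (j * h)) with (j * Cre s) by (rewrite <- Hs; ring). exact B.
        + assert (B := Cnorm_sub_ge (Cpown (- Cexp s) (S N)) C1). rewrite Hn, Cnorm_1, Cnorm_sub_sym, Hs in B.
          le_to B. rewrite exp_Ropp.
          assert (E := exp_pos (j * h)). set (e := exp (j * h)) in *.
          assert (0 <= (e - 1) * (e - 1) / e) by (apply Rdiv_le_0_compat; [apply Rle_0_sqr|auto]).
          replace ((e - 1) * (e - 1) / e) with (e - 1 - (1 - / e)) in H by (field; lra). lra. }
    eapply Rle_trans; [|apply Rmult_le_compat; [left; apply exp_pos|left; apply exp_pos|exact IHN|exact F]].
    rewrite <- exp_plus. apply exp_le.
    assert (HN0 := pos_INR N). assert (E1 := sqrt_sqrt (INR N) HN0). assert (E2 := sqrt_sqrt j ltac:(lra)).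
    unfold j in *. rewrite S_INR in *. set (a := sqrt (INR N)) in *. set (b := sqrt (INR N + 1)) in *.
    enough (2 * a + / b <= 2 * b) by nra.
    assert (b * (2 * b - 2 * a) >= 1) by nra.
    apply Rmult_le_reg_l with b; auto. replace (b * (2 * a + / b)) with (2 * a * b + 1) by (field; lra). lra.
Qed.

Lemma factor_norm2 s j : Cnorm2 (C1 - Cpown (- Cexp s) j)%cx =
  (1 - exp (INR j * Cre s)) ^ 2 + 2 * exp (INR j * Cre s) * (1 - (-1) ^ j * cos (INR j * Cim s)).
Proof.
  rewrite neg_exp_pown. set (sg := (-1) ^ j).
  assert (S1 : sg * sg = 1) by (unfold sg; rewrite <- Rpow_mult_distr; replace (-1 * -1) with 1 by ring; apply pow1).
  assert (S2 := sin2_cos2 (INR j * Cim s)). unfold Rsqr in S2.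
  unfold Cnorm2. simpl.
  replace (INR j * Cre s - 0 * Cim s) with (INR j * Cre s) by ring.
  replace (INR j * Cim s + 0 * Cre s) with (INR j * Cim s) by ring.
  set (e := exp (INR j * Cre s)). set (c := cos _) in *. set (d := sin _) in *.
  transitivity (1 - 2 * sg * e * c + sg * sg * e * e * (d * d + c * c)); [ring|rewrite S1, S2; ring].
Qed.

(** The inequality a <= 2 sinh (a/2), squared and multiplied by exp (-a). *)
Lemma two_sinh a : 0 <= a -> a * a * exp (- a) <= (1 - exp (- a)) ^ 2.
Proof.
  intros Ha.
  assert (B : 0 <= exp (a / 2) - exp (- (a / 2)) - a).
  { assert (D1 : forall u, is_derive (fun u => exp (u / 2)) u (exp (u / 2) * / 2)).
    { intros u. apply (dcomp exp (fun u => u / 2)); [apply dexp|]. eapply is_derive_val; [apply dmult; [apply did|apply dconst]|cbv beta; ring]. }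
    assert (D2 : forall u, is_derive (fun u => exp (- (u / 2))) u (exp (- (u / 2)) * - / 2)).
    { intros u. apply (dcomp exp (fun u => - (u / 2))); [apply dexp|]. apply dopp. eapply is_derive_val; [apply dmult; [apply did|apply dconst]|cbv beta; ring]. }
    assert (M := mono_of_der (fun u => exp (u / 2) - exp (- (u / 2)) - u) (fun u => exp (u / 2) * / 2 - exp (- (u / 2)) * - / 2 - 1) 0 a Ha).
    cbv beta in M. replace (exp (0 / 2) - exp (- (0 / 2)) - 0) with 0 in M.
    - apply M; [intros t Ht; apply dminus; [apply dminus; [apply D1|apply D2]|apply did]|].
      intros t Ht. assert (E : exp (t / 2) * exp (- (t / 2)) = 1) by (rewrite <- exp_plus, <- exp_0; f_equal; field).
      assert (p := exp_pos (t / 2)). set (x := exp (t / 2)) in *. set (y := exp (- (t / 2))) in *.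
      assert (0 <= (x - y) * (x - y)) by apply Rle_0_sqr. nra.
    - replace (- (0 / 2)) with (0 / 2) by field. ring. }
  assert (E : exp (- a) = exp (- (a / 2)) * exp (- (a / 2))) by (rewrite <- exp_plus; f_equal; field).
  assert (E1 : exp (a / 2) * exp (- (a / 2)) = 1) by (rewrite <- exp_plus, <- exp_0; f_equal; field).
  assert (p := exp_pos (- (a / 2))). set (y := exp (- (a / 2))) in *. set (x := exp (a / 2)) in *.
  replace ((1 - y * y) ^ 2) with ((y * (x - y)) * (y * (x - y))) by (simpl; replace (y * (x - y)) with (x * y - y * y) by ring; rewrite E1; ring).
  replace (a * a * (y * y)) with ((y * a) * (y * a)) by ring.
  assert (y * a <= y * (x - y)) by (apply mul_le_l; lra). assert (0 <= y * a) by nra. nra.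
Qed.

Lemma sqrt_prod_le a b z : 0 <= a -> 0 <= b -> a * a * (b * b) <= Cnorm2 z -> a * b <= Cnorm z.
Proof.
  intros Ha Hb H. rewrite <- Cnorm_sqr in H. generalize (Cnorm_nonneg z). intros.
  apply Rnot_lt_le. intros Hc. nra.
Qed.

Section Horizontal.
Variables (s : Cplx) (x : R).
Hypothesis Hx : 0 <= x.
Hypothesis Hs : Cre s = - x \/ (x = 0 /\ 0 <= Cre s).
Hypothesis Hphi : 0 < Cim s.
Notation phi := (Cim s).

Lemma horiz_r j b : 0 <= b -> exp (- (INR j * x)) * b <= (1 - exp (INR j * Cre s)) ^ 2 + exp (INR j * Cre s) * b.
Proof.
  intros Hb. destruct Hs as [E|[E E2]].
  - rewrite E. replace (INR j * - x) with (- (INR j * x)) by ring. assert (0 <= (1 - exp (- (INR j * x))) ^ 2) by apply pow2_ge_0. lra.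
  - rewrite E, Rmult_0_r, Ropp_0, exp_0. assert (1 <= exp (INR j * Cre s)).
    { rewrite <- exp_0. apply exp_le. apply mul_pos; [apply pos_INR|auto]. }
    nra.
Qed.

Lemma horiz_odd j : (-1) ^ j = -1 -> 0 <= cos (INR j * phi / 2) ->
  exp (- (INR j * x / 2)) * (2 * cos (INR j * phi / 2)) <= Cnorm (C1 - Cpown (- Cexp s) j)%cx.
Proof.
  intros Hj Hc. apply sqrt_prod_le; [left; apply exp_pos|lra|].
  rewrite factor_norm2, Hj, <- exp_plus.
  replace (- (INR j * x / 2) + - (INR j * x / 2)) with (- (INR j * x)) by field.
  assert (E : cos (INR j * phi) = 2 * cos (INR j * phi / 2) * cos (INR j * phi / 2) - 1).
  { rewrite <- cos_2a_cos. f_equal. field. }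
  rewrite E. set (c := cos (INR j * phi / 2)) in *.
  assert (B := horiz_r j (2 * c * (2 * c)) ltac:(nra)). lra.
Qed.

(** Moving off the axis to Re s = -x adds 4 sinh^2 (j x/2) to 4 sin^2 (j phi/2), up to the factor
    exp (-j x). Since the former is at least (j x)^2 and the latter at most (j phi)^2, the gain is a
    factor 1 + (x/phi)^2, the same for all even j. *)
Lemma horiz_even j W : (-1) ^ j = 1 -> 0 <= sin (INR j * phi / 2) -> 0 <= W -> W * W = 1 + (x / phi) * (x / phi) ->
  exp (- (INR j * x / 2)) * (W * (2 * sin (INR j * phi / 2))) <= Cnorm (C1 - Cpown (- Cexp s) j)%cx.
Proof.
  intros Hj Hc HW HW2. apply sqrt_prod_le; [left; apply exp_pos|apply mul_pos; lra|].
  rewrite factor_norm2, Hj, <- exp_plus.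
  replace (- (INR j * x / 2) + - (INR j * x / 2)) with (- (INR j * x)) by field.
  assert (E : cos (INR j * phi) = 1 - 2 * sin (INR j * phi / 2) * sin (INR j * phi / 2)).
  { rewrite <- cos_2a_sin. f_equal. field. }
  rewrite E. set (c := sin (INR j * phi / 2)) in *.
  replace (W * (2 * c) * (W * (2 * c))) with (W * W * (4 * (c * c))) by ring. rewrite HW2.
  destruct Hs as [Er|[Er _]].
  - rewrite Er. replace (INR j * - x) with (- (INR j * x)) by ring.
    assert (S := two_sinh (INR j * x) ltac:(apply mul_pos; [apply pos_INR|auto])).
    assert (p := exp_pos (- (INR j * x))). set (e := exp (- (INR j * x))) in *.
    assert (Hjp : 0 <= INR j * phi) by (apply mul_pos; [apply pos_INR|lra]).
    assert (Hc2 : c <= INR j * phi / 2).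
    { unfold c. destruct (Rle_lt_or_eq_dec _ _ Hjp) as [h|h]; [left; apply sin_lt_x; lra|].
      rewrite <- h. replace (0 / 2) with 0 by field. rewrite sin_0. lra. }
    assert (Q : 4 * (c * c) * (x / phi * (x / phi)) <= INR j * x * (INR j * x)).
    { replace (INR j * x * (INR j * x)) with ((INR j * phi) * (INR j * phi) * (x / phi * (x / phi))) by (field; lra).
      apply mul_le_r; [apply Rle_0_sqr|]. nra. }
    assert (e * (4 * (c * c) * (x / phi * (x / phi))) <= e * (INR j * x * (INR j * x))) by (apply mul_le_l; lra).
    lra.
  - assert (B := horiz_r j (4 * (c * c)) ltac:(nra)). rewrite Er. replace (0 / phi) with 0 by (field; lra).
    rewrite Er in B. lra.
Qed.
End Horizontal.

Lemma exp_arith_product M x : Rpr M (fun i => exp (- ((4 * INR i + 3) * x / 2))) = exp (- ((2 * INR M * INR M + INR M) * x / 2)).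
Proof.
  induction M; simpl Rpr.
  - simpl. rewrite <- exp_0. f_equal. field.
  - rewrite IHM, S_INR, <- exp_plus. f_equal. field.
Qed.

(** The factors 2i+1 and 2i+2 are paired. The cosine of the odd one is at least cos ((i+1) phi), and
    the duplication formula turns the pair into 2 sin (2 (i+1) phi), a factor of the axis product.
    The case Re s >= 0 is covered with x = 0. *)
Lemma qpoch_horizontal N s x W : (6 <= N)%nat -> 0 <= x -> Cre s = - x \/ (x = 0 /\ 0 <= Cre s) ->
  Cim s = 3 * PI / (4 * INR N) -> 0 <= W -> W * W = 1 + (x / Cim s) * (x / Cim s) ->
  / 2 * exp (- (INR N * (INR N + 1) * x / 4) - INR N * x / 2) * W ^ (N / 2) * exp ((INR N / 8 - 7 / 8) * ln 2)
   <= Cnorm (qpoch N (- Cexp s)%cx).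
Proof.
  intros HN Hx Hs Him HW HW2. assert (P := PI_RGT_0).
  assert (HNp : 6 <= INR N) by (replace 6 with (INR 6) by (simpl; ring); apply le_INR; auto).
  set (phi := Cim s) in *. assert (Hphi : 0 < phi) by (rewrite Him; apply Rdiv_lt_0_compat; lra).
  assert (HNphi : INR N * phi = 3 * PI / 4) by (rewrite Him; field; lra).
  assert (AP := axis_product_exp N HN).
  replace (3 * PI / (2 * INR N)) with (2 * phi) in AP by (rewrite Him; field; lra).
  set (M := (N / 2)%nat) in *.
  assert (E1 := Nat.div_mod_eq N 2). assert (B1 := Nat.mod_upper_bound N 2 ltac:(lia)).
  assert (HM : 2 * INR M <= INR N) by (rewrite <- (mult_INR 2); apply le_INR; lia).
  rewrite qpoch_norm. set (F := fun i => Cnorm (C1 - Cpown (- Cexp s) (S i))%cx).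
  assert (Pair : Rpr M (fun i => exp (- ((4 * INR i + 3) * x / 2)) * (W * sp (2 * phi) i)) <= Rpr (2 * M) F).
  { rewrite Rpr_pairs. apply Rpr_le. intros i Hi.
    destruct (INR_S_bound i M Hi) as [a b]. rewrite S_INR in a, b. assert (i0 := pos_INR i).
    assert (V : (INR i + 1) * phi <= 3 * PI / 8) by nra. assert (V0 : 0 < (INR i + 1) * phi) by nra.
    assert (S0 : 0 < sin ((INR i + 1) * phi)) by (apply sin_gt_0; lra).
    assert (C0' : 0 < cos ((INR i + 1) * phi)) by (apply cos_gt_0; lra).
    assert (Dbl : sp (2 * phi) i = 2 * cos ((INR i + 1) * phi) * (2 * sin ((INR i + 1) * phi))).
    { unfold sp. rewrite S_INR. replace ((INR i + 1) * (2 * phi)) with (2 * ((INR i + 1) * phi)) by ring. rewrite sin_2a. ring. }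
    assert (I1 : INR (S (2 * i)) = 2 * INR i + 1) by (rewrite S_INR, mult_INR; simpl; ring).
    assert (I2 : INR (S (S (2 * i))) = 2 * (INR i + 1)) by (rewrite S_INR, I1; ring).
    assert (Cmon : cos ((INR i + 1) * phi) <= cos (INR (S (2 * i)) * phi / 2)).
    { apply cos_decr_1; nra. }
    assert (Fo := horiz_odd s x Hs (S (2 * i)) ltac:(apply pow_1_odd) ltac:(fold phi; lra)).
    assert (Fe := horiz_even s x Hx Hs Hphi (S (S (2 * i))) W).
    replace (S (S (2 * i))) with (2 * (S i))%nat in Fe at 1 by lia.
    specialize (Fe (pow_1_even (S i))). fold phi in Fe, Fo.
    replace (INR (S (S (2 * i))) * phi / 2) with ((INR i + 1) * phi) in Fe by (rewrite I2; field).
    specialize (Fe ltac:(lra) HW HW2). split.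
    - apply mul_pos; [left; apply exp_pos|]. apply mul_pos; auto. nra.
    - eapply Rle_trans; [|apply Rmult_le_compat; [| |exact Fo|exact Fe]].
      + rewrite Dbl. set (c := cos ((INR i + 1) * phi)) in *. set (d := sin ((INR i + 1) * phi)) in *. set (c' := cos (INR (S (2 * i)) * phi / 2)) in *.
        replace (exp (- ((4 * INR i + 3) * x / 2))) with (exp (- (INR (S (2 * i)) * x / 2)) * exp (- (INR (S (S (2 * i))) * x / 2)))
          by (rewrite <- exp_plus, I1, I2; f_equal; field).
        assert (p1 := exp_pos (- (INR (S (2 * i)) * x / 2))). assert (p2 := exp_pos (- (INR (S (S (2 * i))) * x / 2))).
        set (e1 := exp (- (INR (S (2 * i)) * x / 2))) in *. set (e2 := exp (- (INR (S (S (2 * i))) * x / 2))) in *.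
        replace (e1 * e2 * (W * (2 * c * (2 * d)))) with ((e1 * e2 * (W * (4 * d))) * c) by ring.
        replace (e1 * (2 * c') * (e2 * (W * (2 * d)))) with ((e1 * e2 * (W * (4 * d))) * c') by ring.
        apply mul_le_l; auto. apply mul_pos; [nra|]. apply mul_pos; lra.
      + apply mul_pos; [left; apply exp_pos|lra].
      + apply mul_pos; [left; apply exp_pos|apply mul_pos; lra]. }
  rewrite Rpr_mult, exp_arith_product, Rpr_mult, Rpr_const in Pair.
  assert (WM : 0 <= W ^ M) by (apply pow_le; auto).
  assert (A0 : 0 < exp ((INR N / 8 - 7 / 8) * ln 2)) by apply exp_pos.
  assert (Hexp : exp (- (INR N * (INR N + 1) * x / 4)) <= exp (- ((2 * INR M * INR M + INR M) * x / 2))).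
  { apply exp_le. assert (0 <= INR M) by apply pos_INR.
    assert (2 * INR M * INR M + INR M <= INR N * (INR N + 1) / 2) by nra. nra. }
  assert (Pair2 : exp (- (INR N * (INR N + 1) * x / 4)) * (W ^ M * exp ((INR N / 8 - 7 / 8) * ln 2)) <= Rpr (2 * M) F).
  { le_to Pair. apply Rmult_le_compat; auto.
    - left; apply exp_pos.
    - apply mul_pos; auto; lra.
    - apply mul_le_l; auto. }
  assert (Ex1 : exp (- (INR N * x / 2)) <= 1).
  { rewrite <- exp_0. apply exp_le. assert (0 <= INR N * x) by nra. lra. }
  unfold Rminus. rewrite exp_plus.
  set (e0 := exp (- (INR N * (INR N + 1) * x / 4))) in *. set (eA := exp ((INR N / 8 + - (7 / 8)) * ln 2)).
  change (exp ((INR N / 8 - 7 / 8) * ln 2)) with eA in *.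
  assert (e00 : 0 < e0) by apply exp_pos. assert (e1p := exp_pos (- (INR N * x / 2))).
  set (e1 := exp (- (INR N * x / 2))) in *.
  assert (T0 : 0 <= e0 * (W ^ M * eA)) by (apply mul_pos; [lra|apply mul_pos; lra]).
  replace (/ 2 * (e0 * e1) * W ^ M * eA) with (e0 * (W ^ M * eA) * (/ 2 * e1)) by ring.
  assert (HN2 : N = (2 * M)%nat \/ N = S (2 * M)) by lia. destruct HN2 as [HN2|HN2].
  - rewrite HN2. nra.
  - rewrite HN2. change (M + (M + 0))%nat with (2 * M)%nat. apply Rmult_le_compat; auto; [lra|].
    (* For odd N the last factor is unpaired. As N phi = 3 PI/4, its squared modulus is at least exp
       (-N x) (2 - sqrt 2), and 2 - sqrt 2 >= 1/4; this is the source of the 1/2 in the bound. *)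
    unfold F. rewrite <- HN2, Rmult_comm. apply sqrt_prod_le; [lra|lra|].
    rewrite factor_norm2. replace ((-1) ^ N) with (-1) by (rewrite HN2; symmetry; apply pow_1_odd).
    fold phi. rewrite HNphi.
    assert (Hc : cos (3 * PI / 4) = - (sqrt 2 / 2)).
    { replace (3 * PI / 4) with (3 * (PI / 4)) by field. rewrite cos_3PI4.
      assert (0 < sqrt 2) by (apply sqrt_lt_R0; lra). assert (S := sqrt_sqrt 2 ltac:(lra)).
      apply Rmult_eq_reg_l with (sqrt 2); [|lra]. field_simplify; [|lra]. simpl. rewrite Rmult_1_r, S. field. }
    assert (Hq : sqrt 2 <= 1.75) by (rewrite <- (sqrt_square 1.75) by lra; apply sqrt_le_1; lra).
    assert (B := horiz_r s x Hs N (2 * (1 - sqrt 2 / 2)) ltac:(lra)).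
    assert (Ee : e1 * e1 = exp (- (INR N * x))) by (unfold e1; rewrite <- exp_plus; f_equal; field).
    nra.
Qed.

(** * The contribution of the saddle point *)

Lemma Cpowz_mul z w k : z <> C0 -> w <> C0 -> Cpowz (z * w)%cx k = (Cpowz z k * Cpowz w k)%cx.
Proof.
  intros Hz Hw. destruct k as [|p|p]; simpl Cpowz; [ring|apply Cpown_mul|].
  rewrite Cpown_mul. field. split; apply Cpown_neq0; auto.
Qed.
Lemma Cpowz_exp w k : Cpowz (Cexp w) k = Cexp (RtoC (IZR k) * w)%cx.
Proof.
  assert (G : forall p, Cpown (Cexp w) (Pos.to_nat p) = Cexp (RtoC (IZR (Zpos p)) * w)%cx).
  { intros p. rewrite <- Cexp_nat. rewrite INR_IZR_INZ, positive_nat_Z. reflexivity. }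
  destruct k as [|p|p]; simpl Cpowz.
  - change (RtoC (IZR 0)) with C0. replace (C0 * w)%cx with C0 by ring. now rewrite Cexp_0.
  - apply G.
  - rewrite G, <- Cexp_opp. f_equal. change (IZR (Z.neg p)) with (- IZR (Zpos p)). rewrite RtoC_opp. ring.
Qed.
Lemma Cpowz_RtoC a k : a <> 0 -> Cpowz (RtoC a) k = RtoC (powerRZ a k).
Proof.
  intros Ha. destruct k as [|p|p]; simpl; [reflexivity|apply Cpown_RtoC|].
  rewrite Cpown_RtoC, RtoC_inv by (apply pow_nonzero; auto). reflexivity.
Qed.

Lemma Xp_pullback Q (X Y : Type) (domX : X -> Prop) (domY : Y -> Prop) (CX : (X -> Cplx) -> Prop) (CY : (Y -> Cplx) -> Prop) (phi : Y -> X) :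
  (forall y, domY y -> domX (phi y)) -> (forall h, CX h -> CY (fun y => h (phi y))) ->
  forall r H, Xp Q X domX CX r H -> Xp Q Y domY CY r (fun N y => H N (phi y)).
Proof.
  intros Hd HC. assert (Ev : forall P, evt Q X domX P -> evt Q Y domY (fun N y => P N (phi y))).
  { intros P [n [Hn HP]]. exists n; split; auto. }
  induction r; intros H HX.
  - destruct HX as [K HK]. exists K. exact (Ev _ HK).
  - destruct HX as (h0 & H1 & A & B & C). exists (fun y => h0 (phi y)), (fun N y => H1 N (phi y)).
    split; [|split]; auto. exact (Ev _ C).
Qed.

(** * Laplace integrals whose amplitude depends on N *)

Section LaplaceXp.
Variables (Q : nat -> Prop) (psi : R -> Cplx) (e d : R).
Hypothesis Hde : 0 < d < e.
Hypothesis Hcsm : csm (itv e) psi.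
Hypothesis Hpsi : forall x, itv e x -> Cre (psi x) <= 0.
Hypothesis HSq : forall h, csm (itv e) h -> forall Q r, Sq Q r (fun N => RtoC (/ Gam N) * LI psi d h N)%cx.
Let dom (x : R) := - d <= x <= d.
Definition cc (H : nat -> R -> Cplx) := forall N, (1 <= N)%nat -> Q N -> forall x, dom x -> ccont (H N) x.
Notation I H := (fun N => RtoC (/ Gam N) * LI psi d (H N) N)%cx.

Lemma cc_integrand H N : cc H -> (1 <= N)%nat -> Q N ->
  ex_CInt (fun x => Cexp (RtoC (INR N) * psi x) * H N x)%cx (- d) d.
Proof.
  intros HH HN HQ. apply ex_CInt_cont. intros x Hx. minmax Hx.
  apply ccont_mul; [|apply HH; auto].
  assert (HO := itv_open e).
  apply (csm_ccont (itv e) (fun x => Cexp (RtoC (INR N) * psi x)%cx)); [|unfold itv; lra].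
  apply csm_exp; auto. apply csm_mul; auto. apply csm_const; auto.
Qed.

Lemma LI_bound H K : cc H -> evt Q R dom (fun N x => Cnorm (H N x) <= K) ->
  exists n, (1 <= n)%nat /\ forall N, (n <= N)%nat -> Q N -> Cnorm (LI psi d (H N) N) <= 2 * K * (2 * d).
Proof.
  intros HH [n [Hn HK]]. exists n; split; auto. intros N HN HQ.
  replace (2 * d) with (d - - d) by ring. apply CInt_bound; [lra|apply cc_integrand; auto; lia|].
  intros x Hx. rewrite Cnorm_mul, Cnorm_exp.
  assert (E : exp (Cre (RtoC (INR N) * psi x)%cx) <= 1).
  { rewrite <- exp_0. apply exp_le. rewrite Cre_RtoC_mul. assert (h := Hpsi x ltac:(unfold itv; lra)).
    generalize (pos_INR N). nra. }
  specialize (HK N HN HQ x Hx). generalize (Cnorm_nonneg (H N x)) (exp_pos (Cre (RtoC (INR N) * psi x)%cx)). nra.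
Qed.

Lemma LI_split H h0 H1 : cc H -> csm (itv e) h0 ->
  evt Q R dom (fun N x => H N x = h0 x + RtoC (eps N) * H1 N x)%cx ->
  cc (fun N x => (/ RtoC (eps N)) * (H N x - h0 x))%cx /\
  (evt Q R dom (fun N x => H1 N x = (/ RtoC (eps N)) * (H N x - h0 x))%cx) /\
  (forall N, (1 <= N)%nat -> Q N -> LI psi d (H N) N = (LI psi d h0 N + RtoC (eps N) * LI psi d (fun x => (/ RtoC (eps N)) * (H N x - h0 x)) N)%cx).
Proof.
  intros HH Hh HE.
  assert (G : cc (fun N x => (/ RtoC (eps N)) * (H N x - h0 x))%cx).
  { intros N HN HQ x Hx. apply ccont_mul; [apply ccont_const|]. apply ccont_sub; [apply HH; auto|].
    apply (csm_ccont (itv e)); auto. unfold itv, dom in *; lra. }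
  split; [exact G|split].
  - revert HE. apply evt_imp. intros N x HN HQ Hx E. rewrite E. field. apply RtoC_neq0. generalize (eps_pos N HN); lra.
  - intros N HN HQ.
    set (f0 := (fun x => Cexp (RtoC (INR N) * psi x) * h0 x)%cx).
    set (f1 := (fun x => Cexp (RtoC (INR N) * psi x) * ((/ RtoC (eps N)) * (H N x - h0 x)))%cx).
    change (LI psi d h0 N) with (CInt f0 (- d) d).
    change (LI psi d (fun x => (/ RtoC (eps N)) * (H N x - h0 x))%cx N) with (CInt f1 (- d) d).
    assert (E0 : ex_CInt f0 (- d) d).
    { apply (cc_integrand (fun _ => h0)); auto. intros N' _ _ x Hx. apply (csm_ccont (itv e)); auto. unfold itv, dom in *; lra. }
    assert (E1 : ex_CInt f1 (- d) d) by (apply (cc_integrand _ N G); auto).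
    rewrite <- (CInt_scal (RtoC (eps N)) f1 (- d) d E1).
    rewrite <- (CInt_add f0 (fun x => RtoC (eps N) * f1 x)%cx (- d) d E0 (ex_CInt_scal _ _ _ _ E1)).
    apply CInt_ext. intros x Hx. unfold f0, f1. field. apply RtoC_neq0. generalize (eps_pos N HN); lra.
Qed.

Lemma Gam_eps_bdd : exists K, forall N, (1 <= N)%nat -> eps N * / Gam N <= K.
Proof.
  destruct Gam_lower as [k [Hk HG]]. exists (/ k). intros N HN. specialize (HG N HN).
  assert (G := Gam_pos N HN). apply Rmult_le_reg_r with (k * Gam N); [nra|].
  replace (eps N * / Gam N * (k * Gam N)) with (k * eps N) by (field; lra).
  replace (/ k * (k * Gam N)) with (Gam N) by (field; lra). lra.
Qed.

Lemma LI_eps_bdd H K : cc H -> evt Q R dom (fun N x => Cnorm (H N x) <= K) -> Sq Q 0 (fun N => RtoC (eps N) * (I H N))%cx.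
Proof.
  intros HH HK. destruct (LI_bound H K HH HK) as [n [Hn B]]. destruct Gam_eps_bdd as [K2 G].
  exists (K2 * (2 * Rabs K * (2 * d))). exists n; split; auto. intros N HN HQ _ _.
  rewrite !Cnorm_mul, !Cnorm_RtoC. assert (HN1 : (1 <= N)%nat) by lia.
  assert (e1 := eps_pos N HN1). assert (g1 := inv_pos _ (Gam_pos N HN1)).
  rewrite !Rabs_right, <- Rmult_assoc by lra.
  apply Rmult_le_compat; [nra|apply Cnorm_nonneg|apply G; auto|].
  eapply Rle_trans; [apply B; auto|]. generalize (Rle_abs K); nra.
Qed.

(** Coefficients of the amplitude are peeled off and integrated one at a time. One order is lost at
    the end: the final remainder is merely bounded, and a factor 1/N is spent to compensate
    1/[Gam]. *)
Lemma LI_Xp r : forall H, cc H -> Xp Q R dom (csm (itv e)) (S r) H -> Sq Q r (I H).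
Proof.
  induction r; intros H HH HX; destruct HX as (h0 & H1 & A & B & C);
    destruct (LI_split H h0 H1 HH A C) as (G1 & G2 & G3);
    assert (B' := Xp_ext Q R dom (csm (itv e)) _ _ _ G2 B);
    apply (Sq_ext Q _ (fun N => RtoC (/ Gam N) * LI psi d h0 N + RtoC (eps N) * (I (fun N x => (/ RtoC (eps N)) * (H N x - h0 x)) N))%cx).
  1, 3: exists 1%nat; split; [lia|]; intros N HN HQ; rewrite (G3 N HN HQ); ring.
  - apply Sq_add; [apply HSq; auto|]. destruct B' as [K HK]. apply (LI_eps_bdd _ K); auto.
  - apply Sq_add; [apply HSq; auto|]. apply Xp_eps; auto. apply IHr; auto.
Qed.

Lemma LI_lead H g v0 : cc H -> (forall n, exists N, (n <= N)%nat /\ Q N) -> Xp Q R dom (csm (itv e)) 2 H ->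
  (exists K, evt Q R dom (fun N x => Cnorm (H N x - g x)%cx <= K * eps N)) ->
  (forall h, csm (itv e) h -> exists K, forall N, (1 <= N)%nat -> Cnorm (RtoC (/ Gam N) * LI psi d h N - h 0%R / v0)%cx <= K * eps N) ->
  exists K n, (1 <= n)%nat /\ forall N, (n <= N)%nat -> Q N -> Cnorm (I H N - g 0%R / v0)%cx <= K * eps N.
Proof.
  intros HH HQ (h0 & H1 & A & B & C) [Kg [ng [Hng Hg]]] Hl.
  assert (Bd : forall f, csm (itv e) f -> exists K, forall x, dom x -> Cnorm (f x) <= K).
  { intros f Hf. destruct (csm_bounded (itv e) f (- d) d Hf ltac:(lra)) as [K [_ HK]]; [intros; unfold itv; lra|eauto]. }
  destruct (LI_split H h0 H1 HH A C) as (G1 & G2 & G3).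
  assert (B' := Xp_ext Q R dom (csm (itv e)) _ _ _ G2 B).
  assert (S0 := LI_Xp 0 _ G1 B'). destruct S0 as [K0 [n0 [Hn0 S0]]].
  destruct (Xp_bdd Q R dom (csm (itv e)) Bd 1 H1 B) as [K1 [n1 [Hn1 B1]]].
  destruct C as [nc [Hnc C]]. destruct (Hl h0 A) as [K2 H2].
  assert (D0 : dom 0) by (unfold dom; lra).
  assert (E : h0 0 = g 0).
  { apply csub_eq0. apply (eps_limit_eq Q HQ _ (K1 + Kg) (ng + n1 + nc)). intros N HN HQN.
    specialize (Hg N ltac:(lia) HQN 0 D0). specialize (C N ltac:(lia) HQN 0 D0). specialize (B1 N ltac:(lia) HQN 0 D0).
    replace (h0 0%R - g 0%R)%cx with ((H N 0%R - g 0%R) - RtoC (eps N) * H1 N 0%R)%cx by (rewrite C; ring).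
    le_via Cnorm_sub_le. rewrite Cnorm_mul, Cnorm_RtoC.
    assert (e1 := eps_pos N ltac:(lia)). rewrite (Rabs_right (eps N)) by lra. nra. }
  exists (K2 + K0), n0. split; auto. intros N HN HQN. specialize (S0 N HN HQN Datatypes.tt Logic.I).
  rewrite <- E, (G3 N ltac:(lia) HQN). specialize (H2 N ltac:(lia)).
  match type of S0 with Cnorm ?t <= _ => set (T := t) in * end.
  replace (RtoC (/ Gam N) * _ - h0 0%R / v0)%cx with ((RtoC (/ Gam N) * LI psi d h0 N - h0 0%R / v0) + RtoC (eps N) * T)%cx by (unfold T; ring).
  le_via Cnorm_triang. rewrite Cnorm_mul, Cnorm_RtoC.
  assert (e1 := eps_pos N ltac:(lia)). rewrite (Rabs_right (eps N)) by lra. nra.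
Qed.
End LaplaceXp.

(** * One coefficient sequence for all orders *)

Section Coefficients.
Variable Q : nat -> Prop.
Hypothesis HQ : forall n, exists N, (n <= N)%nat /\ Q N.
Definition allSq (F : nat -> Cplx) : Prop := forall r, Sq Q r F.

(** For each r there is some expansion, with coefficients that might depend on r. By [eps_limit_eq]
    the first coefficients agree, hence the remainders agree eventually, and one remainder has
    expansions of every order. *)
Lemma allSq_step F : allSq F -> exists p : Cplx * (nat -> Cplx), allSq (snd p) /\
  exists n, forall N, (n <= N)%nat -> Q N -> F N = (fst p + RtoC (eps N) * snd p N)%cx.
Proof.
  intros HF.
  assert (G : forall r, exists c F1, Sq Q r F1 /\ exists n, (1 <= n)%nat /\ forall N, (n <= N)%nat -> Q N -> F N = (c + RtoC (eps N) * F1 N)%cx).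
  { intros r. destruct (HF (S r)) as (h0 & H1 & _ & B & [n [Hn C]]).
    exists (h0 Datatypes.tt), (fun N => H1 N Datatypes.tt). split.
    - apply (Xp_ext _ _ _ _ r H1); [|exact B]. exists 1%nat. split; [lia|]. intros N _ _ [] _. reflexivity.
    - exists n; split; [exact Hn|]. intros N HN HQN. exact (C N HN HQN Datatypes.tt Logic.I). }
  destruct (G 0%nat) as (c & F1 & [K [n1 [Hn1 B1]]] & n & Hn & E). exists (c, F1). simpl. split; [|exists n; auto].
  intros r. destruct (G r) as (c' & F1' & B' & n' & Hn' & E').
  assert (Bb : exists K', evt Q unit (fun _ => True) (fun N _ => Cnorm (F1' N) <= K')).
  { apply (Xp_bdd Q unit (fun _ => True) (fun _ => True)) with (2 := B'). intros f _. exists (Cnorm (f Datatypes.tt)). intros [] _; lra. }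
  destruct Bb as [K' [n2 [Hn2 B2]]].
  assert (Ec : c = c').
  { apply csub_eq0. apply (eps_limit_eq Q HQ _ (K' + K) (n + n' + n1 + n2)). intros N HN HQN.
    assert (X := E N ltac:(lia) HQN). rewrite (E' N ltac:(lia) HQN) in X.
    replace (c - c')%cx with (RtoC (eps N) * (F1' N - F1 N))%cx.
    - rewrite Cnorm_mul, Cnorm_RtoC. assert (e1 := eps_pos N ltac:(lia)). rewrite Rabs_right by lra.
      specialize (B1 N ltac:(lia) HQN Datatypes.tt Logic.I). specialize (B2 N ltac:(lia) HQN Datatypes.tt Logic.I).
      generalize (Cnorm_sub_le (F1' N) (F1 N)). nra.
    - transitivity ((c' + RtoC (eps N) * F1' N) - c' - RtoC (eps N) * F1 N)%cx; [ring|rewrite X; ring]. }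
  apply (Sq_ext Q r F1'); auto. exists (n + n')%nat. split; [lia|]. intros N HN HQN.
  assert (X := E N ltac:(lia) HQN). rewrite (E' N ltac:(lia) HQN), <- Ec in X.
  assert (e0 : RtoC (eps N) <> C0) by (apply RtoC_neq0; generalize (eps_pos N ltac:(lia)); lra).
  transitivity (/ RtoC (eps N) * (c + RtoC (eps N) * F1' N - c))%cx; [field; auto|rewrite X; field; auto].
Qed.

Lemma allSq_coefficients F : allSq F -> exists d : nat -> Cplx, forall r, exists K n, forall N, (n <= N)%nat -> Q N ->
  Cnorm (F N - Csum r (fun j => d j * RtoC (eps N ^ j)))%cx <= K * eps N ^ r.
Proof.
  intros HF.
  (* The step is iterated on sequences paired with the proof that they expand to all orders; choice
     turns the existence statement into a function. *)
  set (T := {F : nat -> Cplx | allSq F}).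
  assert (step : forall t : T, {p : Cplx * T | exists n, forall N, (n <= N)%nat -> Q N ->
    proj1_sig t N = (fst p + RtoC (eps N) * proj1_sig (snd p) N)%cx}).
  { intros t. apply constructive_indefinite_description. destruct (allSq_step (proj1_sig t) (proj2_sig t)) as [[c F1] [A B]].
    exists (c, exist _ F1 A). exact B. }
  set (it := fix it (j : nat) : T := match j with O => exist _ F HF | S j' => snd (proj1_sig (step (it j'))) end).
  exists (fun j => fst (proj1_sig (step (it j)))). intros r.
  assert (E : exists n, forall N, (n <= N)%nat -> Q N ->
    F N = (Csum r (fun j => fst (proj1_sig (step (it j))) * RtoC (eps N ^ j)) + RtoC (eps N ^ r) * proj1_sig (it r) N)%cx).
  { induction r.
    - exists 0%nat. intros N _ _. simpl. change (RtoC 1) with C1. ring.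
    - destruct IHr as [n IH]. destruct (proj2_sig (step (it r))) as [n2 E2]. exists (n + n2)%nat. intros N HN HQN.
      rewrite (IH N ltac:(lia) HQN), (E2 N ltac:(lia) HQN). simpl Csum. simpl (it (S r)).
      change (eps N ^ S r) with (eps N * eps N ^ r). rewrite RtoC_mul. ring. }
  destruct E as [n E]. destruct (proj2_sig (it r) 0%nat) as [K [n2 [Hn2 B]]].
  exists K, (n + n2)%nat. intros N HN HQN. rewrite (E N ltac:(lia) HQN).
  set (s := Csum r _). replace (s + RtoC (eps N ^ r) * proj1_sig (it r) N - s)%cx with (RtoC (eps N ^ r) * proj1_sig (it r) N)%cx by ring.
  assert (e1 := eps_pos N ltac:(lia)).
  rewrite Cnorm_mul, Cnorm_RtoC, Rabs_right, Rmult_comm by (apply Rle_ge, pow_le; lra).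
  apply mul_le_r; [apply pow_le; lra|]. exact (B N ltac:(lia) HQN Datatypes.tt Logic.I).
Qed.
End Coefficients.

Lemma cder_shift f a x l : cder f (a + x) l -> cder (fun t => f (a + t)) x l.
Proof.
  assert (S : is_derive (fun t => a + t) x 1).
  { eapply is_derive_val; [apply dplus; [apply dconst|apply did]|ring]. }
  intros [H1 H2]; split.
  - apply (is_derive_val _ _ (Cre l * 1)); [apply (dcomp (fun t => Cre (f t)) (fun t => a + t) x _ _ H1 S)|ring].
  - apply (is_derive_val _ _ (Cim l * 1)); [apply (dcomp (fun t => Cim (f t)) (fun t => a + t) x _ _ H2 S)|ring].
Qed.
Lemma csm_shift (D E : R -> Prop) f a : open D -> open E -> csm E f -> (forall x, D x -> E (a + x)) -> csm D (fun x => f (a + x)).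
Proof.
  intros HD HE [H1 H2] H.
  assert (S : smooth D (fun x => a + x)) by (apply smooth_plus; [auto|apply smooth_const; auto|apply smooth_id; auto]).
  split; [apply (smooth_comp D E (fun x => Cre (f x)) (fun x => a + x))|apply (smooth_comp D E (fun x => Cim (f x)) (fun x => a + x))]; auto.
Qed.

(** * The amplitude near the saddle *)

Section Saddle.
Variable z0 : Cplx.
Hypothesis Hz0 : Cre z0 < 0.
Variable m : Z.
Notation c := (RtoC (/ 2) * z0)%cx.

Definition rayL (a : nat) (x : R) : Cplx :=
  (RtoC (INR a / 2) * (Clog (- z0) + RtoC (ln x)) + RtoC ((1 - INR a / 2) * ln 2) - RtoC (IZR (m + 1) * ln x))%cx.
(** The logarithm of the amplitude: the bounded part of -log (q)_N, the power t^(-m-1) with t = -c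
    (x/N) exp (rayf (x/N)), and exp s from dq. The argument of [rayf] has the shape expected by
    [XP_shift]. *)
Definition rayW (a N : nat) (x : R) : Cplx :=
  (rayL a x - (rayS z0 N x - RtoC (INR N) * rayA z0 x) - RtoC (IZR (m + 1)) * rayf z0 (0 * x + 1 * x * eps N)%R
   + RtoC (eps N) * (RtoC x * c))%cx.
Definition rayK (a N : nat) (x : R) : Cplx := (- c * Cpowz (- c) (- m - 1) * Cexp (rayW a N x))%cx.
Definition rayW0 (a : nat) (x : R) : Cplx :=
  (rayL a x - (RtoC ((1 - INR a) / 2) * rayf z0 x + RtoC (INR a / 2) * rayg z0 x))%cx.

(** The power of 1/N is 1 - m: one factor from 1/(q)_N, one from ds, and -m - 1 from the power of
    t. *)
Lemma ray_integrand a N x : (a < 2)%nat -> (1 <= N)%nat -> par a N -> 0 < x ->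
  (integrand m N (RtoC (x * eps N) * c) * (RtoC (eps N) * c) =
   RtoC (powerRZ (eps N) (1 - m)) * (RtoC (/ Gam N) * (RtoC (/ sig N) * (Cexp (RtoC (INR N) * rayP z0 x) * rayK a N x))))%cx.
Proof.
  intros Ha HN Hp Hx. assert (He := eps_pos N HN).
  unfold integrand. rewrite (ray_inverse z0 Hz0 a N x Ha HN Hp Hx).
  change (Cexp (RtoC (x * eps N) * c)) with (rayE z0 (x * eps N)).
  assert (Et : tt (RtoC (x * eps N) * c)%cx = ((- c) * (RtoC (eps N) * Cexp (RtoC (ln x) + rayf z0 (x * eps N))))%cx).
  { unfold tt. change (Cexp (RtoC (x * eps N) * c)) with (rayE z0 (x * eps N)).
    rewrite (ray1_eq z0 Hz0), Cexp_add, Cexp_RtoC, exp_ln, (rayf_exp z0 Hz0), RtoC_mul by (auto; nra). ring. }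
  assert (n1 : RtoC (eps N) <> C0) by (apply RtoC_neq0; lra).
  assert (n2 : (- c)%cx <> C0) by (apply Cre_neq0; simpl; lra).
  rewrite Et, !Cpowz_mul, Cpowz_RtoC, Cpowz_exp by (auto using Cexp_neq0, Cmul_neq0; lra).
  assert (Ep : RtoC (powerRZ (eps N) (1 - m)) = (RtoC (eps N) * RtoC (eps N) * RtoC (powerRZ (eps N) (- m - 1)))%cx).
  { rewrite <- !RtoC_mul. f_equal. replace (1 - m)%Z with (2 + (- m - 1))%Z by ring. rewrite powerRZ_add by lra. simpl. ring. }
  rewrite Ep. unfold rayK, rayH, rayE.
  assert (EW : Cexp (rayW a N x) = (Cexp (RtoC (INR a / 2) * (Clog (- z0) + RtoC (ln x)) + RtoC ((1 - INR a / 2) * ln 2) - (rayS z0 N x - RtoC (INR N) * rayA z0 x))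
     * Cexp (RtoC (IZR (- m - 1)) * (RtoC (ln x) + rayf z0 (x * eps N))) * Cexp (RtoC (x * eps N) * c))%cx).
  { rewrite <- !Cexp_add. f_equal. unfold rayW, rayL. replace (0 * x + 1 * x * eps N) with (x * eps N) by ring.
    replace (- m - 1)%Z with (- (m + 1))%Z by ring. rewrite opp_IZR, RtoC_opp, !RtoC_mul. ring. }
  rewrite EW. unfold Rdiv at 1. rewrite RtoC_mul. ring.
Qed.

Section Window.
Variables lo hi : R.
Hypothesis Hlo : 0 < lo.
Hypothesis Hlohi : lo <= hi.
Variable a : nat.
Hypothesis Ha : (a < 2)%nat.

Lemma rayL_csm : csm posR (rayL a).
Proof.
  assert (HO := posR_open). assert (Hl : smooth posR ln) by apply smooth_ln.
  repeat first [apply csm_sub; [exact HO| |]|apply csm_add; [exact HO| |]|apply csm_mul; [exact HO| |]|apply csm_const; exact HO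
    |apply csm_RtoC; [exact HO|]]; auto. apply smooth_mult; auto. apply smooth_const; auto.
Qed.
Lemma rayW_expansion r : Xp (par a) R (box lo hi) (csm posR) r (rayW a).
Proof.
  assert (Bd := pos_bdd lo hi Hlo Hlohi).
  apply Xp_add; [apply pos_add| |].
  - apply Xp_sub; [apply pos_const|apply pos_add|apply pos_mul|exact Bd| |].
    + apply Xp_sub; [apply pos_const|apply pos_add|apply pos_mul|exact Bd| |].
      * apply Xp_cf; [apply pos_const|exact Bd|apply rayL_csm].
      * apply rayS_expansion; auto.
    + apply Xp_mul; [apply pos_const|apply pos_add|apply pos_mul|exact Bd| |].
      * apply Xp_cf; [apply pos_const|exact Bd|apply pos_const].
      * apply (XP_shift allR allR_open allR_pos); auto; try lra. apply rayf_csm; auto.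
  - apply Xp_down; [exact Bd|]. apply Xp_eps; [apply pos_const|].
    apply (Xp_cf _ _ _ _ pos_const Bd r (fun x => RtoC x * c)%cx).
    apply pos_mul; [apply csm_RtoC; [apply posR_open|apply smooth_id, posR_open]|apply pos_const].
Qed.

Lemma rayW_limit : exists K, forall N x, (1 <= N)%nat -> par a N -> box lo hi x -> Cnorm (rayW a N x - rayW0 a x)%cx <= K * eps N.
Proof.
  destruct (rayS_limit z0 Hz0 lo hi Hlo Hlohi a Ha) as [K1 H1].
  destruct (csm_bounded allR (cD (rayf z0)) 0 hi) as [K2 [HK2 H2]]; [apply csm_cD, rayf_csm; auto|lra|intros; exact I|].
  exists (K1 + Cnorm (RtoC (IZR (m + 1))) * (2 * K2 * hi) + hi * Cnorm c). intros N x HN Hp Hx.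
  specialize (H1 N x HN Hp Hx). assert (e1 := eps_pos N HN). assert (e2 := eps_le1 N HN).
  destruct Hx as [x1 x2].
  assert (Hxe : 0 <= x * eps N <= hi) by nra.
  assert (B : Cnorm (rayf z0 (x * eps N) - rayf z0 0%R)%cx <= 2 * K2 * (x * eps N - 0)).
  { apply (cder_MVT (rayf z0) (cD (rayf z0))); [lra| |intros; apply H2; lra].
    intros t _. apply (csm_cder allR); [apply rayf_csm; auto|exact I]. }
  rewrite (rayf_0 z0) in B. replace (rayf z0 (x * eps N) - C0)%cx with (rayf z0 (x * eps N)) in B by ring.
  unfold rayW, rayW0. replace (0 * x + 1 * x * eps N) with (x * eps N) by ring.
  match type of H1 with Cnorm ?t <= _ => set (T := t) in * end.
  match goal with |- Cnorm ?t <= _ => replace t with ((- T - RtoC (IZR (m + 1)) * rayf z0 (x * eps N)) + RtoC (eps N) * (RtoC x * c))%cx by (unfold T; ring) end.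
  le_via Cnorm_triang. eapply Rle_trans; [apply Rplus_le_compat_r, Cnorm_sub_le|].
  rewrite Cnorm_opp, (Cnorm_mul (RtoC (IZR (m + 1)))), (Cnorm_mul (RtoC (eps N))), (Cnorm_mul (RtoC x)), (Cnorm_RtoC (eps N)), (Cnorm_RtoC x), !(Rabs_right (eps N)), (Rabs_right x) by lra.
  assert (P1 := Cnorm_nonneg (RtoC (IZR (m + 1)))). assert (P2 := Cnorm_nonneg c).
  assert (A1 : Cnorm (RtoC (IZR (m + 1))) * Cnorm (rayf z0 (x * eps N)) <= Cnorm (RtoC (IZR (m + 1))) * (2 * K2 * hi * eps N)).
  { apply mul_le_l; auto. le_via B. replace (2 * K2 * (x * eps N - 0)) with (2 * K2 * eps N * x) by ring.
    replace (2 * K2 * hi * eps N) with (2 * K2 * eps N * hi) by ring. apply mul_le_l; nra. }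
  assert (A2 : eps N * (x * Cnorm c) <= eps N * (hi * Cnorm c)) by (apply mul_le_l; [lra|]; apply mul_le_r; auto).
  lra.
Qed.

Lemma rayK_expansion r : Xp (par a) R (box lo hi) (csm posR) r (rayK a).
Proof.
  assert (Bd := pos_bdd lo hi Hlo Hlohi).
  apply Xp_mul; [apply pos_const|apply pos_add|apply pos_mul|exact Bd|apply Xp_cf; [apply pos_const|exact Bd|apply pos_const]|].
  apply Xp_exp; [apply pos_const|apply pos_add|apply pos_mul|apply pos_exp|exact Bd|apply rayW_expansion].
Qed.

Lemma rayK_limit : exists K, forall N x, (1 <= N)%nat -> par a N -> box lo hi x ->
  Cnorm (rayK a N x - - c * Cpowz (- c) (- m - 1) * Cexp (rayW0 a x))%cx <= K * eps N.
Proof.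
  destruct rayW_limit as [K HK].
  assert (W0 : csm posR (fun x => Cexp (rayW0 a x))).
  { apply pos_exp. apply csm_sub; [apply posR_open|apply rayL_csm|].
    apply pos_add; apply pos_mul; try apply pos_const; apply (pos_of_D allR allR_pos); [apply rayf_csm|apply rayg_csm]; auto. }
  destruct (pos_bdd lo hi Hlo Hlohi _ W0) as [K0 HK0].
  set (k := (- c * Cpowz (- c) (- m - 1))%cx).
  exists (Cnorm k * (Rabs K0 * (2 * Rabs K * exp (Rabs K)))). intros N x HN Hp Hx. specialize (HK N x HN Hp Hx). specialize (HK0 x Hx).
  assert (e1 := eps_pos N HN). assert (e2 := eps_le1 N HN).
  unfold rayK. fold k. set (u := (rayW a N x - rayW0 a x)%cx) in *.
  replace (rayW a N x) with (rayW0 a x + u)%cx by (unfold u; ring). rewrite Cexp_add.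
  replace (k * (Cexp (rayW0 a x) * Cexp u) - k * Cexp (rayW0 a x))%cx with (k * (Cexp (rayW0 a x) * (Cexp u - C1)))%cx by ring.
  rewrite !Cnorm_mul, Rmult_assoc. apply mul_le_l; [apply Cnorm_nonneg|].
  rewrite Rmult_assoc. apply Rmult_le_compat; try apply Cnorm_nonneg; [eapply Rle_trans; [exact HK0|apply Rle_abs]|].
  assert (T := Cexp_taylor 1 u). simpl Csum in T.
  replace (C0 + RtoC (/ 1) * C1)%cx with C1 in T by (rewrite Rinv_1; change (RtoC 1) with C1; ring).
  le_via T.
  assert (U1 : Cnorm u <= Rabs K * eps N) by (le_via HK; apply mul_le_r; [lra|apply Rle_abs]).
  assert (U2 : Cnorm u <= Rabs K) by (generalize (Rabs_pos K); nra).
  assert (U3 : exp (Cnorm u) <= exp (Rabs K)) by (apply exp_le; auto).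
  replace (2 * Rabs K * exp (Rabs K) * eps N) with (2 * (Rabs K * eps N) * exp (Rabs K)) by ring.
  apply Rmult_le_compat; auto; [generalize (Cnorm_nonneg u); lra|left; apply exp_pos|lra].
Qed.
End Window.
End Saddle.

(** * The expansion of the saddle integral *)

Section SaddleExpansion.
Variable z0 : Cplx.
Hypothesis Hz0 : Cre z0 < 0.
Variable m : Z.
Notation c := (RtoC (/ 2) * z0)%cx.

Lemma Sm_csm M b f N : b <= 2 -> (1 <= N)%nat -> csm allR f -> csm posR (fun x => Sm M b f N x).
Proof.
  intros Hb HN Hf. assert (e1 := eps_pos N HN). unfold Sm. induction (M N) as [|n IH]; cbn [Csum]; [apply pos_const|].
  apply pos_add; [exact IH|].
  apply (csm_ext posR posR_open (fun x => f (((2 * INR (S n) - b) * eps N) * x))).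
  { intros x _. apply (f_equal f). ring. }
  apply (pos_comp_scale allR); [apply allR_open|apply allR_pos| |exact Hf].
  apply mul_pos; [|lra]. rewrite S_INR. generalize (pos_INR n). lra.
Qed.
Lemma rayK_csm a N : (1 <= N)%nat -> csm posR (rayK z0 m a N).
Proof.
  intros HN. assert (HO := posR_open). assert (e1 := eps_pos N HN).
  assert (Hi : smooth posR (fun x => x)) by (apply smooth_id; auto).
  apply pos_mul; [apply pos_const|]. apply pos_exp.
  apply pos_add; [|apply pos_mul; [apply pos_const|apply pos_mul; [apply csm_RtoC; auto|apply pos_const]]].
  apply csm_sub; auto; [apply csm_sub; auto; [apply rayL_csm|]|].
  - apply csm_sub; auto.
    + apply pos_add; apply Sm_csm; auto; try lra; [apply rayf_csm|apply rayg_csm]; auto.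
    + apply pos_mul; [apply pos_const|]. apply pos_mul.
      * apply (csm_ext posR posR_open (fun x => / RtoC (2 * x))%cx).
        { intros x Hx. rewrite RtoC_inv; auto. unfold posR in Hx. lra. }
        apply csm_inv; auto; [apply csm_RtoC; auto; apply smooth_mult; auto; apply smooth_const; auto|].
        intros x Hx. apply RtoC_neq0. unfold posR in Hx. lra.
      * apply pos_add; apply (pos_of_D allR allR_pos), csm_cprim; auto using allR_open, allR_star; [apply rayf_csm|apply rayg_csm]; auto.
  - apply pos_mul; [apply pos_const|].
    apply (csm_ext posR posR_open (fun x => rayf z0 (eps N * x))).
    { intros x _. apply (f_equal (rayf z0)). ring. }
    apply (pos_comp_scale allR); [apply allR_open|apply allR_pos|lra|apply rayf_csm; auto].
Qed.

Notation w1 := (Cexp (RtoC 1 * z0)).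
(** This is -P''(1): since P' = Q/x^2 and Q(1) = 0, the second derivative of P at 1 is Q'(1). *)
Definition saddle_c2 : Cplx := (- (RtoC (1 / 2) * (z0 * w1 / (C1 - w1))))%cx.
Hypothesis HQ1 : rayQ z0 1 = C0.
Hypothesis Hc2 : 0 < Cre saddle_c2.
Definition psi (x : R) : Cplx := (rayP z0 (1 + x)%R - rayP z0 1)%cx.
Definition saddle_F (d : R) (a N : nat) : Cplx := (RtoC (/ Gam N) * (RtoC (/ sig N) * LI psi d (fun x => rayK z0 m a N (1 + x)%R) N))%cx.
Definition saddle_a0 (a : nat) : Cplx :=
  (RtoC (/ exp (/ 2 * ln 2)) * (- c * Cpowz (- c) (- m - 1) * Cexp (rayW0 z0 m a 1) / Cexp (RtoC (/ 2) * Clog saddle_c2)))%cx.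

Lemma psi_deriv x : -1 < x -> cder psi x (rayQ z0 (1 + x) / RtoC ((1 + x) * (1 + x)))%cx.
Proof.
  intros Hx. eapply cder_val.
  - apply cder_sub; [apply cder_shift, (rayP_der_Q z0 Hz0); lra|apply cder_const].
  - ring.
Qed.
Lemma psi_csm : csm (fun x => -1 < x) psi.
Proof.
  assert (HO := open_gt (-1)). apply csm_sub; [exact HO| |apply csm_const; exact HO].
  apply (csm_shift _ posR); [exact HO|apply posR_open|apply rayP_csm; auto|]. unfold posR. intros x Hx. lra.
Qed.
Lemma psi_der1 : cD psi 0 = C0.
Proof.
  rewrite (cD_unique _ _ _ (psi_deriv 0 ltac:(lra))). rewrite Rplus_0_r, HQ1.
  replace (1 * 1) with 1 by ring. change (RtoC 1) with C1. field. apply Cre_neq0; simpl; lra.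
Qed.
Lemma psi_der2 : (- cD (cD psi) 0%R)%cx = saddle_c2.
Proof.
  unfold saddle_c2. f_equal. apply cD_unique.
  apply (cder_ext_loc (fun x => rayQ z0 (1 + x) * / RtoC ((1 + x) * (1 + x)))%cx).
  { apply filter_imp with (fun t => -1 < t); [|apply (open_gt (-1)); lra].
    intros t Ht. rewrite (cD_unique _ _ _ (psi_deriv t Ht)). reflexivity. }
  eapply cder_val.
  - apply cder_mul; [apply cder_shift, (rayQ_der z0 Hz0); lra|].
    apply cder_inv; [|apply RtoC_neq0; lra]. apply cder_RtoC.
    apply dmult; apply dplus; [apply dconst|apply did|apply dconst|apply did].
  - cbv beta. rewrite Rplus_0_r, HQ1. replace (1 * 1) with 1 by ring. change (RtoC 1) with C1.
    assert (n := one_minus_re _ (w_lt1 z0 Hz0 1 ltac:(lra))). change (RtoC 1) with C1 in n.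
    field. split; apply Cre_neq0; simpl; simpl in n; lra.
Qed.

Lemma saddle_expansion : exists e0, 0 < e0 /\ e0 <= 0.1 /\ forall d, 0 < d < e0 ->
  (forall x, - d <= x <= d -> x <> 0 -> Cre (rayP z0 (1 + x)%R) < Cre (rayP z0 1)) /\
  forall a, (a < 2)%nat -> allSq (par a) (saddle_F d a) /\
    exists K n, (1 <= n)%nat /\ forall N, (n <= N)%nat -> par a N -> Cnorm (saddle_F d a N - saddle_a0 a)%cx <= K * eps N.
Proof.
  assert (psi0 : psi 0 = C0) by (unfold psi; rewrite Rplus_0_r; ring).
  assert (HO := open_gt (-1)).
  assert (St : forall x t, -1 < x -> 0 <= t <= 1 -> -1 < t * x).
  { intros x t Hx [h0 [h1|h1]]; [assert (0 <= t * (x + 1)) by (apply mul_pos; lra); lra|rewrite h1; lra]. }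
  destruct (laplace (fun x => -1 < x) psi HO) as [e0 [He0 L]]; auto using psi_csm, psi_der1.
  { lra. } { rewrite psi_der2. exact Hc2. }
  exists (Rmin e0 0.1). split; [apply Rmin_glb_lt; lra|split; [apply Rmin_r|]]. intros d Hd.
  set (e := Rmin e0 0.1) in *. assert (E1 : e <= e0) by apply Rmin_l. assert (E2 : e <= 0.1) by apply Rmin_r.
  destruct (L e d Hd E1) as [L1 L2].
  assert (Hcsm : csm (itv e) psi).
  { apply (csm_subset (fun x => -1 < x)); [intros x Hx; apply (L1 x Hx)|apply psi_csm]. }
  assert (Hneg : forall x, itv e x -> Cre (psi x) <= 0).
  { intros x Hx. destruct (Req_dec x 0) as [->|Hn]; [rewrite psi0; simpl; lra|]. left. now apply (L1 x Hx). }
  assert (HS : forall h, csm (itv e) h -> forall Q r, Sq Q r (fun N => RtoC (/ Gam N) * LI psi d h N)%cx).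
  { intros h Hh. apply (L2 h Hh). }
  split.
  { intros x Hx Hn. destruct (L1 x) as [_ B]; [unfold itv; lra|]. unfold psi, Csub in B. cbn [Cre Cadd Copp] in B. lra. }
  intros a Ha.
  assert (HX : forall r, Xp (par a) R (fun x => - d <= x <= d) (csm (itv e)) r (fun N x => rayK z0 m a N (1 + x))).
  { intros r. apply (Xp_pullback (par a) R R (box 0.5 2) _ (csm posR) (csm (itv e)) (fun x => 1 + x)).
    - intros y Hy. unfold box. lra.
    - intros h Hh. apply (csm_shift _ posR); auto using itv_open, posR_open. unfold posR, itv. intros; lra.
    - apply rayK_expansion; auto; lra. }
  assert (HC : cc (par a) d (fun N x => rayK z0 m a N (1 + x))).
  { intros N HN _ x Hx. apply (csm_ccont (itv e)); [|unfold itv; lra].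
    apply (csm_shift _ posR); auto using itv_open, posR_open; [apply rayK_csm; auto|]. unfold posR, itv. intros; lra. }
  destruct (stirling a Ha) as [St1 [KS [nS [HnS St2]]]].
  set (G := fun N => (RtoC (/ Gam N) * LI psi d (fun x => rayK z0 m a N (1 + x)) N)%cx).
  assert (EF : forall N, saddle_F d a N = (RtoC (/ sig N) * G N)%cx) by (intros N; unfold saddle_F, G; ring).
  assert (HG : allSq (par a) G).
  { intros r. apply (LI_Xp (par a) psi e d Hd Hcsm Hneg HS r (fun N x => rayK z0 m a N (1 + x))); auto. }
  split.
  { intros r. apply (Sq_ext _ _ (fun N => RtoC (/ sig N) * G N)%cx); [exists 1%nat; split; [lia|]; intros; now rewrite EF|].
    apply Sq_mul; [apply St1|apply HG]. }
  destruct (rayK_limit z0 Hz0 m 0.5 2 ltac:(lra) ltac:(lra) a Ha) as [KK HKK].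
  set (g := fun x => (- c * Cpowz (- c) (- m - 1) * Cexp (rayW0 z0 m a (1 + x)%R))%cx).
  destruct (LI_lead (par a) psi e d Hd Hcsm Hneg HS (fun N x => rayK z0 m a N (1 + x)) g (Cexp (RtoC (/ 2) * Clog saddle_c2)) HC (par_inf a Ha) (HX 2%nat)) as [KG [nG [HnG GL]]].
  { exists KK. apply evt_all. intros N x HN HP Hx. apply HKK; auto. unfold box. lra. }
  { intros h Hh. destruct (L2 h Hh) as [_ [K HK]]. exists K. intros N HN. rewrite <- psi_der2. apply HK; auto. }
  assert (HGb : exists K n, (1 <= n)%nat /\ forall N, (n <= N)%nat -> par a N -> Cnorm (G N) <= K).
  { destruct (HG 0%nat) as [K [n [Hn B]]]. exists K, n. split; auto. intros N HN HP. exact (B N HN HP Datatypes.tt Logic.I). }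
  destruct HGb as [Kb [nb [Hnb Gb]]].
  destruct (St1 0%nat) as [Ks [ns [Hns Sb]]].
  set (q := exp (/ 2 * ln 2)) in *. assert (q0 : 0 < q) by apply exp_pos.
  exists (/ q * KG + / q * (Rabs Ks * Rabs KS * Rabs Kb)), (nG + nb + ns + nS)%nat. split; [lia|]. intros N HN HP.
  specialize (GL N ltac:(lia) HP). specialize (Gb N ltac:(lia) HP). specialize (St2 N ltac:(lia) HP).
  specialize (Sb N ltac:(lia) HP Datatypes.tt Logic.I).
  assert (sp := sig_pos N ltac:(lia)). assert (e1 := eps_pos N ltac:(lia)).
  rewrite EF. unfold g in GL. rewrite Rplus_0_r in GL.
  match type of GL with Cnorm (_ - ?t)%cx <= _ => set (T := t) in * end.
  assert (E : (RtoC (/ sig N) * G N - RtoC (/ q) * T = RtoC (/ q) * (G N - T) - RtoC (/ q) * (RtoC (/ sig N) * (RtoC (sig N) - RtoC q) * G N))%cx).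
  { rewrite !RtoC_inv by lra. field. split; apply RtoC_neq0; lra. }
  change (Cnorm (RtoC (/ sig N) * G N - RtoC (/ q) * T)%cx <= (/ q * KG + / q * (Rabs Ks * Rabs KS * Rabs Kb)) * eps N).
  rewrite E. le_via Cnorm_sub_le.
  assert (iq : 0 < / q) by (apply inv_pos; auto).
  rewrite (Cnorm_mul (RtoC (/ q)) (G N - T)%cx), (Cnorm_mul (RtoC (/ q)) (RtoC (/ sig N) * (RtoC (sig N) - RtoC q) * G N)%cx), (Cnorm_RtoC (/ q)), (Rabs_right (/ q)) by lra.
  rewrite Rmult_plus_distr_r. apply Rplus_le_compat.
  - rewrite Rmult_assoc. apply mul_le_l; [lra|exact GL].
  - rewrite Rmult_assoc. apply mul_le_l; [lra|].
    rewrite Cnorm_mul, (Cnorm_mul (RtoC (/ sig N))).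
    replace (Rabs Ks * Rabs KS * Rabs Kb * eps N) with (Rabs Ks * (Rabs KS * eps N) * Rabs Kb) by ring.
    assert (c1 := Cnorm_nonneg (RtoC (/ sig N))). assert (c2' := Cnorm_nonneg (RtoC (sig N) - RtoC q)%cx). assert (c3 := Cnorm_nonneg (G N)).
    apply Rmult_le_compat; auto; [apply mul_pos; auto| |eapply Rle_trans; [exact Gb|apply Rle_abs]].
    apply Rmult_le_compat; auto; [eapply Rle_trans; [exact Sb|apply Rle_abs]|].
    le_via St2. apply mul_le_r; [lra|apply Rle_abs].
Qed.
End SaddleExpansion.

(** * The remaining parts of the contour *)

Definition sub_exp (Q : nat -> Prop) (B : R) (f : nat -> Cplx) : Prop :=
  exists nu K p n, nu < B /\ 0 <= K /\ (1 <= n)%nat /\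
    forall N, (n <= N)%nat -> Q N -> Cnorm (f N) <= K * INR N ^ p * exp (nu * INR N).

Lemma INR_pow_mono N p q : (1 <= N)%nat -> (p <= q)%nat -> INR N ^ p <= INR N ^ q.
Proof. intros HN H. apply Rle_pow; auto. change 1 with (INR 1). apply le_INR; auto. Qed.

Lemma sub_exp_add Q B f g : sub_exp Q B f -> sub_exp Q B g -> sub_exp Q B (fun N => f N + g N)%cx.
Proof.
  intros (n1 & K1 & p1 & N1 & H1 & H2 & H3 & H4) (n2 & K2 & p2 & N2 & G1 & G2 & G3 & G4).
  exists (Rmax n1 n2), (K1 + K2), (p1 + p2)%nat, (N1 + N2)%nat.
  split; [apply Rmax_lub_lt; auto|split; [lra|split; [lia|]]]. intros N HN HQ.
  assert (Np := pos_INR N).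
  le_via Cnorm_triang. rewrite !Rmult_plus_distr_r. apply Rplus_le_compat.
  - eapply Rle_trans; [apply H4; auto; lia|]. apply Rmult_le_compat; [apply mul_pos; [auto|apply pow_le; auto]|left; apply exp_pos| |].
    + apply mul_le_l; auto. apply INR_pow_mono; lia.
    + apply exp_le, mul_le_r; auto. apply Rmax_l.
  - eapply Rle_trans; [apply G4; auto; lia|]. apply Rmult_le_compat; [apply mul_pos; [auto|apply pow_le; auto]|left; apply exp_pos| |].
    + apply mul_le_l; auto. apply INR_pow_mono; lia.
    + apply exp_le, mul_le_r; auto. apply Rmax_r.
Qed.

(** A lower bound of order 1/N makes negative powers polynomially bounded in N, which the
    exponential margins absorb. *)
Lemma Cpowz_bound k c C : 0 < c -> exists K p, 0 <= K /\ forall N z, (1 <= N)%nat -> c * eps N <= Cnorm z -> Cnorm z <= C ->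
  Cnorm (Cpowz z k) <= K * INR N ^ p.
Proof.
  intros Hc. destruct k as [|q|q].
  - exists 1, 0%nat. split; [lra|]. intros. simpl. rewrite Cnorm_1. lra.
  - exists (Rabs C ^ Pos.to_nat q), 0%nat. split; [apply pow_le, Rabs_pos|]. intros N z HN H1 H2. simpl Cpowz.
    rewrite Cnorm_pown. rewrite Rmult_1_r. apply pow_incr. split; [apply Cnorm_nonneg|].
    eapply Rle_trans; [exact H2|apply Rle_abs].
  - exists ((/ c) ^ Pos.to_nat q), (Pos.to_nat q). split; [apply pow_le; left; apply inv_pos; auto|].
    intros N z HN H1 H2. simpl Cpowz. assert (e1 := eps_pos N HN). assert (ce : 0 < c * eps N) by nra.
    assert (zn : z <> C0) by (intros E; rewrite E, Cnorm_0 in H1; lra).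
    rewrite Cnorm_inv, Cnorm_pown by (apply Cpown_neq0; auto). rewrite <- pow_inv, <- Rpow_mult_distr.
    apply pow_incr. split; [left; apply inv_pos; lra|].
    replace (/ c * INR N) with (/ (c * eps N)) by (unfold eps; field; split; [lra|apply not_0_INR; lia]).
    apply inv_le; auto.
Qed.

Lemma integrand_bound m c C : 0 < c -> exists K p, 0 <= K /\ forall N s, (1 <= N)%nat ->
  c * eps N <= Cnorm (tt s) -> Cnorm (tt s) <= C -> 0 < Cnorm (qpoch N (- Cexp s)%cx) ->
  Cnorm (integrand m N s) <= K * INR N ^ p * / Cnorm (qpoch N (- Cexp s)%cx).
Proof.
  intros Hc. destruct (Cpowz_bound (- m - 1) c C Hc) as [K [p [HK H]]].
  exists (K * (Rabs C + 1)), p. assert (C0' := Rabs_pos C). split; [nra|]. intros N s HN H1 H2 H3.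
  unfold integrand. assert (qn : qpoch N (- Cexp s)%cx <> C0) by (intros E; rewrite E, Cnorm_0 in H3; lra).
  rewrite !Cnorm_mul, Cnorm_inv by auto.
  assert (E : Cnorm (- Cexp s)%cx <= Rabs C + 1).
  { replace (- Cexp s)%cx with (tt s - C1)%cx by (unfold tt; ring). le_via Cnorm_sub_le.
    rewrite Cnorm_1. generalize (Rle_abs C). lra. }
  assert (i : 0 < / Cnorm (qpoch N (- Cexp s)%cx)) by (apply inv_pos; auto).
  rewrite Rmult_assoc, Rmult_comm. apply mul_le_r; [lra|].
  replace (K * (Rabs C + 1) * INR N ^ p) with (K * INR N ^ p * (Rabs C + 1)) by ring.
  apply Rmult_le_compat; auto; apply Cnorm_nonneg.
Qed.

Lemma seg_small m (a b : nat -> Cplx) n0 L C c mu K B Q : 0 < c -> (1 <= n0)%nat -> 0 <= K -> mu < B ->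
  (forall N, (n0 <= N)%nat -> Cnorm (b N - a N)%cx <= L) ->
  (forall N u, (n0 <= N)%nat -> 0 <= u <= 1 -> let s := lin (a N) (b N - a N)%cx u in
     slit N s /\ c * eps N <= Cnorm (tt s) /\ Cnorm (tt s) <= C /\ exp (- (mu * INR N)) <= K * Cnorm (qpoch N (- Cexp s)%cx)) ->
  sub_exp Q B (fun N => seg (integrand m N) (a N) (b N)).
Proof.
  intros Hc Hn0 HK HB HL H.
  destruct (integrand_bound m c C Hc) as [K1 [p [HK1 G]]].
  exists mu, (2 * (K1 * K * Rabs L)), p, n0. assert (L0 := Rabs_pos L).
  split; [auto|split; [|split; [auto|]]].
  { apply mul_pos; [lra|]. apply mul_pos; [nra|auto]. }
  intros N HN _. specialize (HL N HN). assert (HN1 : (1 <= N)%nat) by lia.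
  assert (e1 := eps_pos N HN1).
  set (M := K1 * INR N ^ p * (K * exp (mu * INR N)) * Rabs L).
  replace (2 * (K1 * K * Rabs L) * INR N ^ p * exp (mu * INR N)) with (2 * M * (1 - 0)) by (unfold M; ring).
  assert (S0 : forall s, c * eps N <= Cnorm (tt s) -> s <> C0).
  { intros s Hs E. rewrite E in Hs. unfold tt in Hs. rewrite Cexp_0 in Hs. replace (C1 - C1)%cx with C0 in Hs by ring.
    rewrite Cnorm_0 in Hs. nra. }
  apply CInt_bound; [lra| |].
  - apply ex_CInt_cont. intros u Hu. minmax Hu.
    destruct (H N u HN Hu) as (A1 & A2 & A3 & A4).
    apply ccont_mul; [|apply ccont_const]. apply (integrand_ccont m N _ u (b N - a N)%cx); auto. apply cder_lin.
  - intros u Hu. destruct (H N u HN Hu) as (A1 & A2 & A3 & A4). set (s := lin (a N) (b N - a N)%cx u) in *.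
    assert (ep := exp_pos (- (mu * INR N))). assert (qn := Cnorm_nonneg (qpoch N (- Cexp s)%cx)).
    assert (q0 : 0 < Cnorm (qpoch N (- Cexp s)%cx)) by (destruct qn as [h|h]; [auto|rewrite <- h in A4; lra]).
    specialize (G N s HN1 A2 A3 q0).
    rewrite Cnorm_mul. apply Rmult_le_compat; try apply Cnorm_nonneg; [|eapply Rle_trans; [exact HL|apply Rle_abs]].
    le_via G. apply mul_le_l; [apply mul_pos; [auto|apply pow_le, pos_INR]|].
    assert (e2 := exp_pos (mu * INR N)).
    apply Rmult_le_reg_r with (Cnorm (qpoch N (- Cexp s)%cx)); auto. rewrite Rinv_l by lra.
    replace 1 with (exp (mu * INR N) * exp (- (mu * INR N))) by (rewrite <- exp_plus, <- exp_0; f_equal; ring).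
    rewrite (Rmult_comm K), Rmult_assoc. apply mul_le_l; lra.
Qed.

Lemma cos_ge x : 1 - x * x / 2 <= cos x.
Proof.
  assert (E : cos x = 1 - 2 * sin (x / 2) * sin (x / 2)) by (rewrite <- cos_2a_sin; f_equal; field).
  assert (S : forall y, 0 <= y -> sin y * sin y <= y * y).
  { intros y Hy. destruct (Rle_dec y 1) as [h|h].
    - assert (0 <= sin y) by (apply sin_ge_0; generalize PI_bounds; lra).
      assert (sin y <= y) by (destruct Hy as [hy|hy]; [left; apply sin_lt_x; auto|rewrite <- hy, sin_0; lra]). nra.
    - generalize (SIN_bound y). nra. }
  assert (B : sin (x / 2) * sin (x / 2) <= x / 2 * (x / 2)).
  { destruct (Rle_dec 0 (x / 2)) as [h|h]; [apply S; auto|].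
    assert (T := S (- (x / 2)) ltac:(lra)). rewrite sin_neg in T. nra. }
  nra.
Qed.
Lemma sin_ge_half x : 0 <= x <= 1 -> x / 2 <= sin x.
Proof.
  intros Hx.
  assert (B := mono_of_der (fun t => sin t - t / 2) (fun t => cos t - / 2) 0 x ltac:(lra)). cbv beta in B.
  rewrite sin_0 in B. enough (0 - 0 / 2 <= sin x - x / 2) by lra. apply B.
  - intros t Ht. apply dminus; [apply is_derive_Reals, derivable_pt_lim_sin|].
    eapply is_derive_val; [apply dmult; [apply did|apply dconst]|cbv beta; ring].
  - intros t Ht. assert (C := cos_ge t). nra.
Qed.
Lemma ln2_ge : 0.69 <= ln 2.
Proof.
  assert (H : / 2 < exp (- (0.69))).
  { replace (- (0.69)) with (INR 3 * (- (0.23))) by (simpl; lra). rewrite <- exp_pow_nat.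
    assert (h : 0.7944 <= exp (- (0.23))) by (eapply Rle_trans; [|apply exp_neg_ge_taylor3; lra]; lra).
    apply Rlt_le_trans with (0.7944 ^ 3); [lra|apply pow_incr; lra]. }
  apply ln_increasing in H; [|lra]. rewrite ln_exp, ln_Rinv in H by lra. lra.
Qed.

Lemma tt_lower_re s : Rabs (Cre s) <= 1 -> Rabs (Cre s) / 2 <= Cnorm (tt s).
Proof.
  intros H. unfold tt. unfold Rabs in *. destruct (Rcase_abs (Cre s)).
  - assert (B := Cnorm_sub_ge C1 (Cexp s)). rewrite Cnorm_1, Cnorm_exp in B.
    assert (T := exp_neg_ge_taylor3 (- Cre s) ltac:(lra)).
    assert (U := exp_ineq1_le (- Cre s)).
    assert (E : exp (Cre s) * exp (- Cre s) = 1) by (rewrite <- exp_plus, <- exp_0; f_equal; ring).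
    assert (p := exp_pos (Cre s)). set (x := - Cre s) in *. set (e := exp (Cre s)) in *.
    assert (e * (1 + x) <= 1) by nra.
    apply Rnot_lt_le. intros Hc. assert (Hx : 0 < x <= 1) by (unfold x in *; lra).
    nra.
  - assert (B := Cnorm_sub_ge (Cexp s) C1). rewrite Cnorm_1, Cnorm_exp, Cnorm_sub_sym in B.
    generalize (exp_ineq1_le (Cre s)). lra.
Qed.
Lemma tt_lower_im s : 0 <= Cim s <= 1 -> Cim s / 2 <= Cnorm (tt s).
Proof.
  intros H. assert (Sg := sin_ge_half _ H).
  apply Rnot_lt_le. intros Hc.
  assert (N2 : Cnorm2 (tt s) < Cim s / 2 * (Cim s / 2)) by (rewrite <- Cnorm_sqr; generalize (Cnorm_nonneg (tt s)); nra).
  assert (E : Cnorm2 (tt s) = (exp (Cre s) - cos (Cim s)) * (exp (Cre s) - cos (Cim s)) + sin (Cim s) * sin (Cim s)).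
  { assert (S := sin2_cos2 (Cim s)). unfold Rsqr in S. unfold tt, Cnorm2. simpl.
    set (e := exp (Cre s)). set (k := cos (Cim s)) in *. set (d := sin (Cim s)) in *.
    transitivity (1 - 2 * e * k + e * e * (d * d + k * k)); [ring|].
    transitivity (d * d + k * k - 2 * e * k + e * e); [rewrite S; ring|ring]. }
  assert (0 <= (exp (Cre s) - cos (Cim s)) * (exp (Cre s) - cos (Cim s))) by apply Rle_0_sqr. nra.
Qed.
Lemma tt_upper s X : Cre s <= X -> Cnorm (tt s) <= 1 + exp X.
Proof.
  intros H. le_via Cnorm_sub_le. rewrite Cnorm_1, Cnorm_exp. generalize (exp_le _ _ H). lra.
Qed.

Lemma seg_ray F z a b : a <= b -> (forall r, a <= r <= b -> ccont (fun r => F (RtoC r * z) * z)%cx r) ->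
  seg F (RtoC a * z)%cx (RtoC b * z)%cx = CInt (fun r => F (RtoC r * z) * z)%cx a b.
Proof.
  intros Hab Hc. set (G := fun r => (F (RtoC r * z) * z)%cx).
  assert (Ex : ex_CInt G a b) by (apply ex_CInt_cont; intros x Hx; minmax Hx; apply Hc, Hx).
  assert (T : forall g : Cplx -> R, (forall k w, g (w * (RtoC k * z))%cx = k * g (w * z)%cx) -> ex_RInt (fun r => g (G r)) a b ->
    RInt (fun u => g (F (lin (RtoC a * z) (RtoC b * z - RtoC a * z) u) * (RtoC b * z - RtoC a * z))%cx) 0 1 = RInt (fun r => g (G r)) a b).
  { intros g Hg Hex.
    assert (E := RInt_comp_lin (V := RV) (fun r => g (G r)) (b - a) a 0 1).
    replace ((b - a) * 0 + a) with a in E by ring. replace ((b - a) * 1 + a) with b in E by ring.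
    rewrite <- (E Hex). apply RInt_ext. intros u _.
    replace (RtoC b * z - RtoC a * z)%cx with (RtoC (b - a) * z)%cx by (unfold Rminus; rewrite RtoC_add, RtoC_opp; ring).
    rewrite Hg. unfold lin. replace (RtoC a * z + RtoC u * (RtoC (b - a) * z))%cx with (RtoC ((b - a) * u + a) * z)%cx by (rewrite RtoC_add, RtoC_mul; ring).
    reflexivity. }
  destruct Ex as [e1 e2]. apply cx_eq; simpl.
  - apply (T Cre); auto. intros; simpl; ring.
  - apply (T Cim); auto. intros; simpl; ring.
Qed.

Lemma lin_re a b u : Cre (lin a (b - a)%cx u) = Cre a + u * (Cre b - Cre a).
Proof. simpl. ring. Qed.
Lemma lin_im a b u : Cim (lin a (b - a)%cx u) = Cim a + u * (Cim b - Cim a).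
Proof. simpl. ring. Qed.

Lemma tt_re s : Cre (tt s) = 1 - exp (Cre s) * cos (Cim s).
Proof. reflexivity. Qed.
Lemma tt_im s : Cim (tt s) = - (exp (Cre s) * sin (Cim s)).
Proof. simpl. ring. Qed.

Section Path.
Variable z0 : Cplx.
Hypothesis Hre : - 1.61 <= Cre z0 <= - 1.6.
Hypothesis Him : 7.42 <= Cim z0 <= 7.43.
Variable m : Z.
Notation c := (RtoC (/ 2) * z0)%cx.
(* Large enough for the vertical sides, where [1/(q)_N] is at most [exp (2 sqrt 2 N / sqrt X)]. *)
Definition X : R := 10000.
(** In the variable z = 2 N s the corners are X, X + 3 PI i/2, rho1 z0, rho2 z0 and -X. Thus rho1
    marks where the ray meets Im z = 3 PI/2, and rho2 where it meets Re z = -X. *)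
Definition rho1 : R := 3 * PI / 2 / Cim z0.
Definition rho2 : R := X / - Cre z0.
Definition pt0 (N : nat) : Cplx := RtoC (eps N / 2 * X).
Definition pt1 (N : nat) : Cplx := mkC (eps N / 2 * X) (eps N / 2 * (3 * PI / 2)).
Definition pt2 (N : nat) : Cplx := (RtoC rho1 * (RtoC (eps N) * c))%cx.
Definition pt3 (N : nat) : Cplx := (RtoC rho2 * (RtoC (eps N) * c))%cx.
Definition pt4 (N : nat) : Cplx := RtoC (- (eps N / 2 * X)).

Lemma rho1_bounds : 0.63 <= rho1 <= 0.636.
Proof.
  assert (P := PI_bounds). unfold rho1. split.
  - apply Rmult_le_reg_r with (Cim z0); [lra|]. replace (3 * PI / 2 / Cim z0 * Cim z0) with (3 * PI / 2) by (field; lra). nra.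
  - apply Rmult_le_reg_r with (Cim z0); [lra|]. replace (3 * PI / 2 / Cim z0 * Cim z0) with (3 * PI / 2) by (field; lra). nra.
Qed.
Lemma rho2_bounds : 2 <= rho2 <= 6250.
Proof.
  unfold rho2, X. split.
  - apply Rmult_le_reg_r with (- Cre z0); [lra|]. replace (10000 / - Cre z0 * - Cre z0) with 10000 by (field; lra). nra.
  - apply Rmult_le_reg_r with (- Cre z0); [lra|]. replace (10000 / - Cre z0 * - Cre z0) with 10000 by (field; lra). nra.
Qed.
Lemma ray_re r N : Cre (RtoC r * (RtoC (eps N) * c))%cx = r * eps N / 2 * Cre z0.
Proof. simpl. field. Qed.
Lemma ray_im r N : Cim (RtoC r * (RtoC (eps N) * c))%cx = r * eps N / 2 * Cim z0.
Proof. simpl. field. Qed.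
Lemma pt2_re N : Cre (pt2 N) = eps N / 2 * (rho1 * Cre z0).
Proof. unfold pt2. rewrite ray_re. field. Qed.
Lemma pt2_im N : Cim (pt2 N) = eps N / 2 * (3 * PI / 2).
Proof. unfold pt2. rewrite ray_im. unfold rho1. field. lra. Qed.
Lemma pt3_re N : Cre (pt3 N) = - (eps N / 2 * X).
Proof. unfold pt3. rewrite ray_re. unfold rho2. field. lra. Qed.
Lemma pt3_im N : Cim (pt3 N) = eps N / 2 * (rho2 * Cim z0).
Proof. unfold pt3. rewrite ray_im. field. Qed.

Variable n0 : nat.
Hypothesis Hn0 : (1 <= n0)%nat.
Hypothesis Hn0e : forall N, (n0 <= N)%nat -> eps N < 0.00001.

Lemma eps_facts N : (n0 <= N)%nat -> (1 <= N)%nat /\ 0 < eps N < 0.00001 /\ INR N * eps N = 1 /\ 100000 <= INR N /\ PI / INR N = PI * eps N.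
Proof.
  intros HN. assert (H1 : (1 <= N)%nat) by lia. assert (e1 := eps_pos N H1). assert (e2 := Hn0e N HN). assert (e3 := eps_INR N H1).
  repeat split; auto. nra.
Qed.

(** Here h = 5000/N, so the exponent 2 sqrt N/sqrt h of [qpoch_vertical] is 2 N/sqrt 5000, about
    0.0283 N. *)
Lemma vertical_small N s : (n0 <= N)%nat -> Rabs (Cre s) = eps N / 2 * X ->
  slit N s /\ 1 * eps N <= Cnorm (tt s) /\ Cnorm (tt s) <= 1 + exp 1 /\ exp (- (0.03 * INR N)) <= 1 * Cnorm (qpoch N (- Cexp s)%cx).
Proof.
  intros HN Hs. destruct (eps_facts N HN) as (H1 & He & HNe & HNb & _). unfold X in *.
  split; [|split; [|split]].
  - left. intros E. rewrite E, Rabs_R0 in Hs. lra.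
  - eapply Rle_trans; [|apply tt_lower_re; lra]. lra.
  - apply tt_upper. generalize (Rle_abs (Cre s)). lra.
  - rewrite Rmult_1_l. eapply Rle_trans; [|apply (qpoch_vertical N s (eps N / 2 * 10000)); [lra|exact Hs]].
    apply exp_le. set (h := eps N / 2 * 10000) in *. assert (Hh : 0 < h) by (unfold h; lra).
    set (a := sqrt (INR N)). set (b := sqrt h).
    assert (a0 : 0 < a) by (apply sqrt_lt_R0; lra). assert (b0 : 0 < b) by (apply sqrt_lt_R0; auto).
    assert (a2 : a * a = INR N) by (apply sqrt_sqrt; lra). assert (b2 : b * b = h) by (apply sqrt_sqrt; lra).
    assert (ab2 : (a * b) * (a * b) = 5000).
    { replace (a * b * (a * b)) with ((a * a) * (b * b)) by ring. rewrite a2, b2. unfold h. nra. }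
    assert (ab0 : 0 < a * b) by (apply mul_lt_pos; auto).
    assert (2 * a * / b <= 0.03 * INR N); [|lra].
    apply Rmult_le_reg_r with (a * b); [nra|]. replace (2 * a * / b * (a * b)) with (2 * (a * a)) by (field; lra). nra.
Qed.

Lemma seg01_small Q : sub_exp Q 0.0335 (fun N => seg (integrand m N) (pt0 N) (pt1 N)).
Proof.
  assert (P := PI_bounds).
  apply (seg_small m pt0 pt1 n0 5 (1 + exp 1) 1 0.03 1); auto; try lra.
  - intros N HN. destruct (eps_facts N HN) as (H1 & He & _). le_via Cnorm_le_sum. simpl.
    rewrite Rplus_opp_r, Rabs_R0, Rabs_right by nra. nra.
  - intros N u HN Hu s. apply vertical_small; auto. unfold s. simpl.
    destruct (eps_facts N HN) as (H1 & He & _). unfold X. rewrite Rabs_right; nra.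
Qed.
Lemma seg34_small Q : sub_exp Q 0.0335 (fun N => seg (integrand m N) (pt3 N) (pt4 N)).
Proof.
  assert (R2 := rho2_bounds).
  apply (seg_small m pt3 pt4 n0 1 (1 + exp 1) 1 0.03 1); auto; try lra.
  - intros N HN. destruct (eps_facts N HN) as (H1 & He & _). le_via Cnorm_le_sum.
    unfold Csub. cbn [Cre Cim Cadd Copp]. rewrite pt3_re, pt3_im. simpl.
    rewrite Rplus_opp_r, Rabs_R0, !Rplus_0_l, Rabs_Ropp, Rabs_right; [|apply Rle_ge; apply mul_pos; nra].
    assert (rho2 * Cim z0 <= 50000) by nra. nra.
  - intros N u HN Hu s. apply vertical_small; auto. unfold s. rewrite lin_re, pt3_re. simpl.
    destruct (eps_facts N HN) as (H1 & He & _). unfold X. rewrite Rabs_left1; nra.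
Qed.

(** Up to constants the rate is -t/8 + ln 2/8 + w/4.2, the last term coming from the gain of the
    even factors. At t = 1.03 the first two terms alone give about -0.042, which would lose against
    the saddle; with the gain the rate stays above -0.0325. *)
Lemma horizontal_exponent N t w : (n0 <= N)%nat -> 0 <= t <= 1.03 -> w = (t / (3 * PI / 2)) * (t / (3 * PI / 2)) ->
  exp (- (0.0325 * INR N)) <= exp 4 * (/ 2 * exp (- (INR N * (INR N + 1) * (eps N / 2 * t) / 4) - INR N * (eps N / 2 * t) / 2)
     * sqrt (1 + w) ^ (N / 2) * exp ((INR N / 8 - 7 / 8) * ln 2)).
Proof.
  intros HN Ht Hw. destruct (eps_facts N HN) as (H1 & He & HNe & HNb & _). assert (P := PI_bounds).
  set (q := t / (3 * PI / 2)) in *. assert (Hq : q * (3 * PI / 2) = t) by (unfold q; field; lra).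
  assert (q2 : t <= 4.713 * q) by nra.
  assert (w0 : 0 <= w <= 0.0479) by (rewrite Hw; nra).
  assert (L := ln2_ge).
  assert (L2 : ln 2 <= 1).
  { rewrite <- (ln_exp 1). left. apply ln_increasing; [lra|]. assert (T := exp_ge_taylor4 1 ltac:(lra)). lra. }
  assert (HW : exp (w / 2.1) <= sqrt (1 + w)).
  { rewrite <- (sqrt_square (exp (w / 2.1))) by (left; apply exp_pos). apply sqrt_le_1_alt.
    rewrite <- exp_plus. replace (w / 2.1 + w / 2.1) with (- (- (w / 1.05))) by lra.
    apply exp_le_inv; [lra|]. le_to exp_ineq1_le.
    apply Rmult_le_reg_r with (1 + w); [lra|]. rewrite Rinv_l by lra. nra. }
  assert (HWM : exp (w / 4.2 * (INR N - 1)) <= sqrt (1 + w) ^ (N / 2)).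
  { apply Rle_trans with (exp (w / 2.1) ^ (N / 2)).
    - rewrite exp_pow_nat. apply exp_le.
      assert (E1 := Nat.div_mod_eq N 2). assert (B1 := Nat.mod_upper_bound N 2 ltac:(lia)).
      assert (HM : INR N <= 2 * INR (N / 2) + 1) by (rewrite <- (mult_INR 2), <- S_INR; apply le_INR; lia). nra.
    - apply pow_incr. split; [left; apply exp_pos|auto]. }
  assert (Hhalf : exp (- 1) <= / 2).
  { replace (- 1) with (- (1)) by ring. apply exp_le_inv; [lra|]. assert (T := exp_ge_taylor4 1 ltac:(lra)). lra. }
  set (eA := exp (- (INR N * (INR N + 1) * (eps N / 2 * t) / 4) - INR N * (eps N / 2 * t) / 2)).
  set (eB := exp ((INR N / 8 - 7 / 8) * ln 2)).
  assert (eA0 : 0 < eA) by apply exp_pos. assert (eB0 : 0 < eB) by apply exp_pos.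
  apply Rle_trans with (exp 4 * (exp (- 1) * eA * exp (w / 4.2 * (INR N - 1)) * eB)).
  - unfold eA, eB. rewrite <- !exp_plus. apply exp_le.
    replace (INR N * (INR N + 1) * (eps N / 2 * t) / 4) with ((INR N * eps N) * (INR N + 1) * t / 8) by field.
    replace (INR N * (eps N / 2 * t) / 2) with ((INR N * eps N) * t / 4) by field. rewrite HNe.
    assert (K1 : - t / 8 + w / 4.2 + ln 2 / 8 >= - 0.0325) by nra.
    assert (K2 : INR N * (- t / 8 + w / 4.2 + ln 2 / 8) >= INR N * - 0.0325) by (apply Rle_ge, mul_le_l; lra).
    lra.
  - apply mul_le_l; [left; apply exp_pos|]. apply mul_le_r; [lra|].
    apply Rmult_le_compat; [apply mul_pos; [left; apply exp_pos|lra]|left; apply exp_pos| |auto].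
    apply mul_le_r; lra.
Qed.

Lemma seg12_small Q : sub_exp Q 0.0335 (fun N => seg (integrand m N) (pt1 N) (pt2 N)).
Proof.
  assert (P := PI_bounds). assert (R1 := rho1_bounds).
  assert (Hx1 : 0 <= - (rho1 * Cre z0) <= 1.03) by nra.
  apply (seg_small m pt1 pt2 n0 1 (1 + exp 1) 1 0.0325 (exp 4)); auto; try lra.
  - left; apply exp_pos.
  - intros N HN. destruct (eps_facts N HN) as (H1 & He & _). le_via Cnorm_le_sum.
    unfold Csub. cbn [Cre Cim Cadd Copp]. rewrite pt2_re, pt2_im. simpl. unfold X.
    rewrite Rplus_opp_r, Rabs_R0, Rplus_0_r, Rabs_left1; nra.
  - intros N u HN Hu s. destruct (eps_facts N HN) as (H1 & He & HNe & HNb & HPI).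
    assert (Sim : Cim s = eps N / 2 * (3 * PI / 2)) by (unfold s; rewrite lin_im, pt2_im; unfold pt1; simpl; ring).
    assert (Sre : Cre s = eps N / 2 * (X + u * (rho1 * Cre z0 - X))) by (unfold s; rewrite lin_re, pt2_re; unfold pt1; simpl; ring).
    assert (Sim2 : eps N * 2 <= Cim s <= 0.0001) by (rewrite Sim; nra).
    split; [|split; [|split]].
    + right. rewrite HPI, Rabs_right by lra. nra.
    + eapply Rle_trans; [|apply tt_lower_im; lra]. lra.
    + apply tt_upper. rewrite Sre. unfold X.
      assert (10000 + u * (rho1 * Cre z0 - 10000) <= 10000) by nra. nra.
    (* On the part of the side with Re s >= 0 the estimate is used with t = 0. *)
    + set (t := Rmax 0 (- (X + u * (rho1 * Cre z0 - X)))).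
      assert (Ht : 0 <= t <= 1.03).
      { split; [apply Rmax_l|]. apply Rmax_lub; [lra|]. unfold X. nra. }
      assert (Hcase : Cre s = - (eps N / 2 * t) \/ (eps N / 2 * t = 0 /\ 0 <= Cre s)).
      { unfold t, Rmax. destruct (Rle_dec 0 (- (X + u * (rho1 * Cre z0 - X)))) as [h|h]; [left|right].
        - rewrite Sre. ring.
        - split; [ring|]. rewrite Sre. apply mul_pos; lra. }
      set (w := (t / (3 * PI / 2)) * (t / (3 * PI / 2))).
      eapply Rle_trans; [apply (horizontal_exponent N t w HN Ht eq_refl)|].
      apply mul_le_l; [left; apply exp_pos|].
      apply (qpoch_horizontal N s (eps N / 2 * t) (sqrt (1 + w))); auto.
      * apply INR_le. simpl. lra.
      * apply mul_pos; lra.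
      * rewrite Sim. unfold eps. field. lra.
      * apply sqrt_pos.
      * rewrite sqrt_sqrt by (unfold w; assert (0 <= (t / (3 * PI / 2)) * (t / (3 * PI / 2))) by apply Rle_0_sqr; lra).
        rewrite Sim. unfold w. f_equal. field. split; lra.
Qed.

Lemma path_conditions N : (n0 <= N)%nat ->
  (forall u, 0 <= u <= 1 -> slit N (lin (pt0 N) (pt1 N - pt0 N) u) /\ Cre (tt (lin (pt0 N) (pt1 N - pt0 N) u)) < 0) /\
  (forall u, 0 <= u <= 1 -> slit N (lin (pt1 N) (pt2 N - pt1 N) u) /\ Cim (tt (lin (pt1 N) (pt2 N - pt1 N) u)) < 0) /\
  (forall u, 0 <= u <= 1 -> slit N (lin (pt2 N) (pt3 N - pt2 N) u) /\ Cim (tt (lin (pt2 N) (pt3 N - pt2 N) u)) < 0) /\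
  (forall u, 0 <= u <= 1 -> slit N (lin (pt3 N) (pt4 N - pt3 N) u) /\ 0 < Cre (tt (lin (pt3 N) (pt4 N - pt3 N) u))).
Proof.
  intros HN. destruct (eps_facts N HN) as (H1 & He & HNe & HNb & HPI). assert (P := PI_bounds).
  assert (R1 := rho1_bounds). assert (R2 := rho2_bounds).
  split; [|split; [|split]]; intros u Hu.
  - set (s := lin (pt0 N) (pt1 N - pt0 N)%cx u).
    assert (Sre : Cre s = eps N / 2 * X) by (unfold s; rewrite lin_re; unfold pt0, pt1; simpl; ring).
    assert (Sim : Cim s = eps N / 2 * (u * (3 * PI / 2))) by (unfold s; rewrite lin_im; unfold pt0, pt1; simpl; ring).
    split; [left; rewrite Sre; unfold X; lra|].
    rewrite tt_re. assert (E := exp_ineq1_le (Cre s)). assert (C := cos_ge (Cim s)). rewrite Sre in *. unfold X in *.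
    assert (Hu2 : 0 <= u * (3 * PI / 2) <= 6) by nra.
    assert (0 <= Cim s <= eps N * 3) by (rewrite Sim; nra).
    set (e := exp (eps N / 2 * 10000)) in *. set (k := cos (Cim s)) in *.
    assert (Q1 : Cim s * Cim s / 2 <= eps N) by nra.
    assert (1 < e * k); [|lra].
    apply Rlt_le_trans with ((1 + eps N / 2 * 10000) * (1 - eps N)); [nra|]. apply Rmult_le_compat; lra.
  - set (s := lin (pt1 N) (pt2 N - pt1 N)%cx u).
    assert (Sim : Cim s = eps N / 2 * (3 * PI / 2)) by (unfold s; rewrite lin_im, pt2_im; unfold pt1; simpl; ring).
    assert (0 < Cim s <= 0.0001) by (rewrite Sim; nra).
    split; [right; rewrite HPI, Rabs_right by lra; rewrite Sim; nra|].
    rewrite tt_im. assert (0 < sin (Cim s)) by (apply sin_gt_0; lra).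
    assert (E := exp_pos (Cre s)). assert (0 < exp (Cre s) * sin (Cim s)) by (apply mul_lt_pos; auto). lra.
  - set (s := lin (pt2 N) (pt3 N - pt2 N)%cx u). set (r := rho1 + u * (rho2 - rho1)).
    assert (Hr : 0.63 <= r <= 6250) by (unfold r; nra).
    assert (Sre : Cre s = r * eps N / 2 * Cre z0) by (unfold s, r; rewrite lin_re; unfold pt2, pt3; rewrite !ray_re; field).
    assert (Sim : Cim s = r * eps N / 2 * Cim z0) by (unfold s, r; rewrite lin_im; unfold pt2, pt3; rewrite !ray_im; field).
    assert (re1 : 0 < r * eps N <= 0.0625) by nra.
    split; [left; rewrite Sre; nra|].
    assert (0 < Cim s <= 1) by (rewrite Sim; nra).
    rewrite tt_im. assert (0 < sin (Cim s)) by (apply sin_gt_0; lra).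
    assert (E := exp_pos (Cre s)). assert (0 < exp (Cre s) * sin (Cim s)) by (apply mul_lt_pos; auto). lra.
  - set (s := lin (pt3 N) (pt4 N - pt3 N)%cx u).
    assert (Sre : Cre s = - (eps N / 2 * X)) by (unfold s; rewrite lin_re, pt3_re; unfold pt4; simpl; ring).
    split; [left; rewrite Sre; unfold X; lra|].
    rewrite tt_re. assert (E : exp (Cre s) < 1) by (rewrite <- exp_0; apply exp_increasing; rewrite Sre; unfold X; lra).
    assert (E0 := exp_pos (Cre s)). assert (C := COS_bound (Cim s)). nra.
Qed.

End Path.

Lemma CInt_shift f d : ex_CInt f (1 - d) (1 + d) -> CInt f (1 - d) (1 + d) = CInt (fun x => f (1 + x)) (- d) d.
Proof.
  intros [e1 e2].
  assert (T : forall g : R -> R, ex_RInt g (1 - d) (1 + d) -> RInt g (1 - d) (1 + d) = RInt (fun x => g (1 + x)) (- d) d).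
  { intros g Hg. assert (E := RInt_comp_lin (V := RV) g 1 1 (- d) d).
    replace (1 * - d + 1) with (1 - d) in E by ring. replace (1 * d + 1) with (1 + d) in E by ring.
    rewrite <- (E Hg). apply RInt_ext. intros x _. rewrite (Rplus_comm 1 x).
    match goal with |- ?p = ?q => change (@eq R p q) end.
    rewrite !Rmult_1_l. reflexivity. }
  apply cx_eq; simpl; apply T; auto.
Qed.

(** * The integral along the ray *)

Section RayParts.
Variable z0 : Cplx.
Hypothesis Hz0 : Cre z0 < 0.
Variable m : Z.
Notation c := (RtoC (/ 2) * z0)%cx.
Definition rint (N : nat) (r : R) : Cplx := (integrand m N (RtoC r * (RtoC (eps N) * c)) * (RtoC (eps N) * c))%cx.

Lemma rint_ccont N r : (1 <= N)%nat -> 0 < r -> ccont (rint N) r.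
Proof.
  intros HN Hr. assert (e1 := eps_pos N HN). apply ccont_mul; [|apply ccont_const].
  assert (Hn : Cre (RtoC r * (RtoC (eps N) * c))%cx <> 0).
  { rewrite ray_re. assert (0 < r * eps N / 2 * - Cre z0) by (apply mul_lt_pos; nra). lra. }
  apply (integrand_ccont m N (fun r => RtoC r * (RtoC (eps N) * c))%cx r (RtoC (eps N) * c)%cx); auto.
  - eapply cder_val; [apply cder_mul; [apply cder_id|apply cder_const]|cbv beta; ring].
  - left. exact Hn.
  - apply Cre_neq0, Hn.
Qed.
Lemma rint_ex N a b : (1 <= N)%nat -> 0 < a -> a <= b -> ex_CInt (rint N) a b.
Proof.
  intros HN Ha Hab. apply ex_CInt_cont. intros x Hx. rewrite Rmin_left in Hx by lra. apply rint_ccont; auto; lra.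
Qed.
Lemma rint_eq a N x : (a < 2)%nat -> (1 <= N)%nat -> par a N -> 0 < x ->
  rint N x = (RtoC (powerRZ (eps N) (1 - m)) * (RtoC (/ Gam N) * (RtoC (/ sig N) * (Cexp (RtoC (INR N) * rayP z0 x) * rayK z0 m a N x))))%cx.
Proof.
  intros Ha HN Hp Hx. rewrite <- (ray_integrand z0 Hz0 m a N x Ha HN Hp Hx). unfold rint.
  replace (RtoC x * (RtoC (eps N) * c))%cx with (RtoC (x * eps N) * c)%cx by (rewrite RtoC_mul; ring). reflexivity.
Qed.

(** The exact factorisation of the integrand holds on the whole ray, so a bound on Re P alone
    controls the rate; all other factors are bounded or grow polynomially. *)
Lemma ray_far_small a lo hi B del : (a < 2)%nat -> 0 < lo -> lo <= hi -> 0 < del ->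
  (forall r, lo <= r <= hi -> Cre (rayP z0 r) <= B - del) -> sub_exp (par a) B (fun N => CInt (rint N) lo hi).
Proof.
  intros Ha Hlo Hlh Hdel HP.
  destruct (Cpowz_bound (1 - m) 1 1 ltac:(lra)) as [K1 [p1 [HK1 B1]]].
  destruct PB_Gam_inv as [K2 [p2 B2]].
  destruct (stirling a Ha) as [St1 _]. destruct (St1 0%nat) as [K3 [n3 [Hn3 B3]]].
  destruct (rayK_expansion z0 Hz0 m lo hi Hlo Hlh a Ha 0) as [K4 [n4 [Hn4 B4]]].
  assert (a1 := Rabs_pos K2). assert (a2 := Rabs_pos K3). assert (a3 := Rabs_pos K4).
  exists (B - del), (2 * (K1 * (Rabs K2 * (Rabs K3 * Rabs K4))) * (hi - lo)), (p1 + p2)%nat, (n3 + n4)%nat.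
  split; [lra|split; [|split; [lia|]]].
  { apply mul_pos; [|lra]. apply mul_pos; [lra|]. repeat apply mul_pos; auto. }
  intros N HN HQ. assert (HN1 : (1 <= N)%nat) by lia. assert (e1 := eps_pos N HN1). assert (e2 := eps_le1 N HN1).
  assert (Np := pos_INR N).
  set (E := exp ((B - del) * INR N)).
  set (M := (K1 * INR N ^ p1) * ((Rabs K2 * INR N ^ p2) * (Rabs K3 * (E * Rabs K4)))).
  replace (2 * (K1 * (Rabs K2 * (Rabs K3 * Rabs K4))) * (hi - lo) * INR N ^ (p1 + p2) * E) with (2 * M * (hi - lo))
    by (unfold M; rewrite pow_add; ring).
  apply CInt_bound; [auto|apply rint_ex; auto|]. intros x Hx. rewrite (rint_eq a) by (auto; lra).
  rewrite !Cnorm_mul.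
  assert (q2 : 0 <= INR N ^ p2) by (apply pow_le; auto).
  assert (T1 : Cnorm (RtoC (powerRZ (eps N) (1 - m))) <= K1 * INR N ^ p1).
  { rewrite <- Cpowz_RtoC by lra. apply B1; auto; rewrite Cnorm_RtoC, Rabs_right by lra; lra. }
  assert (T2 : Cnorm (RtoC (/ Gam N)) <= Rabs K2 * INR N ^ p2).
  { eapply Rle_trans; [apply B2; auto|]. apply mul_le_r; [auto|apply Rle_abs]. }
  assert (T3 : Cnorm (RtoC (/ sig N)) <= Rabs K3).
  { eapply Rle_trans; [apply (B3 N ltac:(lia) HQ Datatypes.tt Logic.I)|apply Rle_abs]. }
  assert (T4 : Cnorm (rayK z0 m a N x) <= Rabs K4).
  { eapply Rle_trans; [apply (B4 N ltac:(lia) HQ x Hx)|apply Rle_abs]. }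
  assert (T5 : Cnorm (Cexp (RtoC (INR N) * rayP z0 x)) <= E).
  { rewrite Cnorm_exp, Cre_RtoC_mul. apply exp_le. rewrite Rmult_comm. apply mul_le_r; auto. }
  assert (nn := Cnorm_nonneg).
  repeat (apply Rmult_le_compat; auto using mul_pos).
Qed.

Lemma ray_middle d a N : (a < 2)%nat -> (1 <= N)%nat -> par a N -> 0 < d < 0.1 ->
  CInt (rint N) (1 - d) (1 + d) = (RtoC (powerRZ (eps N) (1 - m)) * (Cexp (RtoC (INR N) * rayP z0 1) * saddle_F z0 m d a N))%cx.
Proof.
  intros Ha HN Hp Hd. rewrite CInt_shift by (apply rint_ex; auto; lra).
  set (k := (RtoC (powerRZ (eps N) (1 - m)) * (RtoC (/ Gam N) * (RtoC (/ sig N) * Cexp (RtoC (INR N) * rayP z0 1))))%cx).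
  set (f := fun x : R => (Cexp (RtoC (INR N) * psi z0 x) * rayK z0 m a N (1 + x)%R)%cx).
  transitivity (CInt (fun x => k * f x)%cx (- d) d).
  - apply CInt_ext. intros x Hx. minmax Hx. rewrite (rint_eq a) by (auto; lra).
    unfold k, f, psi. replace (RtoC (INR N) * rayP z0 (1 + x))%cx with (RtoC (INR N) * rayP z0 1 + RtoC (INR N) * (rayP z0 (1 + x)%R - rayP z0 1))%cx by ring.
    rewrite Cexp_add. ring.
  - rewrite CInt_scal.
    + change (CInt f (- d) d) with (LI (psi z0) d (fun x => rayK z0 m a N (1 + x)) N). unfold k, saddle_F. ring.
    + apply ex_CInt_cont. intros x Hx. minmax Hx.
      apply (csm_ccont (fun x => -1 < x)); [|lra]. assert (HO := open_gt (-1)).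
      apply csm_mul; [exact HO| |].
      * apply csm_exp; [exact HO|]. apply csm_mul; [exact HO|apply csm_const, HO|apply psi_csm; auto].
      * apply (csm_shift _ posR); [exact HO|apply posR_open|apply rayK_csm; auto|]. unfold posR. intros; lra.
Qed.
End RayParts.

(** * The asymptotic expansion *)

Lemma sub_exp_weaken Q B B' f : B <= B' -> sub_exp Q B f -> sub_exp Q B' f.
Proof. intros H (nu & K & p & n & A & T). exists nu, K, p, n. split; [lra|auto]. Qed.

Lemma powerRZ_ge_pow x k : 0 < x <= 1 -> x ^ Z.abs_nat k <= powerRZ x k.
Proof.
  intros Hx. destruct k as [|p|p]; simpl; try lra.
  assert (P : 0 < x ^ Pos.to_nat p) by (apply pow_lt; lra).
  assert (Q : x ^ Pos.to_nat p <= 1) by (rewrite <- (pow1 (Pos.to_nat p)); apply pow_incr; lra).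
  apply Rle_trans with 1; auto. rewrite <- Rinv_1. apply inv_le; auto.
Qed.

(** The exponential gap beats every power of N, including the power k of either sign that normalises
    the main term. *)
Lemma sub_exp_negligible Q B f k r : sub_exp Q B f -> exists K n, (1 <= n)%nat /\ forall N, (n <= N)%nat -> Q N ->
  Cnorm (f N) <= K * (powerRZ (eps N) k * exp (B * INR N) * eps N ^ r).
Proof.
  intros (nu & K & p & n & H1 & H2 & H3 & H4).
  destruct (exp_neg_pow (B - nu) (p + (Z.abs_nat k + r)) ltac:(lra)) as [K2 [HK2 HE]].
  exists (K * K2), n. split; auto. intros N HN HQ. assert (HN1 : (1 <= N)%nat) by lia.
  specialize (HE N HN1). eapply Rle_trans; [apply H4; auto|].
  assert (e1 := eps_pos N HN1). assert (e2 := eps_le1 N HN1). assert (e3 := eps_INR N HN1).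
  assert (pw := powerRZ_ge_pow (eps N) k ltac:(lra)).
  set (q := Z.abs_nat k) in *. rewrite !Rmult_assoc. apply mul_le_l; auto.
  assert (E : exp (nu * INR N) = exp (- (B - nu) * INR N) * exp (B * INR N)) by (rewrite <- exp_plus; f_equal; ring).
  rewrite E. assert (E1 : INR N ^ (q + r) * (eps N ^ q * eps N ^ r) = 1).
  { rewrite <- pow_add, <- Rpow_mult_distr, e3, pow1. reflexivity. }
  assert (eb := exp_pos (B * INR N)). assert (er : 0 < eps N ^ r) by (apply pow_lt; auto). assert (eq0 : 0 < eps N ^ q) by (apply pow_lt; auto).
  apply Rle_trans with (K2 * (eps N ^ q * (exp (B * INR N) * eps N ^ r))).
  - apply Rle_trans with ((exp (- (B - nu) * INR N) * INR N ^ (p + (q + r))) * (eps N ^ q * eps N ^ r) * exp (B * INR N)).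
    + right. rewrite pow_add. transitivity (INR N ^ p * (exp (- (B - nu) * INR N) * exp (B * INR N)) * (INR N ^ (q + r) * (eps N ^ q * eps N ^ r))); [rewrite E1; ring|ring].
    + replace (K2 * (eps N ^ q * (exp (B * INR N) * eps N ^ r))) with (K2 * (eps N ^ q * eps N ^ r) * exp (B * INR N)) by ring.
      apply mul_le_r; [lra|]. apply mul_le_r; [apply mul_pos; lra|exact HE].
  - apply mul_le_l; [lra|]. apply mul_le_r; [apply mul_pos; lra|exact pw].
Qed.

Lemma Cpowz_shift u m : 0 < Cre u -> (u * Cpowz u (- m - 1) = Cpowz (/ u) m)%cx.
Proof.
  intros Hu. rewrite <- (Cexp_Clog u Hu), <- Cexp_opp, !Cpowz_exp, <- Cexp_add. f_equal.
  rewrite minus_IZR, opp_IZR. unfold Rminus. rewrite RtoC_add, !RtoC_opp. change (RtoC 1) with C1. ring.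
Qed.

Lemma sqrt2_exp : exp (/ 2 * ln 2) = sqrt 2.
Proof. rewrite <- Rpower_sqrt by lra. reflexivity. Qed.

(** * Evaluation at the saddle and the leading coefficient *)

Section Main.
Variable w0 : Cplx.
Hypothesis Hw0 : is_Li2 w0 (Cmul (mkC 0 (2 * PI)) (Clog w0)).
Hypothesis Hap : Cnorm (Csub w0 w0_approx) < / 1000000.
Variable m : Z.
Notation z0 := (z0_of w0).
Notation c := (RtoC (/ 2) * z0)%cx.

Lemma z0_neg : Cre z0 < 0. Proof. generalize (z0_re w0 Hap). lra. Qed.
Lemma w_at1 : Cexp (RtoC 1 * z0)%cx = (C1 - w0)%cx.
Proof. rewrite <- (z0_exp w0 Hap). f_equal. change (RtoC 1) with C1. ring. Qed.
Lemma w0_neq0 : w0 <> C0.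
Proof. apply Cre_neq0. generalize (w0_re w0 Hap). lra. Qed.

(** As exp z0 = 1 - w0, [rayP_Dil] gives 2 z0 P(1) = Li2(1 - w0) - Li2(1). By reflection and Li2(w0)
    = 2 PI i log w0 this equals -(2 PI i + log (1 - w0)) log w0, that is -z0 log w0. *)
Lemma rayP_saddle : rayP z0 1 = (- RtoC (/ 2) * Clog w0)%cx.
Proof.
  destruct (Dil_exists C1) as [zeta Hz]; [rewrite Cnorm_1; lra|].
  destruct (Dil_exists (C1 - w0)%cx) as [l2 H2]; [left; apply v_lt1, Hap|].
  assert (H1 := is_Li2_Dil w0 _ ltac:(left; apply w0_lt1, Hap) Hw0).
  assert (E := Dil_reflection w0 (C1 - w0)%cx _ l2 zeta ltac:(ring) (w0_lt1 w0 Hap) (v_lt1 w0 Hap) H1 H2 Hz).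
  assert (D := rayP_Dil z0 z0_neg 1 l2 zeta ltac:(lra)). rewrite w_at1 in D. specialize (D H2 Hz).
  rewrite <- E in D. assert (zn : z0 <> C0) by (apply Cre_neq0; generalize z0_neg; lra).
  assert (Ez : z0 = (mkC 0 (2 * PI) + Clog (C1 - w0))%cx) by reflexivity.
  assert (n2 : RtoC 2 <> C0) by (apply RtoC_neq0; lra).
  replace (rayP z0 1) with ((/ (RtoC 2 * z0)) * (RtoC (2 * 1) * z0 * rayP z0 1))%cx.
  - rewrite D. replace (l2 - _)%cx with (- Clog w0 * z0)%cx by (rewrite Ez at 1; ring).
    rewrite RtoC_inv by lra. field. auto.
  - rewrite Rmult_1_r. field. auto.
Qed.
Lemma rayQ_saddle : rayQ z0 1 = C0.
Proof.
  unfold rayQ, rayU. rewrite w_at1, rayP_saddle. replace (C1 - (C1 - w0))%cx with w0 by ring.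
  replace (1 / 2) with (/ 2) by field. change (RtoC 1) with C1. ring.
Qed.
Lemma rayP_saddle_exp N : Cexp (RtoC (INR N) * rayP z0 1)%cx = Cpow w0 (RtoC (- INR N / 2)).
Proof.
  unfold Cpow. destruct (Req_EM_T (Cnorm2 w0) 0) as [E|E]; [generalize (w0_norm2 w0 Hap); lra|].
  rewrite rayP_saddle. f_equal. unfold Rdiv. rewrite RtoC_mul, RtoC_opp. ring.
Qed.
Lemma rayP_saddle_re : Cre (rayP z0 1) = - / 2 * ln (Cnorm w0).
Proof. rewrite rayP_saddle, <- RtoC_opp, Cre_RtoC_mul. reflexivity. Qed.
Lemma rayP_saddle_ge : 0.0335 <= Cre (rayP z0 1).
Proof. rewrite rayP_saddle_re. generalize (ln_w0 w0 Hap). lra. Qed.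

Lemma c2_eq : saddle_c2 z0 = (- c * (C1 - w0) / w0)%cx.
Proof.
  unfold saddle_c2. rewrite w_at1. replace (C1 - (C1 - w0))%cx with w0 by ring. replace (1 / 2) with (/ 2) by field.
  field. apply w0_neq0.
Qed.
Lemma c2_pos : 0 < Cre (saddle_c2 z0).
Proof.
  rewrite c2_eq. destruct (w0_box w0 Hap) as [[a b] [u v]]. assert (H1 := z0_re w0 Hap). assert (H2 := z0_im w0 Hap).
  assert (H3 := w0_norm2 w0 Hap). set (z := z0) in *. clearbody z.
  set (t := (- (RtoC (/ 2) * z) * (C1 - w0))%cx).
  assert (T1 : 0.7 <= Cre t) by (unfold t; simpl; nra). assert (T2 : Cim t <= 0) by (unfold t; simpl; nra).
  clearbody t. simpl. replace (Cre t * (Cre w0 / Cnorm2 w0) - Cim t * (- Cim w0 / Cnorm2 w0)) with ((Cre t * Cre w0 + Cim t * Cim w0) / Cnorm2 w0) by (field; lra).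
  apply Rdiv_lt_0_compat; [nra|lra].
Qed.

(** The four numbers involved lie in the right half-plane, so the imaginary parts of the two sides
    differ by less than 2 PI and the branches agree. The term i PI is half of the 2 PI i in z0 and
    later supplies the sign of the leading coefficient. *)
Lemma c2_log : (RtoC (/ 2) * Clog (saddle_c2 z0) =
  RtoC (/ 2) * Clog (- z0) - RtoC (/ 2 * ln 2) + RtoC (/ 2) * z0 - mkC 0 PI - RtoC (/ 2) * Clog w0)%cx.
Proof.
  assert (Pv := v_re w0 Hap). assert (Pw := w0_re w0 Hap). assert (Pz := z0_neg).
  assert (Pc : 0 < Cre (RtoC (/ 2) * - z0)%cx) by (rewrite Cre_RtoC_mul; cbn [Cre Copp]; lra).
  assert (E : Clog (saddle_c2 z0) = (Clog (RtoC (/ 2) * - z0) + Clog (C1 - w0) - Clog w0)%cx).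
  { apply Cexp_inj_im.
    - rewrite Cexp_sub, Cexp_add, !Cexp_Clog by (auto using c2_pos). rewrite c2_eq. field. apply w0_neq0.
    - assert (B1 := Clog_im_bound _ c2_pos). assert (B2 := Clog_im_bound _ Pc). assert (B3 := Clog_im_bound _ Pv). assert (B4 := Clog_im_bound _ Pw).
      unfold Csub in *. cbn [Cim Cadd Copp]. apply Rabs_def1; lra. }
  rewrite E, Clog_mul_RtoC by (cbn [Cre Copp]; lra). rewrite ln_Rinv, RtoC_opp, RtoC_mul by lra.
  assert (Ev : Clog (C1 - w0)%cx = (z0 - mkC 0 (2 * PI))%cx) by (unfold z0_of; change (Csub C1 w0) with (C1 - w0)%cx; ring).
  apply cx_eq; simpl; field.
Qed.

Lemma a0_formula a : (a < 2)%nat -> (saddle_a0 z0 m a / mkC 0 PI)%cx = d0_formula w0 m a.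
Proof.
  intros Ha. assert (Hz := z0_neg). assert (P := PI_RGT_0).
  assert (Pc : 0 < Cre (- c)%cx) by (cbn [Cre Copp]; rewrite Cre_RtoC_mul; lra).
  assert (zn : z0 <> C0) by (apply Cre_neq0; lra).
  set (E := rayE z0 1). assert (HE := rayE_norm_lt1 z0 Hz 1 ltac:(lra)).
  assert (P1 := one_minus_re E HE). assert (P2 : 0 < Cre (C1 + E)%cx).
  { assert (T := one_minus_re (- E)%cx ltac:(rewrite Cnorm_opp; exact HE)). replace (C1 - - E)%cx with (C1 + E)%cx in T by ring. exact T. }
  assert (L := ray_log_sum z0 Hz 1 ltac:(lra)). rewrite w_at1, ln_1 in L. replace (C1 - (C1 - w0))%cx with w0 in L by ring.
  rewrite (rayg_Clog z0 Hz) in L by lra. unfold ray2 in L. fold E in L.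
  assert (Lw : Clog w0 = (Clog (C1 - E) + Clog (C1 + E))%cx).
  { assert (Ew : w0 = ((C1 - E) * (C1 + E))%cx).
    { transitivity (C1 - E * E)%cx; [|ring]. unfold E. rewrite <- w_sq, w_at1. ring. }
    rewrite Ew at 1. apply Clog_mul; auto. rewrite <- Ew. apply (w0_re w0 Hap). }
  set (u := (C1 + RtoC ((-1) ^ a) * E)%cx).
  assert (Pu : 0 < Cre u).
  { unfold u. destruct a as [|[|a]]; [| |lia]; simpl pow.
    - change (RtoC 1) with C1. replace (C1 + C1 * E)%cx with (C1 + E)%cx by ring. exact P2.
    - replace (-1 * 1) with (-1) by ring. replace (C1 + RtoC (-1) * E)%cx with (C1 - E)%cx by (apply cx_eq; simpl; ring). exact P1. }
  (* With w0 = (1 - E)(1 + E), half of log w0 cancels one of the two half logarithms; the parity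
     decides whether 1 + E or 1 - E is left as u. *)
  assert (Key : (rayW0 z0 m a 1 - RtoC (/ 2) * Clog (saddle_c2 z0) = RtoC (ln 2) + RtoC (/ 2) * Clog u - RtoC (/ 2) * z0 + mkC 0 PI)%cx).
  { rewrite c2_log. unfold rayW0, rayL. rewrite ln_1, (rayg_Clog z0 Hz) by lra. unfold ray2. fold E.
    assert (Lf : rayf z0 1 = (Clog w0 - Clog (C1 + E) - Clog (- z0) + RtoC (ln 2))%cx).
    { rewrite <- L. unfold Rminus. rewrite RtoC_add, RtoC_opp. change (RtoC 0) with C0. ring. }
    rewrite Lf. unfold u. destruct a as [|[|a]]; [| |lia].
    - simpl pow. change (RtoC 1) with C1. replace (C1 + C1 * E)%cx with (C1 + E)%cx by ring.
      apply cx_eq; simpl; field.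
    - simpl pow. replace (-1 * 1) with (-1) by ring. replace (C1 + RtoC (-1) * E)%cx with (C1 - E)%cx by (apply cx_eq; simpl; ring).
      rewrite Lw. apply cx_eq; simpl; field. }
  unfold saddle_a0, d0_formula. rewrite Cpowz_shift by exact Pc.
  assert (Ei : (/ - c)%cx = (RtoC (-2) / z0)%cx).
  { rewrite RtoC_inv by lra. change (-2) with (- (2)). rewrite RtoC_opp. field. repeat split; auto.
    - apply RtoC_neq0; lra.
    - apply Cre_neq0. cbn [Cre Copp]. lra. }
  rewrite Ei.
  assert (EP : Cpow (Cadd C1 (Cmul (RtoC ((-1) ^ a)) (Cexp (Cmul (RtoC (1 / 2)) z0)))) (RtoC (1 / 2)) = Cexp (RtoC (/ 2) * Clog u)%cx).
  { replace (Cexp (Cmul (RtoC (1 / 2)) z0)) with E.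
    - fold u. unfold Cpow. destruct (Req_EM_T (Cnorm2 u) 0) as [E0|E0].
      + exfalso. assert (T := Cnorm2_pos u (Cre_neq0 u ltac:(lra))). lra.
      + replace (1 / 2) with (/ 2) by field. reflexivity.
    - unfold E, rayE. f_equal. apply cx_eq; simpl; field. }
  rewrite EP.
  set (pz := Cpowz (RtoC (-2) / z0)%cx m).
  change (Cpowz (Cdiv (RtoC (-2)) z0) m) with pz.
  assert (EX : (Cexp (rayW0 z0 m a 1) / Cexp (RtoC (/ 2) * Clog (saddle_c2 z0)) =
    - RtoC 2 * (Cexp (RtoC (/ 2) * Clog u) * Cexp (RtoC (- (1 / 2)) * z0)))%cx).
  { rewrite <- Cexp_sub, Key.
    replace (RtoC (ln 2) + RtoC (/ 2) * Clog u - RtoC (/ 2) * z0 + mkC 0 PI)%cx with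
      (RtoC (ln 2) + (RtoC (/ 2) * Clog u + RtoC (- (1 / 2)) * z0) + mkC 0 PI)%cx by (apply cx_eq; simpl; field).
    rewrite !Cexp_add, Cexp_RtoC, exp_ln by lra.
    replace (Cexp (mkC 0 PI)) with (- C1)%cx by (apply cx_eq; simpl; rewrite exp_0, ?cos_PI, ?sin_PI; ring). ring. }
  transitivity (RtoC (/ exp (/ 2 * ln 2)) * (pz * (Cexp (rayW0 z0 m a 1) / Cexp (RtoC (/ 2) * Clog (saddle_c2 z0)))) / mkC 0 PI)%cx; [unfold Cdiv; ring|].
  rewrite EX, sqrt2_exp.
  (* The 1/sqrt 2 is the limit of 1/[sig], and the 2 comes from exp (ln 2) in [Key]. *)
  assert (Es : (RtoC (/ sqrt 2) * RtoC 2 = RtoC (sqrt 2))%cx).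
  { rewrite <- RtoC_mul. f_equal. assert (s0 := sqrt_lt_R0 2 ltac:(lra)). assert (s2 := sqrt_sqrt 2 ltac:(lra)).
    apply Rmult_eq_reg_l with (sqrt 2); [|lra]. rewrite <- Rmult_assoc, Rinv_r, s2 by lra. ring. }
  set (q2 := Cexp (RtoC (- (1 / 2)) * z0)%cx).
  change (Cexp (Cmul (RtoC (- (1 / 2))) z0)) with q2.
  rewrite RtoC_opp, <- Es. unfold Cdiv. ring.
Qed.

(** The ray is cut at 1 - d and 1 + d: the middle piece is the saddle integral, and T collects the
    two outer pieces and the three other sides, all of smaller rate. *)
Lemma A_saddle : exists d, 0 < d < 0.1 /\ forall a, (a < 2)%nat ->
  allSq (par a) (saddle_F z0 m d a) /\
  (exists K n, (1 <= n)%nat /\ forall N, (n <= N)%nat -> par a N -> Cnorm (saddle_F z0 m d a N - saddle_a0 z0 m a)%cx <= K * eps N) /\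
  exists T n, sub_exp (par a) (Cre (rayP z0 1)) T /\ forall N, (n <= N)%nat -> par a N ->
    PI * A_coef m N = Cim (RtoC (powerRZ (eps N) (1 - m)) * (Cexp (RtoC (INR N) * rayP z0 1) * saddle_F z0 m d a N) + T N)%cx.
Proof.
  assert (Hz := z0_neg). assert (Hre := z0_re w0 Hap). assert (Him := z0_im w0 Hap). assert (HP := rayP_saddle_ge).
  destruct (saddle_expansion z0 Hz m rayQ_saddle c2_pos) as [e0 [He0 [He1 SE]]].
  exists (e0 / 2). set (d := e0 / 2). assert (Hd : 0 < d < e0) by (unfold d; lra).
  split; [lra|]. intros a Ha. destruct (SE d Hd) as [S1 S2]. destruct (S2 a Ha) as [S3 S4].
  split; [exact S3|split; [exact S4|]].
  destruct (Dil_exists C1) as [zeta Hzeta]; [rewrite Cnorm_1; lra|].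
  assert (L1 := S1 (- d) ltac:(lra) ltac:(lra)). assert (L2 := S1 d ltac:(lra) ltac:(lra)).
  assert (Q1 : Cre (rayQ z0 1) = 0) by (rewrite rayQ_saddle; reflexivity).
  destruct (ray_off_saddle z0 Hre Him zeta Hzeta d Q1 HP ltac:(lra) L1 L2) as [del [Hdel Off]].
  assert (R1 := rho1_bounds z0 Him). assert (R2 := rho2_bounds z0 Hre).
  assert (Rho : forall r, rho1 z0 <= r -> 3 * PI / 2 <= r * Cim z0).
  { intros r Hr. replace (3 * PI / 2) with (rho1 z0 * Cim z0) by (unfold rho1; field; lra). apply mul_le_r; lra. }
  assert (R3 : rho1 z0 <= 1 + d) by lra.
  assert (F1 := ray_far_small z0 Hz m a (rho1 z0) (1 - d) (Cre (rayP z0 1)) del Ha ltac:(lra) ltac:(lra) Hdel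
    (fun r Hr => Off r (Rho r (proj1 Hr)) (or_introl (proj2 Hr)))).
  assert (F2 := ray_far_small z0 Hz m a (1 + d) (rho2 z0) (Cre (rayP z0 1)) del Ha ltac:(lra) ltac:(lra) Hdel
    (fun r Hr => Off r (Rho r (Rle_trans _ _ _ R3 (proj1 Hr))) (or_intror (proj1 Hr)))).
  destruct (eps_small 0.00001 ltac:(lra)) as [n0 [Hn0 Hn0e]].
  assert (G1 := sub_exp_weaken _ _ _ _ HP (seg01_small z0 Hre m n0 Hn0 Hn0e (par a))).
  assert (G2 := sub_exp_weaken _ _ _ _ HP (seg12_small z0 Hre Him m n0 Hn0 Hn0e (par a))).
  assert (G3 := sub_exp_weaken _ _ _ _ HP (seg34_small z0 Hre Him m n0 Hn0 Hn0e (par a))).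
  exists (fun N => seg (integrand m N) (pt0 N) (pt1 N) + (seg (integrand m N) (pt1 N) (pt2 z0 N) + (seg (integrand m N) (pt3 z0 N) (pt4 N)
    + (CInt (rint z0 m N) (rho1 z0) (1 - d) + CInt (rint z0 m N) (1 + d) (rho2 z0)))))%cx, (n0 + 2 * Z.abs_nat m + 2)%nat.
  split; [repeat apply sub_exp_add; auto|].
  intros N HN Hp. assert (HN1 : (1 <= N)%nat) by lia.
  destruct (path_conditions z0 Hre Him n0 Hn0 Hn0e N ltac:(lia)) as (C1' & C2' & C3' & C4').
  (* The threshold on N contains 2|m|, so the index is nonnegative and [A_coef] is a true series
     coefficient instead of its default 0. *)
  assert (Hm : (0 <= m + Z.of_nat (N / 2))%Z).
  { assert (Z.abs_nat m <= N / 2)%nat by (apply Nat.div_le_lower_bound; lia). lia. }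
  rewrite (A_coef_contour m N (pt0 N) (pt1 N) (pt2 z0 N) (pt3 z0 N) (pt4 N) HN1 Hm); auto; try reflexivity.
  assert (E : seg (integrand m N) (pt2 z0 N) (pt3 z0 N) = CInt (rint z0 m N) (rho1 z0) (rho2 z0)).
  { apply (seg_ray (integrand m N)); [lra|]. intros r Hr. apply (rint_ccont z0 Hz m); auto; lra. }
  rewrite E.
  rewrite <- (CInt_Chasles (rint z0 m N) (rho1 z0) (1 - d) (rho2 z0)) by (apply rint_ex; auto; lra).
  rewrite <- (CInt_Chasles (rint z0 m N) (1 - d) (1 + d) (rho2 z0)) by (apply rint_ex; auto; lra).
  rewrite (ray_middle z0 Hz m d a N Ha HN1 Hp ltac:(lra)). f_equal. ring.
Qed.

Lemma A_asymptotics a : (a < 2)%nat -> exists e : nat -> Cplx, e 0%nat = saddle_a0 z0 m a /\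
  forall r, (1 <= r)%nat -> exists K n, (1 <= n)%nat /\ forall N, (n <= N)%nat -> par a N ->
   Rabs (PI * A_coef m N - Cim (RtoC (powerRZ (eps N) (1 - m)) * (Cexp (RtoC (INR N) * rayP z0 1) * Csum r (fun j => e j * RtoC (eps N ^ j))))%cx)
    <= K * (powerRZ (eps N) (1 - m) * exp (Cre (rayP z0 1) * INR N) * eps N ^ r).
Proof.
  intros Ha. destruct A_saddle as [d [Hd H]]. destruct (H a Ha) as (H1 & [K0 [n0 [Hn0 H2]]] & T & nT & H3 & H4).
  destruct (allSq_coefficients (par a) (par_inf a Ha) _ H1) as [e He]. exists e. split.
  (* The coefficient sequence came from choice; its first term is identified by comparing both
     approximations of [saddle_F] to order 1/N. *)
  - destruct (He 1%nat) as [K1 [n1 H5]]. apply csub_eq0.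
    apply (eps_limit_eq (par a) (par_inf a Ha) _ (K0 + K1) (n0 + n1)). intros N HN Hp.
    specialize (H2 N ltac:(lia) Hp). specialize (H5 N ltac:(lia) Hp). simpl Csum in H5.
    replace (C0 + e 0%nat * RtoC 1)%cx with (e 0%nat) in H5 by (change (RtoC 1) with C1; ring).
    set (F := saddle_F z0 m d a N) in *. set (a0 := saddle_a0 z0 m a) in *.
    replace (e 0%nat - a0)%cx with ((F - a0) - (F - e 0%nat))%cx by ring.
    le_via Cnorm_sub_le. lra.
  - intros r Hr. destruct (He r) as [K1 [n1 H5]].
    destruct (sub_exp_negligible (par a) _ T (1 - m) r H3) as [K2 [n2 [Hn2 H6]]].
    exists (Rabs K1 + K2), (n1 + n2 + nT)%nat. split; [lia|]. intros N HN Hp. assert (HN1 : (1 <= N)%nat) by lia.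
    rewrite (H4 N ltac:(lia) Hp). specialize (H5 N ltac:(lia) Hp). specialize (H6 N ltac:(lia) Hp).
    set (F := saddle_F z0 m d a N) in *. set (S := Csum r _) in *. set (pr := RtoC (powerRZ (eps N) (1 - m))).
    set (ex := Cexp (RtoC (INR N) * rayP z0 1)%cx).
    assert (e1 := eps_pos N HN1).
    assert (pp : 0 < powerRZ (eps N) (1 - m)) by (apply powerRZ_lt; auto).
    assert (Es : forall x y, Cim x - Cim y = Cim (x - y)%cx) by reflexivity. rewrite Es.
    replace (pr * (ex * F) + T N - pr * (ex * S))%cx with (pr * (ex * (F - S)) + T N)%cx by ring.
    le_via Cim_le_norm. le_via Cnorm_triang. rewrite Rmult_plus_distr_r. apply Rplus_le_compat; [|exact H6].
    unfold pr, ex. rewrite !Cnorm_mul, Cnorm_RtoC, Rabs_right, Cnorm_exp, Cre_RtoC_mul by lra.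
    rewrite (Rmult_comm (INR N)). set (eb := exp (Cre (rayP z0 1) * INR N)). assert (0 < eb) by apply exp_pos.
    assert (er : 0 < eps N ^ r) by (apply pow_lt; auto).
    replace (Rabs K1 * (powerRZ (eps N) (1 - m) * eb * eps N ^ r)) with (powerRZ (eps N) (1 - m) * (eb * (Rabs K1 * eps N ^ r))) by ring.
    apply mul_le_l; [lra|]. apply mul_le_l; [lra|]. le_via H5.
    apply mul_le_r; [lra|apply Rle_abs].
Qed.
End Main.

(** * From large N in each parity class to all N *)

Lemma finite_bound (f g : nat -> R) n : (forall N, (1 <= N)%nat -> 0 < g N) -> exists K, 0 <= K /\ forall N, (1 <= N)%nat -> (N < n)%nat -> f N <= K * g N.
Proof.
  intros Hg. induction n as [|n [K [HK IH]]]; [exists 0; split; [lra|]; intros; lia|].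
  destruct n as [|n]; [exists 0; split; [lra|]; intros; lia|].
  assert (G := Hg (S n) ltac:(lia)). exists (K + Rabs (f (S n)) / g (S n)).
  assert (Q : 0 <= Rabs (f (S n)) / g (S n)) by (apply Rdiv_le_0_compat; [apply Rabs_pos|auto]).
  split; [lra|]. intros N HN HNn. assert (GN := Hg N HN). rewrite Rmult_plus_distr_r.
  destruct (Nat.eq_dec N (S n)) as [->|Hne].
  - assert (0 <= K * g (S n)) by (apply mul_pos; lra).
    replace (Rabs (f (S n)) / g (S n) * g (S n)) with (Rabs (f (S n))) by (field; lra). generalize (Rle_abs (f (S n))). lra.
  - specialize (IH N HN ltac:(lia)). assert (0 <= Rabs (f (S n)) / g (S n) * g N) by (apply mul_pos; lra). lra.
Qed.

Theorem theorem1p2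
  (w0 : Cplx)
  (Hw0 : is_Li2 w0 (Cmul (mkC 0 (2 * PI)) (Clog w0)))
  (Hw0_approx : Cnorm (Csub w0 w0_approx) < / 1000000)
  (m : Z) :
  exists d : nat -> nat -> Cplx,
    (forall a : nat, (a < 2)%nat -> d 0%nat a = d0_formula w0 m a) /\
    forall r : nat, (1 <= r)%nat ->
      exists K : R, forall N : nat, (1 <= N)%nat ->
        Rabs (A_coef m N
              - Cre (Cdiv
                       (Cmul (Cpow w0 (RtoC (- INR N / 2)))
                             (Csum r (fun j => Cdiv (d j (N mod 2)%nat) (RtoC (INR N ^ j)))))
                       (RtoC (powerRZ (INR N) (1 - m)))))
        <= K * (Rpower (Cnorm w0) (- INR N / 2) / powerRZ (INR N) (Z.of_nat r + 1 - m)).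
Proof.
  destruct (A_asymptotics w0 Hw0 Hw0_approx m 0 ltac:(lia)) as [f0 [F00 F01]].
  destruct (A_asymptotics w0 Hw0 Hw0_approx m 1 ltac:(lia)) as [f1 [F10 F11]].
  assert (P := PI_RGT_0). set (ip := mkC 0 PI).
  set (f := fun a : nat => match a with O => f0 | _ => f1 end).
  assert (Ff : forall a, (a < 2)%nat -> f a 0%nat = saddle_a0 (z0_of w0) m a /\
    forall r, (1 <= r)%nat -> exists K n, (1 <= n)%nat /\ forall N, (n <= N)%nat -> par a N ->
     Rabs (PI * A_coef m N - Cim (RtoC (powerRZ (eps N) (1 - m)) * (Cexp (RtoC (INR N) * rayP (z0_of w0) 1) * Csum r (fun j => f a j * RtoC (eps N ^ j))))%cx)
      <= K * (powerRZ (eps N) (1 - m) * exp (Cre (rayP (z0_of w0) 1) * INR N) * eps N ^ r)).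
  { intros [|[|a]] Ha; [split; [exact F00|exact F01]|split; [exact F10|exact F11]|lia]. }
  (* Division by i PI converts the contour formula into the required real part, since Im Y/PI = Re
     (Y/(i PI)). *)
  exists (fun j a => (f a j / ip)%cx). split.
  { intros a Ha. rewrite (proj1 (Ff a Ha)). apply a0_formula; auto. }
  intros r Hr.
  set (bnd := fun N => Rpower (Cnorm w0) (- INR N / 2) / powerRZ (INR N) (Z.of_nat r + 1 - m)).
  set (err := fun N => Rabs (A_coef m N - Cre (Cdiv (Cmul (Cpow w0 (RtoC (- INR N / 2)))
      (Csum r (fun j => Cdiv (f (N mod 2)%nat j / ip)%cx (RtoC (INR N ^ j))))) (RtoC (powerRZ (INR N) (1 - m)))))).
  assert (Hbnd : forall N, (1 <= N)%nat -> 0 < bnd N).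
  { intros N HN. apply Rdiv_lt_0_compat; [apply exp_pos|]. apply powerRZ_lt, lt_0_INR; lia. }
  assert (Main : forall a, (a < 2)%nat -> exists K n, 0 <= K /\ forall N, (n <= N)%nat -> par a N -> err N <= K * bnd N).
  { intros a Ha. destruct (Ff a Ha) as [_ Fr]. destruct (Fr r Hr) as [K [n [Hn B]]].
    exists (/ PI * Rabs K), n. split; [apply mul_pos; [left; apply inv_pos; auto|apply Rabs_pos]|].
    intros N HN Hp. assert (HN1 : (1 <= N)%nat) by lia. specialize (B N HN Hp).
    assert (Np : 0 < INR N) by (apply lt_0_INR; lia).
    assert (Epw : powerRZ (eps N) (1 - m) = / powerRZ (INR N) (1 - m)) by (unfold eps; rewrite powerRZ_inv'; reflexivity).
    assert (Ebnd : powerRZ (eps N) (1 - m) * exp (Cre (rayP (z0_of w0) 1) * INR N) * eps N ^ r = bnd N).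
    { rewrite (rayP_saddle_re w0 Hw0 Hw0_approx). unfold bnd, Rpower.
      replace (Z.of_nat r + 1 - m)%Z with ((1 - m) + Z.of_nat r)%Z by ring. rewrite powerRZ_add, <- pow_powerRZ, Epw by lra.
      unfold eps. rewrite pow_inv. unfold Rdiv. rewrite Rinv_mult.
      replace (- / 2 * ln (Cnorm w0) * INR N) with (- INR N * / 2 * ln (Cnorm w0)) by ring. ring. }
    rewrite Ebnd in B. unfold err. rewrite Hp.
    rewrite (rayP_saddle_exp w0 Hw0 Hw0_approx) in B.
    assert (Es : Csum r (fun j => Cdiv (f a j / ip)%cx (RtoC (INR N ^ j))) = (/ ip * Csum r (fun j => f a j * RtoC (eps N ^ j)))%cx).
    { rewrite <- Csum_scal. apply Csum_ext. intros j _. unfold eps. rewrite pow_inv, RtoC_inv by (apply pow_nonzero; lra).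
      unfold Cdiv. ring. }
    rewrite Es. set (S := Csum r _) in *. set (W := Cpow w0 _) in *.
    rewrite Epw, RtoC_inv in B by (generalize (powerRZ_lt _ (1 - m) Np); lra).
    set (q := RtoC (powerRZ (INR N) (1 - m))) in *. set (Y := (/ q * (W * S))%cx) in *.
    assert (EY : Cre (Cdiv (Cmul W (/ ip * S)%cx) q) = / PI * Cim Y).
    { replace (Cdiv (Cmul W (/ ip * S)%cx) q) with (/ ip * Y)%cx by (unfold Y, Cdiv; ring).
      clearbody Y. simpl. unfold Cnorm2. simpl. field. lra. }
    rewrite EY. replace (A_coef m N - / PI * Cim Y) with (/ PI * (PI * A_coef m N - Cim Y)) by (field; lra).
    rewrite Rabs_mult, Rabs_right by (left; apply inv_pos; auto).
    rewrite Rmult_assoc. apply mul_le_l; [left; apply inv_pos; auto|].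
    le_via B. apply mul_le_r; [left; apply Hbnd; auto|apply Rle_abs]. }
  destruct (Main 0%nat ltac:(lia)) as [K0 [n0 [HK0 M0]]]. destruct (Main 1%nat ltac:(lia)) as [K1 [n1 [HK1 M1]]].
  (* The finitely many N below the thresholds are absorbed into the constant, as the bound is
     positive there. *)
  destruct (finite_bound err bnd (n0 + n1) Hbnd) as [K2 [HK2 M2]].
  exists (K0 + K1 + K2). intros N HN. change (err N <= (K0 + K1 + K2) * bnd N). assert (HB := Hbnd N HN).
  destruct (le_lt_dec (n0 + n1) N) as [h|h].
  - assert (Hc : par 0 N \/ par 1 N) by (unfold par; assert (T := Nat.mod_upper_bound N 2 ltac:(lia)); lia).
    destruct Hc as [Hc|Hc].
    + specialize (M0 N ltac:(lia) Hc). nra.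
    + specialize (M1 N ltac:(lia) Hc). nra.
  - specialize (M2 N HN h). nra.
Qed.
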